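(* Let $X$ be a complex manifold with a holomorphic foliation $\mathcal{F}$ of complex dimension $1$ with parabolic leaves, such that $X$ is either Kähler or has complex dimension $2$. If $D$ is a transverse holomorphic disk whose saturation is foliated by compact leaves, then all the maps $F\in\mathcal{C}$ constructed along this disk are holomorphic. In other words, the invariant $\Gamma$ associated to the foliation vanishes on the saturation of $D$. As a consequence, if $X$ is foliated by compact leaves, then $\Gamma$ vanishes identically on $X$.
   Context: Setting. $n\ge2$ is the complex dimension of $X$, $J$ its complex structure. Parabolic leaf: a leaf with universal covering biholomorphic to $\mathbb{C}$. $L_p$ is the leaf through $p$; $T\mathcal{F}$ is the tangent bundle of the foliation. The saturation of a set is the union of the leaves meeting it. $\mathbb{D}^{n-1}$ is the unit ball of $\mathbb{C}^{n-1}$; points of $\mathbb{D}^{n-1}\times\mathbb{C}$ are written $(x,y)$. The class $\mathcal{C}$. Let $D\subset X$ be a holomorphic disk (of dimension $n-1$) transverse to $\mathcal{F}$, holomorphically parametrized by $\mathbb{D}^{n-1}$, $x\mapsto p(x)$, and let $t:x\mapsto t_x\in T_{p(x)}\mathcal{F}$ be a holomorphic trivialization of $T\mathcal{F}$ along $D$. For each $x$ let $F_x:\mathbb{C}\to L_{p(x)}$ be the unique holomorphic universal covering map with $F_x(0)=p(x)$ and $dF_x(0)(1)=t_x$. Put $F(x,y)=F_x(y)$; this $F$ is the map ''constructed along $D$'' (with the trivialization $t$). $\mathcal{C}$ is the set of all maps $F:\mathbb{D}^{n-1}\times\mathbb{C}\to X$ obtained in this way. Standing assumption: every $F\in\mathcal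 C$ is a smooth immersion (onto the saturation of $D$). The invariant $\Gamma$. For $F\in\mathcal{C}$, let $V_F$ be an open neighborhood of $F(0,0)$ on which $F$ has a local inverse $F^{-1}=((F^{-1})_1,(F^{-1})_2):V_F\to U_0$, $U_0$ a neighborhood of $(0,0)$. Define the $\mathbb{C}$-valued $1$-form $\lambda_F(Z)=d(F^{-1})_2(JZ)-i\,d(F^{-1})_2(Z)$ on $V_F$, and the $\mathbb{C}$-valued $1$-form $A_F$ on $V_F$ by $A_F(Z)\,d(F^{-1})_2(Y)=d\lambda_F(Z,Y)$ for $Z\in TX$, $Y\in T\mathcal{F}$. Then $\Gamma_F=(dA_F)_{|TX\times T\mathcal{F}}$ does not depend on $F$ on overlaps of the sets $V_F$, and $\Gamma$ is the tensor on $X$ equal to $\Gamma_F$ on each $V_F$. *)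

(* Defs.v *)
From HB Require Import structures.
From Stdlib Require Import Relation_Operators.
From mathcomp Require Import all_boot all_order all_algebra.
From mathcomp Require Import complex.
From mathcomp Require Import all_classical all_reals topology normedtype derive.
Set Implicit Arguments.
Unset Strict Implicit.
Unset Printing Implicit Defensive.
Import Order.TTheory GRing.Theory Num.Theory numFieldNormedType.Exports.
Local Open Scope classical_set_scope.
Local Open Scope ring_scope.

(* Going through numClosedFieldType gives R[i] its canonical topology, norm and
   module structure over itself. *)
Definition Cplx (R : realType) : numClosedFieldType := R[i]%C.

Section Calculus.
Context {R : realType}.
Local Notation C := (Cplx R).
Implicit Types V W E : normedModType C.

(* Differentiability here is over the field C. *)
Definition holomorphic_on V W (U : set V) (f : V -> W) : Prop :=
  forall z, U z -> differentiable f z.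

(* Directional derivatives along real lines: the increment t is real. *)
Definition rquot V W (f : V -> W) (v z : V) (t : R) : W :=
  ((t^-1)%:C%C : C) *: (f (z + (t%:C%C : C) *: v) - f z).

Definition rderivable V W (f : V -> W) (v z : V) : Prop :=
  cvg (rquot f v z @ (0 : R)^').

Definition rderive V W (f : V -> W) (v z : V) : W :=
  lim (rquot f v z @ (0 : R)^').

(* Class C^k in the real sense on the open set U of the finite-dimensional
   space V. *)
Fixpoint Ck V W (k : nat) (U : set V) (f : V -> W) : Prop :=
  (forall z, U z -> {for z, continuous f}) /\
  match k with
  | 0%N => True
  | k'.+1 => forall v, (forall z, U z -> rderivable f v z) /\
                       Ck k' U (rderive f v)
  end.

Definition smooth_on V W (U : set V) (f : V -> W) : Prop :=
  forall k, Ck k U f.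

(* A C-valued 1-form is a function of a point and a vector.  Its exterior
   derivative is computed with constant vector fields, for the convention
   d a (Z, Y) = Z (a Y) - Y (a Z) - a [Z, Y]. *)
Definition ext_d V (a : V -> V -> C) (z Z Y : V) : C :=
  rderive (fun w => a w Y : C) Z z - rderive (fun w => a w Z : C) Y z.

Definition ext_d2 V (w : V -> V -> V -> C) (z X Y Z : V) : C :=
  rderive (fun u => w u Y Z : C) X z - rderive (fun u => w u X Z : C) Y z
  + rderive (fun u => w u X Y : C) Z z.

(* The Euclidean unit ball (the norm of 'rV_k is the sup norm). *)
Definition euclidean_ball (k : nat) : set 'rV[C]_k :=
  [set x | \sum_(i < k) `|x 0 i| ^+ 2 < 1].

End Calculus.

Arguments euclidean_ball R k : clear implicits.

Section ComplexManifolds.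
Context {R : realType}.
Local Notation C := (Cplx R).

Record chart (X : topologicalType) (E : normedModType C) := Chart {
  dom : set X;
  crd : X -> E;
  par : E -> X;
  dom_open : open dom;
  cod_open : open (crd @` dom);
  crdK : forall q, dom q -> par (crd q) = q;
  crd_continuous : forall q, dom q -> {for q, continuous crd};
  par_continuous : forall z, (crd @` dom) z -> {for z, continuous par}
}.

Definition change X (E E' : normedModType C) (a : chart X E) (b : chart X E') :
  E -> E' := crd b \o par a.

Definition holomorphically_compatible X (E E' : normedModType C)
    (a : chart X E) (b : chart X E') : Prop :=
  holomorphic_on (crd a @` (dom a `&` dom b)) (change a b) /\
  holomorphic_on (crd b @` (dom a `&` dom b)) (change b a).

Record complex_manifold (n : nat) := ComplexManifold {
  space :> topologicalType;
  atlas : set (chart space 'rV[C]_n);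
  manifold_hausdorff : hausdorff_space space;
  manifold_second_countable : @second_countable space;
  atlas_cover : forall q : space, exists2 a, atlas a & dom a q;
  atlas_compatible : forall a b, atlas a -> atlas b ->
    holomorphically_compatible a b
}.

Variables (n : nat) (M : complex_manifold n).

Definition holomorphic_map (E : normedModType C) (U : set E) (f : E -> M) :
    Prop :=
  forall z, U z -> {for z, continuous f} /\
    forall a, atlas a -> dom a (f z) -> differentiable (crd a \o f) z.

Definition smooth_map (E : normedModType C) (U : set E) (f : E -> M) : Prop :=
  (forall z, U z -> {for z, continuous f}) /\
  forall a, atlas a -> smooth_on (U `&` f @^-1` dom a) (crd a \o f).

Definition immersive (E : normedModType C) (U : set E) (f : E -> M) : Prop :=
  forall z a, U z -> atlas a -> dom a (f z) ->
  forall v, rderive (crd a \o f) v z = 0 -> v = 0.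

(* A tangent vector at q is the family of its coordinate expressions in the
   charts around q. *)
Definition is_tangent (q : M) (v : chart M 'rV[C]_n -> 'rV[C]_n) : Prop :=
  forall a b, atlas a -> atlas b -> dom a q -> dom b q ->
  v b = 'd (change a b) (crd a q) (v a).

(* h a z v w is the Hermitian metric, in the chart a, at the point of
   coordinates z; it is C-linear in v, and its fundamental form is - Im h. *)
Definition kaehler_metric
    (h : chart M 'rV[C]_n -> 'rV[C]_n -> 'rV[C]_n -> 'rV[C]_n -> C) : Prop :=
  (forall a z, atlas a -> (crd a @` dom a) z ->
    [/\ (forall (k : C) u v w, h a z (k *: u + v) w = k * h a z u w + h a z v w),
        (forall v w, h a z w v = (h a z v w)^*%R),
        (forall v, v != 0 -> 0 < h a z v v) &
        (forall u v w, ext_d2 (fun y v' w' => - 'Im (h a y v' w')) z u v w = 0)])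
  /\ (forall a v w, atlas a ->
        smooth_on (crd a @` dom a) (fun z => h a z v w : C))
  /\ (forall a b q v w, atlas a -> atlas b -> dom a q -> dom b q ->
        h a (crd a q) v w =
        h b (crd b q) ('d (change a b) (crd a q) v)
                      ('d (change a b) (crd a q) w)).

Definition kaehler : Prop := exists h, kaehler_metric h.

End ComplexManifolds.

Arguments complex_manifold R n : clear implicits.

(* The domain of a foliated chart is identified with a product P x Q with Q
   connected, whose slices {x} x Q are the plaques.  The last condition says
   that transition maps are locally of the form (x, y) |-> (f x, g (x, y)). *)
Record foliation (R : realType) (n : nat) (M : complex_manifold R n) :=
  Foliation {
  fcharts : set (chart M ('rV[Cplx R]_n.-1 * Cplx R)%type);
  fcharts_cover : forall q : M, exists2 c, fcharts c & dom c q;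
  fcharts_compatible : forall a c, atlas a -> fcharts c ->
    holomorphically_compatible a c;
  fcharts_product : forall c, fcharts c ->
    exists P Q, crd c @` dom c = P `*` Q /\ connected Q;
  fcharts_transverse : forall c c' q, fcharts c -> fcharts c' ->
    dom c q -> dom c' q ->
    forall y : Cplx R,
    ('d (change c c') (crd c q) ((0 : 'rV[Cplx R]_n.-1), y)).1 = 0
}.

(* X with the leaf topology: a set is open when its traces on plaques are. *)
Section LeafTopology.
Context {R : realType} {n : nat} {M : complex_manifold R n}.

Definition leaf_open (Fol : foliation M) : set (set M) :=
  [set O | forall c x, fcharts Fol c ->
    open [set y : Cplx R | (crd c @` dom c) (x, y) /\ O (par c (x, y))]].

Definition leaf_space (Fol : foliation M) : Type := M.

Variable Fol : foliation M.

HB.instance Definition _ := Choice.on (leaf_space Fol).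

Lemma leaf_openT : leaf_open Fol setT.
Proof.
move=> c x _.
have -> : [set y : Cplx R | (crd c @` dom c) (x, y) /\ setT (par c (x, y))] =
          (fun y : Cplx R => (x, y)) @^-1` (crd c @` dom c).
  by apply/seteqP; split => y //= [].
apply: open_comp; last exact: cod_open.
move=> y _.
by apply: (@cvg_pair _ _ _ (nbhs y) (nbhs x) (nbhs y));
  [exact: cvg_cst|exact: cvg_id].
Qed.

Lemma leaf_openI : setI_closed (leaf_open Fol).
Proof.
move=> A B oA oB c x cF.
rewrite [X in open X](_ : _ =
  [set y : Cplx R | (crd c @` dom c) (x, y) /\ A (par c (x, y))] `&`
  [set y : Cplx R | (crd c @` dom c) (x, y) /\ B (par c (x, y))]).
  by apply: openI; [exact: oA|exact: oB].
by apply/seteqP; split => y /=; tauto.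
Qed.

Lemma leaf_open_bigU (I : Type) (f : I -> set M) :
  (forall i, leaf_open Fol (f i)) -> leaf_open Fol (\bigcup_i f i).
Proof.
move=> of_ c x cF.
rewrite [X in open X](_ : _ = \bigcup_i
  [set y : Cplx R | (crd c @` dom c) (x, y) /\ f i (par c (x, y))]).
  by apply: bigcup_open => i _; exact: of_.
apply/seteqP; split => y /=; first by case=> cy [i _ fi]; exists i.
by case=> i _ [cy fi]; split => //; exists i.
Qed.

HB.instance Definition _ := @isOpenTopological.Build (leaf_space Fol)
  (leaf_open Fol) leaf_openT leaf_openI leaf_open_bigU.

End LeafTopology.

Section Foliations.
Context {R : realType} {n : nat} {M : complex_manifold R n}.
Local Notation C := (Cplx R).
Local Notation T := 'rV[C]_n.-1.
Local Notation ball0 := (euclidean_ball R n.-1).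
Variable Fol : foliation M.

Definition same_plaque (q r : M) : Prop :=
  exists c, [/\ fcharts Fol c, dom c q, dom c r & (crd c q).1 = (crd c r).1].

Definition leaf (q : M) : set (leaf_space Fol) :=
  [set r | clos_refl_trans M same_plaque q r].

Definition compact_leaf (q : M) : Prop := compact (leaf q).

Definition saturation (S : set M) : set M :=
  [set r | exists2 q, S q & leaf q r].

(* The vector of coordinates v in the chart a at q belongs to the tangent
   bundle of the foliation. *)
Definition leaf_tangent (a : chart M 'rV[C]_n) (q : M) (v : 'rV[C]_n) : Prop :=
  forall c, fcharts Fol c -> dom c q -> ('d (change a c) (crd a q) v).1 = 0.

(* f : C -> L_q is a holomorphic covering map of the leaf of q, endowed with the
   leaf topology and with the complex structure whose charts are the second
   components of foliated charts.  As C is simply connected, f is a universal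
   covering. *)
Definition leaf_universal_covering (q : M) (f : C -> leaf_space Fol) : Prop :=
  [/\ range f = leaf q,
      continuous f,
      (forall y c, fcharts Fol c -> dom c (f y) ->
         differentiable (fun w : C => (crd c (f w)).2 : C) y) &
      (forall r, leaf q r -> exists W : set (leaf_space Fol),
         [/\ open W, W r, W `<=` leaf q &
         exists S : set (set C),
           [/\ (forall s, S s -> open s), trivIset S id,
               f @^-1` W = \bigcup_(s in S) s &
               (forall s, S s -> set_bij s W f /\
                  forall O, open O -> O `<=` s -> open (f @` O))]])].

Definition parabolic_leaf (q : M) : Prop :=
  exists f, leaf_universal_covering q f.

(* p parametrizes an embedded holomorphic disk transverse to the foliation. *)
Definition transverse_disk (p : T -> M) : Prop :=
  [/\ holomorphic_map ball0 p,
      (forall x x', ball0 x -> ball0 x' -> p x = p x' -> x = x'),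
      (forall O, open O -> O `<=` ball0 ->
         exists V : set M, open V /\ p @` O = V `&` p @` ball0) &
      (forall x a, ball0 x -> atlas a -> dom a (p x) ->
         forall v, leaf_tangent a (p x) ('d (crd a \o p) x v) -> v = 0)].

Definition trivialization (p : T -> M)
    (t : T -> chart M 'rV[C]_n -> 'rV[C]_n) : Prop :=
  forall x, ball0 x -> is_tangent (p x) (t x) /\
    forall a, atlas a -> dom a (p x) ->
      [/\ leaf_tangent a (p x) (t x a), t x a != 0 &
          differentiable (fun x' : T => t x' a) x].

Definition constructed_with (p : T -> M)
    (t : T -> chart M 'rV[C]_n -> 'rV[C]_n) (F : T * C -> M) : Prop :=
  forall x, ball0 x ->
    [/\ leaf_universal_covering (p x) (fun y => F (x, y)),
        F (x, 0) = p x &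
        forall a, atlas a -> dom a (p x) ->
          'd (fun y : C => crd a (F (x, y))) (0 : C) (1 : C) = t x a].

(* Maps are considered on ball0 x C; their values elsewhere are irrelevant. *)
Definition constructed_along (p : T -> M) (F : T * C -> M) : Prop :=
  exists t, trivialization p t /\ constructed_with p t F.

Definition classC (F : T * C -> M) : Prop :=
  exists p, transverse_disk p /\ constructed_along p F.

Definition standing_assumption : Prop :=
  forall p F, transverse_disk p -> constructed_along p F ->
    [/\ smooth_map (ball0 `*` setT) F, immersive (ball0 `*` setT) F &
        F @` (ball0 `*` setT) = saturation (p @` ball0)].

(* G : V -> U0 is an inverse of F near (0, 0). *)
Definition local_inverse (F : T * C -> M) (V : set M) (U0 : set (T * C))
    (G : M -> T * C) : Prop :=
  [/\ open V, open U0, U0 (0, 0), U0 `<=` ball0 `*` setT &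
      set_bij U0 V F /\ forall z, U0 z -> G (F z) = z].

(* The form lambda_F in a chart; g is the coordinate expression of the second
   component of the local inverse, and J is the multiplication by 'i. *)
Definition lambda (g : 'rV[C]_n -> C) (z Z : 'rV[C]_n) : C :=
  rderive g ('i *: Z) z - 'i * rderive g Z z.

(* A is the expression of A_F in the chart a, over V and the domain of a; it is
   determined there by this condition. *)
Definition is_A (a : chart M 'rV[C]_n) (V : set M) (G : M -> T * C)
    (A : 'rV[C]_n -> 'rV[C]_n -> C) : Prop :=
  let g := fun z : 'rV[C]_n => (G (par a z)).2 in
  forall q Z Y, V q -> dom a q -> leaf_tangent a q Y ->
    A (crd a q) Z * rderive g Y (crd a q) = ext_d (lambda g) (crd a q) Z Y.

(* The values at (Z, Y) of the tensors Gamma_F, for all F in the class whose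
   local inverse is defined at q; Z and Y are given in the chart a around q. *)
Definition Gamma_values (a : chart M 'rV[C]_n) (q : M) (Z Y : 'rV[C]_n) :
    set C :=
  [set g | exists F V U0 G A,
     [/\ classC F, local_inverse F V U0 G, V q, is_A a V G A &
         g = ext_d A (crd a q) Z Y]].

(* Gamma (Z, Y) = g at q: since Gamma_F does not depend on F, the set of values
   is a singleton. *)
Definition Gamma_is (a : chart M 'rV[C]_n) (q : M) (Z Y : 'rV[C]_n) (g : C) :
    Prop := Gamma_values a q Z Y = [set g].

Definition Gamma_vanishes_at (q : M) : Prop :=
  forall a Z Y, atlas a -> dom a q -> leaf_tangent a q Y ->
    Gamma_is a q Z Y 0.

End Foliations.

(* Main.v *)
(* Fix F constructed along p, a chart, and a direction v at x.  The operator
   dbar = D_(v,0) + i D_(iv,0) applied to F is tangent to the leaves (its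
   transverse part is constant along the leaf and vanishes at y = 0, where
   F (x, 0) = p x), so it equals b(y) D_(0,1) F for an entire function b, with
   b(0) = b'(0) = 0 as p and t are holomorphic.  By Baire, for a dense set of x
   every period w of F (x, _) is a limit of periods at all nearby points.  For
   such x, differentiating F (x', y + w') = F (x', y) shows that b(y + w) - b(y)
   is constant, so b' is periodic.  When the leaf is compact its covering is
   cocompact, b' is bounded, and b = 0.  By continuity dbar F = 0 everywhere.

   For Gamma, every point of the saturation has a neighbourhood made of compact
   leaves.  The local inverses of the F in C are holomorphic there, so lambda_F
   vanishes, hence A_F, and Gamma.  Deck transformations are automorphisms of
   the plane without fixed points, hence translations. *)
From HB Require Import structures.
Require Import Defs.
From mathcomp Require Import all_boot all_order all_algebra.
From mathcomp Require Import complex ring lra.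
From mathcomp Require Import all_classical all_reals topology normedtype derive.
From mathcomp Require Import landau.
From mathcomp Require ereal lebesgue_measure lebesgue_integral ftc.
From Stdlib Require Import Relation_Operators.
Set Implicit Arguments.
Unset Strict Implicit.
Unset Printing Implicit Defensive.
Import Order.TTheory GRing.Theory Num.Theory numFieldNormedType.Exports.
Local Open Scope classical_set_scope.
Local Open Scope ring_scope.

(** * Real-valued norms *)

Section RealNorm.
Context {R : realType}.
Local Notation C := (Cplx R).

(** The obstacle is that periods of a compact leaf need not persist: because of holonomy, F (x', _)
    may return near p x at a point of the disk other than p x'. The period relation is therefore
    differentiated only at points x all of whose periods persist. There no smooth dependence of
    periods is assumed: as D_(0,1) F is nonzero, the equation F (x', w') = p x' forces the same
    first order increment on all periods close to w.

    That b is entire requires exchanging the derivative in y with real derivatives in x; since F (x,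
    _) is holomorphic, Cauchy estimates for difference quotients do this. Division by D_(0,1) F is
    possible because a covering of a leaf is locally injective and open, and such a holomorphic
    function has nonzero derivative.

    Contours are boundaries of squares, as squares are cut into squares: one bisection principle
    then serves for Goursat's theorem, mean value inequalities, path lifting and connectedness. The
    place of 2 pi i is taken by an explicit integral that only has to be nonzero. *)

Definition rC (t : R) : C := (t%:C)%C.

(** Norms over [C] have values in [C]; their real part lies in the ordered field [R], where [lra]
    and [nra] apply. *)
Definition nrm (V : normedModType C) (v : V) : R := complex.Re (`|v| : C).

Lemma rCD s t : rC (s + t) = rC s + rC t. Proof. exact: rmorphD. Qed.
Lemma rCB s t : rC (s - t) = rC s - rC t. Proof. exact: rmorphB. Qed.
Lemma rCN t : rC (- t) = - rC t. Proof. exact: rmorphN. Qed.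
Lemma rCM s t : rC (s * t) = rC s * rC t. Proof. exact: rmorphM. Qed.
Lemma rCV t : rC (t^-1) = (rC t)^-1. Proof. exact: fmorphV. Qed.
Lemma rC0 : rC 0 = 0. Proof. by []. Qed.
Lemma rC1 : rC 1 = 1. Proof. by []. Qed.
Lemma rCn n : rC n%:R = n%:R. Proof. exact: rmorph_nat. Qed.
Lemma rC_eq0 t : (rC t == 0) = (t == 0). Proof. exact: fmorph_eq0. Qed.
Lemma rC_le s t : (rC s <= rC t) = (s <= t). Proof. exact: lecR. Qed.
Lemma rC_lt s t : (rC s < rC t) = (s < t). Proof. exact: ltcR. Qed.

Section V.
Variable V : normedModType C.
Implicit Types (u v : V) (k : C).

Lemma nrmE v : `|v| = rC (nrm v).
Proof.
rewrite /nrm /rC; have := normr_ge0 v; case: (`|v|) => a b.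
by rewrite lecE /= => /andP[/eqP -> _].
Qed.

Lemma nrm_ge0 v : 0 <= nrm v.
Proof. by rewrite -rC_le -nrmE normr_ge0. Qed.

Lemma nrm_eq0 v : (nrm v == 0) = (v == 0).
Proof. by rewrite -rC_eq0 -nrmE normr_eq0. Qed.

Lemma nrm0 : nrm (0 : V) = 0.
Proof. by apply/eqP; rewrite nrm_eq0. Qed.

Lemma nrm_gt0 v : (0 < nrm v) = (v != 0).
Proof. by rewrite lt_def nrm_ge0 andbT nrm_eq0. Qed.

Lemma nrmD u v : nrm (u + v) <= nrm u + nrm v.
Proof. by rewrite -rC_le rCD -!nrmE ler_normD. Qed.

Lemma nrmN v : nrm (- v) = nrm v.
Proof. by rewrite /nrm normrN. Qed.

Lemma nrmB u v : nrm (u - v) <= nrm u + nrm v.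
Proof. by rewrite -(nrmN v) nrmD. Qed.

Lemma nrmC u v : nrm (u - v) = nrm (v - u).
Proof. by rewrite -nrmN opprB. Qed.

Lemma nrm_sub u v : nrm u <= nrm v + nrm (u - v).
Proof. by have := nrmD v (u - v); rewrite addrC subrK. Qed.

Lemma nrm_dist u v w : nrm (u - w) <= nrm (u - v) + nrm (v - w).
Proof. by have := nrmD (u - v) (v - w); rewrite addrA subrK. Qed.

Lemma nrmZ k v : nrm (k *: v) = nrm k * nrm v.
Proof. by apply/eqP; rewrite -subr_eq0 -rC_eq0 rCB rCM -!nrmE normrZ subrr. Qed.

End V.

Lemma nrmM (k l : C) : nrm (k * l) = nrm k * nrm l.
Proof. exact: (@nrmZ C). Qed.

Lemma nrm_rC (t : R) : nrm (rC t) = `|t|.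
Proof.
by rewrite /nrm /rC normc_def /= expr0n /= addr0 sqrtr_sqr.
Qed.

Lemma nrm1 : nrm (1 : C) = 1.
Proof. by rewrite -rC1 nrm_rC normr1. Qed.

Lemma nrmi : nrm ('i : C) = 1.
Proof. by rewrite /nrm normCi. Qed.

Lemma nrmV (k : C) : nrm (k^-1) = (nrm k)^-1.
Proof. by apply/eqP; rewrite -subr_eq0 -rC_eq0 rCB rCV -!nrmE normfV subrr. Qed.

Lemma nrmX (k : C) n : nrm (k ^+ n) = nrm k ^+ n.
Proof.
elim: n => [|n ih]; first by rewrite !expr0 nrm1.
by rewrite !exprS nrmM ih.
Qed.

Lemma nbhs_nrm (V : normedModType C) (z : V) (A : set V) :
  nbhs z A <-> exists2 e : R, 0 < e & forall w, nrm (w - z) < e -> A w.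
Proof.
split.
  move/nbhs_ballP => [e /= e0 eA].
  have er : e = rC (complex.Re e).
    by move: e0; case: (e) => a b; rewrite ltcE /= => /andP[/eqP -> _].
  exists (complex.Re e); first by rewrite -rC_lt -er.
  move=> w wz; apply: eA; rewrite -ball_normE /= er.
  by rewrite -normrN opprB nrmE rC_lt.
move=> [e e0 eA]; apply/nbhs_ballP; exists (rC e) => /=; first by rewrite rC_lt.
move=> w; rewrite -ball_normE /= -normrN opprB nrmE rC_lt; exact: eA.
Qed.

Lemma nbhsR (x : R) (A : set R) :
  nbhs x A <-> exists2 e : R, 0 < e & forall w, `|w - x| < e -> A w.
Proof.
split.
  move/nbhs_ballP => [e /= e0 eA]; exists e => // w wz; apply: eA.
  by rewrite -ball_normE /= -normrN opprB.
move=> [e e0 eA]; apply/nbhs_ballP; exists e => //= w.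
by rewrite -ball_normE /= -normrN opprB; exact: eA.
Qed.

Lemma continuous_nrm (V W : normedModType C) (f : V -> W) z :
  {for z, continuous f} <->
  forall e : R, 0 < e -> exists2 d : R, 0 < d &
    forall w, nrm (w - z) < d -> nrm (f w - f z) < e.
Proof.
split.
  move=> cf e e0; apply/nbhs_nrm; apply: (cf [set y | nrm (y - f z) < e]).
  by apply/nbhs_nrm; exists e.
move=> H A /nbhs_nrm [e e0 eA]; apply/nbhs_nrm.
by have [d d0 dH] := H e e0; exists d => // w wz; apply: eA; exact: dH.
Qed.

Lemma openP_nrm (V : normedModType C) (A : set V) :
  open A <-> forall z, A z -> exists2 e : R, 0 < e & forall w, nrm (w - z) < e -> A w.
Proof.
split=> [oA z Az|H]; first by apply/nbhs_nrm; exact: open_nbhs_nbhs.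
by rewrite openE => z Az; rewrite /interior; apply/nbhs_nrm; exact: H.
Qed.

End RealNorm.

(** * Cauchy's formula on squares *)

Section Cousin.
Context {R : realType}.

Lemma half_pow_small (s e : R) : 0 < e -> exists n, s / 2 ^+ n < e.
Proof.
move=> e0; have [n hn] : exists n : nat, s / e < n%:R.
  exists (Num.truncn (Num.max 0 (s / e))).+1.
  apply: le_lt_trans (truncnS_gt _); by rewrite le_max lexx orbT.
exists n; rewrite ltr_pdivrMr ?exprn_gt0 // mulrC -ltr_pdivrMr //.
apply: lt_le_trans hn _.
by rewrite -natrX ler_nat ltnW // ltn_expl.
Qed.

(* Compactness of a square as an induction principle (Cousin); for intervals, P
   ignores its second argument. *)
Lemma square_induction (P : R -> R -> R -> Prop) :
  (forall x y s, 0 < s -> P x y (s / 2) -> P (x + s / 2) y (s / 2) ->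
     P x (y + s / 2) (s / 2) -> P (x + s / 2) (y + s / 2) (s / 2) -> P x y s) ->
  forall x0 y0 s0, 0 < s0 ->
  (forall c d, x0 <= c <= x0 + s0 -> y0 <= d <= y0 + s0 ->
     exists2 e, 0 < e & forall x y s, 0 < s -> s < e ->
       x <= c <= x + s -> y <= d <= y + s ->
       x0 <= x -> x + s <= x0 + s0 -> y0 <= y -> y + s <= y0 + s0 -> P x y s) ->
  P x0 y0 s0.
Proof.
move=> Psplit x0 y0 s0 s00 Ploc; apply: contrapT => NP.
(* By [Psplit], a square on which P fails has a quarter on which P fails; p is the lower left corner
   of that quarter. *)
have step (q : R * R * R) : exists p : R * R, 0 < q.2 -> ~ P q.1.1 q.1.2 q.2 ->
    [/\ ~ P p.1 p.2 (q.2 / 2),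
     p.1 = q.1.1 \/ p.1 = q.1.1 + q.2 / 2 & p.2 = q.1.2 \/ p.2 = q.1.2 + q.2 / 2].
  case: q => [[x y] s] /=.
  have [P1|nP1] := pselect (P x y (s / 2)); last by exists (x, y); split; tauto.
  have [P2|nP2] := pselect (P (x + s / 2) y (s / 2)).
    2: by exists (x + s / 2, y); split; tauto.
  have [P3|nP3] := pselect (P x (y + s / 2) (s / 2)).
    2: by exists (x, y + s / 2); split; tauto.
  have [P4|nP4] := pselect (P (x + s / 2) (y + s / 2) (s / 2)).
    2: by exists (x + s / 2, y + s / 2); split; tauto.
  by exists (x, y) => s_0 NPs; exfalso; apply: NPs; exact: Psplit.
have [nx nxP] := choice step.
pose q := fix q n := if n is m.+1 then nx (q m, s0 / 2 ^+ m) else (x0, y0).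
pose s n := s0 / 2 ^+ n.
have s_gt0 n : 0 < s n by rewrite divr_gt0 // exprn_gt0.
have sS n : s n.+1 = s n / 2.
  by rewrite /s exprSr invfM mulrA.
have qP n : ~ P (q n).1 (q n).2 (s n).
  elim: n => [|n ih]; first by rewrite /s expr0 divr1.
  by have [] := nxP (q n, s n) (s_gt0 n) ih; rewrite sS.
have qS n : ((q n.+1).1 = (q n).1 \/ (q n.+1).1 = (q n).1 + s n / 2) /\
            ((q n.+1).2 = (q n).2 \/ (q n.+1).2 = (q n).2 + s n / 2).
  by have [] := nxP (q n, s n) (s_gt0 n) (qP n).
(* The left ends increase and the right ends decrease; c is the supremum of the left ends. *)
have lim (u : nat -> R) : (forall n, u n.+1 = u n \/ u n.+1 = u n + s n / 2) ->
    exists c, forall n, u n <= c <= u n + s n.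
  move=> uS.
  have u_le m k : u m <= u (m + k)%N /\ u (m + k)%N + s (m + k)%N <= u m + s m.
    elim: k => [|k [ih1 ih2]]; first by rewrite addn0 !lexx.
    rewrite addnS; have := s_gt0 (m + k)%N; rewrite sS.
    by case: (uS (m + k)%N) => ->; lra.
  have u_le2 m n : u m <= u n + s n.
    have [mn|nm] := leqP m n.
      have [+ _] := u_le m (n - m)%N; rewrite subnKC //.
      by move=> h; apply: le_trans h _; rewrite lerDl ltW.
    have [_] := u_le n (m - n)%N; rewrite subnKC; last exact: ltnW.
    by move=> h; apply: le_trans h; rewrite lerDl ltW.
  pose A := [set u n | n in setT].
  have supA : has_sup A.
    split; first by exists (u 0%N); exists 0%N.
    by exists (u 0%N + s 0%N) => _ [n _ <-]; exact: u_le2.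
  exists (sup A) => n; apply/andP; split.
    by apply: (ub_le_sup supA.2); exists n.
  by apply: ge_sup => [|_ [m _ <-]]; [exact: supA.1|exact: u_le2].
have [c cP] := lim (fun n => (q n).1) (fun n => (qS n).1).
have [d dP] := lim (fun n => (q n).2) (fun n => (qS n).2).
have inside (u : nat -> R) : (forall n, u n.+1 = u n \/ u n.+1 = u n + s n / 2) ->
    forall n, u 0%N <= u n /\ u n + s n <= u 0%N + s0.
  move=> uS; elim=> [|n [ih1 ih2]]; first by rewrite /s expr0 divr1 !lexx.
  by rewrite sS; have := s_gt0 n; case: (uS n) => ->; lra.
have s0E : s 0%N = s0 by rewrite /s expr0 divr1.
have := cP 0%N; have := dP 0%N; rewrite s0E /= => dP0 cP0.
have [e e0 eP] := Ploc c d cP0 dP0.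
have [n nP] := half_pow_small s0 e0.
have [h1 h2] := inside _ (fun n => (qS n).1) n.
have [h3 h4] := inside _ (fun n => (qS n).2) n.
by apply: (qP n); apply: eP.
Qed.

End Cousin.

(** * Primitives and integrals on the unit interval *)

Section Primitives.
Context {R : realType}.
Local Notation C := (Cplx R).

Definition I01 (t : R) : bool := 0 <= t <= 1.

(** The derivative is relative to [0, 1], one-sided at the ends, so that values outside the interval
    never matter. *)
Definition has_pder (G g : R -> C) :=
  forall t, I01 t -> forall e, 0 < e -> exists2 d, 0 < d &
    forall t', I01 t' -> `|t' - t| < d ->
      nrm (G t' - G t - rC (t' - t) * g t) <= e * `|t' - t|.

(** Mean value inequality by bisection: the bound (M + e) s adds up over two halves, and on a short
    interval around c it follows by comparing both ends with c. *)
Lemma pder_le (G g : R -> C) (M : R) : has_pder G g ->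
  (forall t, I01 t -> nrm (g t) <= M) -> nrm (G 1 - G 0) <= M.
Proof.
move=> Gg gM; apply/ler_addgt0Pr => e e0.
pose P (x y s : R) := nrm (G (x + s) - G x) <= (M + e) * s.
suff : P 0 0 1 by rewrite /P add0r mulr1.
apply: (@square_induction R P) => //.
  move=> x y s s0; rewrite /P => h1 h2 _ _.
  have := nrm_dist (G (x + s)) (G (x + s / 2)) (G x).
  rewrite (_ : x + s / 2 + s / 2 = x + s) in h2; last by field.
  by move=> h; apply: le_trans h _; nra.
move=> c d hc _; rewrite add0r in hc.
have [dl dl0 dlP] := Gg c hc _ e0.
exists dl => // x y s s_0 sd /andP[xc cx] _ x0 xs _ _.
rewrite /P.
have k t : I01 t -> `|t - c| < dl -> nrm (G t - G c) <= (M + e) * `|t - c|.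
  move=> It tc; have h1 := dlP t It tc; have h2 := gM c hc.
  have := nrm_sub (G t - G c) (rC (t - c) * g c).
  rewrite nrmM nrm_rC => h3.
  have : `|t - c| * nrm (g c) <= `|t - c| * M by apply: ler_wpM2l.
  by nra.
have a1 : I01 (x + s) by rewrite /I01; lra.
have a2 : I01 x by rewrite /I01; lra.
have n1 : `|x + s - c| = x + s - c by rewrite ger0_norm //; lra.
have n2 : `|x - c| = c - x by rewrite ler0_norm ?opprB //; lra.
have := k _ a1; have := k _ a2; rewrite n1 n2 => k2 k1.
have {}k2 := k2 ltac:(lra); have {}k1 := k1 ltac:(lra).
have := nrm_dist (G (x + s)) (G c) (G x).
rewrite (nrmC (G c)) => h; nra.
Qed.

Lemma pderD (G H g h : R -> C) : has_pder G g -> has_pder H h ->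
  has_pder (fun t => G t + H t) (fun t => g t + h t).
Proof.
move=> Gg Hh t It e e0; have e2 : 0 < e / 2 by lra.
have [d1 d10 h1] := Gg t It _ e2; have [d2 d20 h2] := Hh t It _ e2.
exists (Num.min d1 d2); first by rewrite lt_min d10.
move=> t' It'; rewrite lt_min => /andP[l1 l2].
have {}h1 := h1 _ It' l1; have {}h2 := h2 _ It' l2.
rewrite (_ : _ - _ = (G t' - G t - rC (t' - t) * g t) +
  (H t' - H t - rC (t' - t) * h t)); last by ring.
by apply: le_trans (nrmD _ _) _; lra.
Qed.

Lemma pderZ k (G g : R -> C) : has_pder G g ->
  has_pder (fun t => k * G t) (fun t => k * g t).
Proof.
move=> Gg t It e e0; have k0 := nrm_ge0 k.
have [d d0 h] := Gg t It (e / (nrm k + 1)) ltac:(apply: divr_gt0; lra).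
exists d => // t' It' l; have {}h := h _ It' l.
rewrite (_ : _ - _ = k * (G t' - G t - rC (t' - t) * g t)); last by ring.
rewrite nrmM; have := normr_ge0 (t' - t) => n0.
apply: le_trans (ler_wpM2l k0 h) _.
rewrite mulrA ler_wpM2r // mulrCA ler_piMr ?(ltW e0) //.
by rewrite ler_pdivrMr; lra.
Qed.

Lemma pder_eq (G H g h : R -> C) : (forall t, I01 t -> G t = H t) ->
  (forall t, I01 t -> g t = h t) -> has_pder G g -> has_pder H h.
Proof.
move=> GH gh Gg t It e e0; have [d d0 hd] := Gg t It e e0.
by exists d => // t' It' l; rewrite -!GH // -gh //; exact: hd.
Qed.

Lemma pderB (G H g h : R -> C) : has_pder G g -> has_pder H h ->
  has_pder (fun t => G t - H t) (fun t => g t - h t).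
Proof.
move=> Gg Hh; have := pderD Gg (pderZ (-1) Hh).
by apply: pder_eq => t _; rewrite mulN1r.
Qed.

Lemma pder_affine (G g : R -> C) (a b : R) : I01 a -> I01 (a + b) ->
  has_pder G g -> has_pder (fun t => G (a + b * t)) (fun t => rC b * g (a + b * t)).
Proof.
rewrite /I01 => Ia Iab Gg t It e e0; have b0 := normr_ge0 b.
have [It0 It1] := andP It.
have [d d0 h] := Gg (a + b * t) ltac:(rewrite /I01; nra) (e / (`|b| + 1))
  ltac:(apply: divr_gt0; lra).
exists (d / (`|b| + 1)); first by apply: divr_gt0; lra.
move=> t' It'; rewrite ltr_pdivlMr; last by lra.
move=> l; have [It'0 It'1] := andP It'; have n0 := normr_ge0 (t' - t).
have := h (a + b * t') ltac:(rewrite /I01; nra).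
rewrite (_ : a + b * t' - (a + b * t) = b * (t' - t)); last by ring.
rewrite normrM => {}h; have {}h := h ltac:(nra).
rewrite rCM in h; rewrite (_ : _ - _ = G (a + b * t') - G (a + b * t) -
  rC b * rC (t' - t) * g (a + b * t)); last by ring.
apply: le_trans h _; rewrite mulrA ler_wpM2r // -mulrA ler_piMr ?(ltW e0) //.
by rewrite mulrC ler_pdivrMr; lra.
Qed.

Definition contI (g : R -> C) := forall t, I01 t -> forall e, 0 < e ->
  exists2 d, 0 < d & forall t', I01 t' -> `|t' - t| < d -> nrm (g t' - g t) < e.

(* The value is 0 when g has no primitive. *)
Definition int01 (g : R -> C) : C :=
  xget 0 [set I | exists2 G, has_pder G g & I = G 1 - G 0].

(** Two primitives of g differ by a function of zero derivative, constant by [pder_le] with M = 0,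
    so the primitive chosen in [int01] is immaterial. *)
Lemma int01E (G g : R -> C) : has_pder G g -> int01 g = G 1 - G 0.
Proof.
move=> Gg; rewrite /int01; case: xgetP => [I _ [H Hg ->]|].
  have h := pderB Hg Gg; have := pder_le (M := 0) h.
  move=> /(_ ltac:(by move=> t _; rewrite subrr nrm0)) le0.
  have /eqP : nrm (H 1 - G 1 - (H 0 - G 0)) == 0 by rewrite eq_le le0 nrm_ge0.
  move=> /eqP; rewrite nrm_eq0 => /eqP e0.
  by apply/eqP; rewrite -subr_eq0 -e0; apply/eqP; ring.
by move=> /(_ (G 1 - G 0)) []; exists G.
Qed.

End Primitives.

(** * Existence of primitives of continuous functions *)

Section Existence.
Import ereal lebesgue_measure lebesgue_integral ftc.
Context {R : realType}.
Local Notation C := (Cplx R).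

Local Notation mu := (@lebesgue_measure R).

Lemma real_primitive (g : R -> R) :
  (forall t, I01 t -> forall e, 0 < e -> exists2 d, 0 < d &
     forall t', I01 t' -> `|t' - t| < d -> `|g t' - g t| < e) ->
  exists G : R -> R, forall t, I01 t -> forall e, 0 < e -> exists2 d, 0 < d &
    forall t', I01 t' -> `|t' - t| < d ->
      `|G t' - G t - (t' - t) * g t| <= e * `|t' - t|.
Proof.
(* Clamping to [0, 1] extends g to a continuous function on the line; the fundamental theorem of
   calculus then applies on [-1, 2], which has both ends 0 and 1 in its interior. *)
move=> cg; pose cl (t : R) : R := Num.max 0 (Num.min 1 t).
have clI t : I01 (cl t).
  rewrite /I01 /cl le_max lexx /= ge_max ler01 /=.
  by rewrite ge_min lexx.
have clE t : I01 t -> cl t = t.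
  by move=> /andP[t0 t1]; rewrite /cl (min_idPr t1) (max_idPr t0).
have clL s t : `|cl s - cl t| <= `|s - t|.
  rewrite /cl; case: (lerP 1 s) => s1; case: (lerP 1 t) => t1;
  rewrite ?(max_idPr ler01).
  - by rewrite subrr normr0.
  - case: (lerP 0 t) => t0; rewrite (@ger0_norm _ (s - t)) ?ger0_norm; lra.
  - case: (lerP 0 s) => s0; rewrite (@ler0_norm _ (s - t)) ?ler0_norm; lra.
  - case: (lerP 0 s) => s0; case: (lerP 0 t) => t0 //.
    + by rewrite !ger0_norm; lra.
    + by rewrite !ler0_norm; lra.
    + by rewrite subrr normr0.
pose h := g \o cl.
have ch : continuous h.
  move=> t; apply/(@cvgrPdist_lt _ R^o) => e e0.
  have [d d0 dP] := cg _ (clI t) e e0.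
  apply/nbhsR; exists d => // w wt; rewrite distrC; apply: dP => //.
  exact: le_lt_trans (clL _ _) wt.
have ih := @continuous_compact_integrable R h `[(-1 : R), 2]
  (@segment_compact _ _ _) (continuous_subspaceT ch).
have FTC t (t2 : t < 2) (t1 : -1 < t) := continuous_FTC1_closed t2 ih t1 (ch t).
move: FTC; set G := (fun x => _) => FTC.
exists G => t It e e0; have [t0 t1] := andP It.
have [dF FE] := FTC t ltac:(lra) ltac:(lra).
have := derivable_nbhs dF; rewrite -derive1E FE => /eqaddoP /(_ e e0) /nbhsR [d d0 dP].
exists d => // t' It' l; have := dP (t' - t); rewrite subr0 => /(_ l) /=.
rewrite /cst /= -![(_ + _ : _ -> _) _]/(_ + _) -![(- _ : _ -> _) _]/(- _) /=.
rewrite scaler1 subrK /h /= (clE _ It) /GRing.scale /=.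
move=> H; have -> : G t' - G t - (t' - t) * g t = G t' - (G t + (t' - t) * g t) by ring.
exact: H.
Qed.

Local Notation Re := (@complex.Re R).
Local Notation Im := (@complex.Im R).

Lemma ReIm_le (z : C) : `|Re z| <= nrm z /\ `|Im z| <= nrm z.
Proof.
rewrite /nrm normc_def /=; split; rewrite -sqrtr_sqr ler_wsqrtr //.
  by rewrite lerDl sqr_ge0.
by rewrite lerDr sqr_ge0.
Qed.

Lemma nrm_le_ReIm (z : C) : nrm z <= `|Re z| + `|Im z|.
Proof.
have -> : z = rC (Re z) + 'i * rC (Im z) by rewrite /rC -complexiE -complexE.
apply: le_trans (nrmD _ _) _; rewrite nrmM nrmi mul1r !nrm_rC.
by rewrite -complexiE -complexE.
Qed.

Lemma ReB (z w : C) : Re (z - w) = Re z - Re w.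
Proof. by case: z; case: w. Qed.
Lemma ImB (z w : C) : Im (z - w) = Im z - Im w.
Proof. by case: z; case: w. Qed.
Lemma RerC (t : R) (w : C) : Re (rC t * w) = t * Re w.
Proof. by case: w => a b; rewrite /= mul0r subr0. Qed.
Lemma ImrC (t : R) (w : C) : Im (rC t * w) = t * Im w.
Proof. by case: w => a b; rewrite /= mul0r addr0. Qed.

Lemma contI_primitive (g : R -> C) : contI g -> exists G, has_pder G g.
Proof.
move=> cg.
have [|P PP] := @real_primitive (Re \o g).
  move=> t It e e0; have [d d0 dP] := cg t It e e0.
  exists d => // t' It' l; apply: le_lt_trans (dP t' It' l).
  by rewrite /= -ReB; exact: (ReIm_le _).1.
have [|Q QQ] := @real_primitive (Im \o g).
  move=> t It e e0; have [d d0 dP] := cg t It e e0.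
  exists d => // t' It' l; apply: le_lt_trans (dP t' It' l).
  by rewrite /= -ImB; exact: (ReIm_le _).2.
exists (fun t => Complex (P t) (Q t)) => t It e e0.
have [d1 d10 h1] := PP t It (e / 2) ltac:(lra).
have [d2 d20 h2] := QQ t It (e / 2) ltac:(lra).
exists (Num.min d1 d2); first by rewrite lt_min d10.
move=> t' It'; rewrite lt_min => /andP[l1 l2].
have {}h1 := h1 _ It' l1; have {}h2 := h2 _ It' l2.
apply: le_trans (nrm_le_ReIm _) _; rewrite !ReB !ImB RerC ImrC /=.
by move: h1 h2 => /=; lra.
Qed.

End Existence.

(** * Rules for the integral over the unit interval *)

Section Integral.
Context {R : realType}.
Local Notation C := (Cplx R).
Implicit Types g h : R -> C.

Lemma int01_ext g h : (forall t, I01 t -> g t = h t) -> int01 g = int01 h.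
Proof.
move=> gh; have e : has_pder^~ g = has_pder^~ h.
  by apply/funext => G; apply/propext; split; apply: pder_eq => // t It; rewrite gh.
by rewrite /int01; congr (xget 0 _); apply/funext => I; rewrite /mkset;
   apply/propext; split=> -[G Gg ->]; exists G => //; move: Gg;
   rewrite (_ : has_pder G g = has_pder G h) //; move: e => /(congr1 (@^~ G)).
Qed.

Lemma int01D g h : contI g -> contI h ->
  int01 (fun t => g t + h t) = int01 g + int01 h.
Proof.
move=> /contI_primitive[G Gg] /contI_primitive[H Hh].
by rewrite (int01E Gg) (int01E Hh) (int01E (pderD Gg Hh)); ring.
Qed.

Lemma int01Z k g : contI g -> int01 (fun t => k * g t) = k * int01 g.
Proof.
move=> /contI_primitive[G Gg].
by rewrite (int01E Gg) (int01E (pderZ k Gg)); ring.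
Qed.

Lemma int01_le g M : contI g -> (forall t, I01 t -> nrm (g t) <= M) ->
  nrm (int01 g) <= M.
Proof. by move=> /contI_primitive[G Gg]; rewrite (int01E Gg); exact: pder_le. Qed.

Lemma int01_split (s : R) g : I01 s -> contI g ->
  int01 g = rC s * int01 (fun t => g (s * t)) +
            rC (1 - s) * int01 (fun t => g (s + (1 - s) * t)).
Proof.
move=> Is /contI_primitive[G Gg].
have prim (a b : R) : I01 a -> I01 (a + b) ->
    rC b * int01 (fun t => g (a + b * t)) = G (a + b) - G a.
  (* For b = 0 the substitution a + b t degenerates, but both sides vanish. *)
  move=> Ia Iab; have [b0|b0] := eqVneq (rC b) 0.
    move/eqP: (b0); rewrite rC_eq0 => /eqP ->.
    by rewrite mul0r addr0 subrr.
  have := pderZ ((rC b)^-1) (pder_affine Ia Iab Gg) => h.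
  have {h} h : has_pder (fun t => (rC b)^-1 * G (a + b * t)) (fun t => g (a + b * t)).
    by apply: pder_eq h => // t _; rewrite mulKf.
  by rewrite (int01E h) mulr1 mulr0 addr0 -mulrBr mulVKf.
have I0 : I01 (0 : R) by rewrite /I01 lexx ler01.
have I1 : I01 (1 : R) by rewrite /I01 lexx ler01.
have := prim 0 s I0; rewrite add0r => /(_ Is) h1.
have := prim s (1 - s) Is; rewrite (_ : s + (1 - s) = 1); last by ring.
move=> /(_ I1) ->; rewrite (int01E Gg).
rewrite (@int01_ext (fun t => g (s * t)) (fun t => g (0 + s * t))).
  by rewrite h1; ring.
by move=> t _; rewrite add0r.
Qed.

Lemma int01_rev g : contI g -> int01 (fun t => g (1 - t)) = int01 g.
Proof.
move=> /contI_primitive[G Gg].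
have I0 : I01 (1 + (-1) : R) by rewrite /I01 subrr lexx ler01.
have I1 : I01 (1 : R) by rewrite /I01 lexx ler01.
have := pderZ (-1) (pder_affine I1 I0 Gg) => h.
have {h} h : has_pder (fun t => - 1 * G (1 + -1 * t)) (fun t => g (1 - t)).
  by apply: pder_eq h => // t _; rewrite rCN rC1 mulN1r mulN1r opprK mulN1r.
by rewrite (int01E h) (int01E Gg) mulr1 mulr0 subrr addr0; ring.
Qed.

End Integral.

Ltac lraq := repeat match goal with H : ?T |- _ =>
    lazymatch T with
    | is_true (_ <= _) => fail | is_true (_ < _) => fail
    | is_true (_ && _) => fail
    | @eq _ _ _ => fail | _ \/ _ => fail | _ => clear H end end; lra.

(** * Goursat's theorem on squares *)

Section Goursat.
Context {R : realType}.
Local Notation C := (Cplx R).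
Local Notation Re := (@complex.Re R).
Local Notation Im := (@complex.Im R).
Implicit Types f g : C -> C.

(** Complex differentiability in the form used by the estimates; [holo_differentiable] relates it to
    [differentiable]. *)
Definition cderiv f (z d : C) := forall e : R, 0 < e -> exists2 dl : R, 0 < dl &
  forall h, nrm h < dl -> nrm (f (z + h) - f z - h * d) <= e * nrm h.

Definition holo f (z : C) := exists d, cderiv f z d.

Definition pt (x y : R) : C := rC x + 'i * rC y.

Lemma ptE (z : C) : z = pt (Re z) (Im z).
Proof. by rewrite /pt /rC -complexiE -complexE. Qed.

Lemma pt_Re x y : Re (pt x y) = x.
Proof. by rewrite /pt -complexiE /rC /= !mul0r !mulr0 subr0 addr0. Qed.
Lemma pt_Im x y : Im (pt x y) = y.
Proof. by rewrite /pt -complexiE /rC /= !mul0r mul1r !add0r. Qed.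

Lemma nrm_pt x y : nrm (pt x y) <= `|x| + `|y|.
Proof. by apply: le_trans (nrm_le_ReIm _) _; rewrite pt_Re pt_Im. Qed.

Definition ccont f (z : C) := forall e : R, 0 < e -> exists2 dl : R, 0 < dl &
  forall h, nrm h < dl -> nrm (f (z + h) - f z) < e.

Lemma holo_ccont f z : holo f z -> ccont f z.
Proof.
move=> [d fd] e e0; have [dl dl0 h] := fd 1 ltr01.
have nd := nrm_ge0 d.
exists (Num.min dl (e / (nrm d + 2))).
  by rewrite lt_min dl0 divr_gt0 //; lra.
move=> k; rewrite lt_min ltr_pdivlMr; last by lra.
move=> /andP[k1 k2]; have := h k k1; have := nrm_sub (f (z + k) - f z) (k * d).
by rewrite nrmM; have := nrm_ge0 k; nra.
Qed.

Definition contH f x y s := contI (fun t => f (pt (x + s * t) y)).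
Definition contV f x y s := contI (fun t => f (pt x (y + s * t))).
Definition hI f (x y s : R) : C := rC s * int01 (fun t => f (pt (x + s * t) y)).
Definition vI f (x y s : R) : C := 'i * rC s * int01 (fun t => f (pt x (y + s * t))).
(* The contour integral along the boundary of the square of side s whose lower
   left corner is pt x y. *)
Definition sqI f (x y s : R) : C :=
  hI f x y s + vI f (x + s) y s - hI f x (y + s) s - vI f x y s.

Lemma ccont_H f x y s : (forall u, x <= u <= x + s -> ccont f (pt u y)) ->
  0 <= s -> contH f x y s.
Proof.
move=> cf s0 t /andP[t0 t1] e e0.
have [dl dl0 h] := cf (x + s * t) ltac:(nra) e e0.
exists (dl / (s + 1)); first by apply: divr_gt0; lra.
move=> t' It'; rewrite ltr_pdivlMr; last by lra.
move=> l; have := h (rC (s * (t' - t))); rewrite nrm_rC normrM (ger0_norm s0).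
have -> : pt (x + s * t) y + rC (s * (t' - t)) = pt (x + s * t') y.
  by rewrite /pt !(rCD, rCM, rCB); ring.
by apply; have := normr_ge0 (t' - t); nra.
Qed.

Lemma ccont_V f x y s : (forall u, y <= u <= y + s -> ccont f (pt x u)) ->
  0 <= s -> contV f x y s.
Proof.
move=> cf s0 t /andP[t0 t1] e e0.
have [dl dl0 h] := cf (y + s * t) ltac:(nra) e e0.
exists (dl / (s + 1)); first by apply: divr_gt0; lra.
move=> t' It'; rewrite ltr_pdivlMr; last by lra.
move=> l; have := h ('i * rC (s * (t' - t))).
rewrite nrmM nrmi mul1r nrm_rC normrM (ger0_norm s0).
have -> : pt x (y + s * t) + 'i * rC (s * (t' - t)) = pt x (y + s * t').
  by rewrite /pt !(rCD, rCM, rCB); ring.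
by apply; have := normr_ge0 (t' - t); nra.
Qed.

Lemma hI_split f x y (a b : R) : 0 <= a -> 0 <= b -> contH f x y (a + b) ->
  hI f x y (a + b) = hI f x y a + hI f (x + a) y b.
Proof.
move=> a0 b0 cf; have [ab0|ab0] := eqVneq (a + b) 0.
  have -> : a = 0 by lra.
  have -> : b = 0 by lra.
  by rewrite /hI addr0 !mul0r addr0.
have abgt : 0 < a + b by rewrite lt_def ab0 /=; lra.
have Is : I01 (a / (a + b)).
  apply/andP; split; first by apply: divr_ge0; lra.
  by rewrite ler_pdivrMr // mul1r; lra.
rewrite /hI (int01_split Is cf) mulrDr !mulrA -!rCM.
have -> : (a + b) * (a / (a + b)) = a by field.
have -> : (a + b) * (1 - a / (a + b)) = b by field.
by congr (_ * _ + _ * _); apply: int01_ext => t _; congr (f (pt _ _)); field.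
Qed.

Lemma vI_split f x y (a b : R) : 0 <= a -> 0 <= b -> contV f x y (a + b) ->
  vI f x y (a + b) = vI f x y a + vI f x (y + a) b.
Proof.
move=> a0 b0 cf; have [ab0|ab0] := eqVneq (a + b) 0.
  have -> : a = 0 by lra.
  have -> : b = 0 by lra.
  by rewrite /vI addr0 !mulr0 !mul0r addr0.
have abgt : 0 < a + b by rewrite lt_def ab0 /=; lra.
have Is : I01 (a / (a + b)).
  apply/andP; split; first by apply: divr_ge0; lra.
  by rewrite ler_pdivrMr // mul1r; lra.
have ea : rC (a + b) * rC (a / (a + b)) = rC a by rewrite -rCM; congr rC; field.
have eb : rC (a + b) * rC (1 - a / (a + b)) = rC b.
  by rewrite -rCM; congr rC; field.
rewrite /vI (int01_split Is cf) mulrDr -!mulrA !(mulrA (rC (a + b))) ea eb !mulrA.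
by congr (_ * _ + _ * _); apply: int01_ext => t _; congr (f (pt _ _)); field.
Qed.

Definition contSq f x y s :=
  [/\ contH f x y s, contV f (x + s) y s, contH f x (y + s) s & contV f x y s].

Lemma sqI_le f x y s M : 0 <= s -> contSq f x y s ->
  (forall u v, x <= u <= x + s -> y <= v <= y + s ->
    u = x \/ u = x + s \/ v = y \/ v = y + s -> nrm (f (pt u v)) <= M) ->
  nrm (sqI f x y s) <= 4 * s * M.
Proof.
move=> s0 [c1 c2 c3 c4] fM.
have b1 : nrm (hI f x y s) <= s * M.
  rewrite nrmM nrm_rC ger0_norm // ler_wpM2l //; apply: int01_le => // t /andP[t0 t1].
  by apply: fM; [nra|lra|auto].
have b2 : nrm (vI f (x + s) y s) <= s * M.
  rewrite !nrmM nrmi mul1r nrm_rC ger0_norm // ler_wpM2l //.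
  by apply: int01_le => // t /andP[t0 t1]; apply: fM; [lra|nra|auto].
have b3 : nrm (hI f x (y + s) s) <= s * M.
  rewrite nrmM nrm_rC ger0_norm // ler_wpM2l //; apply: int01_le => // t /andP[t0 t1].
  by apply: fM; [nra|lra|auto].
have b4 : nrm (vI f x y s) <= s * M.
  rewrite !nrmM nrmi mul1r nrm_rC ger0_norm // ler_wpM2l //.
  by apply: int01_le => // t /andP[t0 t1]; apply: fM; [lra|nra|auto].
rewrite /sqI; apply: le_trans (nrmB _ _) _.
have := nrmB (hI f x y s + vI f (x + s) y s) (hI f x (y + s) s).
by have := nrmD (hI f x y s) (vI f (x + s) y s); lra.
Qed.

Lemma sqID f g x y s : contSq f x y s -> contSq g x y s ->
  sqI (fun w => f w + g w) x y s = sqI f x y s + sqI g x y s.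
Proof.
move=> [c1 c2 c3 c4] [d1 d2 d3 d4]; rewrite /sqI /hI /vI.
by rewrite (int01D c1 d1) (int01D c2 d2) (int01D c3 d3) (int01D c4 d4); ring.
Qed.

Lemma sqIZ k f x y s : contSq f x y s ->
  sqI (fun w => k * f w) x y s = k * sqI f x y s.
Proof.
move=> [c1 c2 c3 c4]; rewrite /sqI /hI /vI.
by rewrite (int01Z k c1) (int01Z k c2) (int01Z k c3) (int01Z k c4); ring.
Qed.

Lemma int01_poly1 (a b : C) : int01 (fun t : R => a + rC t * b) = a + b / 2.
Proof.
have two : (2 : C) != 0 by rewrite pnatr_eq0.
pose G (t : R) : C := rC t * a + rC t * rC t * b / 2.
have Gg : has_pder G (fun t => a + rC t * b).
  move=> t It e e0; exists (e / (nrm b + 1)).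
    by apply: divr_gt0 => //; have := nrm_ge0 b; lra.
  move=> t' It'; rewrite ltr_pdivlMr; last by have := nrm_ge0 b; lra.
  move=> l; have -> : G t' - G t - rC (t' - t) * (a + rC t * b) =
     rC (t' - t) * rC (t' - t) * (b / 2) by rewrite /G !rCB; field.
  have h2 : nrm ((2 : C)^-1) = 2^-1 by rewrite nrmV -(rCn 2) nrm_rC normr_nat.
  rewrite !nrmM nrm_rC h2 mulrC -mulrA -(mulrC `|_|) mulrA.
  by have := nrm_ge0 b; have := normr_ge0 (t' - t); nra.
by rewrite (int01E Gg) /G rC0 rC1; field.
Qed.

(** The base case of Goursat's argument, computed side by side. *)
Lemma sqI_poly1 (a b : C) x y s : sqI (fun w => a + w * b) x y s = 0.
Proof.
rewrite /sqI /hI /vI.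
rewrite (@int01_ext _ (fun t => a + pt (x + s * t) y * b)
  (fun t => (a + pt x y * b) + rC t * (rC s * b))); last first.
  by move=> t _; rewrite /pt !(rCD, rCM); ring.
rewrite (@int01_ext _ (fun t => a + pt (x + s) (y + s * t) * b)
  (fun t => (a + pt (x + s) y * b) + rC t * ('i * rC s * b))); last first.
  by move=> t _; rewrite /pt !(rCD, rCM); ring.
rewrite (@int01_ext _ (fun t => a + pt (x + s * t) (y + s) * b)
  (fun t => (a + pt x (y + s) * b) + rC t * (rC s * b))); last first.
  by move=> t _; rewrite /pt !(rCD, rCM); ring.
rewrite (@int01_ext _ (fun t => a + pt x (y + s * t) * b)
  (fun t => (a + pt x y * b) + rC t * ('i * rC s * b))); last first.
  by move=> t _; rewrite /pt !(rCD, rCM); ring.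
rewrite !int01_poly1 /pt !rCD.
have two : (2 : C) != 0 by rewrite pnatr_eq0.
have i2 : ('i : C) * 'i = -1 by rewrite -expr2 sqrCi.
by field: i2.
Qed.

Definition insq (x y s : R) (w : C) := x <= Re w <= x + s /\ y <= Im w <= y + s.

Lemma insq_contSq f x y s : 0 <= s ->
  (forall w, insq x y s w -> ccont f w) -> contSq f x y s.
Proof.
move=> s0 cf; split.
- by apply: ccont_H => // u hu; apply: cf; rewrite /insq pt_Re pt_Im; split; lra.
- by apply: ccont_V => // u hu; apply: cf; rewrite /insq pt_Re pt_Im; split; lra.
- by apply: ccont_H => // u hu; apply: cf; rewrite /insq pt_Re pt_Im; split; lra.
- by apply: ccont_V => // u hu; apply: cf; rewrite /insq pt_Re pt_Im; split; lra.
Qed.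

Lemma ccont_poly1 a b w : ccont (fun w => a + w * b) w.
Proof.
move=> e e0; have nb := nrm_ge0 b.
exists (e / (nrm b + 1)); first by apply: divr_gt0; lra.
move=> h; rewrite ltr_pdivlMr; last by lra.
rewrite (_ : _ - _ = h * b); last by ring.
by rewrite nrmM; have := nrm_ge0 h; nra.
Qed.

Lemma ccontB f g w : ccont f w -> ccont g w -> ccont (fun w => f w - g w) w.
Proof.
move=> cf cg e e0; have [d1 d10 h1] := cf (e / 2) ltac:(lra).
have [d2 d20 h2] := cg (e / 2) ltac:(lra).
exists (Num.min d1 d2); first by rewrite lt_min d10.
move=> h; rewrite lt_min => /andP[l1 l2].
rewrite (_ : _ - _ = (f (w + h) - f w) - (g (w + h) - g w)); last by ring.
by apply: le_lt_trans (nrmB _ _) _; have := h1 h l1; have := h2 h l2; lra.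
Qed.

Lemma sqI_quarter f x y (s : R) : 0 <= s ->
  (forall w, insq x y (s + s) w -> ccont f w) ->
  sqI f x y (s + s) = sqI f x y s + sqI f (x + s) y s + sqI f x (y + s) s +
     sqI f (x + s) (y + s) s.
Proof.
move=> s0 cf.
have cH v : y <= v <= y + s + s -> contH f x v (s + s).
  move=> hv; apply: ccont_H; last by lra.
  by move=> u hu; apply: cf; rewrite /insq pt_Re pt_Im; split; lra.
have cV v : x <= v <= x + s + s -> contV f v y (s + s).
  move=> hv; apply: ccont_V; last by lra.
  by move=> u hu; apply: cf; rewrite /insq pt_Re pt_Im; split; lra.
rewrite /sqI !addrA.
rewrite (hI_split s0 s0 (cH y ltac:(lra))).
rewrite (hI_split s0 s0 (cH (y + s + s) ltac:(lra))).
rewrite (vI_split s0 s0 (cV x ltac:(lra))).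
rewrite (vI_split s0 s0 (cV (x + s + s) ltac:(lra))).
by ring.
Qed.

(** Subtracting the affine approximation at pt c d does not change the integral; the remainder is at
    most e (2 s) on a contour of length 4 s, whence the factor 8. *)
Lemma sqI_small f c d D (e dl x y s : R) : 0 <= e -> 0 < s -> 2 * s < dl ->
  x <= c <= x + s -> y <= d <= y + s ->
  (forall h, nrm h < dl -> nrm (f (pt c d + h) - f (pt c d) - h * D) <= e * nrm h) ->
  (forall w, insq x y s w -> ccont f w) ->
  nrm (sqI f x y s) <= e * 8 * s ^+ 2.
Proof.
move=> e0 s0 sd hc hd fD cf.
pose a := f (pt c d) - pt c d * D.
have cfg : contSq (fun w => f w - (a + w * D)) x y s.
  apply: insq_contSq; first exact: ltW.
  by move=> w wS; apply: ccontB; [exact: cf|exact: ccont_poly1].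
have cg : contSq (fun w => a + w * D) x y s.
  by apply: insq_contSq; [exact: ltW|move=> w _; exact: ccont_poly1].
have E := sqID cfg cg; rewrite (sqI_poly1 a D) addr0 in E.
have fE : (fun w => f w - (a + w * D) + (a + w * D)) = f.
  by apply/funext => w; rewrite subrK.
rewrite fE in E; rewrite E => {E fE}.
have -> : e * 8 * s ^+ 2 = 4 * s * (e * (2 * s)) by ring.
apply: sqI_le => //; first exact: ltW.
move=> u v hu hv _.
have e1 : pt u v = pt c d + pt (u - c) (v - d) by rewrite /pt !rCB; ring.
have n1 : nrm (pt (u - c) (v - d)) <= 2 * s.
  apply: le_trans (nrm_pt _ _) _.
  have : `|u - c| <= s by rewrite ler_norml; lraq.
  have : `|v - d| <= s by rewrite ler_norml; lraq.
  by lraq.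
have := fD (pt (u - c) (v - d)) (le_lt_trans n1 sd).
rewrite -e1 => h; rewrite (_ : _ - _ = f (pt u v) - f (pt c d) - pt (u - c) (v - d) * D).
  by apply: le_trans h _; apply: ler_wpM2l.
by rewrite /a e1; ring.
Qed.

Lemma insq_sub x y s x' y' s' w : x <= x' -> x' + s' <= x + s -> y <= y' ->
  y' + s' <= y + s -> insq x' y' s' w -> insq x y s w.
Proof. by rewrite /insq => h1 h2 h3 h4 [h5 h6]; split; lraq. Qed.

(** The bound e s^2 passes from four quarters to their union since 4 (s / 2)^2 = s^2, and holds on
    small squares by [sqI_small]; then e is arbitrary. *)
Lemma goursat f x y s : 0 < s -> (forall w, insq x y s w -> holo f w) ->
  sqI f x y s = 0.
Proof.
move=> s0 fh.
suff H e : 0 < e -> nrm (sqI f x y s) <= e * s ^+ 2.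
  apply/eqP; rewrite -nrm_eq0 eq_le nrm_ge0 andbT.
  apply/ler_addgt0Pr => e e0; rewrite add0r.
  have s2 : 0 < s ^+ 2 by apply: exprn_gt0.
  have := H (e / s ^+ 2) ltac:(exact: divr_gt0).
  by rewrite divfK // gt_eqF.
move=> e0.
pose P (x' y' s' : R) := x <= x' -> x' + s' <= x + s -> y <= y' -> y' + s' <= y + s ->
  nrm (sqI f x' y' s') <= e * s' ^+ 2.
suff : P x y s by apply; rewrite lexx.
apply: (@square_induction R P) => //.
  move=> x' y' s' s'0; rewrite /P => h1 h2 h3 h4 i1 i2 i3 i4.
  have e2 : s' = s' / 2 + s' / 2 by field.
  rewrite {1}e2 sqI_quarter; last 2 first.
  - by clear -s'0; lra.
  - move=> w; rewrite -e2 => wS; apply: holo_ccont; apply: fh.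
    exact: insq_sub wS.
  have {}h1 := h1 ltac:(lraq) ltac:(lraq) ltac:(lraq) ltac:(lraq).
  have {}h2 := h2 ltac:(lraq) ltac:(lraq) ltac:(lraq) ltac:(lraq).
  have {}h3 := h3 ltac:(lraq) ltac:(lraq) ltac:(lraq) ltac:(lraq).
  have {}h4 := h4 ltac:(lraq) ltac:(lraq) ltac:(lraq) ltac:(lraq).
  move: h1 h2 h3 h4.
  set q1 := sqI _ _ _ _; set q2 := sqI _ _ _ _; set q3 := sqI _ _ _ _.
  set q4 := sqI _ _ _ _ => h1 h2 h3 h4.
  have := nrmD (q1 + q2 + q3) q4; have := nrmD (q1 + q2) q3; have := nrmD q1 q2.
  have -> : e * s' ^+ 2 = 4 * (e * (s' / 2) ^+ 2) by field.
  by clear -h1 h2 h3 h4; lra.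
move=> c d hc hd.
have [D fD] : holo f (pt c d) by apply: fh; rewrite /insq pt_Re pt_Im.
have [dl dl0 dlP] := fD (e / 8) ltac:(lraq).
exists (dl / 2); first by clear -dl0; lra.
move=> x' y' s' s'0 s'd hc' hd' i1 i2 i3 i4 _ _ _ _.
have -> : e * s' ^+ 2 = e / 8 * 8 * s' ^+ 2 by field.
apply: (@sqI_small f c d D (e / 8) dl) => //; [by lraq|by lraq|].
by move=> w wS; apply: holo_ccont; apply: fh; exact: insq_sub wS.
Qed.

End Goursat.

(** * Contours around the origin *)

Section Cauchy.
Context {R : realType}.
Local Notation C := (Cplx R).
Local Notation Re := (@complex.Re R).
Local Notation Im := (@complex.Im R).
Implicit Types f g : C -> C.

(* The eight outer squares contribute 0 by Goursat, so a square contour around 0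
   can be shrunk by a factor 3. *)
Lemma sqI_ninth f x y (s : R) : 0 < s ->
  (forall w, insq x y (s + s + s) w ->
     ~ (x + s < Re w < x + s + s /\ y + s < Im w < y + s + s) -> holo f w) ->
  sqI f x y (s + s + s) = sqI f (x + s) (y + s) s.
Proof.
move=> s0 fh.
have cH v : y <= v <= y + s + s + s -> v <= y + s \/ y + s + s <= v ->
    contH f x v (s + s + s).
  move=> hv hv'; apply: ccont_H; last by lraq.
  move=> u hu; apply: holo_ccont; apply: fh; rewrite /insq pt_Re pt_Im.
    by split; lraq.
  by move=> [_ ?]; lraq.
have cV v : x <= v <= x + s + s + s -> v <= x + s \/ x + s + s <= v ->
    contV f v y (s + s + s).
  move=> hv hv'; apply: ccont_V; last by lraq.
  move=> u hu; apply: holo_ccont; apply: fh; rewrite /insq pt_Re pt_Im.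
    by split; lraq.
  by move=> [? _]; lraq.
have cH2 v : y <= v <= y + s + s + s -> v <= y + s \/ y + s + s <= v ->
    contH f x v (s + s).
  move=> hv hv'; apply: ccont_H; last by lraq.
  move=> u hu; apply: holo_ccont; apply: fh; rewrite /insq pt_Re pt_Im.
    by split; lraq.
  by move=> [_ ?]; lraq.
have cV2 v : x <= v <= x + s + s + s -> v <= x + s \/ x + s + s <= v ->
    contV f v y (s + s).
  move=> hv hv'; apply: ccont_V; last by lraq.
  move=> u hu; apply: holo_ccont; apply: fh; rewrite /insq pt_Re pt_Im.
    by split; lraq.
  by move=> [? _]; lraq.
have G x' y' : x <= x' -> x' + s <= x + s + s + s -> y <= y' ->
    y' + s <= y + s + s + s ->
    [\/ x' + s <= x + s, x + s + s <= x', y' + s <= y + s | y + s + s <= y'] ->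
    sqI f x' y' s = 0.
  move=> h1 h2 h3 h4 h5; apply: goursat => // w [w1 w2]; apply: fh; first by split; lraq.
  by case: h5; lraq.
have ss0 : 0 <= s + s by lraq.
have s0' := ltW s0.
have g1 := G x y ltac:(lraq) ltac:(lraq) ltac:(lraq) ltac:(lraq) ltac:(constructor 1; lraq).
have g2 := G (x + s) y ltac:(lraq) ltac:(lraq) ltac:(lraq) ltac:(lraq) ltac:(constructor 3; lraq).
have g3 := G (x + s + s) y ltac:(lraq) ltac:(lraq) ltac:(lraq) ltac:(lraq) ltac:(constructor 2; lraq).
have g4 := G x (y + s) ltac:(lraq) ltac:(lraq) ltac:(lraq) ltac:(lraq) ltac:(constructor 1; lraq).
have g6 := G (x + s + s) (y + s) ltac:(lraq) ltac:(lraq) ltac:(lraq) ltac:(lraq) ltac:(constructor 2; lraq).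
have g7 := G x (y + s + s) ltac:(lraq) ltac:(lraq) ltac:(lraq) ltac:(lraq) ltac:(constructor 1; lraq).
have g8 := G (x + s) (y + s + s) ltac:(lraq) ltac:(lraq) ltac:(lraq) ltac:(lraq) ltac:(constructor 4; lraq).
have g9 := G (x + s + s) (y + s + s) ltac:(lraq) ltac:(lraq) ltac:(lraq) ltac:(lraq) ltac:(constructor 2; lraq).
move: g1 g2 g3 g4 g6 g7 g8 g9; rewrite /sqI !addrA => g1 g2 g3 g4 g6 g7 g8 g9.
rewrite (hI_split ss0 s0' (cH y ltac:(lraq) ltac:(lraq))).
rewrite (hI_split s0' s0' (cH2 y ltac:(lraq) ltac:(lraq))).
rewrite (hI_split ss0 s0' (cH (y + s + s + s) ltac:(lraq) ltac:(lraq))).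
rewrite (hI_split s0' s0' (cH2 (y + s + s + s) ltac:(lraq) ltac:(lraq))).
rewrite (vI_split ss0 s0' (cV x ltac:(lraq) ltac:(lraq))).
rewrite (vI_split s0' s0' (cV2 x ltac:(lraq) ltac:(lraq))).
rewrite (vI_split ss0 s0' (cV (x + s + s + s) ltac:(lraq) ltac:(lraq))).
rewrite (vI_split s0' s0' (cV2 (x + s + s + s) ltac:(lraq) ltac:(lraq))).
rewrite !addrA.
(* When the eight vanishing integrals are added to the central one, all interior sides cancel. *)
set S5 := (X in _ = X); set S := (X in X = _).
rewrite -[RHS]addr0 -[X in _ = _ + X]g1.
rewrite -[RHS]addr0 -[X in _ = _ + X]g2.
rewrite -[RHS]addr0 -[X in _ = _ + X]g3.
rewrite -[RHS]addr0 -[X in _ = _ + X]g4.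
rewrite -[RHS]addr0 -[X in _ = _ + X]g6.
rewrite -[RHS]addr0 -[X in _ = _ + X]g7.
rewrite -[RHS]addr0 -[X in _ = _ + X]g8.
rewrite -[RHS]addr0 -[X in _ = _ + X]g9.
by rewrite /S /S5; ring.
Qed.

Lemma pt_opp (u v : R) : pt (- u) (- v) = - pt u v.
Proof. by rewrite /pt !rCN; ring. Qed.

Lemma pt_eq0 (w : C) : w = 0 -> Re w = 0 /\ Im w = 0.
Proof. by move=> ->. Qed.

(* The integral of dz / z along one side of a centred square: by symmetry 4 * kap
   is the integral along the boundary, and plays the role of 2 pi i. *)
Definition kap : C := int01 (fun t : R => 2 / pt (2 * t - 1) (-1)).

Lemma cderivM f g z a b : cderiv f z a -> cderiv g z b ->
  cderiv (fun w => f w * g w) z (a * g z + f z * b).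
Proof.
move=> fa gb; have [d0 d00 cg] := holo_ccont (ex_intro _ b gb) ltr01.
move=> e e0; have na := nrm_ge0 a; have nf := nrm_ge0 (f z); have ng := nrm_ge0 (g z).
have M0 : 0 < nrm a + nrm (f z) + nrm (g z) + 2 by clear -na nf ng; lra.
pose e' := e / (nrm a + nrm (f z) + nrm (g z) + 2).
have e'0 : 0 < e' by exact: divr_gt0.
have e'M : e' * (nrm a + nrm (f z) + nrm (g z) + 2) = e.
  by rewrite /e' divfK // gt_eqF.
have [d1 d10 h1] := fa e' e'0; have [d2 d20 h2] := gb e' e'0.
have [d3 d30 h3] := holo_ccont (ex_intro _ b gb) e'0.
exists (Num.min (Num.min d0 d3) (Num.min d1 d2)); first by rewrite !lt_min d00 d10 d20 d30.
move=> h; rewrite !lt_min => /andP[/andP[l0 l3] /andP[l1 l2]].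
rewrite (_ : _ - _ = (f (z + h) - f z - h * a) * g (z + h) +
  f z * (g (z + h) - g z - h * b) + h * a * (g (z + h) - g z)); last by ring.
have {}h1 := h1 _ l1; have {}h2 := h2 _ l2; have {}h3 := h3 _ l3.
have gz : nrm (g (z + h)) <= nrm (g z) + 1.
  by have := nrm_sub (g (z + h)) (g z); have := cg _ l0; clear; lra.
apply: le_trans (nrmD _ _) _; rewrite !nrmM.
apply: le_trans (lerD (nrmD _ _) (lexx _)) _; rewrite !nrmM.
have nh := nrm_ge0 h; have gg := nrm_ge0 (g (z + h)).
set F := nrm (f (z + h) - f z - h * a) in h1 *.
set G := nrm (g (z + h) - g z - h * b) in h2 *.
set H := nrm (g (z + h) - g z) in h3 *.
have F0 : 0 <= F := nrm_ge0 _.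
have s1 : F * nrm (g (z + h)) <= e' * nrm h * (nrm (g z) + 1) by apply: ler_pM.
have s2 : nrm (f z) * G <= nrm (f z) * (e' * nrm h) by apply: ler_wpM2l.
have s3 : nrm h * nrm a * H <= nrm h * nrm a * e'.
  by apply: ler_wpM2l; [apply: mulr_ge0|exact: ltW].
have s4 : 0 <= e' * nrm h by apply: mulr_ge0 => //; exact: ltW.
rewrite -e'M (_ : e' * _ * nrm h = e' * nrm h * (nrm (g z) + 1) +
  nrm (f z) * (e' * nrm h) + nrm h * nrm a * e' + e' * nrm h); last by ring.
by clear -s1 s2 s3 s4; lra.
Qed.

Lemma cderiv_id z : cderiv (fun w : C => w) z 1.
Proof.
move=> e e0; exists 1 => // h _.
rewrite (_ : _ - _ = 0) ?nrm0; first by apply: mulr_ge0; [exact: ltW|exact: nrm_ge0].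
by rewrite /=; ring.
Qed.

Lemma cderiv_cst (c : C) z : cderiv (fun=> c) z 0.
Proof.
move=> e e0; exists 1 => // h _.
rewrite (_ : _ - _ = 0) ?nrm0; first by apply: mulr_ge0; [exact: ltW|exact: nrm_ge0].
by rewrite /=; ring.
Qed.

Lemma cderivV (z : C) : z != 0 -> cderiv (fun w => w^-1) z (- z^-2).
Proof.
move=> z0 e e0; have nz : 0 < nrm z by rewrite nrm_gt0.
(* The remainder h^2 / ((z + h) z^2) is at most 2 nrm h ^ 2 / nrm z ^ 3 once nrm h <= nrm z / 2. *)
pose k := nrm z ^+ 3 * e / 2.
have k0 : 0 < k by rewrite /k divr_gt0 // mulr_gt0 // exprn_gt0.
exists (Num.min (nrm z / 2) k).
  by rewrite lt_min k0 divr_gt0.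
move=> h; rewrite lt_min => /andP[l1 l2].
have nzh : nrm z / 2 <= nrm (z + h).
  by have := nrm_sub z (z + h); rewrite opprD addNKr nrmN; clear -l1; lra.
have zh0 : z + h != 0 by rewrite -nrm_gt0; clear -nzh nz; lra.
rewrite (_ : _ - _ = h * h * (z + h)^-1 * z^-2); last by field; rewrite z0 zh0.
rewrite !nrmM !nrmV nrmX.
have p0 : 0 < nrm (z + h) by rewrite nrm_gt0.
have q : nrm h / (nrm (z + h) * nrm z ^+ 2) <= e.
  rewrite ler_pdivrMr ?mulr_gt0 ?exprn_gt0 //.
  have : nrm z / 2 * nrm z ^+ 2 <= nrm (z + h) * nrm z ^+ 2.
    by rewrite ler_wpM2r // exprn_ge0 // ltW.
  move=> /(ler_wpM2l (ltW e0)).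
  have -> : e * (nrm z / 2 * nrm z ^+ 2) = k by rewrite /k; field.
  by apply: le_trans; exact: ltW.
rewrite (_ : _ / _ = nrm h * (nrm h / (nrm (z + h) * nrm z ^+ 2))).
  by rewrite mulrC ler_wpM2r // nrm_ge0.
by field; rewrite !gt_eqF.
Qed.

Lemma cderiv_eq f z d d' : d = d' -> cderiv f z d -> cderiv f z d'.
Proof. by move=> ->. Qed.

Lemma holoM f g z : holo f z -> holo g z -> holo (fun w => f w * g w) z.
Proof. by move=> [a fa] [b gb]; exists (a * g z + f z * b); exact: cderivM. Qed.

Lemma contI_rev (g : R -> C) : contI g -> contI (fun t => g (1 - t)).
Proof.
move=> cg t It e e0.
have It1 : I01 (1 - t) by move: It; rewrite /I01; clear; lra.
have [d d0 dP] := cg (1 - t) It1 e e0.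
exists d => // t' It' l; apply: dP; first by move: It'; rewrite /I01; clear; lra.
by rewrite (_ : 1 - t' - (1 - t) = - (t' - t)) ?normrN //; ring.
Qed.

(** Opposite sides of a centred square correspond under w |-> - w with reversed orientation: they
    cancel for even f (sg = 1) and double for odd f (sg = - 1). *)
Lemma sqI_parity f (sg : C) (r : R) : 0 < r -> (forall w, f (- w) = sg * f w) ->
  contSq f (- r) (- r) (r + r) ->
  sqI f (- r) (- r) (r + r) = (1 - sg) * (hI f (- r) (- r) (r + r) + vI f r (- r) (r + r)).
Proof.
move=> r0 fN [c1 c2 c3 c4].
have e1 : - r + (r + r) = r by ring.
rewrite e1 in c2 c3; rewrite /sqI e1.
have -> : hI f (- r) r (r + r) = sg * hI f (- r) (- r) (r + r).
  rewrite /hI -(int01_rev c1) mulrCA -(int01Z sg); last exact: contI_rev c1.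
  congr (_ * _); apply: int01_ext => t _; rewrite -fN -pt_opp opprK.
  by congr (f (pt _ _)); ring.
have -> : vI f (- r) (- r) (r + r) = sg * vI f r (- r) (r + r).
  rewrite /vI -(int01_rev c2) mulrCA -(int01Z sg); last exact: contI_rev c2.
  congr (_ * _); apply: int01_ext => t _; rewrite -fN -pt_opp.
  by congr (f (pt _ _)); ring.
by ring.
Qed.

Lemma holo_inv (w : C) : w != 0 -> holo (fun w => w^-1) w.
Proof. by move=> w0; exists (- w^-2); exact: cderivV. Qed.

Lemma holo_inv2 (w : C) : w != 0 -> holo (fun w => w^-2) w.
Proof.
move=> w0; rewrite (_ : (fun w : C => w^-2) = (fun w => w^-1 * w^-1)).
  by apply: holoM; exact: holo_inv.
by apply/funext => v; rewrite expr2 invfM.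
Qed.

(** The boundary of the centred square avoids 0 and lies in nrm w <= r + r, which explains the form
    of the hypotheses in the sequel. *)
Lemma contSq0 f (r : R) : 0 < r ->
  (forall w, w != 0 -> nrm w <= r + r -> ccont f w) ->
  contSq f (- r) (- r) (r + r).
Proof.
move=> r0 cf.
have e1 : - r + (r + r) = r by ring.
have h (u v : R) : `|u| <= r -> `|v| = r -> ccont f (pt u v).
  move=> hu hv; apply: cf; last by apply: le_trans (nrm_pt _ _) _; clear -hu hv; lra.
  by apply/eqP => /pt_eq0[_]; rewrite pt_Im => v0; move: hv; rewrite v0 normr0; clear -r0; lra.
have h' (u v : R) : `|u| = r -> `|v| <= r -> ccont f (pt u v).
  move=> hu hv; apply: cf; last by apply: le_trans (nrm_pt _ _) _; clear -hu hv; lra.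
  by apply/eqP => /pt_eq0[+ _]; rewrite pt_Re => v0; move: hu; rewrite v0 normr0; clear -r0; lra.
split; [apply: ccont_H|apply: ccont_V|apply: ccont_H|apply: ccont_V];
  rewrite ?e1; do ?(by clear -r0; lra).
- move=> u hu; apply: h; last by rewrite normrN gtr0_norm.
  by rewrite ler_norml.
- move=> u hu; apply: h'; first by rewrite gtr0_norm.
  by rewrite ler_norml.
- move=> u hu; apply: h; last by rewrite gtr0_norm.
  by rewrite ler_norml.
- move=> u hu; apply: h'; first by rewrite normrN gtr0_norm.
  by rewrite ler_norml.
Qed.

(** The form dz / z is invariant under scaling and under rotation by i, so each of the four sides
    contributes [kap]. *)
Lemma sqI_inv (r : R) : 0 < r -> sqI (fun w => w^-1) (- r) (- r) (r + r) = 4 * kap.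
Proof.
move=> r0; have cS : contSq (fun w => w^-1) (- r) (- r) (r + r).
  by apply: contSq0 => // w w0 _; apply: holo_ccont; exact: holo_inv.
rewrite (@sqI_parity _ (-1)) //; last by move=> w; rewrite invrN mulN1r.
have rC0 : rC r != 0 by rewrite rC_eq0 gt_eqF.
have b : hI (fun w => w^-1) (- r) (- r) (r + r) = kap.
  have [c1 _ _ _] := cS; rewrite /hI -(int01Z _ c1); apply: int01_ext => t _.
  rewrite (_ : pt (- r + (r + r) * t) (- r) = rC r * pt (2 * t - 1) (-1)).
    rewrite invfM mulrA; congr (_ * _); rewrite rCD; field.
    exact: rC0.
  by rewrite /pt !(rCD, rCM, rCN, rC1, rCn); ring.
have i0 : ('i : C) != 0 by rewrite neq0Ci.
have b' : vI (fun w => w^-1) r (- r) (r + r) = kap.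
  rewrite -b /hI /vI; have [_ c2 _ _] := cS; have [c1 _ _ _] := cS.
  rewrite (_ : - r + (r + r) = r) in c2; last by ring.
  rewrite -(int01Z (rC (r + r)) c1) -(int01Z ('i * rC (r + r)) c2).
  apply: int01_ext => t _.
  rewrite (_ : pt r (- r + (r + r) * t) = 'i * pt (- r + (r + r) * t) (- r)).
    by rewrite invfM mulrACA divff // mul1r.
  have i2 : ('i : C) * 'i = -1 by rewrite -expr2 sqrCi.
  by rewrite /pt rCN; ring: i2.
by rewrite b b'; ring.
Qed.

End Cauchy.

(** * Cauchy's formula for the derivative *)

Section CauchyFormula.
Context {R : realType}.
Local Notation C := (Cplx R).
Local Notation Re := (@complex.Re R).
Local Notation Im := (@complex.Im R).
Implicit Types f g : C -> C.

Lemma nrm_sq (z : C) : nrm z ^+ 2 = Re z ^+ 2 + Im z ^+ 2.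
Proof.
apply/eqP; rewrite -subr_eq0 -rC_eq0 rCB; rewrite {1}expr2 rCM -nrmE -expr2.
by rewrite -add_Re2_Im2 subrr.
Qed.

Lemma contI_cst (c : C) : contI (fun=> c).
Proof. by move=> t _ e e0; exists 1 => // t' _ _; rewrite subrr nrm0. Qed.

Lemma int01_cst (c : C) : int01 (fun=> c) = c.
Proof.
rewrite (@int01_ext _ _ (fun t => c + rC t * 0)).
  by rewrite int01_poly1 mul0r addr0.
by move=> t _; rewrite mulr0 addr0.
Qed.

Lemma contI_comp_ccont f (u v a b : R) :
  (forall t, I01 t -> ccont f (pt (u + a * t) (v + b * t))) ->
  contI (fun t => f (pt (u + a * t) (v + b * t))).
Proof.
move=> cf t It e e0; have [d d0 dP] := cf t It e e0.
have na := normr_ge0 a; have nb := normr_ge0 b.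
exists (d / (`|a| + `|b| + 1)); first by rewrite divr_gt0 //; clear -na nb; lra.
move=> t' _; rewrite ltr_pdivlMr; last by clear -na nb; lra.
move=> l; have -> : pt (u + a * t') (v + b * t') =
   pt (u + a * t) (v + b * t) + pt (a * (t' - t)) (b * (t' - t)).
  by rewrite /pt !(rCD, rCM, rCB); ring.
apply: dP; apply: le_lt_trans (nrm_pt _ _) _; rewrite !normrM.
by have := normr_ge0 (t' - t); move: l; clear; lra.
Qed.

(** If [kap] were 0, the integral of 2 / (u - i) - 2 i would have norm 2; but the integrand is - 2 i
    u / (u - i), of norm at most sqrt 2 < 3 / 2 for real u with |u| <= 1. *)
Lemma kap_neq0 : kap != 0 :> C.
Proof.
have pt0 (u : R) : pt u (-1) != 0.
  by apply/eqP => /pt_eq0[_]; rewrite pt_Im => /eqP; rewrite oppr_eq0 oner_eq0.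
have cg : contI (fun t : R => 2 / pt (2 * t - 1) (-1)).
  have := @contI_comp_ccont (fun w => 2 / w) (-1) (-1) 2 0.
  have -> : (fun t : R => 2 / pt (-1 + 2 * t) (-1 + 0 * t)) =
            (fun t : R => 2 / pt (2 * t - 1) (-1)).
    by apply/funext => t; rewrite mul0r addr0 addrC.
  apply => t _; apply: holo_ccont; apply: holoM; first by exists 0; exact: cderiv_cst.
  by apply: holo_inv; rewrite mul0r addr0 pt0.
have i2 : ('i : C) * 'i = -1 by rewrite -expr2 sqrCi.
apply/eqP => k0.
have := int01D cg (contI_cst (- (2 * 'i))); rewrite int01_cst -/kap k0 add0r => E.
have cgi : contI (fun t : R => 2 / pt (2 * t - 1) (-1) + - (2 * 'i)).
  move=> t It e e0; have [d d0 dP] := cg t It e e0; exists d => // t' It' l.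
  by rewrite (_ : _ - _ = 2 / pt (2 * t' - 1) (-1) - 2 / pt (2 * t - 1) (-1));
     [exact: dP|ring].
have := @int01_le _ _ (3 / 2) cgi; rewrite E => H.
have n2 : nrm (2 : C) = 2 by rewrite -(rCn 2) nrm_rC normr_nat.
move: H; rewrite nrmN nrmM nrmi mulr1 n2 => H.
suff : (2 : R) <= 3 / 2 by clear; lra.
apply: H => t /andP[t0 t1].
set u := 2 * t - 1; have u1 : `|u| <= 1 by rewrite ler_norml /u; clear -t0 t1; lra.
have -> : 2 / pt u (-1) + - (2 * 'i) = - (2 * 'i * rC u) / pt u (-1).
  have p0 := pt0 u; rewrite -[X in _ + X](mulfK p0) -mulrDl; congr (_ / _).
  by rewrite /pt rCN rC1; ring: i2.
rewrite nrmM nrmN !nrmM nrmi n2 mulr1 nrm_rC nrmV.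
have p1 : 0 < nrm (pt u (-1)) by rewrite nrm_gt0.
rewrite ler_pdivrMr //.
have := nrm_sq (pt u (-1)); rewrite pt_Re pt_Im sqrrN expr1n.
have -> : u ^+ 2 = `|u| ^+ 2 by rewrite -normrX ger0_norm // sqr_ge0.
set p := nrm _ in p1 *; have := normr_ge0 u; move: u1; set q := `|u|.
move=> q1 q0 pq; clear -q1 q0 pq p1.
suff : 4 * q <= 3 * p by lra.
have l4 : 0 <= 4 * q by lra.
have l3 : 0 <= 3 * p by lra.
rewrite -(ler_pXn2r (n := 2)) // !exprMn pq; nra.
Qed.

Lemma sqI_ext f g x y s : f =1 g -> sqI f x y s = sqI g x y s.
Proof. by move=> /funext ->. Qed.

Lemma sqI_ext0 f g (r : R) : 0 < r ->
  (forall w, nrm w <= r + r -> f w = g w) ->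
  sqI (fun w => f w * w^-2) (- r) (- r) (r + r) = sqI (fun w => g w * w^-2) (- r) (- r) (r + r).
Proof.
move=> r0 fg; have e1 : - r + (r + r) = r by ring.
have h (u v : R) : `|u| <= r -> `|v| <= r -> f (pt u v) = g (pt u v).
  by move=> hu hv; apply: fg; apply: le_trans (nrm_pt _ _) _; exact: lerD.
have rr : `|r| <= r by rewrite gtr0_norm.
have rN : `|- r| <= r by rewrite normrN gtr0_norm.
have tr (t : R) : I01 t -> `|- r + (r + r) * t| <= r.
  by move=> /andP[t0 t1]; rewrite ler_norml; clear -t0 t1 r0; nra.
rewrite /sqI /hI /vI e1.
by do ![congr (_ + _)|congr (- _)|congr (_ * _)]; apply: int01_ext => t It; rewrite h // ?tr.
Qed.

(* Cauchy's formula for the derivative of g at 0. *)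
Definition cau (r : R) g : C := (4 * kap)^-1 * sqI (fun w => g w * w^-2) (- r) (- r) (r + r).
(** In [cau_le] the contour has length 4 (r + r) and the kernel is at most 1 / r ^ 2; this gives 8 /
    r. *)
Definition cauK : R := nrm ((4 * kap)^-1 : C) * 8.

Lemma cauK_ge0 : 0 <= cauK.
Proof. by rewrite /cauK mulr_ge0 // nrm_ge0. Qed.

Lemma ccontM f g w : ccont f w -> ccont g w -> ccont (fun w => f w * g w) w.
Proof.
move=> cf cg e e0.
have nf := nrm_ge0 (f w); have ng := nrm_ge0 (g w).
pose k := e / (nrm (f w) + nrm (g w) + 2).
have k0 : 0 < k by rewrite divr_gt0 //; clear -nf ng; lra.
have kE : k * (nrm (f w) + nrm (g w) + 2) = e.
  by rewrite divfK // gt_eqF //; clear -nf ng; lra.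
have [d0 d00 h0] := cg 1 ltr01; have [d1 d10 h1] := cf k k0; have [d2 d20 h2] := cg k k0.
exists (Num.min d0 (Num.min d1 d2)); first by rewrite !lt_min d00 d10.
move=> h; rewrite !lt_min => /and3P[l0 l1 l2].
have {}h0 := h0 _ l0; have {}h1 := h1 _ l1; have {}h2 := h2 _ l2.
rewrite (_ : _ - _ = (f (w + h) - f w) * (g (w + h) - g w) +
  ((f (w + h) - f w) * g w + f w * (g (w + h) - g w))); last by ring.
apply: le_lt_trans (nrmD _ _) _.
apply: le_lt_trans (lerD (lexx _) (nrmD _ _)) _; rewrite !nrmM.
move: h0 h1 h2 (nrm_ge0 (f (w + h) - f w)) (nrm_ge0 (g (w + h) - g w)).
set F := nrm (f (w + h) - _); set G := nrm (g (w + h) - _) => h0 h1 h2 F0 G0.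
have s1 : F * G <= k * 1 by apply: ler_pM => //; exact: ltW.
have s2 : F * nrm (g w) <= k * nrm (g w) by rewrite ler_wpM2r // ltW.
have s3 : nrm (f w) * G <= nrm (f w) * k by rewrite ler_wpM2l // ltW.
by clear -s1 s2 s3 kE k0; lra.
Qed.

Lemma cau_contSq (r : R) g : 0 < r ->
  (forall w, w != 0 -> nrm w <= r + r -> ccont g w) ->
  contSq (fun w => g w * w^-2) (- r) (- r) (r + r).
Proof.
move=> r0 cg; apply: contSq0 => // w w0 wr; apply: ccontM; first exact: cg.
by apply: holo_ccont; exact: holo_inv2.
Qed.

Lemma cau_le (r M : R) g : 0 < r ->
  (forall w, w != 0 -> nrm w <= r + r -> ccont g w) ->
  (forall w, r <= nrm w -> nrm w <= r + r -> nrm (g w) <= M) ->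
  nrm (cau r g) <= cauK * M / r.
Proof.
move=> r0 cg gM; rewrite /cau nrmM /cauK -!mulrA ler_wpM2l ?nrm_ge0 //.
have -> : 8 * (M / r) = 4 * (r + r) * (M / r ^+ 2) by field; rewrite gt_eqF.
apply: sqI_le; [by clear -r0; lra|exact: cau_contSq|].
move=> u v hu hv huv.
have l1 : r <= nrm (pt u v).
  have [] := ReIm_le (pt u v); rewrite pt_Re pt_Im.
  have hu' : `|u| = r \/ `|v| = r.
    have e1 : - r + (r + r) = r by ring.
    have nr : `|r| = r by rewrite gtr0_norm.
    have nNr : `|- r| = r by rewrite normrN gtr0_norm.
    by case: huv => [->|[->|[->|->]]]; rewrite ?e1 ?nr ?nNr; [left|left|right|right].
  by case: hu' => ->.
have l2 : nrm (pt u v) <= r + r.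
  apply: le_trans (nrm_pt _ _) _.
  have : `|u| <= r by rewrite ler_norml; clear -hu; lra.
  have : `|v| <= r by rewrite ler_norml; clear -hv; lra.
  by clear; lra.
rewrite nrmM nrmV nrmX; have gM' := gM _ l1 l2.
have n0 : 0 < nrm (pt u v) by exact: lt_le_trans l1.
apply: ler_pM => //; [exact: nrm_ge0|by rewrite invr_ge0 exprn_ge0 // ltW|].
by rewrite lef_pV2 ?posrE ?exprn_gt0 // ler_pXn2r // nnegrE ltW.
Qed.

Lemma cauD (r : R) f g : 0 < r ->
  (forall w, w != 0 -> nrm w <= r + r -> ccont f w) ->
  (forall w, w != 0 -> nrm w <= r + r -> ccont g w) ->
  cau r (fun w => f w + g w) = cau r f + cau r g.
Proof.
move=> r0 cf cg; rewrite /cau -mulrDr; congr (_ * _).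
rewrite -(sqID (cau_contSq r0 cf) (cau_contSq r0 cg)).
by apply: sqI_ext => w; exact: mulrDl.
Qed.

Lemma cauZ (r : R) k f : 0 < r ->
  (forall w, w != 0 -> nrm w <= r + r -> ccont f w) ->
  cau r (fun w => k * f w) = k * cau r f.
Proof.
move=> r0 cf; rewrite /cau mulrCA; congr (_ * _).
rewrite -(sqIZ k (cau_contSq r0 cf)).
by apply: sqI_ext => w; rewrite mulrA.
Qed.

(** The side r + r is cut into three; the middle square of [sqI_ninth] is again centred at 0, with
    half side r / 3. *)
Lemma cau_third (r : R) g : 0 < r -> (forall w, w != 0 -> nrm w <= r + r -> holo g w) ->
  cau r g = cau (r / 3) g.
Proof.
move=> r0 hg; rewrite /cau; congr (_ * _).
pose s := (r + r) / 3; have s0 : 0 < s by rewrite /s; clear -r0; lra.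
have e1 : r + r = s + s + s by rewrite /s; field.
rewrite {1}e1 sqI_ninth //; last first.
  rewrite -e1 => w [w1 w2] wN.
  have w0 : w != 0.
    by apply/eqP => w0; apply: wN; rewrite w0 /= /s; clear -r0; lra.
  have wr : nrm w <= r + r.
    apply: le_trans (nrm_le_ReIm _) _.
    have : `|Re w| <= r by rewrite ler_norml; clear -w1; lra.
    have : `|Im w| <= r by rewrite ler_norml; clear -w2; lra.
    by clear; lra.
  by apply: holoM; [exact: hg|exact: holo_inv2].
have -> : - r + s = - (r / 3) by rewrite /s; field.
by have -> : s = r / 3 + r / 3 by rewrite /s; field.
Qed.

Lemma cau_small (r rho : R) g : 0 < r -> 0 < rho ->
  (forall w, w != 0 -> nrm w <= r + r -> holo g w) ->
  exists r', [/\ 0 < r', r' <= rho, r' <= r & cau r g = cau r' g].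
Proof.
move=> r0 rho0 hg.
(* A division by 3 is more than a division by 2, so powers of 2 suffice for [half_pow_small]. *)
have H n : exists r', [/\ 0 < r', r' <= r / 2 ^+ n, r' <= r & cau r g = cau r' g].
  elim: n => [|n [r' [h1 h2 h3 h4]]]; first by exists r; rewrite expr0 divr1.
  exists (r' / 3); split; first by rewrite divr_gt0.
  - rewrite exprS invfM mulrCA mulrC; apply: ler_pM => //; try exact: ltW.
      by rewrite invr_ge0.
    by rewrite lef_pV2 ?posrE // ler_nat.
  - by clear -h1 h3; lra.
  - rewrite h4; apply: cau_third => // w w0 wr; apply: hg => //.
    by apply: le_trans wr _; clear -h3; lra.
have [n hn] := half_pow_small r rho0; have [r' [h1 h2 h3 h4]] := H n.
by exists r'; split => //; apply: le_trans h2 _; exact: ltW.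
Qed.

(** The contour may be taken arbitrarily small. There g is g 0 + d w plus an error at most e' nrm w:
    the constant contributes 0 because w^-2 is even, the linear term d by [sqI_inv], and the error
    at most 2 [cauK] e'. *)
Lemma cauP (r : R) g d : 0 < r -> (forall w, nrm w <= r + r -> holo g w) ->
  cderiv g 0 d -> cau r g = d.
Proof.
move=> r0 hg gd; apply/eqP; rewrite -subr_eq0 -nrm_eq0 eq_le nrm_ge0 andbT.
apply/ler_addgt0Pr => e e0; rewrite add0r.
have K0 := cauK_ge0.
pose e' := e / (cauK * 2 + 1).
have e'0 : 0 < e' by rewrite divr_gt0 //; clear -K0; lra.
have [dl dl0 dP] := gd e' e'0.
have [|r' [r'0 r'd r'r ->]] := @cau_small r (dl / 3) g r0 _ (fun w _ => hg w).
  by clear -dl0; lra.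
have cg w : w != 0 -> nrm w <= r' + r' -> ccont g w.
  by move=> _ wr; apply: holo_ccont; apply: hg; clear -wr r'r; lra.
pose er w := g w - g 0 - w * d.
have cer w : w != 0 -> nrm w <= r' + r' -> ccont er w.
  move=> w0 wr; rewrite /er; apply: ccontB; last first.
    rewrite (_ : (fun w => w * d) = (fun w => 0 + w * d)); first exact: ccont_poly1.
    by apply/funext => v; rewrite add0r.
  by apply: ccontB; [exact: cg|apply: holo_ccont; exists 0; exact: cderiv_cst].
have cid (k : C) w : w != 0 -> nrm w <= r' + r' -> ccont (fun w => w * k) w.
  move=> _ _; rewrite (_ : (fun w => w * k) = (fun w => 0 + w * k)); first exact: ccont_poly1.
  by apply/funext => v; rewrite add0r.
have cid1 w : w != 0 -> nrm w <= r' + r' -> ccont (fun w => w) w.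
  by move=> _ _; apply: holo_ccont; exists 1; exact: cderiv_id.
have ccst (k : C) w : w != 0 -> nrm w <= r' + r' -> ccont (fun=> k) w.
  by move=> _ _; apply: holo_ccont; exists 0; exact: cderiv_cst.
have E : g = (fun w => er w + (g 0 * 1 + d * w)).
  by apply/funext => w; rewrite /er; ring.
have ccst1 w : w != 0 -> nrm w <= r' + r' -> ccont (fun=> g 0 * 1) w by exact: ccst.
have cid2 w : w != 0 -> nrm w <= r' + r' -> ccont (fun w => d * w) w.
  move=> w0 wr; rewrite (_ : (fun w => d * w) = (fun w => w * d)); first exact: cid.
  by apply/funext => v; rewrite mulrC.
have csum w : w != 0 -> nrm w <= r' + r' -> ccont (fun w => g 0 * 1 + d * w) w.
  move=> _ _; rewrite (_ : (fun w => _) = (fun w => g 0 * 1 + w * d)); first exact: ccont_poly1.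
  by apply/funext => v; rewrite [d * v]mulrC.
have k4 : 4 * kap != 0 :> C by rewrite mulf_neq0 ?kap_neq0 ?pnatr_eq0.
have c1 : cau r' (fun w => w) = 1.
  rewrite /cau (_ : sqI _ _ _ _ = 4 * kap) ?mulVf //.
  rewrite -(sqI_inv r'0); apply: sqI_ext => w.
  by have [->|w0] := eqVneq w 0; [rewrite mul0r invr0|field].
have c0 : cau r' (fun=> 1) = 0.
  rewrite /cau (@sqI_parity _ _ 1) //; first by rewrite subrr mul0r mulr0.
    by move=> w; rewrite !mul1r sqrrN.
  exact: cau_contSq r'0 (ccst 1).
have -> : cau r' g = cau r' er + d.
  have E1 : cau r' (fun=> g 0 * 1) = g 0 * cau r' (fun=> 1) := cauZ (g 0) r'0 (ccst 1).
  have E2 : cau r' (fun w => d * w) = d * cau r' (fun w => w) := cauZ d r'0 cid1.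
  by rewrite {1}E (cauD r'0 cer csum) (cauD r'0 ccst1 cid2) E1 E2 c0 c1; ring.
rewrite addrK.
have B : nrm (cau r' er) <= cauK * (e' * (r' + r')) / r'.
  apply: cau_le => // w w1 w2; rewrite /er.
  have := dP w ltac:(clear -w2 r'd dl0; lra); rewrite add0r => h.
  by apply: le_trans h _; rewrite ler_wpM2l // ltW.
apply: le_trans B _.
have -> : cauK * (e' * (r' + r')) / r' = e' * (cauK * 2) by field; rewrite gt_eqF.
have : e' * (cauK * 2 + 1) = e by rewrite /e' divfK // gt_eqF //; clear -K0; lra.
by clear -e'0; lra.
Qed.

End CauchyFormula.

(** * Holomorphic functions of several variables *)

Section Differentials.
Context {R : realType}.
Local Notation C := (Cplx R).
Variables V W : normedModType C.
Implicit Types (f : V -> W) (z h : V).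

Lemma littleo_nrm (g : V -> W) :
  (forall e : C, 0 < e -> \forall h \near (0 : V), `|g h| <= e * `|h|) <->
  (forall e : R, 0 < e -> exists2 dl : R, 0 < dl &
     forall h, nrm h < dl -> nrm (g h) <= e * nrm h).
Proof.
split=> H.
  move=> e e0; have /H /nbhs_nrm[dl dl0 dP] : 0 < rC e by rewrite rC_lt.
  exists dl => // h hd; have := dP h; rewrite subr0 => /(_ hd).
  by rewrite !nrmE -rCM rC_le.
move=> e e0; have er : e = rC (complex.Re e).
  by move: e0; case: (e) => a b; rewrite ltcE /= => /andP[/eqP -> _].
have /H[dl dl0 dP] : 0 < complex.Re e by rewrite -rC_lt -er.
apply/nbhs_nrm; exists dl => // h; rewrite subr0 => /dP.
by rewrite er !nrmE -rCM rC_le.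
Qed.

Lemma diff_eps f z : differentiable f z ->
  forall e : R, 0 < e -> exists2 dl : R, 0 < dl &
    forall h, nrm h < dl -> nrm (f (z + h) - f z - 'd f z h) <= e * nrm h.
Proof.
move=> df; apply/littleo_nrm => e e0.
have := diff_locally df => /eqaddoP /(_ e e0).
apply: filterS => h /=.
by rewrite -![(_ + _ : _ -> _) _]/(_ + _) -![(- _ : _ -> _) _]/(- _) /cst /= opprD addrA
   [h + z]addrC.
Qed.

Lemma diff_bounded f z : differentiable f z ->
  exists2 K : R, 0 <= K & forall h, nrm ('d f z h) <= K * nrm h.
Proof.
move=> df; have /continuous_nrm : {for (0 : V), continuous ('d f z)}.
  exact: diff_continuous.
move=> /(_ 1 ltr01) [dl dl0 dP].
exists (2 / dl); first by rewrite divr_ge0 // ltW.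
move=> h; have [->|h0] := eqVneq h 0; first by rewrite linear0 !nrm0 mulr0.
have nh : 0 < nrm h by rewrite nrm_gt0.
pose k : R := dl / 2 / nrm h.
have k0 : 0 < k by rewrite !divr_gt0.
have d0 : 'd f z 0 = 0 by exact: linear0.
have dZ : 'd f z (rC k *: h) = rC k *: 'd f z h by exact: linearZ.
have := dP (rC k *: h); rewrite d0 !subr0 dZ !nrmZ nrm_rC gtr0_norm //.
rewrite {1}/k divfK ?gt_eqF // => /(_ ltac:(clear -dl0; lra)) H.
have kE : 2 / dl * nrm h = k^-1 by rewrite /k; field; rewrite !gt_eqF.
by rewrite kE ltW // -[ltRHS]mulr1 ltr_pdivlMl.
Qed.

(** The way back from explicit estimates to [differentiable]: the bound K makes L continuous, and
    [diff_unique] identifies it with the differential. *)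
Lemma diff_intro f z (L : V -> W) (K : R) :
  (forall k u v, L (k *: u + v) = k *: L u + L v) ->
  (forall v, nrm (L v) <= K * nrm v) ->
  (forall e : R, 0 < e -> exists2 dl : R, 0 < dl &
    forall h, nrm h < dl -> nrm (f (z + h) - f z - L h) <= e * nrm h) ->
  differentiable f z /\ forall v, 'd f z v = L v.
Proof.
move=> Llin Lb Lo.
pose l : {linear V -> W} :=
  HB.pack_for {linear V -> W} L (GRing.isLinear.Build C V W *:%R L Llin).
have lc : continuous l.
  move=> v; apply/continuous_nrm => e e0.
  have K0 : 0 <= `|K| by exact: normr_ge0.
  exists (e / (`|K| + 1)); first by rewrite divr_gt0 //; clear -K0; lra.
  move=> w; rewrite ltr_pdivlMr; last by clear -K0; lra.
  move=> H; have <- : L (w - v) = l w - l v by exact: (linearB l).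
  apply: le_lt_trans (Lb (w - v)) _.
  have := nrm_ge0 (w - v); have := ler_norm K => K1 n0.
  have : K * nrm (w - v) <= `|K| * nrm (w - v) by rewrite ler_wpM2r.
  by move: H n0; clear; lra.
have lo : f \o shift z = cst (f z) + l +o_ (0 : V) id.
  apply/eqaddoP; apply/littleo_nrm => e e0; have [dl dl0 dP] := Lo e e0.
  exists dl => // h /dP.
  by rewrite -![(_ + _ : _ -> _) _]/(_ + _) -![(- _ : _ -> _) _]/(- _) /cst /= opprD addrA
     [h + z]addrC.
have dE := diff_unique lc lo.
split; last by move=> v; rewrite dE.
by apply/diff_locallyP; rewrite dE.
Qed.

End Differentials.

Section DiffLinear.
Context {R : realType} {V W : normedModType (Cplx R)}.
Variables (f : V -> W) (z : V).
Lemma diffZv k v : 'd f z (k *: v) = k *: 'd f z v. Proof. exact: linearZ. Qed.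
Lemma diffDv u v : 'd f z (u + v) = 'd f z u + 'd f z v. Proof. exact: linearD. Qed.
Lemma diff0v : 'd f z 0 = 0. Proof. exact: linear0. Qed.
End DiffLinear.

(** * Complex derivatives in one variable *)

Section OneVariable.
Context {R : realType}.
Local Notation C := (Cplx R).
Implicit Types f g : C -> C.

Lemma cderiv_uniq f z d d' : cderiv f z d -> cderiv f z d' -> d = d'.
Proof.
move=> h1 h2; apply/eqP; rewrite -subr_eq0 -nrm_eq0 eq_le nrm_ge0 andbT.
apply/ler_addgt0Pr => e e0; rewrite add0r.
have [d1 d10 H1] := h1 (e / 2) ltac:(lra); have [d2 d20 H2] := h2 (e / 2) ltac:(lra).
pose t := Num.min d1 d2 / 2.
have m0 : 0 < Num.min d1 d2 by rewrite lt_min d10.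
have t0 : 0 < t by rewrite /t divr_gt0.
have tm : t < Num.min d1 d2 by rewrite /t; clear -m0; lra.
move: tm; rewrite lt_min => /andP[t1 t2].
have nt : nrm (rC t : C) = t by rewrite nrm_rC gtr0_norm.
have {}H1 := H1 (rC t); have {}H2 := H2 (rC t); rewrite nt in H1 H2.
have {}H1 := H1 t1; have {}H2 := H2 t2.
have : t * nrm (d - d') <= e * t.
  rewrite -{1}nt -nrmM (_ : rC t * (d - d') = (f (z + rC t) - f z - rC t * d') -
    (f (z + rC t) - f z - rC t * d)); last by ring.
  by apply: le_trans (nrmB _ _) _; clear -H1 H2; lra.
by rewrite mulrC ler_pM2r.
Qed.

Lemma cderiv_near f g z d (e : R) : 0 < e ->
  (forall h, nrm h < e -> f (z + h) = g (z + h)) -> cderiv f z d -> cderiv g z d.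
Proof.
move=> e0 fg fd k k0; have [dl dl0 dP] := fd k k0.
exists (Num.min e dl); first by rewrite lt_min e0.
move=> h; rewrite lt_min => /andP[h1 h2].
rewrite -fg // -[X in g X]addr0 -fg ?addr0 ?nrm0 //; exact: dP.
Qed.

Lemma cderiv_ext f g z d : f =1 g -> cderiv f z d -> cderiv g z d.
Proof. by move=> /funext ->. Qed.

Lemma cderiv_comp f g z a b : cderiv f z a -> cderiv g (f z) b ->
  cderiv (fun w => g (f w)) z (a * b).
Proof.
move=> fa gb e e0; have na := nrm_ge0 a; have nb := nrm_ge0 b.
pose k := e / (nrm a + nrm b + 2).
have k0 : 0 < k by rewrite divr_gt0 //; clear -na nb; lra.
have kE : k * (nrm a + nrm b + 2) = e by rewrite divfK // gt_eqF //; clear -na nb; lra.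
pose k1 := Num.min 1 k; have k10 : 0 < k1 by rewrite lt_min ltr01.
have k1k : k1 <= k by rewrite ge_min lexx orbT.
have k11 : k1 <= 1 by rewrite ge_min lexx.
have [d1 d10 H1] := fa k1 k10; have [d2 d20 H2] := gb k k0.
exists (Num.min d1 (d2 / (nrm a + 2))).
  by rewrite lt_min d10 divr_gt0 //; clear -na; lra.
move=> h; rewrite lt_min ltr_pdivlMr; last by clear -na; lra.
move=> /andP[l1 l2]; have {}H1 := H1 h l1; have nh := nrm_ge0 h.
have B : nrm (f (z + h) - f z) <= (nrm a + 1) * nrm h.
  have := nrm_sub (f (z + h) - f z) (h * a); rewrite nrmM.
  have : k1 * nrm h <= 1 * nrm h by rewrite ler_wpM2r.
  by clear -H1; lra.
have := H2 (f (z + h) - f z) ltac:(clear -B l2 nh d20; nra).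
rewrite (addrC (f z)) subrK => {}H2.
rewrite (_ : _ - h * (a * b) = (g (f (z + h)) - g (f z) - (f (z + h) - f z) * b) +
  (f (z + h) - f z - h * a) * b); last by ring.
apply: le_trans (nrmD _ _) _; rewrite nrmM.
have s1 : k * nrm (f (z + h) - f z) <= k * ((nrm a + 1) * nrm h) by rewrite ler_wpM2l // ltW.
have s2 : nrm (f (z + h) - f z - h * a) * nrm b <= k * nrm h * nrm b.
  by rewrite ler_wpM2r //; apply: le_trans H1 _; rewrite ler_wpM2r.
have s3 : 0 <= k * nrm h by rewrite mulr_ge0 // ltW.
rewrite -kE (_ : k * _ * nrm h = k * ((nrm a + 1) * nrm h) + k * nrm h * nrm b + k * nrm h); last by ring.
by clear -s1 s2 s3 H2; lra.
Qed.

Lemma cderivD f g z a b : cderiv f z a -> cderiv g z b -> cderiv (fun w => f w + g w) z (a + b).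
Proof.
move=> fa gb e e0; have [d1 d10 H1] := fa (e / 2) ltac:(lra).
have [d2 d20 H2] := gb (e / 2) ltac:(lra).
exists (Num.min d1 d2); first by rewrite lt_min d10.
move=> h; rewrite lt_min => /andP[l1 l2].
rewrite (_ : _ - _ = (f (z + h) - f z - h * a) + (g (z + h) - g z - h * b)); last by ring.
apply: le_trans (nrmD _ _) _.
by have := H1 _ l1; have := H2 _ l2; have := nrm_ge0 h; clear; lra.
Qed.

Lemma cderivZ k f z a : cderiv f z a -> cderiv (fun w => k * f w) z (k * a).
Proof. by move=> /(cderivM (cderiv_cst k z)); rewrite mul0r add0r. Qed.

Lemma cderivN f z a : cderiv f z a -> cderiv (fun w => - f w) z (- a).
Proof.
move=> /(cderivZ (-1)); rewrite mulN1r; apply: cderiv_ext => w.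
by rewrite mulN1r.
Qed.

Lemma cderivB f g z a b : cderiv f z a -> cderiv g z b -> cderiv (fun w => f w - g w) z (a - b).
Proof. by move=> fa /cderivN gb; exact: cderivD. Qed.

Lemma cderiv_shift f z0 z d :
  cderiv (fun w => f (z0 + w)) z d <-> cderiv f (z0 + z) d.
Proof.
by split=> H e e0; have [dl dl0 dP] := H e e0; exists dl => // h hd;
   have := dP h hd; rewrite addrA.
Qed.

Lemma cderiv_affine (a b z : C) : cderiv (fun w => a + w * b) z b.
Proof.
move=> e e0; exists 1 => // h _; rewrite (_ : _ - _ = 0); last by ring.
by rewrite nrm0 mulr_ge0 ?nrm_ge0 // ltW.
Qed.

Lemma differentiable_cderiv f z : differentiable f z -> cderiv f z ('d f z 1).
Proof.
move=> df e e0; have [dl dl0 dP] := diff_eps df e0; exists dl => // h hd.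
have := diffZv f z h 1; rewrite [h *: 1]mulr1 => E; have := dP h hd; rewrite E.
exact.
Qed.

Lemma cderiv_differentiable f z d : cderiv f z d ->
  differentiable f z /\ forall h, 'd f z h = h * d.
Proof.
move=> fd; apply: (@diff_intro _ C C f z (fun h => h * d) (nrm d)).
- by move=> k u v; rewrite mulrDl -mulrA.
- by move=> v; rewrite nrmM mulrC.
- exact: fd.
Qed.

End OneVariable.

(** * Cauchy estimates along complex lines *)

Section SeveralVariables.
Context {R : realType}.
Local Notation C := (Cplx R).

(** Derivatives along complex lines only (Gateaux). The Cauchy estimates below control the Taylor
    remainder uniformly in the direction, which gives differentiability once the derivative is known
    to be linear in v. *)
Definition gder (V : normedModType C) (phi : V -> C) (z v : V) (d : C) := cderiv (fun s : C => phi (z + s *: v)) 0 d.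
Definition ghol (V : normedModType C) (phi : V -> C) (z : V) := forall v, exists d, gder phi z v d.
Definition gd (V : normedModType C) (phi : V -> C) (z v : V) : C := xget 0 (gder phi z v).

Lemma gd_uniq (V : normedModType C) (phi : V -> C) (z : V) (v : V) d : gder phi z v d -> gd phi z v = d.
Proof.
move=> hd; rewrite /gd; case: xgetP => [x _ hx|/(_ d)//].
exact: cderiv_uniq hx hd.
Qed.

Lemma gdP (V : normedModType C) (phi : V -> C) (z : V) (v : V) : ghol phi z -> gder phi z v (gd phi z v).
Proof. by move=> /(_ v)[d hd]; rewrite (gd_uniq hd). Qed.

Lemma gder_line (V : normedModType C) (phi : V -> C) (z : V) (v : V) (s : C) d : gder phi (z + s *: v) v d ->
  cderiv (fun s => phi (z + s *: v)) s d.
Proof.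
move=> H; rewrite -[s]addr0; apply/cderiv_shift; move: H; apply: cderiv_ext => w.
by rewrite -addrA -scalerDl.
Qed.

Lemma gderZ (V : normedModType C) (phi : V -> C) (z : V) (v : V) d (k : C) : gder phi z v d -> gder phi z (k *: v) (k * d).
Proof.
move=> H; rewrite /gder.
have := @cderiv_comp _ (fun s => 0 + s * k) (fun s => phi (z + s *: v)) 0 k d
  (cderiv_affine 0 k 0).
rewrite mul0r addr0 => /(_ H); apply: cderiv_ext => s.
by rewrite add0r scalerA.
Qed.

Lemma differentiable_gder (V : normedModType C) (phi : V -> C) (z : V) (v : V) : differentiable phi z -> gder phi z v ('d phi z v).
Proof.
move=> df; have nv := nrm_ge0 v; move=> e e0.
have [|dl dl0 dP] := diff_eps df (e := e / (nrm v + 1)).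
  by rewrite divr_gt0 //; clear -nv; lra.
exists (dl / (nrm v + 1)); first by rewrite divr_gt0 //; clear -nv; lra.
move=> s; rewrite ltr_pdivlMr; last by clear -nv; lra.
move=> l; rewrite add0r scale0r addr0; have ns := nrm_ge0 s.
have := dP (s *: v); rewrite nrmZ => /(_ ltac:(clear -l nv ns; nra)).
rewrite diffZv.
move=> H; apply: le_trans H _.
have : e / (nrm v + 1) * (nrm v + 1) = e by rewrite divfK // gt_eqF //; clear -nv; lra.
set q := e / _ => qE; have q0 : 0 <= q by rewrite /q divr_ge0 //; [exact: ltW|clear -nv; lra].
rewrite -qE; have : 0 <= q * nrm s by exact: mulr_ge0.
by clear; lra.
Qed.

Lemma differentiable_ghol (V : normedModType C) (phi : V -> C) (z : V) : differentiable phi z -> ghol phi z.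
Proof. by move=> df v; exists ('d phi z v); exact: differentiable_gder. Qed.

Lemma gd_diff (V : normedModType C) (phi : V -> C) (z : V) (v : V) : differentiable phi z -> gd phi z v = 'd phi z v.
Proof. by move=> df; apply: gd_uniq; exact: differentiable_gder. Qed.

Lemma pder_segment (V : normedModType C) (phi : V -> C) (z : V) (v : V) (g : R -> C) :
  (forall t, I01 t -> gder phi (z + rC t *: v) v (g t)) ->
  has_pder (fun t => phi (z + rC t *: v)) g.
Proof.
move=> H t It e e0; have [dl dl0 dP] := gder_line (H t It) e0.
exists dl => // t' It' l; have := dP (rC (t' - t)).
rewrite nrm_rC => /(_ l); rewrite (_ : rC t + rC (t' - t) = rC t') //.
by rewrite -rCD addrC subrK.
Qed.

Lemma gd0 (V : normedModType C) (phi : V -> C) (z : V) : gd phi z 0 = 0.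
Proof.
apply: gd_uniq; rewrite /gder.
by apply: cderiv_ext (cderiv_cst (phi z) 0) => s; rewrite scaler0 addr0.
Qed.

Lemma gd_cau (V : normedModType C) (phi : V -> C) (z : V) (v : V) (rho : R) : 0 < rho ->
  (forall w : C, nrm w <= rho + rho -> ghol phi (z + w *: v)) ->
  gd phi z v = cau rho (fun w => phi (z + w *: v)).
Proof.
move=> rho0 H; apply/esym; apply: cauP => //.
  by move=> w wr; have [d hd] := H w wr v; exists d; exact: gder_line.
apply: gdP; have := H 0; rewrite scale0r addr0; apply.
by rewrite nrm0 addr_ge0 // ltW.
Qed.

(* The margin 4 r leaves room for two successive Cauchy estimates at the points at
   distance less than r from z0. *)
Definition hball (V : normedModType C) (phi : V -> C) (z0 : V) (r M : R) :=
  0 < r /\ forall z, nrm (z - z0) < 4 * r -> ghol phi z /\ nrm (phi z) <= M.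

(** The factor 2 comes from the radius r / (2 nrm v) in [gd_le]. *)
Definition cK1 : R := cauK (R := R) * 2.

Lemma cK1_ge0 : 0 <= cK1.
Proof. by rewrite mulr_ge0 // cauK_ge0. Qed.

Lemma hball_ge0 (V : normedModType C) (phi : V -> C) (z0 : V) (r M : R) :
  hball phi z0 r M -> 0 <= M.
Proof.
move=> [r0 hphi].
have [|_ h] := @hphi z0; first by rewrite subrr nrm0 mulr_gt0.
exact: le_trans (nrm_ge0 _) h.
Qed.

Lemma near_line (V : normedModType C) (z0 z v : V) (s : R) (w : C) (rho : R) : nrm (z - z0) < s -> nrm w <= rho ->
  nrm (z + w *: v - z0) < s + rho * nrm v.
Proof.
move=> h1 h2; rewrite addrAC; apply: le_lt_trans (nrmD _ _) _; rewrite nrmZ.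
have : nrm w * nrm v <= rho * nrm v by rewrite ler_wpM2r // nrm_ge0.
by move: h1; clear; lra.
Qed.

Lemma gd_le (V : normedModType C) (phi : V -> C) (z0 : V) (r M : R) (z v : V) :
  hball phi z0 r M -> nrm (z - z0) < 2 * r -> nrm (gd phi z v) <= cK1 * M * nrm v / r.
Proof.
move=> hb; have [r0 hphi] := hb; have M_ge0 := hball_ge0 hb.
move=> zr; have [->|v0] := eqVneq v 0.
  by rewrite gd0 !nrm0 mulr0 mul0r.
have nv : 0 < nrm v by rewrite nrm_gt0.
(* The points z + w v with nrm w <= 2 rho are within r of z, hence within 3 r < 4 r of z0. *)
pose rho := r / (2 * nrm v); have rho0 : 0 < rho by rewrite divr_gt0 // mulr_gt0.
have rhoE : (rho + rho) * nrm v = r by rewrite /rho; field; rewrite gt_eqF.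
have inside (w : C) : nrm w <= rho + rho -> nrm (z + w *: v - z0) < 4 * r.
  move=> /(near_line v zr); rewrite rhoE => h; apply: lt_trans h _.
  by clear -r0; lra.
rewrite (gd_cau (rho := rho)) //; last by move=> w /inside /hphi[].
apply: le_trans (@cau_le _ rho M _ rho0 _ _) _.
- by move=> w _ /inside /hphi[/(_ v)[d hd] _]; apply: holo_ccont; exists d; exact: gder_line.
- by move=> w _ /inside /hphi[].
- rewrite le_eqVlt /cK1 /rho; apply/orP; left; apply/eqP; field.
  by rewrite !gt_eqF.
Qed.

Lemma conv_lt (t a b s : R) : 0 <= t -> t <= 1 -> a < s -> b < s -> (1 - t) * a + t * b < s.
Proof.
move=> t0 t1 sa sb; apply: le_lt_trans (_ : Num.max a b < s); last by rewrite gt_max sa.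
have am : a <= Num.max a b by rewrite le_max lexx.
have bm : b <= Num.max a b by rewrite le_max lexx orbT.
by move: am bm t0 t1; set m := Num.max a b; clear; nra.
Qed.

(** The derivative estimate [gd_le] is integrated along the segment from z to z'. *)
Lemma gd_lip (V : normedModType C) (phi : V -> C) (z0 : V) (r M : R) (z z' : V) :
  hball phi z0 r M -> nrm (z - z0) < 2 * r -> nrm (z' - z0) < 2 * r ->
  nrm (phi z' - phi z) <= cK1 * M * nrm (z' - z) / r.
Proof.
move=> hb; have [r0 hphi] := hb; have M_ge0 := hball_ge0 hb.
move=> zr zr'.
have inside t : I01 t -> nrm (z + rC t *: (z' - z) - z0) < 2 * r.
  move=> /andP[t0 t1].
  rewrite (_ : _ - z0 = rC (1 - t) *: (z - z0) + rC t *: (z' - z0)).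
    apply: le_lt_trans (nrmD _ _) _; rewrite !nrmZ !nrm_rC (ger0_norm t0).
    rewrite ger0_norm; last by clear -t1; lra.
    exact: conv_lt.
  have -> : z' - z = (z' - z0) - (z - z0) by rewrite opprB addrA subrK.
  by rewrite addrAC rCB rC1 scalerBl scale1r scalerBr addrA addrAC.
have P : has_pder (fun t => phi (z + rC t *: (z' - z)))
    (fun t => gd phi (z + rC t *: (z' - z)) (z' - z)).
  apply: pder_segment => t It; apply: gdP.
  have [|//] := hphi (z + rC t *: (z' - z)).
  by apply: lt_trans (inside t It) _; clear -r0; lra.
have := pder_le P (M := cK1 * M * nrm (z' - z) / r).
rewrite rC1 rC0 scale1r scale0r addr0 [z + _]addrC subrK; apply.
by move=> t It; apply: (gd_le _ hb); exact: inside.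
Qed.

Definition cK2 : R := cK1 * cK1.

(** Cauchy's formula is applied to the difference of the restrictions of phi to two parallel lines,
    which [gd_lip] bounds; [cK2] is the product of the two successive constants. *)
Lemma gd_lip2 (V : normedModType C) (phi : V -> C) (z0 : V) (r M : R) (z z' v : V) :
  hball phi z0 r M -> nrm (z - z0) < r -> nrm (z' - z0) < r ->
  nrm (gd phi z' v - gd phi z v) <= cK2 * M * nrm v * nrm (z' - z) / r ^+ 2.
Proof.
move=> hb; have [r0 hphi] := hb; have M_ge0 := hball_ge0 hb.
move=> zr zr'; have [->|v0] := eqVneq v 0.
  by rewrite !gd0 subrr !nrm0 mulr0 !mul0r.
have nv : 0 < nrm v by rewrite nrm_gt0.
pose rho := r / (2 * nrm v); have rho0 : 0 < rho by rewrite divr_gt0 // mulr_gt0.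
have rhoE : (rho + rho) * nrm v = r by rewrite /rho; field; rewrite gt_eqF.
have inside x (w : C) : nrm (x - z0) < r -> nrm w <= rho + rho ->
    nrm (x + w *: v - z0) < 2 * r.
  move=> xr /(near_line v xr); rewrite rhoE => h; apply: lt_le_trans h _.
  by clear; lra.
have inside4 x (w : C) : nrm (x - z0) < r -> nrm w <= rho + rho ->
    nrm (x + w *: v - z0) < 4 * r.
  by move=> xr wr; apply: lt_trans (inside x w xr wr) _; clear -r0; lra.
have cc x : nrm (x - z0) < r -> forall w, w != 0 -> nrm w <= rho + rho ->
    ccont (fun w => phi (x + w *: v)) w.
  move=> xr w _ wr; have [/(_ v)[d hd] _] := hphi _ (inside4 x w xr wr).
  by apply: holo_ccont; exists d; exact: gder_line.
rewrite (gd_cau (rho := rho)) //; last by move=> w wr; case: (hphi _ (inside4 _ w zr' wr)).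
rewrite (gd_cau (rho := rho)) //; last by move=> w wr; case: (hphi _ (inside4 _ w zr wr)).
have E : cau rho (fun w => phi (z' + w *: v)) =
    cau rho (fun w => (phi (z' + w *: v) - phi (z + w *: v))) +
    cau rho (fun w => phi (z + w *: v)).
  rewrite -cauD //; last 2 first.
  - by move=> w w0 wr; apply: ccontB; exact: cc.
  - exact: cc.
  by congr cau; apply/funext => w; rewrite subrK.
rewrite E addrK.
apply: le_trans (@cau_le _ rho (cK1 * M * nrm (z' - z) / r) _ rho0 _ _) _.
- by move=> w w0 wr; apply: ccontB; exact: cc.
- move=> w _ wr; have := gd_lip hb (inside z w zr wr) (inside z' w zr' wr).
  by rewrite opprD addrACA subrr addr0.
- rewrite le_eqVlt /cK2 /cK1 /rho; apply/orP; left; apply/eqP; field.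
  by rewrite !gt_eqF.
Qed.

(** Along the segment, the derivative of the remainder is a difference of two values of [gd],
    bounded by [gd_lip2]. *)
Lemma gd_taylor (V : normedModType C) (phi : V -> C) (z0 : V) (r M : R) (z h : V) :
  hball phi z0 r M -> nrm (z - z0) < r -> nrm (z + h - z0) < r ->
  nrm (phi (z + h) - phi z - gd phi z h) <= cK2 * M * nrm h ^+ 2 / r ^+ 2.
Proof.
move=> hb; have [r0 hphi] := hb; have M_ge0 := hball_ge0 hb.
move=> zr zr'.
have inside t : I01 t -> nrm (z + rC t *: h - z0) < r.
  move=> /andP[t0 t1].
  rewrite (_ : _ - z0 = rC (1 - t) *: (z - z0) + rC t *: (z + h - z0)).
    apply: le_lt_trans (nrmD _ _) _; rewrite !nrmZ !nrm_rC (ger0_norm t0).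
    rewrite ger0_norm; last by clear -t1; lra.
    exact: conv_lt.
  by rewrite [z + h - z0]addrAC [rC t *: (_ + h)]scalerDr addrA -scalerDl -rCD subrK rC1 scale1r addrAC.
have P : has_pder (fun t => phi (z + rC t *: h)) (fun t => gd phi (z + rC t *: h) h).
  apply: pder_segment => t It; apply: gdP.
  have [|//] := hphi (z + rC t *: h).
  by apply: lt_trans (inside t It) _; clear -r0; lra.
have P2 : has_pder (fun t => rC t * gd phi z h) (fun=> gd phi z h).
  move=> t _ e e0; exists 1 => // t' _ _; rewrite -mulrBl -rCB subrr nrm0.
  by rewrite mulr_ge0 // ltW.
have := pder_le (pderB P P2) (M := cK2 * M * nrm h ^+ 2 / r ^+ 2).
rewrite rC1 rC0 !mul1r mul0r scale1r scale0r addr0 subr0 addrAC; apply.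
move=> t It; have [t0 t1] := andP It.
apply: le_trans (gd_lip2 h hb zr (inside t It)) _.
rewrite [z + _]addrC addrK nrmZ nrm_rC ger0_norm //.
apply: ler_wpM2r; first by rewrite invr_ge0 exprn_ge0 // ltW.
have p0 : 0 <= cK2 * M * nrm h by rewrite !mulr_ge0 ?nrm_ge0 ?cK1_ge0.
rewrite (_ : cK2 * M * nrm h ^+ 2 = cK2 * M * nrm h * nrm h); last by ring.
by apply: ler_wpM2l => //; rewrite ler_piMl ?nrm_ge0.
Qed.

End SeveralVariables.

(** * Holomorphy of the differential *)

Section Holomorphic.
Context {R : realType}.
Local Notation C := (Cplx R).

Lemma small_quad (K e : R) : 0 <= K -> 0 < e ->
  exists2 dl : R, 0 < dl & forall x : R, 0 <= x -> x < dl -> K * x ^+ 2 <= e * x.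
Proof.
move=> K0 e0; exists (e / (K + 1)); first by rewrite divr_gt0 //; clear -K0; lra.
move=> x x0; rewrite ltr_pdivlMr; last by clear -K0; lra.
move=> xl; rewrite expr2 mulrA ler_wpM2r //.
by clear -x0 xl K0; nra.
Qed.

Lemma hball_exists (V : normedModType C) (phi : V -> C) (z0 : V) (e : R) : 0 < e ->
  (forall z, nrm (z - z0) < e -> ghol phi z) ->
  {for z0, continuous phi} -> exists r M, r <= e /\ hball phi z0 r M.
Proof.
move=> e0 hg /continuous_nrm /(_ 1 ltr01) [dl dl0 dP].
exists (Num.min e dl / 4), (nrm (phi z0) + 1).
have m0 : 0 < Num.min e dl by rewrite lt_min e0.
have m1 : Num.min e dl <= e by rewrite ge_min lexx.
split; first by clear -m1 m0; lra.
split; first by rewrite divr_gt0.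
move=> z; rewrite (_ : 4 * (Num.min e dl / 4) = Num.min e dl); last by field.
rewrite lt_min => /andP[h1 h2].
split; first exact: hg.
have := nrm_sub (phi z) (phi z0); have := dP z h2.
by clear; lra.
Qed.

(** The derivative in direction v is a Cauchy integral over a contour in the line z + s v, and is
    differentiated under the integral sign: the Taylor remainder of phi is quadratic in h, uniformly
    on the contour. *)
Lemma diff_holomorphic (V : normedModType C) (phi : V -> C) (z0 v : V) :
  (exists2 e : R, 0 < e & forall z, nrm (z - z0) < e -> differentiable phi z) ->
  differentiable (fun z => 'd phi z v : C) z0.
Proof.
move=> [e e0 df].
have cz0 : {for z0, continuous phi}.
  by apply: differentiable_continuous; apply: df; rewrite subrr nrm0.
have [r [M [re hb]]] := hball_exists e0 (fun z h => differentiable_ghol (df z h)) cz0.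
have [r0 hphi] := hb; have M0 := hball_ge0 hb.
have dfr z : nrm (z - z0) < r -> differentiable phi z.
  by move=> zr; apply: df; exact: lt_le_trans re.
have nv := nrm_ge0 v.
(* The + 1 covers v = 0; the radius keeps s v within r / 2, leaving r / 2 for the increment of
   z0. *)
pose rho := r / (4 * (nrm v + 1)).
have rho0 : 0 < rho by rewrite divr_gt0 // mulr_gt0 //; clear -nv; lra.
have rhov : (rho + rho) * nrm v <= r / 2.
  have : rho * (4 * (nrm v + 1)) = r by rewrite divfK // gt_eqF // mulr_gt0 //; clear -nv; lra.
  by clear -rho0; lra.
have near (s : C) : nrm s <= rho + rho -> nrm (s *: v) <= r / 2.
  by move=> sr; rewrite nrmZ; apply: le_trans rhov; rewrite ler_wpM2r.
have in1 (w : V) (s : C) : nrm w < r / 2 -> nrm s <= rho + rho ->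
    nrm (z0 + w + s *: v - z0) < r.
  move=> wr /near sr; rewrite addrAC [z0 + w]addrC addrK.
  by apply: le_lt_trans (nrmD _ _) _; clear -wr sr; lra.
have in0 (s : C) : nrm s <= rho + rho -> nrm (z0 + s *: v - z0) < r.
  by move=> sr; have := in1 0 s; rewrite addr0 nrm0; apply => //; rewrite divr_gt0.
have r2 : r < 2 * r by clear -r0; lra.
have r4 : r < 4 * r by clear -r0; lra.
pose D (w : V) (s : C) := gd phi (z0 + s *: v) w.
have cD w : forall s, s != 0 -> nrm s <= rho + rho -> ccont (D w) s.
  move=> s _ sr d d0.
  pose B := cK2 * M * nrm w / r ^+ 2 * nrm v.
  have B0 : 0 <= B.
    by rewrite !mulr_ge0 ?nrm_ge0 ?cK1_ge0 ?invr_ge0 ?exprn_ge0 // ltW.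
  exists (Num.min (r / 2 / (nrm v + 1)) (d / (B + 1))).
    by rewrite lt_min !divr_gt0 //; clear -nv B0; lra.
  move=> h; rewrite lt_min => /andP[h1 h2]; have nh := nrm_ge0 h.
  have v10 : 0 < nrm v + 1 by clear -nv; lra.
  have B10 : 0 < B + 1 by clear -B0; lra.
  rewrite ltr_pdivlMr // in h1; rewrite ltr_pdivlMr // in h2.
  have hv : nrm (h *: v) < r / 2 by rewrite nrmZ; clear -h1 nh nv; nra.
  have := in1 (h *: v) s hv sr.
  have -> : z0 + h *: v + s *: v = z0 + (s + h) *: v by rewrite addrAC scalerDl addrA.
  move=> i1; apply: le_lt_trans (gd_lip2 w hb (in0 s sr) i1) _.
  rewrite opprD addrACA subrr add0r -scalerBl [s + h]addrC addrK nrmZ.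
  rewrite (_ : _ / _ = B * nrm h); last by rewrite /B; ring.
  by clear -h2 nh B0; nra.
(* The candidate differential: the Cauchy integral of the derivatives of phi in direction w at the
   points of the contour. *)
pose L w := cau rho (D w).
have cphi (w : V) : nrm w < r / 2 -> forall s, s != 0 -> nrm s <= rho + rho ->
    ccont (fun s => phi (z0 + w + s *: v)) s.
  move=> wr s _ sr; apply: holo_ccont; exists (gd phi (z0 + w + s *: v) v).
  apply: gder_line; apply: gdP; apply: differentiable_ghol; apply: dfr; exact: in1.
have psi w : nrm w < r / 2 ->
    'd phi (z0 + w) v = cau rho (fun s => phi (z0 + w + s *: v)).
  move=> wr; rewrite -gd_diff; last first.
    by apply: dfr; have := in1 w 0 wr; rewrite scale0r addr0 nrm0; apply; clear -rho0; lra.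
  apply: gd_cau => // s sr; apply: differentiable_ghol; apply: dfr; exact: in1.
have Llin k u w : L (k *: u + w) = k *: L u + L w.
  have ckD s : s != 0 -> nrm s <= rho + rho -> ccont (fun s => k * D u s) s.
    move=> s0 sr; apply: ccontM; last exact: cD.
    by apply: holo_ccont; exists 0; exact: cderiv_cst.
  have E1 : cau rho (fun s => k * D u s) = k * cau rho (D u).
    by apply: cauZ => // s s0 sr; exact: cD.
  have E2 := cauD rho0 ckD (cD w).
  change (L (k *: u + w) = k * L u + L w).
  rewrite /L -E1 -E2 /cau; congr (_ * _).
  apply: sqI_ext0 => // s sr.
  have dz : differentiable phi (z0 + s *: v) by apply: dfr; exact: in0.
  by rewrite /D !gd_diff // diffDv diffZv.
suff Lo : forall d : R, 0 < d -> exists2 dl : R, 0 < dl & forall h, nrm h < dl ->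
    nrm (('d phi (z0 + h) v : C) - 'd phi z0 v - L h) <= d * nrm h.
  have [] // := @diff_intro _ V C (fun z => 'd phi z v : C) z0 L
    (cauK * (cK1 * M / r) / rho) Llin _ Lo.
  move=> w; apply: le_trans (@cau_le _ rho (cK1 * M * nrm w / r) _ rho0 (cD w) _) _.
    move=> s _ sr; apply: (gd_le w hb); exact: lt_trans (in0 s sr) r2.
  by rewrite le_eqVlt; apply/orP; left; apply/eqP; ring.
move=> d d0; pose B := cauK * (cK2 * M / r ^+ 2) / rho.
have B0 : 0 <= B.
  apply: mulr_ge0; last by rewrite invr_ge0 ltW.
  apply: mulr_ge0; first exact: cauK_ge0.
  apply: mulr_ge0; last by rewrite invr_ge0 exprn_ge0 // ltW.
  by apply: mulr_ge0 => //; apply: mulr_ge0; exact: cK1_ge0.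
have [dl dl0 dP] := small_quad B0 d0.
exists (Num.min dl (r / 2)); first by rewrite lt_min dl0 divr_gt0.
move=> h; rewrite lt_min => /andP[h1 h2].
have n00 : nrm (0 : V) < r / 2 by rewrite nrm0 divr_gt0.
have := psi 0 n00; rewrite addr0 => psi0.
have E : cau rho (fun s => phi (z0 + h + s *: v)) =
    cau rho (fun s => phi (z0 + h + s *: v) - phi (z0 + s *: v) - D h s) +
    (cau rho (fun s => phi (z0 + s *: v)) + L h).
  have c0 s : s != 0 -> nrm s <= rho + rho -> ccont (fun s => phi (z0 + s *: v)) s.
    by have := cphi 0 n00 s; rewrite addr0.
  have cs s : s != 0 -> nrm s <= rho + rho ->
      ccont (fun s => phi (z0 + s *: v) + D h s) s.
    (* The sum a + d is obtained from [ccontB] as a - ((a - d) - a). *)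
    move=> s0 sr; have := ccontB (c0 s s0 sr) (ccontB (ccontB (c0 s s0 sr) (cD h s s0 sr)) (c0 s s0 sr)).
    by congr ccont; apply/funext => u; ring.
  have cd s : s != 0 -> nrm s <= rho + rho ->
      ccont (fun s => phi (z0 + h + s *: v) - phi (z0 + s *: v) - D h s) s.
    by move=> s0 sr; apply: ccontB; [apply: ccontB; [exact: cphi|exact: c0]|exact: cD].
  rewrite /L -(cauD rho0 c0 (cD h)) -(cauD rho0 cd cs) /cau; congr (_ * _).
  by apply: sqI_ext => s; ring.
rewrite psi // psi0 E.
rewrite (_ : _ - L h = cau rho (fun s => phi (z0 + h + s *: v) - phi (z0 + s *: v) - D h s)); last by ring.
apply: le_trans (@cau_le _ rho (cK2 * M * nrm h ^+ 2 / r ^+ 2) _ rho0 _ _) _.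
- move=> s s0 sr; apply: ccontB; last exact: cD.
  apply: ccontB; first exact: cphi.
  by have := cphi 0 n00 s; rewrite addr0; apply.
- move=> s _ sr; have := @gd_taylor _ _ _ _ _ _ (z0 + s *: v) h hb (in0 s sr).
  rewrite (addrAC z0 (s *: v) h); apply; exact: in1.
- rewrite (_ : _ / rho = B * nrm h ^+ 2); last by rewrite /B; ring.
  by apply: dP => //; exact: nrm_ge0.
Qed.

End Holomorphic.

(** * Entire functions *)

Section OneVariableTheory.
Context {R : realType}.
Local Notation C := (Cplx R).
Local Notation Re := (@complex.Re R).
Local Notation Im := (@complex.Im R).
Implicit Types f g : C -> C.

Definition dv f (z : C) : C := gd f z 1.

Lemma gder1 f (z : C) d : gder f z 1 d <-> cderiv f z d.
Proof.
rewrite /gder -[z in cderiv f z]addr0 -cderiv_shift.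
by split; apply: cderiv_ext => s; rewrite [s *: 1]mulr1.
Qed.

Lemma dv_uniq f z d : cderiv f z d -> dv f z = d.
Proof. by move=> h; apply: gd_uniq; apply/gder1. Qed.

Lemma dvP f z : holo f z -> cderiv f z (dv f z).
Proof. by move=> [d fd]; rewrite (dv_uniq fd). Qed.

Lemma holo_differentiable f z : holo f z <-> differentiable f z.
Proof.
split=> [[d fd]|df]; first by have [] := cderiv_differentiable fd.
by exists ('d f z 1); exact: differentiable_cderiv.
Qed.

Lemma holo_ghol f z : holo f z -> ghol f z.
Proof. by move=> /holo_differentiable; exact: differentiable_ghol. Qed.

Lemma dv_holo f z0 : (exists2 e : R, 0 < e & forall z, nrm (z - z0) < e -> holo f z) ->
  holo (dv f) z0.
Proof.
move=> [e e0 fh].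
have H : differentiable (fun z => 'd f z 1 : C) z0.
  by apply: diff_holomorphic; exists e => // z /fh /holo_differentiable.
have [d dd] : holo (fun z => 'd f z 1 : C) z0 by apply/holo_differentiable.
exists d.
move: dd; apply: (cderiv_near e0) => h hh.
have df : differentiable f (z0 + h).
  by apply/holo_differentiable; apply: fh; rewrite [z0 + h]addrC addrK.
rewrite /dv; have := gd_diff (1 : C) df; exact: esym.
Qed.

Lemma cauchy_estimate f z (r M : R) : 0 < r ->
  (forall w, nrm (w - z) < 4 * r -> holo f w /\ nrm (f w) <= M) ->
  nrm (dv f z) <= cK1 * M / r.
Proof.
move=> r0 H; have hb : hball f z r M.
  by split => // w /H[h1 h2]; split => //; exact: holo_ghol.
have := @gd_le _ _ _ _ _ _ z 1 hb; rewrite subrr nrm0 nrm1 mulr1; apply.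
by rewrite mulr_gt0.
Qed.

Lemma mvt f (a b c : C) (M : R) :
  (forall t, I01 t -> holo f (a + rC t * (b - a)) /\
     nrm (dv f (a + rC t * (b - a)) - c) <= M) ->
  nrm (f b - f a - c * (b - a)) <= M * nrm (b - a).
Proof.
move=> H.
have P : has_pder (fun t => f (a + rC t * (b - a)))
    (fun t => gd f (a + rC t *: (b - a)) (b - a)).
  by apply: (@pder_segment R C) => t It; apply: gdP; apply: holo_ghol; exact: (H t It).1.
have P2 : has_pder (fun t => rC t * (c * (b - a))) (fun=> c * (b - a)).
  move=> t _ e e0; exists 1 => // t' _ _; rewrite -mulrBl -rCB subrr nrm0.
  by rewrite mulr_ge0 // ltW.
have := pder_le (pderB P P2) (M := M * nrm (b - a)).
rewrite rC1 rC0 !mul1r !mul0r addr0 subr0 [a + _]addrC subrK.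
rewrite (_ : f b - c * (b - a) - f a = f b - f a - c * (b - a)); last by ring.
apply => t It; have [h1 h2] := H t It.
have -> : gd f (a + rC t *: (b - a)) (b - a) = dv f (a + rC t * (b - a)) * (b - a).
  have := gderZ (b - a) ((gder1 _ _ _).2 (dvP h1)).
  by rewrite [_ *: 1]mulr1 => h; exact: etrans (gd_uniq h) (mulrC _ _).
by rewrite -mulrBl nrmM ler_wpM2r // nrm_ge0.
Qed.

Lemma dv0_cst f : (forall z, holo f z) -> (forall z, dv f z = 0) -> forall z, f z = f 0.
Proof.
move=> fh f0 z; apply/eqP; rewrite -subr_eq0 -nrm_eq0 eq_le nrm_ge0 andbT.
have := @mvt f 0 z 0 0; rewrite !subr0 !mul0r subr0; apply => t It.
by rewrite subr0 f0 nrm0.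
Qed.

Lemma ball_segment (e : R) (a b : C) t : I01 t -> nrm a < e -> nrm b < e ->
  nrm (a + rC t * (b - a)) < e.
Proof.
move=> /andP[t0 t1] ae be.
rewrite (_ : a + _ = rC (1 - t) * a + rC t * b); last by rewrite rCB rC1; ring.
apply: le_lt_trans (nrmD _ _) _; rewrite !nrmM !nrm_rC (ger0_norm t0).
by rewrite ger0_norm; [exact: conv_lt|clear -t1; lra].
Qed.

Lemma holo_poly2 (a b c : C) z : cderiv (fun w => a + w * b + c * (w * w)) z (b + c * (z + z)).
Proof.
apply: cderivD; first exact: cderiv_affine.
apply: cderivZ; have := cderivM (cderiv_id z) (cderiv_id z).
by rewrite mul1r mulr1.
Qed.

(** The derivative of the remainder at z is f' z - f' 0 - z a, which is o(z); the mean value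
    inequality does the rest. *)
Lemma taylor2 f (e : R) a : 0 < e -> (forall z, nrm z < e -> holo f z) ->
  cderiv (dv f) 0 a ->
  forall k : R, 0 < k -> exists2 dl : R, 0 < dl & forall z, nrm z < dl ->
    nrm (f z - f 0 - z * dv f 0 - a / 2 * (z * z)) <= k * nrm z ^+ 2.
Proof.
move=> e0 fh fa k k0; have [dl dl0 dP] := fa k k0.
exists (Num.min e dl); first by rewrite lt_min e0.
move=> z; rewrite lt_min => /andP[ze zd].
pose g w := f w - (f 0 + w * dv f 0 + a / 2 * (w * w)).
have two : (2 : C) != 0 by rewrite pnatr_eq0.
have gd w : nrm w < e -> cderiv g w (dv f w - dv f 0 - w * a).
  move=> we; apply: cderiv_eq (cderivB (dvP (fh w we)) (holo_poly2 _ _ _ w)).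
  by move: (dv f w) (dv f 0) => u v; field.
suff H : nrm (g z - g 0 - 0 * (z - 0)) <= k * nrm z * nrm (z - 0).
  rewrite !subr0 in H; rewrite expr2 (mulrA k); apply: le_trans H.
  by rewrite le_eqVlt; apply/orP; left; apply/eqP; congr nrm; rewrite /g; ring.
apply: mvt => t It; rewrite add0r !subr0.
have tz : nrm (rC t * z) <= nrm z.
  have [t0 t1] := andP It.
  by rewrite nrmM nrm_rC ger0_norm // ler_piMl // nrm_ge0.
have te := le_lt_trans tz ze; have td := le_lt_trans tz zd.
split; first by exists (dv f (rC t * z) - dv f 0 - (rC t * z) * a); exact: gd.
rewrite (dv_uniq (gd _ te)).
have := dP _ td; rewrite add0r => h; apply: le_trans h _.
by rewrite ler_wpM2l // ltW.
Qed.

(** Only the point 0 needs an argument: the quotient f z / z, with value f' 0 there, has derivative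
    f'' 0 / 2 by [taylor2]. *)
Lemma division f (e : R) : 0 < e -> (forall z, nrm z < e -> holo f z) -> f 0 = 0 ->
  exists g, [/\ forall z, nrm z < e -> holo g z, forall z, f z = z * g z,
    g 0 = dv f 0 & forall z, z != 0 -> g z = f z / z].
Proof.
move=> e0 fh f0.
exists (fun z => if z == 0 then dv f 0 else f z / z); split.
- move=> z ze; have [->|z0] := eqVneq z 0; last first.
    have nz : 0 < nrm z by rewrite nrm_gt0.
    have [d hd] : holo (fun w => f w * w^-1) z by apply: holoM; [exact: fh|exact: holo_inv].
    exists d; move: hd; apply: (cderiv_near nz) => h hz.
    case: eqP => // zh; move: hz; rewrite (_ : h = - z) ?nrmN ?ltxx //.
    by rewrite -[h](addKr z) zh addr0.
  have [a fa] : holo (dv f) 0 by apply: dv_holo; exists e => // w; rewrite subr0; exact: fh.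
  exists (a / 2) => k k0; have [dl dl0 dP] := taylor2 e0 fh fa k0.
  exists dl => // h hd; rewrite add0r eqxx.
  case: eqVneq => [->|h0].
    by rewrite mul0r subr0 subrr nrm0 mulr0.
  have := dP h hd; rewrite f0 subr0.
  rewrite (_ : f h - _ - _ = h * (f h / h - dv f 0 - h * (a / 2))); last by field.
  have nh : 0 < nrm h by rewrite nrm_gt0.
  by rewrite nrmM expr2 (mulrA k) [nrm h * nrm _]mulrC ler_pM2r.
- move=> z; case: eqVneq => [->|z0]; first by rewrite f0 mul0r.
  by rewrite mulrC divfK.
- by rewrite eqxx.
- by move=> z /negbTE ->.
Qed.

(** Continuity of g makes w g (z0 + w) differentiable at 0 too, with derivative g z0; dividing it by
    w recovers g. *)
Lemma removable g z0 (e : R) : 0 < e ->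
  (forall z, z != z0 -> nrm (z - z0) < e -> holo g z) -> ccont g z0 -> holo g z0.
Proof.
move=> e0 gh gc.
pose H w := w * g (z0 + w).
have H0 : cderiv H 0 (g z0).
  move=> k k0; have [dl dl0 dP] := gc k k0; exists dl => // h hd.
  rewrite /H !add0r mul0r subr0 -mulrBr nrmM mulrC ler_wpM2r ?nrm_ge0 //.
  by apply: ltW; exact: dP.
have Hh z : nrm z < e -> holo H z.
  move=> ze; have [->|z0'] := eqVneq z 0; first by exists (g z0).
  apply: holoM; first by exists 1; exact: cderiv_id.
  have [|d gd] := gh (z0 + z) _ ltac:(by rewrite addrC addKr).
    by rewrite -subr_eq0 addrC addKr.
  by exists d; apply/cderiv_shift.
have [q [qh Hq q0 qE]] := division e0 Hh (mul0r _).
have [d qd] : holo q 0 by apply: qh; rewrite nrm0.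
exists d; rewrite -[z0]addr0; apply/cderiv_shift.
move: qd; apply: cderiv_ext => w; have [->|w0] := eqVneq w 0.
  by rewrite q0 (dv_uniq H0) addr0.
by rewrite qE // /H mulrC mulKf.
Qed.

(** Accumulating zeros make f divisible by z ^ n for every n. A Cauchy bound for the quotient then
    gives nrm (f z) <= K / 2 ^ n near 0, with K independent of n. *)
Lemma identity_principle f (e : R) : 0 < e -> (forall z, nrm z < e -> holo f z) ->
  (forall dl : R, 0 < dl -> exists z, [/\ z != 0, nrm z < dl & f z = 0]) ->
  exists2 dl : R, 0 < dl & forall z, nrm z < dl -> f z = 0.
Proof.
move=> e0 fh f0.
have zero g : (forall z, nrm z < e -> holo g z) ->
    (forall dl : R, 0 < dl -> exists z, [/\ z != 0, nrm z < dl & g z = 0]) -> g 0 = 0.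
  move=> gh g0; apply/eqP; rewrite -nrm_eq0 eq_le nrm_ge0 andbT.
  apply/ler_addgt0Pr => k k0; rewrite add0r.
  have [dl dl0 dP] := holo_ccont (gh 0 ltac:(by rewrite nrm0)) k0.
  have [z [_ zd gz]] := g0 dl dl0; have := dP z zd.
  by rewrite add0r gz sub0r nrmN => /ltW.
have fac n : exists g, (forall z, nrm z < e -> holo g z) /\ forall z, f z = z ^+ n * g z.
  elim: n => [|n [g [gh fg]]]; first by exists f; split => // z; rewrite mul1r.
  have g0 : g 0 = 0.
    apply: zero => // dl dl0; have [z [z0 zd fz]] := f0 dl dl0.
    exists z; split => //; move/eqP: fz; rewrite fg mulf_eq0 expf_eq0 (negbTE z0) andbF.
    by move=> /eqP.
  have [q [qh gq _ _]] := division e0 gh g0.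
  by exists q; split => // z; rewrite fg gq exprSr mulrA.
have [d1 d10 d1P] := holo_ccont (fh 0 ltac:(by rewrite nrm0)) ltr01.
pose r := Num.min e d1; have r0 : 0 < r by rewrite lt_min e0.
pose M := nrm (f 0) + 1; have M0 : 0 <= M by rewrite addr_ge0 // nrm_ge0.
have fM z : nrm z < r -> nrm z < e /\ nrm (f z) <= M.
  rewrite lt_min => /andP[ze zd]; split => //.
  by have := d1P z zd; have := nrm_sub (f z) (f 0); rewrite add0r /M; clear; lra.
have K0 := @cauK_ge0 R.
exists (r / 16); first by rewrite divr_gt0.
move=> z zr; apply/eqP; rewrite -nrm_eq0 eq_le nrm_ge0 andbT.
apply/ler_addgt0Pr => k k0; rewrite add0r.
have [n hn] := half_pow_small (cauK * M * 2) k0.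
apply: le_trans (ltW hn).
have [g [gh fg]] := fac n.
(* On the contour around z, nrm (z + w) lies between r / 4 - r / 16 >= r / 8 and r, so the quotient
   is at most M (8 / r) ^ n there, while z contributes (r / 16) ^ n. *)
pose rho := r / 4; have rho0 : 0 < rho by rewrite divr_gt0.
have inside (w : C) : nrm w <= rho + rho -> nrm (z + w) < r.
  move=> wr; apply: le_lt_trans (nrmD _ _) _.
  by move: wr zr; rewrite /rho; clear -r0; lra.
have hw (w : C) : nrm w <= rho + rho -> holo (fun w => g (z + w)) w.
  by move=> wr; have [d gd] := gh (z + w) (fM _ (inside w wr)).1; exists d; apply/cderiv_shift.
have hw2 (w : C) : nrm w <= rho + rho -> holo (fun w => w * g (z + w)) w.
  by move=> wr; apply: holoM; [exists 1; exact: cderiv_id|exact: hw].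
(* The formula for derivatives also gives values: g z is the derivative at w = 0 of w g (z + w). *)
have E : g z = cau rho (fun w => w * g (z + w)).
  apply/esym; apply: cauP => //.
  have h0 := hw 0 ltac:(by rewrite nrm0 addr_ge0 // ltW).
  have := cderivM (cderiv_id 0) (dvP h0).
  by rewrite mul1r mul0r !addr0.
pose B := M * (8 / r) ^+ n.
have q0 : 0 < 8 / r by rewrite divr_gt0.
have gB (w : C) : rho <= nrm w -> nrm w <= rho + rho -> nrm (g (z + w)) <= B.
  move=> w1 w2; have [_ fm] := fM _ (inside w w2).
  have zw : r / 8 <= nrm (z + w).
    have := nrm_sub w (z + w); rewrite (_ : w - (z + w) = - z); last by ring.
    by rewrite nrmN; move: w1 zr; rewrite /rho; clear -r0; lra.
  have zw0 : 0 < nrm (z + w) by apply: lt_le_trans zw; rewrite divr_gt0.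
  move: fm; rewrite fg nrmM nrmX mulrC -ler_pdivlMr ?exprn_gt0 // => h.
  apply: le_trans h _; rewrite /B ler_wpM2l // -exprVn; apply: lerXn2r.
  - by rewrite nnegrE invr_ge0 ltW.
  - by rewrite nnegrE ltW.
  - by rewrite -[8 / r]invf_div lef_pV2 ?posrE // divr_gt0.
have gz : nrm (g z) <= cauK * (2 * rho * B) / rho.
  rewrite E; apply: cau_le => //.
    by move=> w _ wr; apply: holo_ccont; exact: hw2.
  move=> w w1 w2; rewrite nrmM; apply: ler_pM; rewrite ?nrm_ge0 //.
    by apply: le_trans w2 _; rewrite mulrDl mul1r.
  exact: gB.
rewrite fg nrmM nrmX.
apply: le_trans (_ : (r / 16) ^+ n * (cauK * (2 * rho * B) / rho) <= _).
  apply: ler_pM => //; [by rewrite exprn_ge0 // nrm_ge0|exact: nrm_ge0|].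
  by apply: lerXn2r; rewrite ?nnegrE ?nrm_ge0 ?divr_ge0 //; exact: ltW.
rewrite le_eqVlt; apply/orP; left; apply/eqP.
have -> : cauK * (2 * rho * B) / rho = cauK * M * 2 * (8 / r) ^+ n.
  by rewrite /B; field; rewrite gt_eqF.
rewrite mulrCA -exprMn (_ : r / 16 * (8 / r) = 2^-1) ?exprVn //.
by field; rewrite gt_eqF.
Qed.

End OneVariableTheory.

(** * Univalent functions and automorphisms of the plane *)

Section Univalent.
Context {R : realType}.
Local Notation C := (Cplx R).
Local Notation Re := (@complex.Re R).
Local Notation Im := (@complex.Im R).
Implicit Types f g : C -> C.

(** As a is nonzero and psi continuous, the relation f o psi = g first bounds the increment of psi
    by K nrm h; inserting this bound then yields its derivative. *)
Lemma cderiv_implicit f g (psi : C -> C) z a b : a != 0 ->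
  cderiv f (psi z) a -> cderiv g z b -> ccont psi z ->
  (exists2 e : R, 0 < e & forall h, nrm h < e -> f (psi (z + h)) = g (z + h)) ->
  cderiv psi z (b / a).
Proof.
move=> a0 fa gb cp [e0 e00 fg] e e_0.
have na : 0 < nrm a by rewrite nrm_gt0.
have nb := nrm_ge0 b.
have na2 : 0 < nrm a / 2 by rewrite divr_gt0.
have fz : f (psi z) = g z by have := fg 0; rewrite nrm0 addr0; apply.
have [d1 d10 h1] := fa (nrm a / 2) na2.
have [d2 d20 h2] := gb 1 ltr01.
pose K := 2 * (nrm b + 1) / nrm a.
have K0 : 0 < K by rewrite divr_gt0 // mulr_gt0 //; clear -nb; lra.
pose k := nrm a * e / (K + 1).
have k0 : 0 < k by rewrite divr_gt0 ?mulr_gt0 //; clear -K0; lra.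
have kE : k * (K + 1) = nrm a * e by rewrite divfK // gt_eqF //; clear -K0; lra.
have [d3 d30 h3] := fa k k0; have [d4 d40 h4] := gb k k0.
have [d5 d50 h5] := cp _ d10; have [d6 d60 h6] := cp _ d30.
exists (Num.min (Num.min e0 d2) (Num.min d4 (Num.min d5 d6))).
  by rewrite !lt_min e00 d20 d40 d50.
move=> h; rewrite !lt_min => /andP[/andP[l0 l2] /and3P[l4 l5 l6]].
have nh := nrm_ge0 h.
pose w := psi (z + h) - psi z.
have w1 := h5 h l5; have w3 := h6 h l6; rewrite -/w in w1 w3.
have pw : psi z + w = psi (z + h) by rewrite addrC subrK.
have e1 := h1 w w1; have e2 := h2 h l2; have e3 := h3 w w3; have e4 := h4 h l4.
rewrite pw (fg h l0) fz in e1 e3.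
have nw := nrm_ge0 w.
have B : nrm w <= K * nrm h.
  have t1 := nrm_sub (w * a) (g (z + h) - g z).
  rewrite nrmC in e1; have t2 := nrm_sub (g (z + h) - g z) (h * b).
  rewrite !nrmM in t1 t2.
  rewrite -(ler_pM2r na2) /K.
  have -> : 2 * (nrm b + 1) / nrm a * nrm h * (nrm a / 2) = (nrm b + 1) * nrm h.
    by field; rewrite gt_eqF.
  by clear -t1 t2 e1 e2; lra.
rewrite -(ler_pM2l na) -nrmM.
rewrite (_ : a * _ = (g (z + h) - g z - h * b) - (g (z + h) - g z - w * a)); last by rewrite /w; field.
apply: le_trans (nrmB _ _) _; rewrite mulrA -kE.
by clear -e3 e4 B k0; nra.
Qed.

(* The inverse is continuous, holomorphic off the critical values, which are
   isolated, hence holomorphic. *)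
Lemma univalent f (e : R) : 0 < e -> (forall z, nrm z < e -> holo f z) ->
  (forall z z', nrm z < e -> nrm z' < e -> f z = f z' -> z = z') ->
  (forall z0 (dl : R), nrm z0 < e -> 0 < dl -> exists2 eta : R, 0 < eta &
     forall w, nrm (w - f z0) < eta -> exists z, [/\ nrm (z - z0) < dl, nrm z < e & f z = w]) ->
  dv f 0 != 0.
Proof.
move=> e0 fh finj fo; apply/eqP => df0.
have n0 : nrm (0 : C) < e by rewrite nrm0.
have dfh z : nrm z < e -> holo (dv f) z.
  move=> ze; apply: dv_holo; exists (e - nrm z); first by rewrite subr_gt0.
  by move=> w wz; apply: fh; have := nrm_sub w z; move: wz; clear; lra.
(* Otherwise the zeros of f' accumulate at 0, f' vanishes near 0, and f is constant there, against
   injectivity. *)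
have [d1 d10 dfN0] : exists2 d1 : R, 0 < d1 & forall z, z != 0 -> nrm z < d1 -> dv f z != 0.
  apply: contrapT => H.
  have [|d d0 dP] := identity_principle e0 dfh.
    move=> dl dl0; apply: contrapT => H'; apply: H; exists dl => // z z0 zd.
    by apply/eqP => fz; apply: H'; exists z.
  pose m := Num.min d e; have m0 : 0 < m by rewrite lt_min d0.
  have m2 : nrm (rC (m / 2) : C) < m.
    by rewrite nrm_rC ger0_norm ?divr_ge0 // ?ltW //; clear -m0; lra.
  have [md me] : m <= d /\ m <= e by rewrite !ge_min !lexx orbT.
  have E : nrm (f (rC (m / 2)) - f 0 - 0 * (rC (m / 2) - 0)) <= 0 * nrm (rC (m / 2) - 0).
    apply: mvt => t It; have := ball_segment It (a := 0) (b := rC (m / 2)) _ m2.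
    rewrite nrm0 => /(_ m0) h; split; first by apply: fh; exact: lt_le_trans me.
    by rewrite dP ?subrr ?nrm0 //; exact: lt_le_trans md.
  rewrite !mul0r subr0 in E.
  have /eqP : nrm (f (rC (m / 2)) - f 0) == 0 by rewrite eq_le E nrm_ge0.
  move=> /eqP; rewrite nrm_eq0 subr_eq0 => /eqP /finj.
  move=> /(_ (lt_le_trans m2 me) n0) /eqP; rewrite rC_eq0; apply/negP.
  by rewrite gt_eqF // divr_gt0.
have ex w : exists z, forall z', nrm z' < e -> f z' = w -> z = z'.
  have [[z [ze fz]]|N] := pselect (exists z, nrm z < e /\ f z = w).
    by exists z => z' z'e fz'; apply: finj => //; rewrite fz.
  by exists 0 => z' z'e fz'; exfalso; apply: N; exists z'.
have [phi phiP] := choice ex.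
have phiK z : nrm z < e -> phi (f z) = z by move=> ze; exact: phiP.
have phic z : nrm z < e -> ccont phi (f z).
  move=> ze k k0; have [eta eta0 hP] := fo z k ze k0; exists eta => // h hh.
  have [|z' [z1 z2 z3]] := hP (f z + h); first by rewrite addrC addKr.
  by rewrite -z3 !phiK.
have phid z : nrm z < e -> dv f z != 0 -> holo phi (f z).
  move=> ze dz; exists (1 / dv f z).
  apply: (@cderiv_implicit f (fun w => w)) => //.
  - by rewrite phiK //; apply: dvP; exact: fh.
  - exact: cderiv_id.
  - exact: phic.
  - have [eta eta0 hP] := fo z 1 ze ltr01; exists eta => // h hh.
    have [|z' [z1 z2 z3]] := hP (f z + h); first by rewrite addrC addKr.
    by rewrite -z3 phiK.
have [b bd] : holo phi (f 0).
  pose m := Num.min d1 e; have m0 : 0 < m by rewrite lt_min d10.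
  have [md me] : m <= d1 /\ m <= e by rewrite !ge_min !lexx orbT.
  have [eta eta0 hP] := fo 0 m n0 m0.
  apply: (removable eta0); last exact: phic.
  move=> w w0 wh; have [z [z1 z2 z3]] := hP w wh; rewrite subr0 in z1.
  have z0 : z != 0 by apply: contra w0 => /eqP zz; rewrite -z3 zz.
  by rewrite -z3; apply: phid => //; apply: dfN0 => //; exact: lt_le_trans md.
(* The chain rule gives phi o f derivative 0 at the origin, although it is the identity. *)
have := cderiv_comp (dvP (fh 0 n0)) bd; rewrite df0 mul0r => H1.
have H2 : cderiv (fun w => phi (f w)) 0 1.
  by apply: (cderiv_near e0) (cderiv_id 0) => h hh; rewrite phiK // add0r.
by have /eqP := cderiv_uniq H1 H2; rewrite eq_sym oner_eq0.
Qed.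

Lemma liouville f (M : R) : (forall z, holo f z) -> (forall z, nrm (f z) <= M) ->
  forall z, f z = f 0.
Proof.
move=> fh fM; apply: dv0_cst => // z.
apply/eqP; rewrite -nrm_eq0 eq_le nrm_ge0 andbT.
apply/ler_addgt0Pr => e e0; rewrite add0r.
have M0 : 0 <= M by exact: le_trans (nrm_ge0 _) (fM 0).
have K0 := @cK1_ge0 R.
pose r := (cK1 * M + 1) / e.
have KM : 0 <= cK1 * M by exact: mulr_ge0.
have r0 : 0 < r by rewrite divr_gt0 //; clear -KM; lra.
apply: le_trans (cauchy_estimate r0 (M := M) _) _; first by [].
rewrite ler_pdivrMr // (_ : e * r = cK1 * M + 1); last by rewrite /r; field; rewrite gt_eqF.
by clear; lra.
Qed.

Lemma bounded_on_square f x y (s : R) : 0 < s -> (forall z, holo f z) ->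
  exists M, forall w, insq x y s w -> nrm (f w) <= M.
Proof.
move=> s0 fh.
pose P (x y s : R) := exists M, forall w, insq x y s w -> nrm (f w) <= M.
suff : P x y s by [].
apply: square_induction => //.
  move=> x' y' s' s'0 [M1 h1] [M2 h2] [M3 h3] [M4 h4].
  exists (Num.max (Num.max M1 M2) (Num.max M3 M4)) => w [/andP[w1 w2] /andP[w3 w4]].
  rewrite !le_max.
  have [l1|l1] := lerP (Re w) (x' + s' / 2); have [l2|l2] := lerP (Im w) (y' + s' / 2).
  - by rewrite h1 //; split; clear -w1 w2 w3 w4 l1 l2; lra.
  - by rewrite h3 ?orbT //; split; clear -w1 w2 w3 w4 l1 l2; lra.
  - by rewrite h2 ?orbT //; split; clear -w1 w2 w3 w4 l1 l2; lra.
  - by rewrite h4 ?orbT //; split; clear -w1 w2 w3 w4 l1 l2; lra.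
move=> c d hc hd; have [dl dl0 dP] := holo_ccont (fh (pt c d)) ltr01.
exists (dl / 2); first by rewrite divr_gt0.
move=> x' y' s' s'0 s'd hc' hd' _ _ _ _; exists (nrm (f (pt c d)) + 1) => w [w1 w2].
have e1 : w = pt c d + pt (Re w - c) (Im w - d).
  by rewrite {1}(ptE w) /pt !rCB; ring.
have := dP (pt (Re w - c) (Im w - d)); rewrite -e1.
have n1 : nrm (pt (Re w - c) (Im w - d)) < dl.
  apply: le_lt_trans (nrm_pt _ _) _.
  have : `|Re w - c| <= s' by rewrite ler_norml; clear -w1 hc'; lra.
  have : `|Im w - d| <= s' by rewrite ler_norml; clear -w2 hd'; lra.
  by clear -s'd; lra.
by move=> /(_ n1); have := nrm_sub (f w) (f (pt c d)); clear; lra.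
Qed.

Lemma bounded_on_ball f (N : R) : (forall z, holo f z) ->
  exists2 M, 0 < M & forall w, nrm w <= N -> nrm (f w) <= M.
Proof.
move=> fh; pose s := `|N| + 1; have s0 : 0 < s by rewrite /s; have := normr_ge0 N; lra.
have [M MP] := @bounded_on_square f (- s) (- s) (s + s) ltac:(by rewrite addr_gt0) fh.
exists (`|M| + 1); first by have := normr_ge0 M; lra.
move=> w wN; have [a1 a2] := ReIm_le w; have NN := ler_norm N.
have := MP w; rewrite /insq => H.
have : nrm (f w) <= M.
  apply: H; move: a1 a2; rewrite !ler_norml /s => /andP[? ?] /andP[? ?].
  by split; lra.
by have := ler_norm M; clear; lra.
Qed.

(* In the coordinate w = 1 / (z - a) at infinity, the automorphism is bounded near
   w = 0, where its singularity is removable. *)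
Lemma holo_continuous_inv (tau sig : C -> C) (a : C) : (forall z, holo tau z) ->
  (forall z, holo sig z) -> cancel tau sig ->
  forall w, holo (fun w => (tau (w^-1 + a) - tau a)^-1) w.
Proof.
move=> th sh tK.
pose G w := (tau (w^-1 + a) - tau a)^-1.
have tinj := can_inj tK.
have G1 w : w != 0 -> holo G w.
  move=> w0; have [d1 h1] : holo (fun w => w^-1 + a) w.
    by exists (- w^-2 + 0); apply: cderivD; [exact: cderivV|exact: cderiv_cst].
  have [d2 h2] := th (w^-1 + a).
  have h3 := cderivB (cderiv_comp h1 h2) (cderiv_cst (tau a) w).
  have n0 : tau (w^-1 + a) - tau a != 0.
    rewrite subr_eq0; apply/eqP => /tinj /eqP.
    by rewrite -subr_eq0 addrK invr_eq0 (negbTE w0).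
  by eexists; exact: cderiv_comp h3 (cderivV n0).
move=> w; have [->|w0] := eqVneq w 0; last exact: G1.
apply: (removable ltr01) => [z z0 _|]; first exact: G1.
(* Were tau (1 / h + a) within 1 / e of tau a, then sig would send it to a point of norm at most M,
   namely 1 / h + a; a small h excludes this. *)
move=> e e0; have [M M0 MP] := bounded_on_ball (nrm (tau a) + e^-1) sh.
have Ma0 : 0 < M + nrm a + 1 by have := nrm_ge0 a; move: M0; clear; lra.
exists (M + nrm a + 1)^-1; first by rewrite invr_gt0.
move=> h hh; rewrite add0r /G invr0 add0r subrr invr0 subr0.
have [->|h0] := eqVneq h 0; first by rewrite invr0 add0r subrr invr0 nrm0.
have nh : 0 < nrm h by rewrite nrm_gt0.
rewrite nrmV -[e]invrK ltf_pV2 ?posrE ?invr_gt0 //; last first.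
  rewrite nrm_gt0 subr_eq0; apply/eqP => /tinj /eqP.
  by rewrite -subr_eq0 addrK invr_eq0 (negbTE h0).
rewrite ltNge; apply/negP => H.
have := MP (tau (h^-1 + a)); rewrite tK => H2.
have {}H2 : nrm (h^-1 + a) <= M.
  by apply: H2; have := nrm_sub (tau (h^-1 + a)) (tau a); move: H; clear; lra.
have H3 : nrm (h^-1) <= M + nrm a.
  by have := nrm_sub (h^-1) (h^-1 + a); rewrite opprD addNKr nrmN; move: H2; clear; lra.
have H4 : M + nrm a + 1 < nrm (h^-1).
  by rewrite nrmV -[X in X < _]invrK ltf_pV2 ?posrE ?invr_gt0.
by move: H3 H4; clear; lra.
Qed.

(** At infinity, in the coordinate 1 / z, tau becomes G with holomorphic left inverse H, so G' 0 is
    nonzero and tau grows at most linearly. Cauchy's estimate bounds tau', and Liouville makes it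
    constant. *)
Lemma automorphism_affine (tau sig : C -> C) : (forall z, holo tau z) ->
  (forall z, holo sig z) -> cancel tau sig -> cancel sig tau ->
  exists a, forall z, tau z = tau 0 + a * z.
Proof.
move=> th sh tK sK.
pose G w := (tau (w^-1 + 0) - tau 0)^-1.
pose H w := (sig (w^-1 + tau 0) - sig (tau 0))^-1.
have Gh := holo_continuous_inv 0 th sh tK.
have Hh := holo_continuous_inv (tau 0) sh th sK.
have HG w : H (G w) = w by rewrite /H /G invrK subrK !tK addr0 subr0 invrK.
have G0 : G 0 = 0 by rewrite /G invr0 addr0 subrr invr0.
have [g gd] := Gh 0; have [k kd] := Hh (G 0).
have gk : g * k = 1.
  apply: cderiv_uniq (cderiv_comp gd kd) _.
  by apply: cderiv_ext (cderiv_id 0) => w; rewrite -/(G w) -/(H (G w)) HG.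
have g0 : 0 < nrm g.
  rewrite nrm_gt0; apply/eqP => g0; move/eqP: gk.
  by rewrite g0 mul0r eq_sym oner_eq0.
have [dl dl0 dP] := gd (nrm g / 2) ltac:(by rewrite divr_gt0).
have far z : dl^-1 < nrm z -> nrm (tau z - tau 0) <= 2 / nrm g * nrm z.
  move=> zd; have z0 : 0 < nrm z by apply: lt_trans zd; rewrite invr_gt0.
  have zi : nrm (z^-1) < dl by rewrite nrmV -[dl]invrK ltf_pV2 ?posrE ?invr_gt0.
  have := dP _ zi; rewrite add0r -/(G 0) -/(G z^-1) G0 subr0 => h.
  have h2 : nrm g / 2 * nrm (z^-1) <= nrm (G z^-1).
    have := nrm_sub (z^-1 * g) (G z^-1); rewrite nrmC in h; move: h; rewrite nrmM; clear; lra.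
  have G1 : G z^-1 = (tau z - tau 0)^-1 by rewrite /G invrK addr0.
  rewrite G1 !nrmV in h2.
  have [t0|t0] := eqVneq (tau z - tau 0) 0.
    by rewrite t0 nrm0 mulr_ge0 ?divr_ge0 ?(ltW g0) ?(ltW z0).
  have nt : 0 < nrm (tau z - tau 0) by rewrite nrm_gt0.
  have p : 0 < nrm g / 2 / nrm z by rewrite !divr_gt0.
  have -> : 2 / nrm g * nrm z = (nrm g / 2 / nrm z)^-1.
    by field; rewrite !gt_eqF.
  by rewrite -[X in X <= _]invrK lef_pV2 ?posrE ?invr_gt0.
have [M M0 MP] := bounded_on_ball dl^-1 th.
pose B := 2 / nrm g; have B0 : 0 < B by rewrite divr_gt0.
have growth z : nrm (tau z) <= nrm (tau 0) + M + B * nrm z.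
  have n1 := nrm_ge0 (tau 0); have n2 : 0 <= B * nrm z by rewrite mulr_ge0 ?nrm_ge0 // ltW.
  have [zd|zd] := lerP (nrm z) dl^-1.
    by have := MP z zd; move: n1 n2; clear; lra.
  by have := far z zd; have := nrm_sub (tau z) (tau 0); rewrite -/B; move: n1 n2 M0; clear; lra.
have K0 := @cK1_ge0 R.
have dtb z : nrm (dv tau z) <= cK1 * (B * 5 + 1).
  pose A := nrm (tau 0) + M; have A0 : 0 <= A by rewrite addr_ge0 ?nrm_ge0 // ltW.
  (* As r exceeds both nrm z and A, the estimate is uniform in z: (A + B (nrm z + 4 r)) / r <= 5 B +
     1. *)
  pose r := nrm z + A + 1; have nz := nrm_ge0 z.
  have r0 : 0 < r by rewrite /r; move: A0 nz; clear; lra.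
  have BR : 0 <= B * r by rewrite mulr_ge0 // ltW.
  apply: le_trans (@cauchy_estimate _ tau z r (A + B * (nrm z + 4 * r)) r0 _) _.
    move=> w wz; split => //; apply: le_trans (growth w) _; rewrite -/A lerD2l ler_pM2l //.
    by have := nrm_sub w z; move: wz; clear; lra.
  rewrite -mulrA ler_wpM2l // ler_pdivrMr //.
  have : B * nrm z <= B * r by rewrite ler_pM2l // /r; move: A0; clear; lra.
  have : A <= r by rewrite /r; move: nz; clear; lra.
  by move: B0; clear; lra.
have dth z : holo (dv tau) z by apply: dv_holo; exists 1.
have dtc := liouville dth dtb.
exists (dv tau 0) => z.
have E : nrm (tau z - tau 0 - dv tau 0 * (z - 0)) <= 0 * nrm (z - 0).
  by apply: mvt => t _; split => //; rewrite dtc subrr nrm0.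
rewrite mul0r subr0 in E; apply/eqP; rewrite -subr_eq0 opprD addrA -nrm_eq0.
by rewrite eq_le E nrm_ge0.
Qed.

End Univalent.

Lemma open_nball (R : realType) (V : normedModType (Cplx R)) (c : V) (e : R) :
  open [set y | nrm (y - c) < e].
Proof.
apply/openP_nrm => z /= ze; exists (e - nrm (z - c)); first by rewrite subr_gt0.
by move=> w wz; have := nrm_dist w z c; move: wz; clear; lra.
Qed.

(** * Coverings by the plane *)

Section Covering.
Context {R : realType}.
Local Notation C := (Cplx R).
Variables (T : topologicalType) (L : set T) (f : C -> T).

(** The topological part of [leaf_universal_covering], for an arbitrary space. *)
Definition is_covering := [/\ range f = L, continuous f &
  forall r, L r -> exists W : set T, [/\ open W, W r, W `<=` L &
    exists S : set (set C),
      [/\ (forall s, S s -> open s), trivIset S id,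
          f @^-1` W = \bigcup_(s in S) s &
          (forall s, S s -> set_bij s W f /\
             forall O, open O -> O `<=` s -> open (f @` O))]]].

Hypothesis fcov : is_covering.

Lemma cov_even r : L r -> exists W S, [/\ open W, W r, W `<=` L &
  [/\ forall s, S s -> open s,
      forall s1 s2 y, S s1 -> S s2 -> s1 y -> s2 y -> s1 = s2,
      forall y, W (f y) -> exists2 s : set C, S s & s y &
      forall s, S s -> [/\ forall y, s y -> W (f y),
        forall y y', s y -> s y' -> f y = f y' -> y = y',
        forall w, W w -> exists2 y, s y & f y = w &
        forall O, open O -> O `<=` s -> open (f @` O)]]].
Proof.
have [_ _ h] := fcov; move=> /h[W [oW Wr WL [S [oS tS fS bS]]]].
exists W, S; split => //; split => //.
- by move=> s1 s2 y S1 S2 y1 y2; apply: (tS s1 s2) => //; exists y.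
- move=> y Wy; have : (f @^-1` W) y by [].
  by rewrite fS => -[s Ss sy]; exists s.
- move=> s /bS[[h1 h2 h3] h4]; split => //.
  by move=> y y' sy sy' fy; apply: h2; rewrite ?inE.
Qed.

Lemma cov_range y : L (f y).
Proof. by have [<- _ _] := fcov; exists y. Qed.

Definition contT (g : R -> T) (x s : R) := forall t, x <= t <= x + s ->
  forall U, open U -> U (g t) -> exists2 d : R, 0 < d &
    forall t', x <= t' <= x + s -> `|t' - t| < d -> U (g t').

Definition contP (p : R -> C) (x s : R) := forall t, x <= t <= x + s ->
  forall e : R, 0 < e -> exists2 d : R, 0 < d &
    forall t', x <= t' <= x + s -> `|t' - t| < d -> nrm (p t' - p t) < e.

Lemma contP_open p x s t (U : set C) : contP p x s -> x <= t <= x + s -> open U ->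
  U (p t) -> exists2 d : R, 0 < d &
    forall t', x <= t' <= x + s -> `|t' - t| < d -> U (p t').
Proof.
move=> cp ht /openP_nrm oU /oU[e e0 eP]; have [d d0 dP] := cp t ht e e0.
by exists d => // t' ht' l; apply: eP; exact: dP.
Qed.

Lemma contP_sub p x s x' s' : contP p x s -> x <= x' -> x' + s' <= x + s -> contP p x' s'.
Proof.
move=> cp h1 h2 t ht e e0; have [d d0 dP] := cp t ltac:(clear -fcov ht h1 h2; lra) e e0.
by exists d => // t' ht'; apply: dP; clear -fcov ht' h1 h2; lra.
Qed.

(** On a short interval each lift stays in one sheet; agreement at one time makes the sheets equal,
    hence the lifts agree throughout. Bisection carries the equivalence between agreement at the two
    ends. *)
Lemma lift_unique p q x s : 0 <= s -> contP p x s -> contP q x s ->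
  (forall t, x <= t <= x + s -> f (p t) = f (q t)) -> p x = q x -> p (x + s) = q (x + s).
Proof.
move=> s0 cp cq fpq; have [->|s0'] := eqVneq s 0; first by rewrite addr0.
have {s0 s0'} s0 : 0 < s by rewrite lt_def s0'.
pose P (x y s : R) := p x = q x <-> p (x + s) = q (x + s).
suff : P x 0 s by move=> [+ _].
apply: square_induction => //.
  move=> x' y' s' s'0; rewrite /P => h1 h2 _ _; rewrite h1 h2.
  by rewrite -addrA (_ : s' / 2 + s' / 2 = s') //; field.
move=> c d hc _.
have [W [S [oW Wr WL [oS tS fS bS]]]] := cov_even (cov_range (p c)).
have [s1 S1 s1p] := fS _ Wr.
have [s2 S2 s2q] : exists2 s, S s & s (q c) by apply: fS; rewrite -fpq.
have [d1 d10 h1] := contP_open cp hc (oS _ S1) s1p.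
have [d2 d20 h2] := contP_open cq hc (oS _ S2) s2q.
exists (Num.min d1 d2); first by rewrite lt_min d10.
move=> x' y' s' s'0; rewrite lt_min => /andP[sd1 sd2] hc' _ i1 i2 _ _.
have key t t' : x' <= t <= x' + s' -> x' <= t' <= x' + s' -> p t = q t -> p t' = q t'.
  move=> ht ht' pq.
  have near u : x' <= u <= x' + s' -> [/\ x <= u <= x + s, s1 (p u) & s2 (q u)].
    move=> hu; have hu' : x <= u <= x + s by clear -fcov hu i1 i2; lra.
    have uc : `|u - c| <= s' by rewrite ler_norml; clear -fcov hu hc'; lra.
    by split => //; [apply: h1|apply: h2] => //; exact: le_lt_trans uc _.
  have [_ a1 a2] := near t ht; have [h b1 b2] := near t' ht'.
  have s12 : s1 = s2 by apply: (tS _ _ (p t)) => //; rewrite pq.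
  have [_ inj _ _] := bS _ S1; apply: inj => //; first by rewrite s12.
  exact: fpq.
by split; apply: key; clear -fcov s'0; lra.
Qed.

Lemma sheet_lift (g : R -> T) x s (W : set T) (sh : set C) w : 0 < s -> contT g x s ->
  (forall t, x <= t <= x + s -> W (g t)) -> open sh ->
  [/\ forall y, sh y -> W (f y),
        forall y y', sh y -> sh y' -> f y = f y' -> y = y',
        forall w, W w -> exists2 y, sh y & f y = w &
        forall O, open O -> O `<=` sh -> open (f @` O)] ->
  sh w -> f w = g x ->
  exists p, [/\ p x = w, forall t, x <= t <= x + s -> f (p t) = g t /\ sh (p t) & contP p x s].
Proof.
move=> s0 cg Wg osh [h1 h2 h3 h4] shw fw.
have ex t : exists y, x <= t <= x + s -> sh y /\ f y = g t.
  have [ht|ht] := pselect (x <= t <= x + s); last by exists 0.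
  by have [y y1 y2] := h3 _ (Wg t ht); exists y.
have [p pP] := choice ex.
exists p; split.
- have hx : x <= x <= x + s by clear -fcov s0; lra.
  by have [a b] := pP x hx; apply: h2 => //; rewrite b fw.
- by move=> t /pP[].
- move=> t ht e e0; have [a b] := pP t ht.
  pose O := sh `&` [set y | nrm (y - p t) < e].
  have oO : open O.
    by apply: openI => //; exact: open_nball.
  have [d d0 dP] := cg t ht _ (h4 O oO (@subIsetl _ _ _)) ltac:(by exists (p t) => //; split => //=; rewrite subrr nrm0).
  exists d => // t' ht' l; have [y [sy ny] fy] := dP t' ht' l.
  have [a' b'] := pP t' ht'.
  by have -> : p t' = y by apply: h2 => //; rewrite b' fy.
Qed.

Lemma contT_sub g x s x' s' : contT g x s -> x <= x' -> x' + s' <= x + s -> contT g x' s'.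
Proof.
move=> cp h1 h2 t ht U oU Ut; have [d d0 dP] := cp t ltac:(clear -fcov ht h1 h2; lra) U oU Ut.
by exists d => // t' ht'; apply: dP; clear -fcov ht' h1 h2; lra.
Qed.

(** The induction quantifies over the starting point above g x, so that the lift over the second
    half can start where the first one ends. *)
Lemma path_lift (g : R -> T) x s w : 0 < s -> contT g x s ->
  (forall t, x <= t <= x + s -> L (g t)) -> f w = g x ->
  exists p, [/\ p x = w, forall t, x <= t <= x + s -> f (p t) = g t & contP p x s].
Proof.
move=> s0 cg Lg.
pose P (x y s : R) := forall w, f w = g x ->
  exists p, [/\ p x = w, forall t, x <= t <= x + s -> f (p t) = g t & contP p x s].
suff : P x 0 s by move=> h /h.
apply: square_induction => //.
  move=> x' y' s' s'0 h1 h2 _ _ w' fw.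
  have [p [p1 p2 p3]] := h1 w' fw; set m := x' + s' / 2 in h2.
  have mE : m = x' + s' / 2 by [].
  have e1 : m + s' / 2 = x' + s' by rewrite /m; field.
  have [q [q1 q2 q3]] := h2 (p m) ltac:(apply: p2; rewrite /m; clear -fcov s'0; lra).
  rewrite e1 in q2; rewrite /contP e1 in q3; rewrite /contP -/m in p3.
  exists (fun t => if t <= m then p t else q t); split.
  - by rewrite (_ : x' <= m) // /m; clear -fcov s'0; lra.
  - move=> t ht; case: (lerP t m) => tm; first by apply: p2; clear -fcov ht tm mE s'0; lra.
    by apply: q2; clear -fcov ht tm mE s'0; lra.
  - move=> t ht e e0; case: (lerP t m) => tm.
      have [d1 d10 h1'] := p3 t ltac:(clear -fcov ht tm mE s'0; lra) e e0.
      have [d2 d20 h2'] := q3 m ltac:(clear -fcov s'0 mE; lra) e e0.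
      have [tm'|tm'] := eqVneq t m.
        exists (Num.min d1 d2); first by rewrite lt_min d10.
        move=> t' ht'; rewrite lt_min => /andP[l1 l2]; case: (lerP t' m) => t'm.
          by apply: h1' => //; clear -fcov ht' t'm mE s'0; lra.
        by rewrite tm' -q1; apply: h2'; [clear -fcov ht' t'm mE s'0; lra|rewrite -tm'].
      have tlt : t < m by rewrite lt_def eq_sym tm'.
      exists (Num.min d1 (m - t)); first by rewrite lt_min d10 subr_gt0.
      move=> t' ht'; rewrite lt_min => /andP[l1 l2]; case: (lerP t' m) => t'm.
        by apply: h1' => //; clear -fcov ht' t'm mE s'0; lra.
      by have := ler_norm (t' - t); move: l2 t'm; clear -fcov; lra.
    have [d2 d20 h2'] := q3 t ltac:(clear -fcov ht tm mE s'0; lra) e e0.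
    exists (Num.min d2 (t - m)); first by rewrite lt_min d20 subr_gt0.
    move=> t' ht'; rewrite lt_min => /andP[l1 l2]; case: (lerP t' m) => t'm.
      by have := ler_norm (t - t'); rewrite distrC; move: l2 t'm; clear -fcov; lra.
    by apply: h2' => //; clear -fcov ht' t'm mE s'0; lra.
move=> c d hc _.
have [W [S [oW Wr WL [oS tS fS bS]]]] := cov_even (Lg c hc).
have [dl dl0 dP] := cg c hc W oW Wr.
exists dl => // x' y' s' s'0 s'd hc' _ i1 i2 _ _ w' fw.
have Wg t : x' <= t <= x' + s' -> W (g t).
  move=> ht; apply: dP; first by clear -fcov ht i1 i2; lra.
  have : `|t - c| <= s' by rewrite ler_norml; clear -fcov ht hc'; lra.
  by move: s'd; clear -fcov; lra.
have [sh Ssh shw] : exists2 s, S s & s w'.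
  by apply: fS; rewrite fw; apply: Wg; clear -fcov s'0; lra.
have [p [p1 p2 p3]] := sheet_lift s'0 (contT_sub cg i1 i2) Wg (oS _ Ssh) (bS _ Ssh) shw fw.
by exists p; split => // t /p2[].
Qed.

(** The plane is star-shaped: tau z is the end of the lift of the path t |-> g (t z). *)
Lemma map_lift (g : C -> T) (w0 : C) : continuous g -> (forall z, L (g z)) -> f w0 = g 0 ->
  exists tau : C -> C, [/\ tau 0 = w0, forall z, f (tau z) = g z & forall z, ccont tau z].
Proof.
move=> cg Lg fw0.
have cg' z U : open U -> U (g z) -> exists2 e : R, 0 < e & forall w, nrm (w - z) < e -> U (g w).
  by move=> oU Uz; apply/nbhs_nrm; apply: cg; exact: open_nbhs_nbhs.
have cray z x s : contT (fun t => g (rC t * z)) x s.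
  move=> t _ U oU Ut; have [e e0 eP] := cg' _ U oU Ut; have nz := nrm_ge0 z.
  exists (e / (nrm z + 1)); first by rewrite divr_gt0 //; clear -fcov nz; lra.
  move=> t' _; rewrite ltr_pdivlMr; last by clear -fcov nz; lra.
  move=> l; apply: eP; rewrite -mulrBl -rCB nrmM nrm_rC.
  by move: l (normr_ge0 (t' - t)); clear -fcov; lra.
have ex z : exists p, [/\ p 0 = w0, forall t, 0 <= t <= 0 + 1 -> f (p t) = g (rC t * z) & contP p 0 1].
  by apply: path_lift => //; rewrite rC0 mul0r.
have [p pP] := choice ex.
exists (fun z => p z 1); split.
- have [p1 p2 p3] := pP 0.
  have := @lift_unique (p 0) (fun=> w0) 0 1 ler01 p3; rewrite add0r; apply => //.
    by move=> t _ e e0; exists 1 => // t' _ _; rewrite subrr nrm0.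
  by move=> t ht; have := p2 t; rewrite add0r => /(_ ht) ->; rewrite mulr0 -fw0.
- move=> z; have [p1 p2 p3] := pP z.
  by rewrite p2 ?rC1 ?mul1r // add0r ler01 lexx.
- move=> z.
  (* Continuity in z of the lift at time x is propagated from x = 0 to x = 1 along the ray. *)
  pose cont x := forall e : R, 0 < e -> exists2 d : R, 0 < d &
    forall h, nrm h < d -> nrm (p (z + h) x - p z x) < e.
  pose P (x y s : R) := cont x -> cont (x + s).
  have [p1 p2 p3] := pP z.
  suff : P 0 0 1.
    rewrite /P add0r; apply=> e e0; exists 1 => // h _.
    by have [-> _ _] := pP (z + h); rewrite p1 subrr nrm0.
  apply: square_induction => //.
    move=> x' y' s' s'0; rewrite /P => h1 h2 _ _ /h1 /h2.
    by rewrite -addrA (_ : s' / 2 + s' / 2 = s') //; field.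
  move=> c d hc _.
  have [W [S [oW Wr WL [oS tS fS bS]]]] := cov_even (Lg (rC c * z)).
  have [sh Ssh shc] : exists2 s, S s & s (p z c) by apply: fS; rewrite p2.
  have [sh1 sh2 sh3 sh4] := bS _ Ssh.
  have [eta eta0 etaP] := cg' _ W oW Wr.
  have [d1 d10 h1] := contP_open p3 hc (oS _ Ssh) shc.
  have nz := nrm_ge0 z.
  exists (Num.min d1 (eta / 2 / (nrm z + 1))).
    by rewrite lt_min d10 !divr_gt0 //; clear -fcov nz; lra.
  move=> x y s s0; rewrite lt_min => /andP[sd1 sd2] hc' _ i1 i2 _ _ cx.
  rewrite ltr_pdivlMr in sd2; last by clear -fcov nz; lra.
  have tc t : x <= t <= x + s -> `|t - c| <= s by move=> ht; rewrite ler_norml; clear -fcov ht hc'; lra.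
  have Wz h t : nrm h < eta / 2 -> x <= t <= x + s -> W (g (rC t * (z + h))).
    move=> he ht; apply: etaP.
    rewrite (_ : _ - _ = rC (t - c) * z + rC t * h); last by rewrite rCB; ring.
    apply: le_lt_trans (nrmD _ _) _; rewrite !nrmM !nrm_rC.
    have : `|t| <= 1 by rewrite ler_norml; clear -fcov ht i1 i2; lra.
    have := tc t ht; have := nrm_ge0 h; have := normr_ge0 t; have := normr_ge0 (t - c).
    by move: he sd2 nz; clear -fcov; nra.
  have sx : sh (p z x).
    by apply: h1; [clear -fcov i1 i2 s0; lra|apply: le_lt_trans (tc x _) sd1; clear -fcov s0; lra].
  have sxs : sh (p z (x + s)).
    by apply: h1; [clear -fcov i1 i2 s0; lra|apply: le_lt_trans (tc _ _) sd1; clear -fcov s0; lra].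
  have [e2 e20 e2P] : exists2 e : R, 0 < e & forall w, nrm (w - p z x) < e -> sh w.
    by have /openP_nrm := oS _ Ssh; exact.
  have [d2 d20 d2P] := cx e2 e20.
  move=> e e0.
  pose O := sh `&` [set y | nrm (y - p z (x + s)) < e].
  have oO : open O.
    by apply: openI; [exact: oS|exact: open_nball].
  have Og : (f @` O) (g (rC (x + s) * z)).
    exists (p z (x + s)); first by split => //=; rewrite subrr nrm0.
    by apply: p2; clear -fcov i1 i2 s0; lra.
  have [d3 d30 d3P] := cg' _ _ (sh4 O oO (@subIsetl _ _ _)) Og.
  exists (Num.min (eta / 2) (Num.min d2 d3)); first by rewrite !lt_min d20 d30 divr_gt0.
  move=> h; rewrite !lt_min => /and3P[l1 l2 l3].
  have [q1 q2 q3] := pP (z + h).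
  have shx : sh (p (z + h) x) by apply: e2P; exact: d2P.
  have fx : f (p (z + h) x) = g (rC x * (z + h)) by apply: q2; clear -fcov i1 i2 s0; lra.
  (* The lift of the neighbouring ray inside the sheet [sh] coincides with p (z + h) by uniqueness,
     so p (z + h) stays in [sh]. *)
  have [r [r1 r2 r3]] := sheet_lift s0 (cray (z + h) x s) (fun t => Wz h t l1)
    (oS _ Ssh) (bS _ Ssh) shx fx.
  have E : r (x + s) = p (z + h) (x + s).
    apply: lift_unique => //; first exact: ltW.
      exact: contP_sub q3 i1 i2.
    by move=> t ht; have [-> _] := r2 t ht; rewrite q2 //; clear -fcov ht i1 i2; lra.
  have [|y' [sy' ny'] fy'] := d3P (rC (x + s) * (z + h)).
    rewrite -mulrBr [z + h]addrC addrK nrmM nrm_rC ger0_norm; last by clear -fcov i1 s0; lra.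
    have := nrm_ge0 h; have : x + s <= 1 by clear -fcov i2; lra.
    have : 0 <= x + s by clear -fcov i1 s0; lra.
    by move: l3; clear -fcov; nra.
  have [r4 r5] := r2 (x + s) ltac:(clear -fcov s0; lra).
  by rewrite -E; have -> : r (x + s) = y' by apply: sh2 => //; rewrite r4 fy'.
Qed.

Lemma map_lift_unique (tau sig : C -> C) (z0 : C) : (forall z, ccont tau z) ->
  (forall z, ccont sig z) -> (forall z, f (tau z) = f (sig z)) -> tau z0 = sig z0 ->
  forall z, tau z = sig z.
Proof.
move=> ct cs fts t0 z.
have cpath (h : C -> C) : (forall z, ccont h z) -> contP (fun t => h (z0 + rC t * (z - z0))) 0 1.
  move=> ch t _ e e0; have [d d0 dP] := ch (z0 + rC t * (z - z0)) e e0.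
  have nz := nrm_ge0 (z - z0).
  exists (d / (nrm (z - z0) + 1)); first by rewrite divr_gt0 //; clear -fcov nz; lra.
  move=> t' _; rewrite ltr_pdivlMr; last by clear -fcov nz; lra.
  move=> l; have := dP (rC (t' - t) * (z - z0)).
  rewrite (_ : z0 + _ + _ = z0 + rC t' * (z - z0)); last by rewrite rCB; ring.
  by apply; rewrite nrmM nrm_rC; move: l (normr_ge0 (t' - t)); clear -fcov; lra.
have := lift_unique ler01 (cpath _ ct) (cpath _ cs).
rewrite add0r rC1 rC0 mul1r mul0r addr0 [z0 + (_ - _)]addrC subrK; exact.
Qed.

Lemma deck_translation (y0 y1 : C) :
  (forall tau : C -> C, (forall z, ccont tau z) -> (forall z, f (tau z) = f z) ->
     forall z, holo tau z) ->
  f y0 = f y1 -> forall y, f (y + (y1 - y0)) = f y.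
Proof.
move=> hol fy.
(* The map f is lifted through itself; the shift by a brings the base point to 0, where [map_lift]
   starts. *)
have deck a b : f a = f b -> exists tau : C -> C, [/\ tau a = b, forall z, f (tau z) = f z & forall z, ccont tau z].
  move=> fab; have [_ cf _] := fcov.
  have [|||tau [t1 t2 t3]] := @map_lift (fun u => f (a + u)) b.
  - move=> u; apply: (@continuous_comp _ _ _ (fun u => a + u) f); last exact: cf.
    apply/(@continuous_nrm R C C) => e e0; exists e => // w.
    by rewrite opprD addrACA subrr add0r.
  - by move=> z; exact: cov_range.
  - by rewrite addr0.
  exists (fun z => tau (z - a)); split; first by rewrite subrr.
    by move=> z; rewrite t2 addrC subrK.
  move=> z e e0; have [d d0 dP] := t3 (z - a) e e0; exists d => // h hd.
  by rewrite addrAC; exact: dP.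
have [tau [ta tf tc]] := deck _ _ fy; have [sig [sa sf sc]] := deck _ _ (esym fy).
have ccomp (g h : C -> C) : (forall z, ccont g z) -> (forall z, ccont h z) ->
    forall z, ccont (fun z => g (h z)) z.
  move=> cg ch z e e0; have [d d0 dP] := cg (h z) e e0; have [d' d'0 d'P] := ch z d d0.
  by exists d' => // k kd; have := dP _ (d'P k kd); rewrite (addrC (h z)) subrK.
have cid z : ccont (fun z : C => z) z by apply: holo_ccont; exists 1; exact: cderiv_id.
have sK : cancel sig tau.
  apply: (map_lift_unique (z0 := y1)); [exact: ccomp|exact: cid| |by rewrite sa ta].
  by move=> z; rewrite tf sf.
have tK : cancel tau sig.
  apply: (map_lift_unique (z0 := y0)); [exact: ccomp|exact: cid| |by rewrite ta sa].
  by move=> z; rewrite sf tf.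
have [a aP] := automorphism_affine (hol _ tc tf) (hol _ sc sf) tK sK.
have a1 : a = 1.
  apply/eqP; apply: contraT => a1; have a1' : 1 - a != 0 by rewrite subr_eq0 eq_sym.
  (* A factor a <> 1 produces a fixed point; uniqueness of lifts then makes tau the identity, so a =
     1 after all. *)
  have fix0 : tau (tau 0 / (1 - a)) = tau 0 / (1 - a) by rewrite aP; field.
  have H := map_lift_unique tc cid tf fix0.
  have := aP 1; rewrite !H add0r mulr1 => ae; by rewrite ae eqxx in a1.
have tE z : tau z = z + (y1 - y0).
  by have := ta; rewrite (aP z) (aP y0) a1 !mul1r => <-; ring.
by move=> y; rewrite -tE tf.
Qed.

End Covering.

(** * Real derivatives, completeness, inverse functions *)

Section RealDerivatives.
Context {R : realType}.
Local Notation C := (Cplx R).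

Definition rder (V W : normedModType C) (phi : V -> W) (z v : V) (d : W) :=
  forall e : R, 0 < e -> exists2 dl : R, 0 < dl & forall t : R, `|t| < dl ->
    nrm (phi (z + rC t *: v) - phi z - rC t *: d) <= e * `|t|.

Lemma rder_rquot (V W : normedModType C) (phi : V -> W) (z v : V) (d : W) :
  rder phi z v d <-> rquot phi v z @ (0 : R)^' --> d.
Proof.
have key (t : R) : t != 0 -> nrm (rquot phi v z t - d) * `|t| =
    nrm (phi (z + rC t *: v) - phi z - rC t *: d).
  move=> t0; rewrite -nrm_rC mulrC -nrmZ scalerBr /rquot -/(rC t) -/(rC t^-1) rCV.
  by rewrite scalerA divff ?scale1r // rC_eq0.
split=> H.
  move=> A /nbhs_nrm [e e0 eA]; have [dl dl0 dP] := H (e / 2) ltac:(lra).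
  apply/nbhsR; exists dl => // t; rewrite subr0 => td t0.
  apply: eA; have nt : 0 < `|t| by rewrite normr_gt0.
  have := dP t td; rewrite -key // ler_pM2r // => h; apply: le_lt_trans h _.
  by clear -e0; lra.
move=> e e0; have /H /nbhsR[dl dl0 dP] : nbhs d [set y | nrm (y - d) < e].
  by apply/nbhs_nrm; exists e.
exists dl => // t td; have [->|t0] := eqVneq t 0.
  by rewrite rC0 !scale0r addr0 subrr subr0 nrm0 normr0 mulr0.
rewrite -key // ler_wpM2r //; apply: ltW; apply: (dP t) => //.
by rewrite subr0.
Qed.

Lemma rderivable_rder (V W : normedModType C) (phi : V -> W) (z v : V) :
  rderivable phi v z -> rder phi z v (rderive phi v z).
Proof. by move=> h; apply/rder_rquot. Qed.

Lemma rder_rderive (V W : normedModType C) (phi : V -> W) (z v : V) (d : W) :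
  rder phi z v d -> rderive phi v z = d.
Proof. by move=> /rder_rquot h; apply: cvg_lim => //; exact: norm_hausdorff. Qed.

Lemma rder_uniq (V W : normedModType C) (phi : V -> W) (z v : V) (d d' : W) :
  rder phi z v d -> rder phi z v d' -> d = d'.
Proof. by move=> /rder_rderive <- /rder_rderive. Qed.

Lemma rder_near (V W : normedModType C) (phi psi : V -> W) (z v : V) (d : W) (e : R) :
  0 < e -> (forall w, nrm (w - z) < e -> phi w = psi w) -> rder phi z v d -> rder psi z v d.
Proof.
move=> e0 E H k k0; have [dl dl0 dP] := H k k0; have nv := nrm_ge0 v.
exists (Num.min dl (e / (nrm v + 1))).
  by rewrite lt_min dl0 divr_gt0 //; clear -nv; lra.
move=> t; rewrite lt_min ltr_pdivlMr; last by clear -nv; lra.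
move=> /andP[t1 t2]; rewrite -!E ?subrr ?nrm0 //; first exact: dP.
rewrite addrC addKr nrmZ nrm_rC; move: t2 (normr_ge0 t); clear; lra.
Qed.

Lemma rderZ (V W : normedModType C) (phi : V -> W) (z v : V) (d : W) (b : R) :
  rder phi z v d -> rder phi z (rC b *: v) (rC b *: d).
Proof.
move=> H e e0; have nb := normr_ge0 b.
have [dl dl0 dP] := H (e / (`|b| + 1)) ltac:(by rewrite divr_gt0 //; clear -nb; lra).
exists (dl / (`|b| + 1)); first by rewrite divr_gt0 //; clear -nb; lra.
move=> t; rewrite ltr_pdivlMr; last by clear -nb; lra.
move=> tl; rewrite !scalerA -rCM.
have := dP (t * b); rewrite normrM => h.
have {}h := h ltac:(move: tl (normr_ge0 t); clear -nb; lra).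
apply: le_trans h _.
have : e / (`|b| + 1) * (`|b| + 1) = e by rewrite divfK // gt_eqF //; clear -nb; lra.
set q := e / _ => qE; have q0 : 0 <= q by rewrite /q divr_ge0 //; [exact: ltW|clear -nb; lra].
have : 0 <= q * `|t| by exact: mulr_ge0.
by rewrite -qE; clear; lra.
Qed.

Lemma differentiable_rder (V W : normedModType C) (phi : V -> W) (z v : V) :
  differentiable phi z -> rder phi z v ('d phi z v).
Proof.
move=> df e e0; have nv := nrm_ge0 v.
have [|dl dl0 dP] := diff_eps df (e := e / (nrm v + 1)).
  by rewrite divr_gt0 //; clear -nv; lra.
exists (dl / (nrm v + 1)); first by rewrite divr_gt0 //; clear -nv; lra.
move=> t; rewrite ltr_pdivlMr; last by clear -nv; lra.
move=> tl; have := dP (rC t *: v); rewrite nrmZ nrm_rC diffZv => h.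
have {}h := h ltac:(move: tl (normr_ge0 t); clear -nv; lra).
apply: le_trans h _; rewrite mulrCA mulrC ler_wpM2r //.
rewrite -[X in _ <= X]mulr1 -mulrA ler_wpM2l ?(ltW e0) //.
by rewrite mulrC ler_pdivrMr ?mul1r; clear -nv; lra.
Qed.

Lemma rder_chain (V W Z : normedModType C) (phi : V -> W) (psi : W -> Z) (z v : V) (d : W) :
  rder phi z v d -> differentiable psi (phi z) ->
  rder (fun w => psi (phi w)) z v ('d psi (phi z) d).
Proof.
move=> H df; have [K K0 KP] := diff_bounded df.
move=> e e0; have nd := nrm_ge0 d.
pose k := e / (nrm d + K + 2).
have k0 : 0 < k by rewrite divr_gt0 //; clear -nd K0; lra.
have kE : k * (nrm d + K + 2) = e by rewrite divfK // gt_eqF //; clear -nd K0; lra.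
pose k1 := Num.min 1 k; have k10 : 0 < k1 by rewrite lt_min ltr01.
have k1k : k1 <= k by rewrite ge_min lexx orbT.
have k11 : k1 <= 1 by rewrite ge_min lexx.
have [d1 d10 H1] := H k1 k10; have [d2 d20 H2] := diff_eps df k0.
exists (Num.min d1 (d2 / (nrm d + 2))).
  by rewrite lt_min d10 divr_gt0 //; clear -nd; lra.
move=> t; rewrite lt_min ltr_pdivlMr; last by clear -nd; lra.
move=> /andP[l1 l2]; have {}H1 := H1 t l1; have nt := normr_ge0 t.
pose w := phi (z + rC t *: v) - phi z; rewrite -/w in H1.
have B : nrm w <= (nrm d + 1) * `|t|.
  have := nrm_sub w (rC t *: d); rewrite nrmZ nrm_rC.
  have : k1 * `|t| <= 1 * `|t| by rewrite ler_wpM2r.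
  by move: H1; clear; lra.
have := H2 w ltac:(clear -B l2 nt d20; nra).
rewrite /w (addrC (phi z)) subrK -/w => {}H2.
have -> : psi (phi (z + rC t *: v)) - psi (phi z) - rC t *: 'd psi (phi z) d =
  (psi (phi (z + rC t *: v)) - psi (phi z) - 'd psi (phi z) w) +
  'd psi (phi z) (w - rC t *: d).
  have -> : 'd psi (phi z) (w - rC t *: d) = 'd psi (phi z) w - rC t *: 'd psi (phi z) d.
    by rewrite diffDv -scaleNr diffZv scaleNr.
  by rewrite addrA subrK.
apply: le_trans (nrmD _ _) _.
have s1 : k * nrm w <= k * ((nrm d + 1) * `|t|) by rewrite ler_wpM2l // ltW.
have s2 := KP (w - rC t *: d).
have s3 : K * nrm (w - rC t *: d) <= K * (k * `|t|).
  by rewrite ler_wpM2l //; apply: le_trans H1 _; rewrite ler_wpM2r.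
have s4 : 0 <= k * `|t| by rewrite mulr_ge0 // ltW.
rewrite -kE; move: H2 s1 s2 s3 s4; clear; lra.
Qed.

Lemma rmvt (V : normedModType C) (phi : V -> C) (w v : V) (g : R -> C) (c : C) (M : R) :
  (forall t, I01 t -> rder phi (w + rC t *: v) v (g t) /\ nrm (g t - c) <= M) ->
  nrm (phi (w + v) - phi w - c) <= M.
Proof.
move=> H.
have P : has_pder (fun t => phi (w + rC t *: v)) g.
  move=> t It e e0; have [dl dl0 dP] := (H t It).1 e e0; exists dl => // t' It' l.
  have := dP (t' - t) l.
  have -> : w + rC t *: v + rC (t' - t) *: v = w + rC t' *: v.
    by rewrite -addrA -scalerDl -rCD; congr (w + rC _ *: v); ring.
  exact.
have P2 : has_pder (fun t => rC t * c) (fun=> c).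
  move=> t _ e e0; exists 1 => // t' _ _; rewrite -mulrBl -rCB subrr nrm0.
  by rewrite mulr_ge0 // ltW.
have := pder_le (pderB P P2) (M := M).
rewrite rC1 rC0 !mul1r !mul0r scale0r scale1r addr0 subr0.
rewrite (_ : phi (w + v) - c - phi w = phi (w + v) - phi w - c); last by ring.
by apply => t It; exact: (H t It).2.
Qed.

Definition cont_at (V : normedModType C) (phi : V -> C) (z : V) :=
  forall e : R, 0 < e -> exists2 d : R, 0 < d &
    forall w, nrm (w - z) < d -> nrm (phi w - phi z) < e.

(** A step along u, then one along v: each is controlled by the mean value inequality and the
    continuity at z of the corresponding derivative. *)
Lemma C1_incr (V : normedModType C) (phi : V -> C) (z u v : V) (Du Dv : V -> C) (r : R) :
  0 < r -> (forall w, nrm (w - z) < r -> rder phi w u (Du w) /\ rder phi w v (Dv w)) ->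
  cont_at Du z -> cont_at Dv z ->
  forall e : R, 0 < e -> exists2 dl : R, 0 < dl & forall a b : R, `|a| < dl -> `|b| < dl ->
    nrm (phi (z + rC a *: u + rC b *: v) - phi z - (rC a * Du z + rC b * Dv z)) <=
      e * (`|a| + `|b|).
Proof.
move=> r0 H cu cv e e0; have nu := nrm_ge0 u; have nv := nrm_ge0 v.
have [d1 d10 h1] := cu e e0; have [d2 d20 h2] := cv e e0.
pose m := Num.min r (Num.min d1 d2).
have m0 : 0 < m by rewrite !lt_min r0 d10.
have mP x : x < m -> [/\ x < r, x < d1 & x < d2] by rewrite !lt_min => /and3P[].
exists (m / (nrm u + nrm v + 1)); first by rewrite divr_gt0 //; clear -nu nv; lra.
move=> a b; rewrite !ltr_pdivlMr; [|by clear -nu nv; lra..].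
move=> al bl.
have near (s t : R) : `|s| <= `|a| -> `|t| <= `|b| ->
    nrm (z + rC s *: u + rC t *: v - z) < m.
  move=> sa tb; rewrite addrAC [z + _]addrC addrK; apply: le_lt_trans (nrmD _ _) _.
  rewrite !nrmZ !nrm_rC.
  have k1 : `|s| * nrm u <= `|a| * nrm u by rewrite ler_wpM2r.
  have k2 : `|t| * nrm v <= `|b| * nrm v by rewrite ler_wpM2r.
  have [ab|ab] := lerP `|a| `|b|.
    have k3 : `|a| * nrm u <= `|b| * nrm u by rewrite ler_wpM2r.
    by move: k1 k2 k3 bl (normr_ge0 b); clear; lra.
  have k3 : `|b| * nrm v <= `|a| * nrm v by rewrite ler_wpM2r // ltW.
  by move: k1 k2 k3 al (normr_ge0 a); clear; lra.
have tI (t c : R) : I01 t -> `|t * c| <= `|c|.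
  by move=> /andP[t0 t1]; rewrite normrM ger0_norm // ler_piMl.
have na0 : `|0 : R| <= `|a| by rewrite normr0.
have nb0 : `|0 : R| <= `|b| by rewrite normr0.
have A1 : nrm (phi (z + rC a *: u) - phi z - rC a * Du z) <= `|a| * e.
  apply: (@rmvt _ _ _ _ (fun t => rC a * Du (z + rC (t * a) *: u))) => t It.
  have := near (t * a) 0 (tI _ _ It) nb0; rewrite rC0 scale0r addr0 => n1.
  have [k1 k2 k3] := mP _ n1.
  split; first by rewrite scalerA -rCM; apply: (rderZ a (H _ k1).1).
  by rewrite -mulrBr nrmM nrm_rC ler_wpM2l // ltW // h1.
have A2 : nrm (phi (z + rC a *: u + rC b *: v) - phi (z + rC a *: u) - rC b * Dv z) <= `|b| * e.
  apply: (@rmvt _ _ _ _ (fun t => rC b * Dv (z + rC a *: u + rC (t * b) *: v))) => t It.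
  have := near a (t * b) (lexx _) (tI _ _ It) => n1.
  have [k1 k2 k3] := mP _ n1.
  split; first by rewrite scalerA -rCM; apply: (rderZ b (H _ k1).2).
  by rewrite -mulrBr nrmM nrm_rC ler_wpM2l // ltW // h2.
rewrite (_ : _ - _ = (phi (z + rC a *: u + rC b *: v) - phi (z + rC a *: u) - rC b * Dv z) +
  (phi (z + rC a *: u) - phi z - rC a * Du z)); last by ring.
apply: le_trans (nrmD _ _) _.
by move: A1 A2; clear; lra.
Qed.

Lemma rder_additive (V : normedModType C) (phi : V -> C) (z u v : V) (Du Dv : V -> C) (r : R) :
  0 < r -> (forall w, nrm (w - z) < r -> rder phi w u (Du w) /\ rder phi w v (Dv w)) ->
  cont_at Du z -> cont_at Dv z -> rder phi z (u + v) (Du z + Dv z).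
Proof.
move=> r0 H cu cv e e0.
have [dl dl0 dP] := C1_incr r0 H cu cv (e := e / 2) ltac:(lra).
exists dl => // t tl; have := dP t t tl tl.
rewrite scalerDr addrA -mulrDr => h; apply: le_trans h _.
by clear; lra.
Qed.

(** [C1_incr] for the directions v and i v gives complex derivatives along complex lines, and
    [rder_additive] their additivity; [gd_taylor] then bounds the remainder uniformly in the
    direction. *)
Lemma cauchy_riemann (V : normedModType C) (phi : V -> C) (D : V -> V -> C) (O : set V) :
  open O ->
  (forall z v, O z -> [/\ rder phi z v (D v z), cont_at (D v) z & D ('i *: v) z = 'i * D v z]) ->
  (forall z, O z -> {for z, continuous phi}) ->
  forall z, O z -> differentiable phi z /\ forall v, 'd phi z v = D v z.
Proof.
move=> /openP_nrm oO H cphi.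
have dphi z v : O z -> gder phi z v (D v z).
  move=> Oz e e0; have [r r0 rP] := oO z Oz.
  have [||||dl dl0 dP] := @C1_incr V phi z v ('i *: v) (D v) (D ('i *: v)) r r0 _ _ _ (e / 2).
  - by move=> w /rP Ow; have [h1 _ _] := H w v Ow; have [h2 _ _] := H w ('i *: v) Ow.
  - by have [] := H z v Oz.
  - by have [] := H z ('i *: v) Oz.
  - by clear -e0; lra.
  exists dl => // s sl; rewrite add0r scale0r addr0.
  have [r1 r2] := ReIm_le s.
  have := dP (complex.Re s) (complex.Im s) (le_lt_trans r1 sl) (le_lt_trans r2 sl).
  have [_ _ ->] := H z v Oz.
  have sE : s = rC (complex.Re s) + rC (complex.Im s) * 'i.
    by rewrite {1}(ptE s) /pt [_ * 'i]mulrC.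
  have -> : z + rC (complex.Re s) *: v + rC (complex.Im s) *: ('i *: v) = z + s *: v.
    by rewrite scalerA -[LHS]addrA -scalerDl -sE.
  have -> : rC (complex.Re s) * D v z + rC (complex.Im s) * ('i * D v z) = s * D v z.
    by rewrite mulrA -mulrDl -sE.
  move=> h; apply: le_trans h _.
  by move: r1 r2; clear -e0; nra.
move=> z Oz; have [r0 r00 r0P] := oO z Oz.
have ghP w : nrm (w - z) < r0 -> ghol phi w.
  by move=> /r0P Ow v; exists (D v w); exact: dphi.
have [r [M [rr0 hb]]] := hball_exists r00 ghP (cphi z Oz).
have [r_gt0 _] := hb; have M0 := hball_ge0 hb.
have gdE v : gd phi z v = D v z by apply: gd_uniq; exact: dphi.
have DD u v : D (u + v) z = D u z + D v z.
  apply: rder_uniq (_ : rder phi z (u + v) _) _; first by have [] := H z (u + v) Oz.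
  apply: (rder_additive r00).
  - by move=> w /r0P Ow; have [? _ _] := H w u Ow; have [? _ _] := H w v Ow.
  - by have [] := H z u Oz.
  - by have [] := H z v Oz.
have DZ k u : D (k *: u) z = k * D u z.
  by rewrite -gdE; apply: gd_uniq; apply: gderZ; exact: dphi.
have K2 : 0 <= cK2 * M / r ^+ 2.
  apply: mulr_ge0; last by rewrite invr_ge0 exprn_ge0 // ltW.
  by apply: mulr_ge0 => //; apply: mulr_ge0; exact: cK1_ge0.
apply: (@diff_intro _ V C phi z (fun v => D v z) (cK1 * M / r)).
- by move=> k u v; rewrite DD DZ.
- move=> v; rewrite -gdE (_ : _ * nrm v = cK1 * M * nrm v / r); last by ring.
  by apply: (gd_le v hb); rewrite subrr nrm0 mulr_gt0.
move=> e e0; have [dl dl0 dP] := small_quad K2 e0.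
exists (Num.min dl r); first by rewrite lt_min dl0.
move=> h; rewrite lt_min => /andP[h1 h2]; rewrite -gdE.
have zz : nrm (z - z) < r by rewrite subrr nrm0.
have zh : nrm (z + h - z) < r by rewrite addrC addKr.
apply: le_trans (gd_taylor hb zz zh) _.
rewrite (_ : _ / r ^+ 2 = cK2 * M / r ^+ 2 * nrm h ^+ 2); last by ring.
by apply: dP => //; exact: nrm_ge0.
Qed.

End RealDerivatives.

(** * Completeness and Baire's theorem *)

Section Complete.
Context {R : realType}.
Local Notation C := (Cplx R).
Local Notation Re := (@complex.Re R).
Local Notation Im := (@complex.Im R).

Lemma nrm_coord (k : nat) (v : 'rV[C]_k) i : nrm (v 0 i) <= nrm v.
Proof.
apply/ler_addgt0Pr => e e0; apply: ltW.
have : ball (0 : 'rV[C]_k) (rC (nrm v + e)) v.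
  by rewrite -ball_normE /= sub0r normrN nrmE rC_lt ltrDl.
by case=> _ /(_ 0 i); rewrite -ball_normE /= mxE sub0r normrN nrmE rC_lt.
Qed.

Lemma nrm_rV_le (k : nat) (v : 'rV[C]_k) (e : R) : 0 <= e ->
  (forall i, nrm (v 0 i) <= e) -> nrm v <= e.
Proof.
move=> e0 H; apply/ler_addgt0Pr => d d0; apply: ltW.
have : ball (0 : 'rV[C]_k) (rC (e + d)) v.
  split; first by rewrite -[0]/(rC 0) rC_lt; move: e0 d0; lra.
  move=> i j; rewrite -ball_normE /= mxE sub0r normrN nrmE rC_lt ord1.
  by apply: le_lt_trans (H j) _; rewrite ltrDl.
by rewrite -ball_normE /= sub0r normrN nrmE rC_lt.
Qed.

Lemma nrm_pair (V W : normedModType C) (v : V) (w : W) : nrm (v, w) = Num.max (nrm v) (nrm w).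
Proof.
apply/eqP; rewrite -subr_eq0 -rC_eq0 rCB -nrmE subr_eq0; apply/eqP.
by rewrite prod_normE /= !nrmE maxEle rC_le maxEle; case: ifP.
Qed.

Lemma nrm_pair_le (V W : normedModType C) (v : V) (w : W) (e : R) :
  (nrm (v, w) <= e) = (nrm v <= e) && (nrm w <= e).
Proof. by rewrite nrm_pair ge_max. Qed.

Lemma nrm_pair_lt (V W : normedModType C) (v : V) (w : W) (e : R) :
  (nrm (v, w) < e) = (nrm v < e) && (nrm w < e).
Proof. by rewrite nrm_pair gt_max. Qed.

Lemma nest_real (a r : nat -> R) : (forall n, 0 <= r n) ->
  (forall n, `|a n.+1 - a n| <= r n - r n.+1) -> exists c, forall n, `|c - a n| <= r n.
Proof.
move=> r0 ar.
have H m k : a m - r m <= a (m + k)%N - r (m + k)%N /\ a (m + k)%N + r (m + k)%N <= a m + r m.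
  elim: k => [|k [h1 h2]]; first by rewrite addn0 !lexx.
  by have := ar (m + k)%N; rewrite addnS ler_norml => /andP[h3 h4]; split; lra.
have H2 m n : a m - r m <= a n + r n.
  have [mn|nm] := leqP m n.
    have [+ _] := H m (n - m)%N; rewrite subnKC // => h.
    by have := r0 n; move: h; clear; lra.
  have [_] := H n (m - n)%N; rewrite subnKC; last exact: ltnW.
  by have := r0 m; clear; lra.
pose A := [set a n - r n | n in setT].
have supA : has_sup A.
  by split; [exists (a 0%N - r 0%N); exists 0%N|exists (a 0%N + r 0%N) => _ [n _ <-]].
exists (sup A) => n; rewrite ler_norml.
have h1 : a n - r n <= sup A by apply: (ub_le_sup supA.2); exists n.
have h2 : sup A <= a n + r n by apply: ge_sup => [|_ [m _ <-]]; [exact: supA.1|].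
by apply/andP; split; move: h1 h2; clear; lra.
Qed.

(* The factor 2 comes from treating real and imaginary parts separately. *)
Definition nest_complete (V : normedModType C) := forall (x : nat -> V) (r : nat -> R),
  (forall n, 0 <= r n) -> (forall n, nrm (x n.+1 - x n) <= r n - r n.+1) ->
  exists c, forall n, nrm (c - x n) <= 2 * r n.

Lemma nest_C : nest_complete C.
Proof.
move=> x r r0 xr.
have [|a aP] := @nest_real (fun n => Re (x n)) r r0 _.
  by move=> n; apply: le_trans (xr n); rewrite -ReB; exact: (ReIm_le _).1.
have [|b bP] := @nest_real (fun n => Im (x n)) r r0 _.
  by move=> n; apply: le_trans (xr n); rewrite -ImB; exact: (ReIm_le _).2.
exists (Complex a b) => n; apply: le_trans (nrm_le_ReIm _) _; rewrite ReB ImB /=.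
by have := aP n; have := bP n; clear; lra.
Qed.

Lemma nest_rV k : nest_complete ('rV[C]_k).
Proof.
move=> x r r0 xr.
have ex i : exists c : C, forall n, nrm (c - x n 0 i) <= 2 * r n.
  apply: (@nest_C (fun n => x n 0 i) r r0) => n; apply: le_trans (xr n).
  by have := nrm_coord (x n.+1 - x n) i; rewrite !mxE.
have [c cP] := choice ex.
exists (\row_i c i) => n; apply: nrm_rV_le; first by rewrite mulr_ge0.
by move=> i; rewrite !mxE; exact: cP.
Qed.

Lemma nest_prod (V W : normedModType C) : nest_complete V -> nest_complete W ->
  nest_complete (V * W)%type.
Proof.
move=> nV nW x r r0 xr.
have [|a aP] := nV (fun n => (x n).1) r r0 _.
  move=> n; apply: le_trans (xr n); rewrite [x n.+1 - x n]surjective_pairing nrm_pair /=.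
  by rewrite le_max lexx.
have [|b bP] := nW (fun n => (x n).2) r r0 _.
  move=> n; apply: le_trans (xr n); rewrite [x n.+1 - x n]surjective_pairing nrm_pair /=.
  by rewrite le_max lexx orbT.
exists (a, b) => n; rewrite [_ - x n]surjective_pairing nrm_pair_le /=.
by apply/andP; split.
Qed.

(** Baire's theorem: the boundaries of countably many closed sets P n leave a point of O uncovered.
    The n-th ball is shrunk until P n is constantly true or constantly false on it. *)
Lemma baire_boundary (V : normedModType C) (O : set V) (P : nat -> V -> Prop) (x0 : V) :
  nest_complete V -> open O -> O x0 ->
  (forall n x, O x -> ~ P n x -> exists2 d : R, 0 < d &
     forall x', nrm (x' - x) < d -> ~ P n x') ->
  exists2 x, O x & forall n, P n x -> exists2 d : R, 0 < d &
     forall x', nrm (x' - x) < d -> P n x'.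
Proof.
move=> nV /openP_nrm oO Ox0 cP.
have [r0 r00 r0P] := oO x0 Ox0.
(* The limit point is within 2 r of each centre, so the ball of radius 3 r contains a ball of radius
   r around the limit. *)
pose inv (q : V * R) := 0 < q.2 /\ forall y, nrm (y - q.1) < 3 * q.2 -> O y.
pose good n (q : V * R) := (forall y, nrm (y - q.1) < 3 * q.2 -> P n y) \/
  (forall y, nrm (y - q.1) < 3 * q.2 -> ~ P n y).
(* The centre moves by at most r / 2 while the radius drops by at least 3 r / 4, as [nest_complete]
   demands. *)
have step (nq : nat * (V * R)) : exists q', inv nq.2 -> [/\ inv q', good nq.1 q',
    q'.2 <= nq.2.2 / 4 & nrm (q'.1 - nq.2.1) <= nq.2.2 / 2].
  case: nq => n q /=.
  have [[q0 qO]|] := pselect (inv q); last by exists q.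
  have [all|] := pselect (forall y, nrm (y - q.1) < q.2 -> P n y).
    exists (q.1, q.2 / 4) => _; split => //=.
    - split => /=; first by rewrite divr_gt0.
      by move=> y yq; apply: qO; move: yq; clear -q0; lra.
    - by left => /= y yq; apply: all; move: yq; clear -q0; lra.
    - by rewrite subrr nrm0 divr_ge0 // ltW.
  have [[y [yq NP]] _|N] := pselect (exists y, nrm (y - q.1) < q.2 / 2 /\ ~ P n y).
    have Oy : O y by apply: qO; move: yq; clear -q0; lra.
    have [d d0 dP] := cP n y Oy NP.
    pose r := Num.min (q.2 / 4) (d / 3).
    have r_gt0 : 0 < r by rewrite lt_min !divr_gt0.
    have [rq rd] : r <= q.2 / 4 /\ r <= d / 3 by rewrite !ge_min !lexx orbT.
    exists (y, r) => _; split => //=.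
    - split => //= z zy; apply: qO; have := nrm_dist z y q.1.
      by move: zy yq rq; clear -q0; lra.
    - by right => /= z zy; apply: dP; move: zy rd; clear -q0; lra.
    - exact: ltW.
  move=> _; exists (q.1, q.2 / 8) => _; split => //=.
  - split => /=; first by rewrite divr_gt0.
    by move=> y yq; apply: qO; move: yq; clear -q0; lra.
  - left => /= y yq; apply: contrapT => NP; apply: N; exists y; split => //.
    by move: yq; clear -q0; lra.
  - by clear -q0; lra.
  - by rewrite subrr nrm0 divr_ge0 // ltW.
have [nx nxP] := choice step.
pose q := fix q n := if n is m.+1 then nx (m, q m) else (x0, r0 / 3).
have qi n : inv (q n).
  elim: n => [|n ih]; last by have [] := nxP (n, q n) ih.
  split => /=; first by rewrite divr_gt0.
  by move=> y yx; apply: r0P; move: yx; clear; lra.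
have [c cq] : exists c, forall n, nrm (c - (q n).1) <= 2 * (q n).2.
  apply: nV => n; first by apply: ltW; case: (qi n).
  have [_ _ h1 h2] := nxP (n, q n) (qi n); rewrite /= in h1 h2.
  have [q0 _] := qi n.
  by apply: le_trans h2 _; move: h1 q0; clear; rewrite /=; lra.
exists c; first by have [q0 qO] := qi 0%N; apply: qO; have := cq 0%N; move: q0; clear; lra.
move=> n Pc; have [_ gd _ _] := nxP (n, q n) (qi n).
have [q0 _] := qi n.+1; have cn := cq n.+1.
case: gd => gd.
  exists (q n.+1).2 => // x' x'c; apply: (gd x').
  by have := nrm_dist x' c (q n.+1).1; move: cn x'c; rewrite /=; clear; lra.
by exfalso; apply: (gd c) => //; move: cn q0; rewrite /=; clear; lra.
Qed.

End Complete.

(** * The inverse function theorem *)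

Section InverseFunction.
Context {R : realType}.
Local Notation C := (Cplx R).

(** The Taylor remainder at z costs K nrm (z' - z), and moving the derivative from z to z0 costs K
    nrm (z - z0); with both points within dl of z0 this makes 3 K dl. *)
Lemma strict_diff (V : normedModType C) (phi : V -> C) (z0 : V) (r0 : R) : 0 < r0 ->
  (forall z, nrm (z - z0) < r0 -> differentiable phi z) ->
  forall e : R, 0 < e -> exists2 dl : R, 0 < dl & forall z z',
    nrm (z - z0) < dl -> nrm (z' - z0) < dl ->
    nrm (phi z' - phi z - 'd phi z0 (z' - z)) <= e * nrm (z' - z).
Proof.
move=> r00 df e e0.
have dz0 : differentiable phi z0 by apply: df; rewrite subrr nrm0.
have [r [M [rr0 hb]]] := hball_exists r00 (fun z h => differentiable_ghol (df z h))
  (differentiable_continuous dz0).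
have [r_gt0 _] := hb; have M0 := hball_ge0 hb.
pose K := cK2 * M / r ^+ 2.
have K0 : 0 <= K.
  apply: mulr_ge0; last by rewrite invr_ge0 exprn_ge0 // ltW.
  by apply: mulr_ge0 => //; apply: mulr_ge0; exact: cK1_ge0.
have K31 : 0 < 3 * K + 1 by clear -K0; lra.
exists (Num.min r (e / (3 * K + 1))); first by rewrite lt_min r_gt0 divr_gt0.
move=> z z'; rewrite !lt_min !ltr_pdivlMr // => /andP[z1 z2] /andP[z1' z2'].
have zz0 : nrm (z0 - z0) < r by rewrite subrr nrm0.
have h1 := @gd_taylor _ _ _ _ _ _ z (z' - z) hb z1.
rewrite (addrC z) subrK in h1; have {}h1 := h1 z1'.
have h2 := gd_lip2 (z' - z) hb zz0 z1; rewrite (gd_diff _ dz0) in h2.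
have -> : phi z' - phi z - 'd phi z0 (z' - z) =
  (phi z' - phi z - gd phi z (z' - z)) + (gd phi z (z' - z) - 'd phi z0 (z' - z)) by ring.
apply: le_trans (nrmD _ _) _.
have n := nrm_dist z' z0 z; rewrite (nrmC z0) in n.
have nz := nrm_ge0 (z' - z).
have a1 : cK2 * M * nrm (z' - z) ^+ 2 / r ^+ 2 = K * nrm (z' - z) * nrm (z' - z) by rewrite /K; ring.
have a2 : cK2 * M * nrm (z' - z) * nrm (z - z0) / r ^+ 2 = K * nrm (z - z0) * nrm (z' - z).
  by rewrite /K; ring.
rewrite a1 in h1; rewrite a2 in h2.
apply: le_trans (lerD h1 h2) _; rewrite -mulrDl ler_wpM2r //.
have nz0 := nrm_ge0 (z - z0); have nz0' := nrm_ge0 (z' - z0).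
have : K * nrm (z' - z) <= K * (nrm (z' - z0) + nrm (z - z0)) by rewrite ler_wpM2l.
by move: z2 z2'; clear -nz0 nz0'; lra.
Qed.

(** Newton's iteration with the derivative frozen at z0: x - B (f x - w). Strict differentiability
    with e = 1 / (2 KB) halves the steps, and the same estimate gives injectivity. *)
Lemma newton (V W : normedModType C) (f : V -> W) (A : V -> W) (B : W -> V) (KA KB : R) (z0 : V) :
  nest_complete V ->
  (forall u v, A (u - v) = A u - A v) -> (forall v, nrm (A v) <= KA * nrm v) ->
  (forall u v, B (u - v) = B u - B v) -> (forall w, nrm (B w) <= KB * nrm w) ->
  0 <= KA -> 0 < KB -> cancel A B -> cancel B A ->
  (forall e : R, 0 < e -> exists2 dl : R, 0 < dl & forall z z',
    nrm (z - z0) < dl -> nrm (z' - z0) < dl ->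
    nrm (f z' - f z - A (z' - z)) <= e * nrm (z' - z)) ->
  exists2 r : R, 0 < r &
    (forall z z', nrm (z - z0) < r -> nrm (z' - z0) < r -> f z = f z' -> z = z') /\
    (forall dl : R, 0 < dl -> exists2 eta : R, 0 < eta & forall w, nrm (w - f z0) < eta ->
      exists2 z, nrm (z - z0) < dl & f z = w).
Proof.
move=> nV Ab AK Bb BK KA0 KB0 AB BA sd.
have A0 : A 0 = 0 by rewrite -(subrr (0 : V)) Ab subrr.
have AN v : A (- v) = - A v by rewrite -[- v]sub0r Ab A0 sub0r.
have [r r0 rP] := sd (KB^-1 / 2) ltac:(by rewrite divr_gt0 ?invr_gt0).
have contr z z' : nrm (z - z0) < r -> nrm (z' - z0) < r ->
    nrm (B (f z' - f z - A (z' - z))) <= nrm (z' - z) / 2.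
  move=> h1 h2; apply: le_trans (BK _) _.
  have := rP z z' h1 h2; rewrite -(ler_pM2l KB0) => h; apply: le_trans h _.
  by rewrite !mulrA divff ?mul1r ?gt_eqF // mulrC.
exists r => //; split.
  move=> z z' h1 h2 fz; have := contr z z' h1 h2.
  rewrite fz subrr sub0r -AN AB nrmN => h.
  have /eqP : nrm (z' - z) == 0 by rewrite eq_le nrm_ge0 andbT; move: h; clear; lra.
  by move=> /eqP; rewrite nrm_eq0 subr_eq0 => /eqP.
move=> dl dl0; pose m := Num.min dl r; have m0 : 0 < m by rewrite lt_min dl0.
have [mdl mr] : m <= dl /\ m <= r by rewrite !ge_min !lexx orbT.
(* The steps add up to at most rho = 2 KB nrm (f z0 - w) < m / 4, and [nest_complete] loses a factor
   2. *)
exists (m / 8 / KB); first by rewrite !divr_gt0.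
move=> w; rewrite ltr_pdivlMr // => wl.
pose x := fix x n := if n is k.+1 then x k - B (f (x k) - w) else z0.
pose rho := 2 * (KB * nrm (f z0 - w)).
have rho0 : 0 <= rho by rewrite !mulr_ge0 ?nrm_ge0 // ltW.
have rhom : rho < m / 4 by rewrite /rho nrmC mulrC; move: wl; clear; lra.
pose s n := rho / 2 ^+ n.
have s0 n : 0 <= s n by rewrite divr_ge0 // exprn_ge0.
have sS n : s n.+1 = s n / 2 by rewrite /s exprSr invfM mulrA.
have x0E : x 0%N = z0 by [].
have xS n : x n.+1 - x n = - B (f (x n) - w) by rewrite /= addrAC subrr add0r.
have Bx n : nrm (x n - z0) <= rho - s n -> nrm (x n - z0) < r.
  by move=> h; apply: le_lt_trans h _; have := s0 n; move: rhom mr m0; clear; lra.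
have main n : nrm (x n - z0) <= rho - s n /\ nrm (x n.+1 - x n) <= s n - s n.+1.
  elim: n => [|n [h1 h2]].
    rewrite x0E subrr nrm0 {1}/s expr0 divr1 subrr; split => //.
    rewrite xS nrmN; apply: le_trans (BK _) _.
    by rewrite sS /s expr0 divr1 x0E /rho; clear; lra.
  have h3 : nrm (x n.+1 - z0) <= rho - s n.+1.
    by have := nrm_dist (x n.+1) (x n) z0; move: h1 h2; clear; lra.
  split => //; rewrite xS nrmN.
  have -> : f (x n.+1) - w = f (x n.+1) - f (x n) - A (x n.+1 - x n).
    by rewrite xS AN BA opprK addrA subrK.
  apply: le_trans (contr _ _ (Bx _ h1) (Bx _ h3)) _.
  by rewrite !sS; move: h2; rewrite !sS; clear; lra.
have [c cP] := nV x s s0 (fun n => (main n).2).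
have cz0 : nrm (c - z0) < m.
  by have := cP 0%N; rewrite x0E {1}/s expr0 divr1; move: rhom m0; clear; lra.
exists c; first exact: lt_le_trans mdl.
apply/eqP; rewrite -subr_eq0 -nrm_eq0 eq_le nrm_ge0 andbT.
apply/ler_addgt0Pr => e e0; rewrite add0r.
pose K := (KA + KB^-1 / 2) * 2 + KA.
have K0 : 0 <= K.
  have : 0 < KB^-1 / 2 by rewrite divr_gt0 // invr_gt0.
  by rewrite /K; move: KA0; clear; lra.
have [n nP] := half_pow_small (K * rho) e0.
apply: le_trans (ltW nP).
have cr := lt_le_trans cz0 mr; have xr := Bx n (main n).1.
have t1 : nrm (f c - f (x n)) <= (KA + KB^-1 / 2) * nrm (c - x n).
  have := rP (x n) c xr cr; have := AK (c - x n).
  by have := nrm_sub (f c - f (x n)) (A (c - x n)); clear; lra.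
have t2 : nrm (f (x n) - w) <= KA * s n.
  have -> : f (x n) - w = A (B (f (x n) - w)) by rewrite BA.
  apply: le_trans (AK _) _; rewrite ler_wpM2l // -nrmN -xS.
  by apply: le_trans (main n).2 _; rewrite lerBlDr lerDl.
have t3 := cP n.
have t4 : (KA + KB^-1 / 2) * nrm (c - x n) <= (KA + KB^-1 / 2) * (2 * s n).
  by rewrite ler_wpM2l // addr_ge0 // divr_ge0 // invr_ge0 ltW.
have -> : K * rho / 2 ^+ n = (KA + KB^-1 / 2) * (2 * s n) + KA * s n by rewrite /K /s; ring.
have := nrm_dist (f c) (f (x n)) w.
by move: t1 t2 t4; clear; lra.
Qed.

Lemma rV_linear_bounded k (V : normedModType C) (B : 'rV[C]_k -> V) :
  (forall a u v, B (a *: u + v) = a *: B u + B v) ->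
  exists2 K : R, 0 < K & forall w, nrm (B w) <= K * nrm w.
Proof.
move=> Bl; exists (1 + \sum_(i < k) nrm (B (delta_mx 0 i))).
  by rewrite ltr_pwDl // sumr_ge0 // => i _; exact: nrm_ge0.
have B0 : B 0 = 0.
  by have := Bl (-1) 0 0; rewrite scaler0 addr0 scaleN1r addNr.
move=> w; rewrite {1}(row_sum_delta w).
have Bsum (F : 'I_k -> 'rV[C]_k) : B (\sum_i F i) = \sum_i B (F i).
  elim/big_ind2: _ => // x1 x2 y1 y2 <- <-.
  by have := Bl 1 x2 y2; rewrite !scale1r.
rewrite Bsum.
have nsum (F : 'I_k -> V) : nrm (\sum_i F i) <= \sum_i nrm (F i).
  elim/big_ind2: _ => // [|x1 x2 y1 y2 h1 h2]; first by rewrite nrm0.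
  by apply: le_trans (nrmD _ _) _; exact: lerD.
apply: le_trans (nsum _) _.
apply: le_trans (_ : \sum_i nrm (B (delta_mx 0 i)) * nrm w <= _).
  apply: ler_sum => i _; have := Bl (w 0 i) (delta_mx 0 i) 0.
  by rewrite B0 !addr0 => ->; rewrite nrmZ mulrC ler_wpM2l ?nrm_ge0 // nrm_coord.
by rewrite -mulr_suml ler_wpM2r ?nrm_ge0 // lerDr.
Qed.

(** Equality of dimensions: J identifies rows of length m + 1 with pairs, and A becomes a square
    matrix with trivial kernel. *)
Lemma injective_linear_inverse m (A : 'rV[C]_m * C -> 'rV[C]_m.+1) :
  (forall a u v, A (a *: u + v) = a *: A u + A v) -> (forall v, A v = 0 -> v = 0) ->
  exists B : 'rV[C]_m.+1 -> 'rV[C]_m * C,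
    [/\ forall a u v, B (a *: u + v) = a *: B u + B v, cancel A B & cancel B A].
Proof.
move=> Al Ainj.
pose J (v : 'rV[C]_m.+1) : 'rV[C]_m * C := (@rsubmx _ 1 1 m v, v 0 0).
pose J' (u : 'rV[C]_m * C) : 'rV[C]_m.+1 := @row_mx _ 1 1 m (const_mx u.2) u.1.
have JK : cancel J J'.
  move=> v; apply: etrans (@hsubmxK _ 1 1 m v); congr (@row_mx _ 1 1 m _ _).
  by apply/matrixP => i j; rewrite !mxE !ord1; congr (v _ _); apply: val_inj.
have J'K : cancel J' J.
  move=> [x y]; rewrite /J' /J /= row_mxKr; congr (_, _).
  have -> : (0 : 'I_m.+1) = lshift m (0 : 'I_1) by apply: val_inj.
  by rewrite (@row_mxEl _ 1 1 m) mxE.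
have Jl a u v : J (a *: u + v) = a *: J u + J v.
  by rewrite /J; congr (_, _); [apply/rowP => i; rewrite !mxE|rewrite !mxE].
have J'l a u v : J' (a *: u + v) = a *: J' u + J' v.
  by apply: (can_inj JK); rewrite Jl !J'K.
pose M : 'M[C]_m.+1 := \matrix_(i, j) (A (J (delta_mx 0 i))) 0 j.
have A0 : A 0 = 0 by have := Al (-1) 0 0; rewrite scaler0 addr0 scaleN1r addNr.
have J0 : J 0 = 0 by have := Jl (-1) 0 0; rewrite scaler0 addr0 scaleN1r addNr.
have AM v : A (J v) = v *m M.
  have Asum (F : 'I_m.+1 -> 'rV[C]_m.+1) : A (J (\sum_i F i)) = \sum_i A (J (F i)).
    elim/big_ind2: _ => // [|x1 x2 y1 y2 <- <-]; first by rewrite J0 A0.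
    by have := Jl 1 x2 y2; rewrite !scale1r => ->; have := Al 1 (J x2) (J y2); rewrite !scale1r.
  rewrite {1}(row_sum_delta v) Asum; apply/rowP => j; rewrite summxE mxE.
  apply: eq_bigr => i _; rewrite mxE.
  have := Jl (v 0 i) (delta_mx 0 i) 0; rewrite J0 !addr0 => ->.
  by have := Al (v 0 i) (J (delta_mx 0 i)) 0; rewrite A0 !addr0 => ->; rewrite mxE.
have Mu : M \in unitmx.
  rewrite -row_free_unit; apply: inj_row_free => v; rewrite -AM => /Ainj Jv.
  by rewrite -(JK v) Jv; apply: (can_inj JK); rewrite J'K J0.
exists (fun w => J (w *m invmx M)); split.
- by move=> a u v; rewrite mulmxDl -scalemxAl Jl.
- by move=> v; rewrite -{1}(J'K v) AM mulmxK // J'K.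
- by move=> w; rewrite AM mulmxKV.
Qed.

End InverseFunction.

(** * Charts and leaves *)

Section NearDifferential.
Context {R : realType}.
Local Notation C := (Cplx R).

Lemma diff_near (V W : normedModType C) (f g : V -> W) (z : V) (e : R) : 0 < e ->
  (forall w, nrm (w - z) < e -> f w = g w) -> differentiable f z ->
  differentiable g z /\ forall v, 'd g z v = 'd f z v.
Proof.
move=> e0 fg df; have [K _ KP] := diff_bounded df.
apply: (@diff_intro _ V W g z (fun v => 'd f z v) K) => //.
  by move=> k u v; rewrite diffDv diffZv.
move=> k k0; have [dl dl0 dP] := diff_eps df k0.
exists (Num.min e dl); first by rewrite lt_min e0.
move=> h; rewrite lt_min => /andP[h1 h2].
rewrite -!fg ?subrr ?nrm0 //; first exact: dP.
by rewrite addrC addKr.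
Qed.

Lemma diff_comp_val (U V W : normedModType C) (f : U -> V) (g : V -> W) (z v : U) :
  differentiable f z -> differentiable g (f z) ->
  'd (g \o f) z v = 'd g (f z) ('d f z v).
Proof. by move=> df dg; rewrite diff_comp. Qed.

Lemma diff_post (V W Z : normedModType C) (f : V -> W) (pi : W -> Z) (z : V) :
  (forall k u v, pi (k *: u + v) = k *: pi u + pi v) -> (forall w, nrm (pi w) <= nrm w) ->
  differentiable f z ->
  differentiable (fun w => pi (f w)) z /\ forall v, 'd (fun w => pi (f w)) z v = pi ('d f z v).
Proof.
move=> pil pib df; have [K _ KP] := diff_bounded df.
apply: (@diff_intro _ V Z _ z (fun v => pi ('d f z v)) K).
- by move=> k u v; rewrite diffDv diffZv pil.
- by move=> v; apply: le_trans (pib _) (KP v).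
move=> e e0; have [dl dl0 dP] := diff_eps df e0; exists dl => // h hd.
have piB u v : pi (u - v) = pi u - pi v.
  by rewrite addrC -scaleN1r pil scaleN1r addrC.
by rewrite -!piB; apply: le_trans (pib _) (dP h hd).
Qed.

Lemma coord1_lin (k : nat) (W : normedModType C) i (a : C) (u v : 'rV[C]_k * W) :
  (a *: u + v).1 0 i = a *: (u.1 0 i : C) + v.1 0 i.
Proof. by case: u v => u1 u2 [v1 v2]; rewrite /= !mxE. Qed.

Lemma coord1_le (k : nat) (W : normedModType C) i (u : 'rV[C]_k * W) :
  nrm (u.1 0 i) <= nrm u.
Proof.
by case: u => u1 u2 /=; apply: le_trans (nrm_coord u1 i) _; rewrite nrm_pair le_max lexx.
Qed.

Lemma coord_lin (k : nat) i (a : C) (u v : 'rV[C]_k) :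
  (a *: u + v) 0 i = a *: (u 0 i : C) + v 0 i.
Proof. by rewrite !mxE. Qed.

Lemma snd_le (W W' : normedModType C) (u : W * W') : nrm u.2 <= nrm u.
Proof. by case: u => u1 u2 /=; rewrite nrm_pair le_max lexx orbT. Qed.

Lemma fst_le (W W' : normedModType C) (u : W * W') : nrm u.1 <= nrm u.
Proof. by case: u => u1 u2 /=; rewrite nrm_pair le_max lexx. Qed.

Lemma line_snd (W : normedModType C) (x : W) (y s : C) :
  (x, y) + s *: (0 : W, 1 : C) = (x, y + s).
Proof.
apply/eqP; rewrite xpair_eqE /= scaler0 addr0 eqxx /=; apply/eqP.
by congr (_ + _); exact: mulr1.
Qed.

Lemma gder_snd (W : normedModType C) (phi : W * C -> C) (x : W) (y d : C) :
  gder phi (x, y) (0, 1) d <-> cderiv (fun y => phi (x, y)) y d.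
Proof.
have S := cderiv_shift (fun y => phi (x, y)) y 0 d; rewrite addr0 in S.
by split => [h|/S h]; [apply/S|]; apply: cderiv_ext h => s; rewrite line_snd.
Qed.

End NearDifferential.

Section Charts.
Context {R : realType} {n : nat} {M : complex_manifold R n}.
Local Notation C := (Cplx R).
Implicit Types (E : normedModType C).

Lemma par_near E (k : chart M E) (q : M) (U : set M) : dom k q -> open U -> U q ->
  exists2 e : R, 0 < e & forall w, nrm (w - crd k q) < e ->
    [/\ dom k (par k w), U (par k w) & crd k (par k w) = w].
Proof.
move=> kq oU Uq.
have cq : (crd k @` dom k) (crd k q) by exists q.
have [e1 e10 h1] : exists2 e : R, 0 < e & forall w, nrm (w - crd k q) < e -> (crd k @` dom k) w.
  by have /openP_nrm := cod_open k; apply.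
have [e2 e20 h2] : exists2 e : R, 0 < e & forall w, nrm (w - crd k q) < e -> U (par k w).
  apply/nbhs_nrm; apply: (par_continuous cq); rewrite crdK //.
  exact: open_nbhs_nbhs.
exists (Num.min e1 e2); first by rewrite lt_min e10.
move=> w; rewrite lt_min => /andP[w1 w2].
have Uw := h2 w w2; have [r kr rw] := h1 w w1; rewrite -rw crdK //.
by rewrite -rw crdK // in Uw.
Qed.

Lemma map_near (V : normedModType C) (f : V -> M) (z : V) (U : set M) :
  {for z, continuous f} -> open U -> U (f z) ->
  exists2 e : R, 0 < e & forall w, nrm (w - z) < e -> U (f w).
Proof. by move=> cf oU Uz; apply/nbhs_nrm; apply: cf; exact: open_nbhs_nbhs. Qed.

Definition change_diff E E' (k : chart M E) (k' : chart M E') (q : M) :=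
  differentiable (change k k') (crd k q).

Lemma change_near_id E (k : chart M E) (q : M) : dom k q ->
  change_diff k k q /\ forall v, 'd (change k k) (crd k q) v = v.
Proof.
move=> kq; have [e e0 eP] := par_near kq (dom_open k) kq.
have [did didE] : differentiable (fun w : E => w) (crd k q) /\
    forall v, 'd (fun w : E => w) (crd k q) v = v.
  apply: (@diff_intro _ E E (fun w => w) (crd k q) (fun v => v) 1) => //.
    by move=> v; rewrite mul1r.
  move=> k0 k00; exists 1 => // h _.
  by rewrite [_ + h]addrC addrK subrr nrm0 mulr_ge0 ?nrm_ge0 // ltW.
have [|h1 h2] := @diff_near _ _ _ (fun w => w) (change k k) (crd k q) e e0 _ did.
  by move=> w /eP[_ _ ww]; rewrite /change /= ww.
by split; [exact: h1|move=> v]; rewrite h2.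
Qed.

Lemma change_chain E E' E'' (k : chart M E) (k' : chart M E') (k'' : chart M E'') (q : M) :
  dom k q -> dom k' q -> dom k'' q -> change_diff k k' q -> change_diff k' k'' q ->
  change_diff k k'' q /\ forall v,
  'd (change k k'') (crd k q) v = 'd (change k' k'') (crd k' q) ('d (change k k') (crd k q) v).
Proof.
move=> kq k'q k''q d1 d2.
have e1 : change k k' (crd k q) = crd k' q by rewrite /change /= crdK.
have d2' : differentiable (change k' k'') (change k k' (crd k q)) by rewrite e1.
have [e e0 eP] := par_near kq (dom_open k') k'q.
have [|h1 h2] := @diff_near _ _ _ (change k' k'' \o change k k') (change k k'') (crd k q) e e0 _
  (differentiable_comp d1 d2').
  by move=> w /eP[kw k'w ww]; rewrite /change /= crdK.
by split; [exact: h1|move=> v]; rewrite h2 diff_comp_val // e1.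
Qed.

(* Charts that may replace those of the atlas: foliated charts in particular. *)
Definition gchart E (k : chart M E) := forall a, atlas a -> forall q, dom a q -> dom k q ->
  change_diff a k q /\ change_diff k a q.

Lemma compat_gchart E (k : chart M E) :
  (forall a, atlas a -> holomorphically_compatible a k) -> gchart k.
Proof.
move=> h a aa q aq kq; have [h1 h2] := h a aa.
by split; [apply: h1; exists q|apply: h2; exists q].
Qed.

Lemma atlas_gchart a : @atlas R n M a -> gchart a.
Proof. by move=> aa; apply: compat_gchart => b ab; exact: atlas_compatible. Qed.

(** The change of charts factors through a chart of the atlas around q. *)
Lemma gchart_change E E' (k : chart M E) (k' : chart M E') q : gchart k -> gchart k' ->
  dom k q -> dom k' q -> change_diff k k' q.
Proof.
move=> gk gk' kq k'q; have [a aa aq] := atlas_cover q.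
have [_ h1] := gk a aa q aq kq; have [h2 _] := gk' a aa q aq k'q.
by have [] := change_chain kq aq k'q h1 h2.
Qed.

Lemma gchart_chain E E' E'' (k : chart M E) (k' : chart M E') (k'' : chart M E'') (q : M) v :
  gchart k -> gchart k' -> gchart k'' -> dom k q -> dom k' q -> dom k'' q ->
  'd (change k k'') (crd k q) v = 'd (change k' k'') (crd k' q) ('d (change k k') (crd k q) v).
Proof.
move=> gk gk' gk'' kq k'q k''q.
by have [_ ->] := change_chain kq k'q k''q (gchart_change gk gk' kq k'q) (gchart_change gk' gk'' k'q k''q).
Qed.

Lemma gchart_inj E E' (k : chart M E) (k' : chart M E') (q : M) v :
  gchart k -> gchart k' -> dom k q -> dom k' q ->
  'd (change k k') (crd k q) v = 0 -> v = 0.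
Proof.
move=> gk gk' kq k'q h; have [_ hid] := change_near_id kq.
by rewrite -[v]hid (gchart_chain v gk gk' gk kq k'q kq) h diff0v.
Qed.

Lemma change_par_diff E E' (k : chart M E) (k' : chart M E') (w : E) : gchart k -> gchart k' ->
  (crd k @` dom k) w -> dom k' (par k w) -> differentiable (change k k') w.
Proof. by move=> gk gk' [q kq <-]; rewrite crdK // => k'q; exact: gchart_change. Qed.

Lemma map_rder (V : normedModType C) E E' (k : chart M E) (k' : chart M E') (f : V -> M) z v d :
  gchart k -> gchart k' -> dom k (f z) -> dom k' (f z) -> {for z, continuous f} ->
  rder (crd k \o f) z v d ->
  rder (crd k' \o f) z v ('d (change k k') (crd k (f z)) d).
Proof.
move=> gk gk' kf k'f cf df.
have := rder_chain df (gchart_change gk gk' kf k'f).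
have [e e0 eP] := map_near cf (dom_open k) kf.
by apply: (rder_near e0) => w /eP kw; rewrite /change /= crdK.
Qed.

Lemma map_diff (V : normedModType C) E E' (k : chart M E) (k' : chart M E') (f : V -> M) z :
  gchart k -> gchart k' -> dom k (f z) -> dom k' (f z) -> {for z, continuous f} ->
  differentiable (crd k \o f) z ->
  differentiable (crd k' \o f) z /\
  forall v, 'd (crd k' \o f) z v = 'd (change k k') (crd k (f z)) ('d (crd k \o f) z v).
Proof.
move=> gk gk' kf k'f cf df.
have [e e0 eP] := map_near cf (dom_open k) kf.
have dc : differentiable (change k k') ((crd k \o f) z) by exact: gchart_change.
have [|h1 h2] := @diff_near _ _ _ (change k k' \o (crd k \o f)) (crd k' \o f) z e e0 _
   (differentiable_comp df dc).
  by move=> w /eP kw; rewrite /change /= crdK.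
by split; [exact: h1|move=> v]; rewrite h2 diff_comp_val.
Qed.

End Charts.

(** * Plaques and the leaf topology *)

Section Leaves.
Context {R : realType} {n : nat} {M : complex_manifold R n}.
Local Notation C := (Cplx R).
Local Notation T := 'rV[C]_n.-1.
Variable Fol : foliation M.
Local Notation Leaf := (@leaf R n M Fol).

Lemma fchart_gchart c : fcharts Fol c -> gchart c.
Proof. by move=> fc; apply: compat_gchart => a aa; exact: fcharts_compatible fc. Qed.

Lemma leaf_refl q : Leaf q q.
Proof. exact: rt_refl. Qed.

Lemma leaf_sym q r : Leaf q r -> Leaf r q.
Proof.
elim=> [x y [c [h1 h2 h3 h4]]|x|x y z _ h1 _ h2]; first by apply: rt_step; exists c.
  exact: rt_refl.
exact: rt_trans h2 h1.
Qed.

Lemma leaf_trans q r s : Leaf q r -> Leaf r s -> Leaf q s.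
Proof. exact: rt_trans. Qed.

Lemma leaf_eq q r : Leaf q r -> Leaf q = Leaf r.
Proof.
move=> h; apply/seteqP; split => s; first by apply: leaf_trans; exact: leaf_sym.
exact: leaf_trans.
Qed.

(** By [fcharts_transverse] each coordinate of the first component has zero derivative in y, hence
    is constant on the disk by the mean value inequality. *)
Lemma transverse_const c c' (x : T) (y0 : C) (e : R) : fcharts Fol c -> fcharts Fol c' ->
  (forall y : C, nrm (y - y0) < e -> (crd c' @` dom c') (x, y) /\ dom c (par c' (x, y))) ->
  forall y, nrm (y - y0) < e -> (change c' c (x, y)).1 = (change c' c (x, y0)).1.
Proof.
move=> fc fc' H y ye; apply/rowP => i.
pose h (y : C) : C := (change c' c (x, y)).1 0 i.
have e0 : 0 < e by exact: le_lt_trans (nrm_ge0 _) ye.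
have dh w : nrm (w - y0) < e -> cderiv h w 0.
  move=> we; have [[q c'q qE] cq] := H w we.
  have d : differentiable (change c' c) (x, w).
    by apply: change_par_diff; [exact: fchart_gchart|exact: fchart_gchart|exists q|].
  have pq : par c' (x, w) = q by rewrite -qE crdK.
  rewrite pq in cq.
  have t0 := fcharts_transverse fc' fc c'q cq 1; rewrite qE in t0.
  have [d1 d2] := diff_post (coord1_lin i) (coord1_le i) d.
  apply/(gder_snd (fun z => (change c' c z).1 0 i)).
  have <- : 'd (fun z => (change c' c z).1 0 i : C) (x, w) ((0 : T), (1 : C)) = 0.
    by rewrite d2 t0 mxE.
  exact: differentiable_gder.
have E : nrm (h y - h y0 - 0 * (y - y0)) <= 0 * nrm (y - y0).
  apply: mvt => t It; have le : nrm (y0 + rC t * (y - y0) - y0) < e.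
    rewrite addrC addKr nrmM nrm_rC; have [t0 t1] := andP It.
    by rewrite ger0_norm //; apply: le_lt_trans ye; rewrite ler_piMl ?nrm_ge0.
  split; first by exists 0; exact: dh.
  by rewrite (dv_uniq (dh _ le)) subrr nrm0.
rewrite !mul0r subr0 in E.
by apply/eqP; rewrite -subr_eq0 -nrm_eq0 eq_le E nrm_ge0.
Qed.

Definition plaque (c : chart M (T * C)%type) (x : T) : set (leaf_space Fol) :=
  [set r | dom c (r : M) /\ (crd c (r : M)).1 = x].

Lemma plaque_open c (x : T) : fcharts Fol c -> open (plaque c x).
Proof.
move=> fc; suff : leaf_open Fol (plaque c x) by [].
move=> c' x' fc'; apply/openP_nrm => y [[q c'q qE] [cq qx]].
have pq : par c' (x', y) = q by rewrite -qE crdK.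
rewrite pq in cq qx.
have [e e0 eP] := par_near c'q (dom_open c) cq; rewrite qE in eP.
have H w : nrm (w - y) < e -> (crd c' @` dom c') (x', w) /\ dom c (par c' (x', w)).
  move=> we; have [|h1 h2 h3] := eP (x', w).
    by rewrite [_ - _]surjective_pairing nrm_pair_lt /= subrr nrm0 e0.
  by split => //; exists (par c' (x', w)).
exists e => // w we; have [h1 h2] := H w we; split => //; split => //.
have := transverse_const fc fc' H we; rewrite /change /= => ->.
by rewrite pq.
Qed.

(** Plaques are open for the leaf topology, so continuity into the leaf space keeps the transverse
    coordinate locally constant. *)
Lemma leaf_plaque (f : C -> leaf_space Fol) c y0 : continuous f -> fcharts Fol c ->
  dom c (f y0 : M) -> exists2 e : R, 0 < e & forall y, nrm (y - y0) < e ->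
    dom c (f y : M) /\ (crd c (f y : M)).1 = (crd c (f y0 : M)).1.
Proof.
move=> cf fc cy; have := plaque_open (x := (crd c (f y0 : M)).1) fc => oP.
have nP : nbhs (f y0) (plaque c (crd c (f y0 : M)).1) by apply: open_nbhs_nbhs.
by apply/nbhs_nrm; exact: (cf y0 _ nP).
Qed.

(** The covering is holomorphic in the leaf coordinate by definition; the transverse coordinate is
    locally constant and adds nothing to the differential. *)
Lemma leaf_map_diff q (f : C -> leaf_space Fol) y0 : leaf_universal_covering q f ->
  forall c, fcharts Fol c -> dom c (f y0 : M) ->
  differentiable (fun y => crd c (f y : M)) y0 /\
  forall v, ('d (fun y => crd c (f y : M)) y0 v).1 = 0 /\
    'd (fun y => crd c (f y : M)) y0 v =
      ((0 : T), 'd (fun y => (crd c (f y : M)).2 : C) y0 v).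
Proof.
move=> [rf cf df cov] c fc cy.
have [e e0 eP] := leaf_plaque cf fc cy; have d2 := df y0 c fc cy.
have [K K0 KP] := diff_bounded d2.
have [| | |h1 h2] := @diff_intro _ C (T * C)%type (fun y => crd c (f y : M)) y0
  (fun v => ((0 : T), 'd (fun y => (crd c (f y : M)).2 : C) y0 v)) K.
- move=> k u v; rewrite diffDv diffZv.
  by apply/eqP; rewrite xpair_eqE /= scaler0 addr0 !eqxx.
- by move=> v; rewrite nrm_pair nrm0 (max_idPr (nrm_ge0 _)); exact: KP.
- move=> k k0; have [dl dl0 dP] := diff_eps d2 k0.
  exists (Num.min e dl); first by rewrite lt_min e0.
  move=> h; rewrite lt_min => /andP[h1 h2].
  have [_ h3] := eP (y0 + h) ltac:(by rewrite addrC addKr).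
  rewrite [_ - _ - _]surjective_pairing nrm_pair_le /=; apply/andP; split; last exact: dP.
  by rewrite h3 subrr subr0 nrm0 mulr_ge0 ?nrm_ge0 // ltW.
by split; [exact: h1|move=> v]; rewrite h2.
Qed.

End Leaves.

(** * Universal coverings of leaves *)

Section LeafCoverings.
Context {R : realType} {n : nat} {M : complex_manifold R n}.
Local Notation C := (Cplx R).
Local Notation T := 'rV[C]_n.-1.
Variable Fol : foliation M.
Local Notation Leaf := (@leaf R n M Fol).
Implicit Types (q : M) (f : C -> leaf_space Fol).

Lemma luc_covering q f : leaf_universal_covering q f -> is_covering (Leaf q) f.
Proof. by move=> [h1 h2 _ h4]; split. Qed.

Lemma luc_open_map q f (O : set C) : leaf_universal_covering q f -> open O -> open (f @` O).
Proof.
move=> luc oO; rewrite openE => r [y Oy <-].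
have cov := luc_covering luc.
have [W [S [oW Wy WL [oS dS cS pS]]]] := cov_even cov (cov_range cov y).
have [s Ss sy] := cS y Wy; have [_ _ _ om] := pS s Ss.
apply: (@filterS _ (nbhs (f y)) _ (f @` (O `&` s))).
  by move=> w [z [Oz _] <-]; exists z.
apply: open_nbhs_nbhs; split; last by exists y.
by apply: om; [apply: openI => //; exact: oS|move=> z []].
Qed.

Lemma luc_injective_near q f y0 : leaf_universal_covering q f ->
  exists2 e : R, 0 < e & forall y y', nrm (y - y0) < e -> nrm (y' - y0) < e -> f y = f y' -> y = y'.
Proof.
move=> /luc_covering cov.
have [W [S [oW Wy WL [oS dS cS pS]]]] := cov_even cov (cov_range cov y0).
have [s Ss sy] := cS y0 Wy; have [_ inj _ _] := pS s Ss.
have /openP_nrm os := oS s Ss; have [e e0 eP] := os y0 sy.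
by exists e => // y y' /eP h /eP h' /(inj _ _ h h').
Qed.

Lemma luc_cderiv q f y0 c : leaf_universal_covering q f -> fcharts Fol c ->
  dom c (f y0 : M) ->
  cderiv (fun y => (crd c (f y : M)).2) y0 ('d (fun y => (crd c (f y : M)).2 : C) y0 1).
Proof. by move=> [_ _ df _] fc cy; apply: differentiable_cderiv; exact: df. Qed.

(** A covering is locally injective and open; in the leaf coordinate these are the hypotheses of
    [univalent]. *)
Lemma luc_derivative_neq0 q f y0 c : leaf_universal_covering q f -> fcharts Fol c ->
  dom c (f y0 : M) -> 'd (fun y => (crd c (f y : M)).2 : C) y0 1 != 0.
Proof.
move=> luc fc cy; have [rf cf df cov] := luc.
have [e1 e10 pl] := leaf_plaque cf fc cy.
have [e2 e20 inj] := luc_injective_near y0 luc.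
pose g y : C := (crd c (f (y0 + y) : M)).2.
pose e := Num.min e1 e2; have e0 : 0 < e by rewrite lt_min e10.
have near z : nrm z < e -> [/\ dom c (f (y0 + z) : M),
    (crd c (f (y0 + z) : M)).1 = (crd c (f y0 : M)).1 & nrm (y0 + z - y0) < e2].
  rewrite lt_min => /andP[h1 h2].
  have E : y0 + z - y0 = z by rewrite addrC addKr.
  by have [|h3 h4] := pl (y0 + z); rewrite E.
have D z : nrm z < e -> cderiv g z ('d (fun y => (crd c (f y : M)).2 : C) (y0 + z) 1).
  by move=> /near[h1 _ _]; apply/(cderiv_shift (fun y => (crd c (f y : M)).2) y0); exact: (luc_cderiv luc).
have <- : dv g 0 = 'd (fun y => (crd c (f y : M)).2 : C) y0 1.
  by apply: dv_uniq; have := D 0; rewrite nrm0 addr0; apply.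
apply: (univalent e0).
- by move=> z /D h; exists ('d (fun y => (crd c (f y : M)).2 : C) (y0 + z) 1).
- move=> z z' ze ze' E; have [h1 h2 h3] := near z ze; have [h1' h2' h3'] := near z' ze'.
  have E2 : crd c (f (y0 + z) : M) = crd c (f (y0 + z') : M).
    by rewrite [LHS]surjective_pairing [RHS]surjective_pairing h2 h2'; congr pair.
  have E3 : f (y0 + z) = f (y0 + z').
    by have := congr1 (par c) E2; rewrite !crdK.
  by have := inj _ _ h3 h3' E3; apply: addrI.
move=> z0 dl ze dl0.
pose O := [set y | nrm (y - (y0 + z0)) < dl] `&` [set y | nrm (y - y0) < e].
have oO : open O by apply: openI; exact: open_nball.
have lo : leaf_open Fol (f @` O) by exact: luc_open_map luc oO.
have /openP_nrm op := lo c (crd c (f y0 : M)).1 fc.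
have [h1 h2 h3] := near z0 ze.
have [|eta eta0 etaP] := op (g z0).
  have E : ((crd c (f y0 : M)).1, g z0) = crd c (f (y0 + z0) : M).
    by rewrite [RHS]surjective_pairing h2.
  split; rewrite E; first by exists (f (y0 + z0)).
  rewrite crdK //; exists (y0 + z0) => //; split => /=; first by rewrite subrr nrm0.
  by rewrite addrC addKr.
exists eta => // w /etaP [[r cr rE] [y [yO1 yO2] yE]].
have pr : par c ((crd c (f y0 : M)).1, w) = r by rewrite -rE crdK.
exists (y - y0); split => //; first by move: yO1; rewrite /= opprD addrA.
by rewrite /g addrC subrK yE pr rE.
Qed.

(** In the leaf coordinate, f o tau = f determines the derivative of tau, as that of f does not
    vanish. *)
Lemma luc_lift_holo q f (tau : C -> C) z : leaf_universal_covering q f ->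
  (forall z, ccont tau z) -> (forall z, f (tau z) = f z) -> holo tau z.
Proof.
move=> luc ct ft; have [c fc cz] := fcharts_cover Fol (f z).
have cz' : dom c (f (tau z) : M) by rewrite ft.
have := cderiv_implicit (luc_derivative_neq0 luc fc cz') (luc_cderiv luc fc cz')
  (luc_cderiv luc fc cz) (ct z).
move=> H; eexists; apply: H; exists 1 => // h _; by rewrite ft.
Qed.

Lemma luc_deck q f y0 y1 : leaf_universal_covering q f -> f y0 = f y1 ->
  forall y, f (y + (y1 - y0)) = f y.
Proof.
move=> luc; apply: (deck_translation (luc_covering luc)) => tau ct ft z.
exact: luc_lift_holo luc ct ft.
Qed.

(** The images of the disks of integer radius are open and cover the leaf, so finitely many do. If u
    in the largest disk has the image of y, the translation by y - u is a deck transformation, and y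
    - u lies above f 0. *)
Lemma luc_cocompact q f : leaf_universal_covering q f -> compact_leaf Fol q ->
  exists N : R, forall y, exists2 u, nrm u <= N & f (y + u) = f 0.
Proof.
(* The covering form of compactness is applied in a pointed space; q serves as the point. *)
move=> luc cL; pose P : ptopologicalType := HB.pack (leaf_space Fol) (isPointed.Build (leaf_space Fol) q).
have cl : @cover_compact P (Leaf q) by rewrite -(@compact_cover P).
have [rf cf _ _] := luc.
have [||D _ cD] := cl nat setT (fun m => f @` [set y : C | nrm (y - 0) < m%:R]).
- by move=> m _; apply: luc_open_map luc _; exact: open_nball.
- rewrite -rf => r [y _ <-]; exists (Num.bound (nrm y)) => //; exists y => //=.
  by rewrite subr0; apply: archi_boundP; exact: nrm_ge0.
exists (\max_(i <- finmap.enum_fset D) i)%N%:R => y.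
have /cD[m mD [u /= um uE]] : Leaf q (f y) by rewrite -rf; exists y.
exists (- u); last by have := luc_deck luc uE 0; rewrite add0r.
rewrite nrmN; rewrite subr0 in um; apply: le_trans (ltW um) _.
by rewrite ler_nat; exact: leq_bigmax_seq.
Qed.

(** Reparametrization by an affine automorphism normalises the base point and the derivative of a
    covering in [constructed_exists]. *)
Lemma luc_affine q f (a b : C) : a != 0 -> leaf_universal_covering q f ->
  leaf_universal_covering q (fun y => f (b + y * a)).
Proof.
move=> a0 luc; have [rf cf df cov] := luc.
pose l (y : C) : C := b + y * a; pose l' (y : C) : C := - (b / a) + y * a^-1.
have lK : cancel l l' by move=> y; rewrite /l /l'; field.
have l'K : cancel l' l by move=> y; rewrite /l /l'; field.
have cl : continuous l.
  by move=> y; exact: differentiable_continuous (proj1 (cderiv_differentiable (cderiv_affine b a y))).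
have cl' : continuous l'.
  move=> y; exact: differentiable_continuous
    (proj1 (cderiv_differentiable (cderiv_affine (- (b / a)) a^-1 y))).
have oim (O : set C) : open O -> open (l @` O).
  move=> oO; rewrite (_ : l @` O = l' @^-1` O).
    by apply: open_comp => // y _; exact: cl'.
  apply/seteqP; split => [_ [y Oy <-]|y Oy]; first by rewrite /= lK.
  by exists (l' y).
split.
- rewrite -rf; apply/seteqP; split => _ [y _ <-]; first by exists (l y).
  by exists (l' y) => //; rewrite -/(l (l' y)) l'K.
- by move=> y; apply: (@continuous_comp _ _ _ l f); [exact: cl|exact: cf].
- move=> y c fc cy; have h := luc_cderiv luc fc cy.
  have := cderiv_comp (f := l) (g := fun y => (crd c (f y : M)).2) (z := y) (a := a) _ h.
  move=> H; apply: (proj1 (cderiv_differentiable (H _))).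
  exact: cderiv_affine.
move=> r /cov[W [oW Wr WL [S [oS dS pS bS]]]]; exists W; split => //.
exists [set s | exists2 s0, S s0 & s = l @^-1` s0]; split.
- by move=> _ [s Ss ->]; apply: open_comp => [y _|]; [exact: cl|exact: oS].
- move=> _ _ [s Ss ->] [s' Ss' ->] [y [sy s'y]].
  by have -> : s = s' by apply: dS => //; exists (l y).
- rewrite (_ : _ @^-1` W = l @^-1` (f @^-1` W)) // pS.
  apply/seteqP; split => y /=; first by case=> s Ss sy; exists (l @^-1` s) => //; exists s.
  by case=> _ [s Ss ->] sy; exists s.
move=> _ [s Ss ->]; have [[b1 b2 b3] om] := bS s Ss; split; [split|].
- by move=> y sy; exact: b1.
- move=> y y' /set_mem sy /set_mem sy' E.
  by apply: (can_inj lK); apply: b2 => //; apply: mem_set.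
- move=> w /b3[y sy yE]; exists (l' y); first by rewrite /= l'K.
  by rewrite -/(l (l' y)) l'K.
move=> O oO Os; rewrite (_ : _ @` O = f @` (l @` O)).
  by apply: om; [exact: oim|move=> _ [y Oy <-]; exact: Os].
by rewrite image_comp.
Qed.

End LeafCoverings.

(** * The dbar operator along the leaves *)

Section PartialHolomorphy.
Context {R : realType}.
Local Notation C := (Cplx R).
Variable W : normedModType C.
Implicit Types (phi E D : W * C -> C) (x v : W).

Lemma pair_shift x (y : C) v (s : C) : (x, y) + s *: (v, 0 : C) = (x + s *: v, y).
Proof. by apply/eqP; rewrite xpair_eqE /= scaler0 addr0 !eqxx. Qed.

Lemma pair_dist x (y y0 : C) v : nrm ((x + v, y) - (x, y0)) = Num.max (nrm v) (nrm (y - y0)).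
Proof. by rewrite -[_ - _]/(x + v - x, y - y0) nrm_pair addrC addKr. Qed.

(** The step along v is made at fixed y1, where its derivative d is given; the step along y is made
    at the displaced point and controlled by continuity of E. *)
Lemma partial_increment phi E x (y1 : C) v d (r : R) : 0 < r ->
  (forall z, nrm (z - (x, y1)) < r -> cderiv (fun y => phi (z.1, y)) z.2 (E z)) ->
  cont_at E (x, y1) -> rder phi (x, y1) (v, 0) d ->
  forall e : R, 0 < e -> exists2 dl : R, 0 < dl & forall (s : R) (h : C), `|s| < dl -> nrm h < dl ->
    nrm (phi (x + rC s *: v, y1 + h) - phi (x, y1) - (rC s * d + E (x, y1) * h)) <=
      e * (`|s| + nrm h).
Proof.
move=> r0 pE cE pD e e0.
have [d1 d10 D1] := pD e e0; have [d2 d20 D2] := cE e e0.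
have [m [m0 mr md]] : exists m, [/\ 0 < m, m <= r & m <= d2].
  by exists (Num.min r d2); rewrite lt_min r0 !ge_min !lexx orbT.
have v0 := nrm_ge0 v; have v1 : 0 < 1 + nrm v by rewrite ltr_wpDr.
pose dl := Num.min d1 (Num.min m (m / (1 + nrm v))).
exists dl; first by rewrite !lt_min d10 m0 divr_gt0.
move=> s h; rewrite !lt_min => /and3P[s1 _ s3] /and3P[_ h2 _].
have sv : nrm (rC s *: v) < m.
  rewrite nrmZ nrm_rC; move: s3; rewrite ltr_pdivlMr // => H; apply: le_lt_trans H.
  by rewrite ler_wpM2l // lerDr.
have near t : I01 t -> nrm ((x + rC s *: v, y1 + rC t * h) - (x, y1)) < m.
  move=> /andP[t0 t1]; rewrite pair_dist gt_max sv addrC addKr nrmM nrm_rC ger0_norm //.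
  by apply: le_lt_trans h2; rewrite ler_piMl ?nrm_ge0.
have A : nrm (phi (x + rC s *: v, y1 + h) - phi (x + rC s *: v, y1) - E (x, y1) * h) <= e * nrm h.
  have := @mvt R (fun y => phi (x + rC s *: v, y)) y1 (y1 + h) (E (x, y1)) e.
  rewrite [y1 + h - y1]addrC addKr; apply => t It.
  have N := near t It; have n1 := lt_le_trans N mr; have n2 := lt_le_trans N md.
  have H := pE _ n1; split; first by eexists; exact: H.
  by rewrite (dv_uniq H); apply: ltW; exact: D2.
have B := D1 s s1; rewrite pair_shift in B.
rewrite mulrDr [e * _ + _]addrC.
have -> : phi (x + rC s *: v, y1 + h) - phi (x, y1) - (rC s * d + E (x, y1) * h) =
  (phi (x + rC s *: v, y1 + h) - phi (x + rC s *: v, y1) - E (x, y1) * h) +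
  (phi (x + rC s *: v, y1) - phi (x, y1) - rC s * d) by ring.
by apply: le_trans (nrmD _ _) _; apply: lerD.
Qed.

Lemma rder_quotient (V : normedModType C) (phi : V -> C) z u d : rder phi z u d ->
  forall e : R, 0 < e -> exists2 dl : R, 0 < dl & forall s : R, s != 0 -> `|s| < dl ->
    nrm ((phi (z + rC s *: u) - phi z) / rC s - d) <= e.
Proof.
move=> H e e0; have [dl dl0 dP] := H e e0; exists dl => // s s0 sd.
have sc : rC s != 0 by rewrite rC_eq0.
have -> : (phi (z + rC s *: u) - phi z) / rC s - d =
  (phi (z + rC s *: u) - phi z - rC s * d) / rC s by field.
rewrite nrmM nrmV nrm_rC ler_pdivrMr ?normr_gt0 //; exact: dP.
Qed.

(* The difference quotients in the direction (v, 0) are holomorphic in y and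
   locally bounded, so their second order Taylor estimates pass to the limit. *)
Lemma partial_derivative_holo phi E D x (y0 : C) v d (r M : R) : 0 < r ->
  (forall z, nrm (z - (x, y0)) < r -> [/\ cderiv (fun y => phi (z.1, y)) z.2 (E z),
     rder phi z (v, 0) (D z) & nrm (D z) <= M]) ->
  rder E (x, y0) (v, 0) d -> cderiv (fun y => D (x, y)) y0 d.
Proof.
move=> r0 H Ed; have v0 := nrm_ge0 v; have v1 : 0 < 1 + nrm v by rewrite ltr_wpDr.
pose q (s : R) (y : C) := (phi (x + rC s *: v, y) - phi (x, y)) / rC s.
pose r4 := r / 4; have r40 : 0 < r4 by rewrite divr_gt0.
have r44 : 4 * r4 = r by rewrite /r4; field.
pose sb := r / (1 + nrm v); have sb0 : 0 < sb by rewrite divr_gt0.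
have near (s : R) y : `|s| < sb -> nrm (y - y0) < r ->
    nrm ((x + rC s *: v, y) - (x, y0)) < r.
  move=> sl yl; rewrite pair_dist gt_max yl andbT nrmZ nrm_rC.
  by move: sl; rewrite ltr_pdivlMr // => K; apply: le_lt_trans K; rewrite ler_wpM2l // lerDr.
have near0 y : nrm (y - y0) < r -> nrm ((x, y) - (x, y0)) < r.
  by move=> yl; rewrite -[x in (x, y)]addr0 pair_dist nrm0 gt_max r0.
have qd (s : R) y : `|s| < sb -> nrm (y - y0) < r ->
    cderiv (q s) y ((E (x + rC s *: v, y) - E (x, y)) / rC s).
  move=> sl yl; have [h1 _ _] := H _ (near s y sl yl); have [h2 _ _] := H _ (near0 y yl).
  have := cderivZ (rC s)^-1 (cderivB h1 h2); rewrite mulrC.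
  by apply: cderiv_ext => w; rewrite /q mulrC.
have qb (s : R) y : s != 0 -> `|s| < sb -> nrm (y - y0) < r -> nrm (q s y) <= M.
  move=> s0 sl yl; rewrite /q nrmM nrmV nrm_rC ler_pdivrMr ?normr_gt0 //.
  have := @rmvt R _ phi (x, y) (rC s *: (v, 0)) (fun t => rC s * D (x + rC (t * s) *: v, y)) 0 (M * `|s|).
  rewrite pair_shift subr0; apply => t It.
  have tl : `|t * s| < sb.
    have [t0 t1] := andP It; rewrite normrM (ger0_norm t0).
    by apply: le_lt_trans sl; rewrite ler_piMl.
  have [_ h1 h2] := H _ (near _ _ tl yl).
  rewrite scalerA -rCM pair_shift; split; first exact: rderZ.
  by rewrite subr0 nrmM nrm_rC mulrC ler_wpM2r.
have T (s : R) h : s != 0 -> `|s| < sb -> nrm h < r4 ->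
  nrm (q s (y0 + h) - q s y0 - (E (x + rC s *: v, y0) - E (x, y0)) / rC s * h) <=
    cK2 * M * nrm h ^+ 2 / r4 ^+ 2.
  move=> s0 sl hl.
  have hb : hball (q s) (y0 : C) r4 M.
    split => // y; rewrite r44 => yl; split; last exact: qb.
    by apply: holo_ghol; eexists; exact: qd.
  have g : gd (q s) y0 h = (E (x + rC s *: v, y0) - E (x, y0)) / rC s * h.
    apply: gd_uniq; have y00 : nrm (y0 - y0) < r by rewrite subrr nrm0.
    have := gderZ h (proj2 (gder1 _ _ _) (qd s y0 sl y00)).
    by rewrite mulrC [h *: _]mulr1.
  rewrite -g; apply: gd_taylor hb _ _; first by rewrite subrr nrm0.
  by rewrite addrC addKr.
have L h : nrm h < r4 -> nrm (D (x, y0 + h) - D (x, y0) - d * h) <=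
    cK2 * M * nrm h ^+ 2 / r4 ^+ 2.
  move=> hl; apply/ler_addgt0Pr => e e0.
  have h0 := nrm_ge0 h; have h1 : 0 < 2 + nrm h by rewrite ltr_wpDr.
  have hr : nrm (y0 + h - y0) < r.
    rewrite addrC addKr; apply: lt_trans hl _; rewrite /r4 ltr_pdivrMr //.
    by rewrite ltr_pMr // ltr1n.
  have [_ D1 _] := H _ (near0 _ hr).
  have [_ D0 _] := H (x, y0) ltac:(by rewrite subrr nrm0).
  pose k := e / (2 + nrm h); have k0 : 0 < k by rewrite divr_gt0.
  have [d1 d10 P1] := rder_quotient D1 k0; have [d2 d20 P2] := rder_quotient D0 k0.
  have [d3 d30 P3] := rder_quotient Ed k0.
  pose m := Num.min sb (Num.min d1 (Num.min d2 d3)).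
  have m0 : 0 < m by rewrite !lt_min sb0 d10 d20 d30.
  pose s := m / 2; have s0 : 0 < s by rewrite divr_gt0.
  have : `|s| < m by rewrite gtr0_norm // /s ltr_pdivrMr // ltr_pMr // ltr1n.
  rewrite !lt_min => /and4P[l0 l1 l2 l3]; have sn : s != 0 by rewrite gt_eqF.
  have := P1 s sn l1; rewrite pair_shift -[_ / _]/(q s (y0 + h)) => Q1.
  have := P2 s sn l2; rewrite pair_shift -[_ / _]/(q s y0) => Q2.
  have := P3 s sn l3; rewrite pair_shift => Q3.
  have Q4 := T s h sn l0 hl.
  set e1 := (E _ - E _) / rC s in Q3 Q4.
  have -> : D (x, y0 + h) - D (x, y0) - d * h =
    (q s (y0 + h) - q s y0 - e1 * h) +
    ((q s y0 - D (x, y0)) - (q s (y0 + h) - D (x, y0 + h)) + (e1 - d) * h) by ring.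
  apply: le_trans (nrmD _ _) _; apply: lerD => //.
  have -> : e = k + k + k * nrm h by rewrite /k; field; rewrite gt_eqF.
  apply: le_trans (nrmD _ _) _; apply: lerD; last by rewrite nrmM ler_wpM2r.
  by apply: le_trans (nrmB _ _) _; apply: lerD.
move=> k k0.
have M0 : 0 <= M by have [_ _] := H (x, y0) ltac:(by rewrite subrr nrm0); apply: le_trans; exact: nrm_ge0.
have K0 : 0 <= cK2 * M / r4 ^+ 2.
  by rewrite divr_ge0 ?sqr_ge0 // mulr_ge0 // /cK2 mulr_ge0 // cK1_ge0.
have [dl dl0 dP] := small_quad K0 k0.
exists (Num.min dl r4); first by rewrite lt_min dl0.
move=> h; rewrite lt_min => /andP[h1 h2].
apply: le_trans (dP _ (nrm_ge0 h) h1); rewrite [h * d]mulrC; apply: le_trans (L h h2) _.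
by rewrite mulrAC.
Qed.

End PartialHolomorphy.

(** * The Euclidean ball and connectedness of the plane *)

Section Preliminaries.
Context {R : realType}.
Local Notation C := (Cplx R).

Lemma euclidean_ball_nrm k (x : 'rV[C]_k) :
  euclidean_ball R k x <-> \sum_(i < k) nrm (x 0 i) ^+ 2 < 1.
Proof.
rewrite /euclidean_ball /= -(rC_lt (\sum_(i < k) _)) rC1.
suff -> : \sum_(i < k) `|x 0 i| ^+ 2 = rC (\sum_(i < k) nrm (x 0 i) ^+ 2) by [].
rewrite /rC rmorph_sum; apply: eq_bigr => i _.
by rewrite rmorphXn /= -/(rC _) -nrmE.
Qed.

Lemma euclidean_ball0 k : euclidean_ball R k 0.
Proof.
by apply/euclidean_ball_nrm; rewrite big1 // => i _; rewrite mxE nrm0 expr0n.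
Qed.

Lemma open_euclidean_ball k : open (euclidean_ball R k).
Proof.
apply/openP_nrm => x /euclidean_ball_nrm; set S := \sum_(i < k) _ => xS.
(* When the coordinates move by less than e <= 1, each square grows by at most (2 nrm x + 1) e. *)
have x0 := nrm_ge0 x; pose K := k%:R * (2 * nrm x + 1) + 1.
have K0 : 0 < K by rewrite ltr_wpDl // mulr_ge0 // addr_ge0 // mulr_ge0.
pose e := Num.min 1 ((1 - S) / K).
have e0 : 0 < e by rewrite lt_min ltr01 divr_gt0 ?subr_gt0.
exists e => // w we; apply/euclidean_ball_nrm.
apply: (@le_lt_trans _ _ (S + k%:R * (2 * nrm x + 1) * e)).
  rewrite -mulrA mulr_natl -[X in _ *+ X]card_ord -sumr_const -big_split /=.
  apply: ler_sum => i _; have xi := nrm_coord x i; have xi0 := nrm_ge0 (x 0 i).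
  have wi : nrm (w 0 i) <= nrm (x 0 i) + e.
    apply: le_trans (nrm_sub (w 0 i) (x 0 i)) _; apply: lerD => //.
    by apply: ltW; apply: le_lt_trans we; have := nrm_coord (w - x) i; rewrite !mxE.
  have e1 : e <= 1 by rewrite ge_min lexx.
  apply: (@le_trans _ _ ((nrm (x 0 i) + e) ^+ 2)); first by rewrite ler_sqr ?nnegrE ?nrm_ge0 // addr_ge0 // ltW.
  move: xi xi0 e1 e0; set u := nrm (x 0 i); set v := nrm x; clear; nra.
have eK : e * K <= 1 - S by rewrite -ler_pdivlMr // ge_min lexx orbT.
move: eK e0; rewrite /K; set L := _%:R * _; clear; nra.
Qed.

Lemma rder_coord (V : normedModType C) (k : nat) (f : V -> 'rV[C]_k) z u d i :
  rder f z u d -> rder (fun w => f w 0 i : C) z u (d 0 i).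
Proof.
move=> H e e0; have [dl dl0 dP] := H e e0; exists dl => // s sd.
by apply: le_trans (dP s sd); have := nrm_coord (f (z + rC s *: u) - f z - rC s *: d) i; rewrite !mxE.
Qed.

Lemma continuous_coord (V : normedModType C) (k : nat) (f : V -> 'rV[C]_k) z i :
  {for z, continuous f} -> cont_at (fun w => f w 0 i : C) z.
Proof.
move=> /continuous_nrm H e e0; have [dl dl0 dP] := H e e0; exists dl => // w wd.
by apply: le_lt_trans (dP w wd); have := nrm_coord (f w - f z) i; rewrite !mxE.
Qed.

Lemma close_neq0 (a b : C) : nrm (a - b) < nrm b -> a != 0.
Proof. by apply: contraTneq => ->; rewrite sub0r nrmN ltxx. Qed.

(** Connectedness of the plane, by bisection along the segment from 0 to y. *)
Lemma locally_constant_prop (P : C -> Prop) :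
  (forall y0, exists2 e : R, 0 < e &
     forall y y', nrm (y - y0) < e -> nrm (y' - y0) < e -> P y -> P y') ->
  P 0 -> forall y, P y.
Proof.
move=> H P0 y; pose Q (x _ s : R) := forall t t', x <= t <= x + s -> x <= t' <= x + s ->
  P (rC t * y) -> P (rC t' * y).
suff /(_ 0 1) : Q 0 0 1.
  by rewrite rC0 rC1 mul0r mul1r; apply => //; rewrite add0r lexx ler01.
apply: square_induction => [x y' s s0 h1 h2 _ _ t t'|//|c d c01 _].
  have s20 : 0 < s / 2 by rewrite divr_gt0.
  move=> /andP[t1 t2] /andP[t1' t2'].
  have m1 : x <= x + s / 2 <= x + s / 2 by rewrite lexx lerDl ltW.
  have m2 : x + s / 2 <= x + s / 2 <= x + s / 2 + s / 2 by rewrite lexx lerDl ltW.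
  have E : x + s / 2 + s / 2 = x + s by rewrite -addrA -splitr.
  have A u : x <= u -> u <= x + s ->
      (P (rC u * y) -> P (rC (x + s / 2) * y)) /\ (P (rC (x + s / 2) * y) -> P (rC u * y)).
    move=> u1 u2; have [ul|ul] := lerP u (x + s / 2).
      by split; apply: h1 => //; rewrite u1.
    by split; apply: h2 => //; rewrite (ltW ul) E.
  by move=> /(proj1 (A t t1 t2)) /(proj2 (A t' t1' t2')).
have [e e0 eP] := H (rC c * y); have y0 := nrm_ge0 y.
have y1 : 0 < 1 + nrm y by rewrite ltr_wpDr.
exists (e / (1 + nrm y)); first by rewrite divr_gt0.
move=> x y' s s0; rewrite ltr_pdivlMr // => sl cx _ _ _ _ _ t t' tx tx'.
have A u : x <= u <= x + s -> nrm (rC u * y - rC c * y) < e.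
  move=> ux; rewrite -mulrBl -rCB nrmM nrm_rC; apply: le_lt_trans sl.
  have : `|u - c| <= s by rewrite ler_norml; move: cx ux; clear; lra.
  have := normr_ge0 (u - c); move: y0; clear; nra.
by apply: eP; exact: A.
Qed.

End Preliminaries.

(** * Maps constructed along a disk and their dbar derivative *)

Section ConstructedMaps.
Context {R : realType} {n : nat} {M : complex_manifold R n}.
Local Notation C := (Cplx R).
Local Notation T := 'rV[C]_n.-1.
Local Notation ball0 := (euclidean_ball R n.-1).
Variables (Fol : foliation M) (p : T -> M) (t : T -> chart M 'rV[C]_n -> 'rV[C]_n).
Variable F : T * C -> M.
Hypotheses (hp : transverse_disk Fol p) (ht : trivialization Fol p t).
Hypotheses (hF : constructed_with Fol p t F) (hs : smooth_map (ball0 `*` setT) F).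

Lemma constructed_continuous z : ball0 z.1 -> {for z, continuous F}.
Proof. by case: hs => h _ bz; apply: h; split. Qed.

Lemma constructed_covering x : ball0 x -> leaf_universal_covering (p x) (fun y => F (x, y) : leaf_space Fol).
Proof. by move=> /hF[]. Qed.

Lemma constructed_at0 x : ball0 x -> F (x, 0) = p x.
Proof. by move=> /hF[]. Qed.

Lemma F_near (E : normedModType C) (k : chart M E) z : ball0 z.1 -> dom k (F z) ->
  exists2 r : R, 0 < r & forall w, nrm (w - z) < r -> ball0 w.1 /\ dom k (F w).
Proof.
move=> bz kz; have [r1 r10 h1] := map_near (constructed_continuous bz) (dom_open k) kz.
have /openP_nrm ob := @open_euclidean_ball R n.-1; have [r2 r20 h2] := ob _ bz.
exists (Num.min r1 r2); first by rewrite lt_min r10.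
move=> w; rewrite lt_min => /andP[w1 w2]; split; last exact: h1.
by apply: h2; apply: le_lt_trans w2; have := fst_le (w - z).
Qed.

Lemma leafwise_continuous z : ball0 z.1 -> {for z.2, continuous (fun y => F (z.1, y))}.
Proof.
case: z => x y /= bx; apply: (@continuous_comp _ _ _ (fun y => (x, y)) F); last exact: constructed_continuous.
by apply: (@cvg_pair _ _ _ (nbhs y) (nbhs x) (nbhs y)); [exact: cvg_cst|exact: cvg_id].
Qed.

Lemma leafwise_diff (E : normedModType C) (k : chart M E) z : gchart k -> ball0 z.1 -> dom k (F z) ->
  differentiable (fun y : C => crd k (F (z.1, y))) z.2.
Proof.
case: z => x y gk bx kz; have [c fc cz] := fcharts_cover Fol (F (x, y)).
have [d _] := leaf_map_diff (constructed_covering bx) fc cz.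
by have [] := map_diff (fchart_gchart fc) gk cz kz (leafwise_continuous (z := (x, y)) bx) d.
Qed.

Definition coord_derive (E : normedModType C) (k : chart M E) (u z : T * C) : E :=
  rderive (crd k \o F) u z.
Local Notation D := coord_derive.

(** The second derivatives are used for D_(0,1) F in the directions (v, 0) and (i v, 0), when b is
    differentiated in [multiple_entire]. *)
Lemma smooth_coord a : atlas a -> forall z, ball0 z.1 -> dom a (F z) -> forall u,
  [/\ rder (crd a \o F) z u (D a u z), {for z, continuous (D a u)} &
      forall u', exists d, rder (D a u) z u' d].
Proof.
move=> aa z bz az u; case: hs => _ /(_ a aa 2%N)[_ /(_ u)[h1 [h2 h3]]].
have Uz : (ball0 `*` setT `&` F @^-1` dom a) z by [].
split; [by apply: rderivable_rder; exact: h1|exact: h2|].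
move=> u'; have [h4 _] := h3 u'; exists (rderive (D a u) u' z).
by apply: rderivable_rder; exact: h4.
Qed.

Lemma coord_rder (E : normedModType C) (k : chart M E) z u : gchart k -> ball0 z.1 -> dom k (F z) ->
  rder (crd k \o F) z u (D k u z).
Proof.
move=> gk bz kz; have [a aa az] := atlas_cover (F z).
have [h _ _] := smooth_coord aa bz az u.
have h' := map_rder (atlas_gchart aa) gk az kz (constructed_continuous bz) h.
by rewrite /coord_derive (rder_rderive h').
Qed.

Lemma D_change (E E' : normedModType C) (k : chart M E) (k' : chart M E') z u : gchart k ->
  gchart k' -> ball0 z.1 -> dom k (F z) -> dom k' (F z) ->
  D k' u z = 'd (change k k') (crd k (F z)) (D k u z).
Proof.
move=> gk gk' bz kz kz'.
exact: rder_rderive (map_rder gk gk' kz kz' (constructed_continuous bz) (coord_rder u gk bz kz)).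
Qed.

Lemma D_leaf (E : normedModType C) (k : chart M E) (z : T * C) (h : C) : gchart k -> ball0 z.1 -> dom k (F z) ->
  D k (0, h) z = 'd (fun y : C => crd k (F (z.1, y))) (z.2 : C) h.
Proof.
case: z => x y gk bz kz; apply: rder_rderive.
have := differentiable_rder h (leafwise_diff gk bz kz).
move=> H e e0; have [dl dl0 dP] := H e e0; exists dl => // s sd; have := dP s sd.
rewrite /= (_ : (x, y) + rC s *: (0, h) = (x, y + rC s *: h)) //.
by apply/eqP; rewrite xpair_eqE /= scaler0 addr0 !eqxx.
Qed.

Lemma leaf_cderiv (k : chart M 'rV[C]_n) z i : gchart k -> ball0 z.1 -> dom k (F z) ->
  cderiv (fun y : C => crd k (F (z.1, y)) 0 i) z.2 (D k (0, 1) z 0 i).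
Proof.
move=> gk bz kz; rewrite D_leaf //.
have [h1 h2] := diff_post (@coord_lin R n i) (fun w => @nrm_coord R n w i) (leafwise_diff gk bz kz).
by have := differentiable_cderiv h1; rewrite h2.
Qed.

Lemma D_leaf_fchart c z : fcharts Fol c -> ball0 z.1 -> dom c (F z) ->
  (D c (0, 1) z).1 = 0 /\ (D c (0, 1) z).2 != 0.
Proof.
case: z => x y fc bz cz; rewrite D_leaf //; last exact: fchart_gchart fc.
have [_ /(_ 1)[h1 h2]] := leaf_map_diff (constructed_covering bz) fc cz; split => //.
by rewrite h2; exact: luc_derivative_neq0 (constructed_covering bz) fc cz.
Qed.

Lemma D_leaf_neq0 a z : atlas a -> ball0 z.1 -> dom a (F z) -> D a (0, 1) z != 0.
Proof.
move=> aa bz az; have [c fc cz] := fcharts_cover Fol (F z).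
apply/eqP => E; have [_ /eqP] := D_leaf_fchart fc bz cz; apply.
by rewrite (D_change _ (atlas_gchart aa) (fchart_gchart fc) bz az cz) E diff0v.
Qed.

(** Twice the conjugate derivative along the complex line of v in the x variable. *)
Definition dbar (E : normedModType C) (k : chart M E) (v : T) (z : T * C) : E :=
  D k (v, 0) z + 'i *: D k ('i *: v, 0) z.

Lemma dbar_change (E E' : normedModType C) (k : chart M E) (k' : chart M E') z v : gchart k ->
  gchart k' -> ball0 z.1 -> dom k (F z) -> dom k' (F z) ->
  dbar k' v z = 'd (change k k') (crd k (F z)) (dbar k v z).
Proof.
by move=> gk gk' bz kz kz'; rewrite /dbar !(D_change _ gk gk') // diffDv diffZv.
Qed.

Lemma rder_along_p (E : normedModType C) (k : chart M E) (a : chart M 'rV[C]_n) x v : atlas a ->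
  gchart k -> ball0 x -> dom a (p x) -> dom k (p x) ->
  D k (v, 0) (x, 0) = 'd (change a k) (crd a (p x)) ('d (crd a \o p) x v).
Proof.
move=> aa gk bx ax kx; have ga := atlas_gchart aa.
have [hol _ _ _] := hp; have [cp dp] := hol x bx.
have H := differentiable_rder v (dp a aa ax).
rewrite (D_change _ ga gk) ?constructed_at0 //; congr ('d _ _ _).
have [r r0 rP] := F_near (z := (x, 0)) (k := a) bx ltac:(by rewrite constructed_at0).
apply: rder_rderive => e e0; have [dl dl0 dP] := H e e0.
have v0 := nrm_ge0 v; have v1 : 0 < 1 + nrm v by rewrite ltr_wpDr.
exists (Num.min dl (r / (1 + nrm v))); first by rewrite lt_min dl0 divr_gt0.
move=> s; rewrite lt_min => /andP[s1 s2]; have := dP s s1.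
have [b _] : ball0 (x + rC s *: v) /\ dom a (F (x + rC s *: v, 0)).
  apply: (rP (x + rC s *: v, 0)); rewrite pair_dist subrr nrm0 (max_idPl (nrm_ge0 _)) nrmZ nrm_rC.
  move: s2; rewrite ltr_pdivlMr // => K; apply: le_lt_trans K.
  by rewrite ler_wpM2l // lerDr.
by rewrite /= pair_shift !constructed_at0.
Qed.

Lemma dbar_zero (E : normedModType C) (k : chart M E) x v : gchart k -> ball0 x -> dom k (p x) ->
  dbar k v (x, 0) = 0.
Proof.
move=> gk bx kx; have [a aa ax] := atlas_cover (p x).
rewrite /dbar !(rder_along_p _ aa gk bx ax kx) !diffZv scalerA -expr2 sqrCi scaleN1r.
exact: subrr.
Qed.

Lemma dbar_tangent x v : ball0 x -> forall y c, fcharts Fol c -> dom c (F (x, y)) ->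
  (dbar c v (x, y)).1 = 0.
Proof.
move=> bx; apply: (@locally_constant_prop R (fun y => forall c, fcharts Fol c ->
  dom c (F (x, y)) -> (dbar c v (x, y)).1 = 0)); last first.
  move=> c fc; rewrite constructed_at0 // => cx; rewrite dbar_zero //; exact: fchart_gchart fc.
move=> y0; have [c fc c0] := fcharts_cover Fol (F (x, y0)).
have gc := fchart_gchart fc.
have [r r0 rP] := F_near (z := (x, y0)) bx c0.
(* The transverse coordinate of F (x', y) is independent of y near y0 for all x' near x at once, so
   its derivatives in x are independent of y as well. *)
have cst x' y y' : nrm (x' - x) < r -> nrm (y - y0) < r -> nrm (y' - y0) < r ->
    (crd c (F (x', y))).1 = (crd c (F (x', y'))).1.
  move=> xr yr yr'.
  have near w : nrm (w - y0) < r -> ball0 x' /\ dom c (F (x', w)).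
    by move=> wr; apply: (rP (x', w)); rewrite -[_ - _]/(x' - x, w - y0) nrm_pair_lt xr.
  have [bx' _] := near y yr.
  apply/rowP => i; pose h (w : C) : C := (crd c (F (x', w))).1 0 i.
  have dh w : nrm (w - y0) < r -> cderiv h w 0.
    move=> wr; have [_ cw] := near w wr.
    have [d /(_ 1)[d1 _]] := leaf_map_diff (constructed_covering bx') fc cw.
    have [h1 h2] := diff_post (@coord1_lin R n.-1 C i) (@coord1_le R n.-1 C i) d.
    by have := differentiable_cderiv h1; rewrite h2 d1 mxE.
  have E : nrm (h y - h y' - 0 * (y - y')) <= 0 * nrm (y - y').
    apply: mvt => s Is.
    have le : nrm (y' + rC s * (y - y') - y0) < r.
      have -> : y' + rC s * (y - y') - y0 = (y' - y0) + rC s * ((y - y0) - (y' - y0)) by ring.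
      exact: ball_segment.
    split; first by exists 0; exact: dh.
    by rewrite (dv_uniq (dh _ le)) subrr nrm0.
  rewrite !mul0r subr0 in E.
  by apply/eqP; rewrite -subr_eq0 -nrm_eq0 eq_le E nrm_ge0.
have key u y y' : nrm (y - y0) < r -> nrm (y' - y0) < r ->
    (D c (u, 0) (x, y)).1 = (D c (u, 0) (x, y')).1.
  move=> yr yr'; apply/rowP => i.
  have rd w : nrm (w - y0) < r -> rder (fun z => (crd c (F z)).1 0 i : C) (x, w) (u, 0)
      ((D c (u, 0) (x, w)).1 0 i).
    move=> wr; have [_ cw] : ball0 x /\ dom c (F (x, w)).
      by apply: (rP (x, w)); rewrite -[_ - _]/(x - x, w - y0) nrm_pair_lt subrr nrm0 r0.
    have H := coord_rder (z := (x, w)) (u, 0) gc bx cw.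
    move=> e e0; have [dl dl0 dP] := H e e0; exists dl => // s sd.
    apply: le_trans (dP s sd).
    have := coord1_le i (crd c (F ((x, w) + rC s *: (u, 0))) - crd c (F (x, w)) - rC s *: D c (u, 0) (x, w)).
    by rewrite !mxE.
  apply: rder_uniq (rd y yr) _.
  have H := rd y' yr'; have u0 := nrm_ge0 u; have u1 : 0 < 1 + nrm u by rewrite ltr_wpDr.
  move=> e e0; have [dl dl0 dP] := H e e0.
  exists (Num.min dl (r / (1 + nrm u))); first by rewrite lt_min dl0 divr_gt0.
  move=> s; rewrite lt_min => /andP[s1 s2]; have := dP s s1; rewrite !pair_shift.
  have sr : nrm (x + rC s *: u - x) < r.
    rewrite addrC addKr nrmZ nrm_rC; move: s2; rewrite ltr_pdivlMr // => K; apply: le_lt_trans K.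
    by rewrite ler_wpM2l // lerDr.
  rewrite (cst _ y' y sr yr' yr) (cst x y' y _ yr' yr) //.
  by rewrite subrr nrm0.
have cy y : nrm (y - y0) < r -> dom c (F (x, y)).
  move=> yr; have [] // : ball0 x /\ dom c (F (x, y)).
  by apply: (rP (x, y)); rewrite -[_ - _]/(x - x, y - y0) nrm_pair_lt subrr nrm0 r0.
exists r => // y y' yr yr' H c' fc' cy'.
have E : (dbar c v (x, y')).1 = 0.
  have e := congr2 (fun a b : T => a + 'i *: b) (key v y' y yr' yr) (key ('i *: v) y' y yr' yr).
  exact: etrans e (H c fc (cy y yr)).
rewrite (dbar_change (z := (x, y')) v gc (fchart_gchart fc') bx (cy y' yr') cy').
have -> : dbar c v (x, y') = ((0 : T), (dbar c v (x, y')).2).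
  by case: (dbar c v (x, y')) E => b1 b2 /= ->.
exact: fcharts_transverse fc fc' (cy y' yr') cy' _.
Qed.

Lemma dbar_multiple x v : ball0 x -> exists b : C -> C, forall y a, atlas a ->
  dom a (F (x, y)) -> dbar a v (x, y) = b y *: D a (0, 1) (x, y).
Proof.
move=> bx; suff H y : exists b : C, forall a, atlas a -> dom a (F (x, y)) ->
    dbar a v (x, y) = b *: D a (0, 1) (x, y).
  by have [b bP] := choice H; exists b.
have [c fc cy] := fcharts_cover Fol (F (x, y)); have gc := fchart_gchart fc.
have [e1 e2] := D_leaf_fchart (z := (x, y)) fc bx cy; have t1 := @dbar_tangent x v bx y c fc cy.
(* In a foliated chart both vectors have zero transverse part, so their ratio is that of the leaf
   components; linear changes of charts preserve it. *)
exists ((dbar c v (x, y)).2 / (D c (0, 1) (x, y)).2) => a aa ay.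
have ga := atlas_gchart aa.
rewrite (dbar_change (z := (x, y)) v gc ga bx cy ay) (D_change (z := (x, y)) (0, 1) gc ga bx cy ay) -diffZv; congr ('d _ _ _).
rewrite [LHS]surjective_pairing [D _ _ _ in RHS]surjective_pairing t1 e1.
apply/eqP; rewrite xpair_eqE scaler0 eqxx /=; apply/eqP.
by rewrite -[RHS]/(_ / _ * _) divfK.
Qed.

Lemma leaf_D_holo a x y i : atlas a -> ball0 x -> dom a (F (x, y)) ->
  holo (fun y => D a (0, 1) (x, y) 0 i) y.
Proof.
move=> aa bx ay; have ga := atlas_gchart aa.
have [r r0 rP] := F_near (z := (x, y)) bx ay.
have near w : nrm (w - y) < r -> cderiv (fun y => crd a (F (x, y)) 0 i) w (D a (0, 1) (x, w) 0 i).
  move=> wr; have [_ aw] : ball0 x /\ dom a (F (x, w)).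
    by apply: (rP (x, w)); rewrite -[_ - _]/(x - x, w - y) nrm_pair_lt subrr nrm0 r0.
  exact: (leaf_cderiv (z := (x, w))).
have H := @dv_holo R (fun y => crd a (F (x, y)) 0 i) y.
have [|d dP] := H; first by exists r => // w /near h; eexists; exact: h.
exists d; apply: cderiv_near r0 _ dP => h hr; apply: dv_uniq; apply: near.
by rewrite addrC addKr.
Qed.

(** The derivatives in y and in x are exchanged by [partial_derivative_holo], one real direction at
    a time. *)
Lemma dbar_cderiv a x v y i d1 d2 : atlas a -> ball0 x -> dom a (F (x, y)) ->
  rder (fun z => D a (0, 1) z 0 i : C) (x, y) (v, 0) d1 ->
  rder (fun z => D a (0, 1) z 0 i : C) (x, y) ('i *: v, 0) d2 ->
  cderiv (fun y => dbar a v (x, y) 0 i) y (d1 + 'i * d2).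
Proof.
move=> aa bx ay h1 h2; have ga := atlas_gchart aa.
have [r r0 rP] := F_near (z := (x, y)) bx ay.
have A u d : rder (fun z => D a (0, 1) z 0 i : C) (x, y) (u, 0) d ->
    cderiv (fun y => D a (u, 0) (x, y) 0 i) y d.
  move=> h; have [_ /(@continuous_coord _ _ _ _ _ i) cD _] := smooth_coord (z := (x, y)) aa bx ay (u, 0).
  have [r1 r10 r1P] := cD 1 ltr01.
  apply: (@partial_derivative_holo _ _ (fun z => crd a (F z) 0 i)
    (fun z => D a (0, 1) z 0 i) (fun z => D a (u, 0) z 0 i) x y u d (Num.min r r1)
    (nrm (D a (u, 0) (x, y) 0 i) + 1)) => //.
    by rewrite lt_min r0.
  move=> z; rewrite lt_min => /andP[z1 z2]; have [bz az] := rP z z1.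
  split; [exact: leaf_cderiv|by apply: rder_coord; exact: coord_rder|].
  apply: le_trans (nrm_sub _ (D a (u, 0) (x, y) 0 i)) _; rewrite lerD2l; apply: ltW; exact: r1P.
have := cderivD (A _ _ h1) (cderivZ 'i (A _ _ h2)).
by apply: cderiv_ext => w; rewrite !mxE.
Qed.

Lemma multiple_entire x v b : ball0 x ->
  (forall y a, atlas a -> dom a (F (x, y)) -> dbar a v (x, y) = b y *: D a (0, 1) (x, y)) ->
  [/\ forall y, holo b y, b 0 = 0 & dv b 0 = 0].
Proof.
move=> bx bE.
(* In a coordinate i where D_(0,1) F is nonzero, b is the quotient of dbar F by D_(0,1) F; the
   formula for its derivative d is the quotient rule. *)
have main y a i d1 d2 : atlas a -> dom a (F (x, y)) -> D a (0, 1) (x, y) 0 i != 0 ->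
    rder (fun z => D a (0, 1) z 0 i : C) (x, y) (v, 0) d1 ->
    rder (fun z => D a (0, 1) z 0 i : C) (x, y) ('i *: v, 0) d2 ->
    exists2 d, cderiv b y d & d * D a (0, 1) (x, y) 0 i =
      d1 + 'i * d2 - b y * dv (fun y => D a (0, 1) (x, y) 0 i) y.
  move=> aa ay i0 h1 h2; have hB := dbar_cderiv aa bx ay h1 h2.
  have hE := dvP (leaf_D_holo i aa bx ay).
  have [r r0 rP] := F_near (z := (x, y)) bx ay.
  have Ec := holo_ccont (leaf_D_holo i aa bx ay).
  have [|r1 r10 r1P] := Ec (nrm (D a (0, 1) (x, y) 0 i)); first by rewrite nrm_gt0.
  have H := cderivM hB (cderiv_comp hE (cderivV i0)).
  eexists.
    apply: (@cderiv_near _ _ _ _ _ (Num.min r r1) _ _ H); first by rewrite lt_min r0.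
    move=> h; rewrite lt_min => /andP[hr hr1].
    have [_ ah] : ball0 x /\ dom a (F (x, y + h)).
      by apply: (rP (x, y + h)); rewrite -[_ - _]/(x - x, y + h - y) nrm_pair_lt subrr nrm0 r0 addrC addKr.
    have E0 : D a (0, 1) (x, y + h) 0 i != 0.
      exact: close_neq0 (r1P h hr1).
    by rewrite (bE _ _ aa ah) !mxE mulfK.
  rewrite (bE _ _ aa ay) !mxE; field.
  exact: i0.
have nz y : exists a i, [/\ atlas a, dom a (F (x, y)) & D a (0, 1) (x, y) 0 i != 0].
  have [a aa ay] := atlas_cover (F (x, y)); exists a.
  have := D_leaf_neq0 (z := (x, y)) aa bx ay => /eqP E.
  apply/not_existsP => H; apply: E; apply/rowP => i; rewrite mxE.
  by apply/eqP/negPn/negP => h; apply: (H i); split.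
have b0 : b 0 = 0.
  have [a [i [aa ay i0]]] := nz 0; have := bE 0 a aa ay.
  have -> : dbar a v (x, 0) = 0.
    by apply: dbar_zero; [exact: atlas_gchart|exact: bx|rewrite -(constructed_at0 bx); exact: ay].
  move=> /(congr1 (fun w : 'rV_n => w 0 i)); rewrite !mxE => /esym/eqP.
  by rewrite mulf_eq0 (negPf i0) orbF => /eqP.
split; last 1 first; last exact: b0; last first.
  move=> y; have [a [i [aa ay i0]]] := nz y.
  have [_ _ S2] := smooth_coord (z := (x, y)) aa bx ay (0, 1).
  have [d1 h1] := S2 (v, 0); have [d2 h2] := S2 ('i *: v, 0).
  have [d hd _] := main y a i _ _ aa ay i0 (rder_coord i h1) (rder_coord i h2).
  by exists d.
have [a [i [aa ay i0]]] := nz 0; have ax : dom a (p x) by rewrite -constructed_at0.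
have [_ /(_ a aa ax)[_ _ dt]] := ht bx.
(* Along y = 0 the vector D_(0,1) F is the trivialization t, whose holomorphy will make d1 + i d2
   vanish. *)
have rt u : rder (fun z => D a (0, 1) z 0 i : C) (x, 0) (u, 0) (('d (fun x' => t x' a) x u) 0 i).
  have H := rder_coord i (differentiable_rder u dt).
  have [r r0 rP] := F_near (z := (x, 0)) bx ay.
  have u0 := nrm_ge0 u; have u1 : 0 < 1 + nrm u by rewrite ltr_wpDr.
  move=> e e0; have [dl dl0 dP] := H e e0.
  exists (Num.min dl (r / (1 + nrm u))); first by rewrite lt_min dl0 divr_gt0.
  move=> s; rewrite lt_min => /andP[s1 s2]; have := dP s s1; rewrite !pair_shift.
  have tE x' : ball0 x' -> dom a (F (x', 0)) -> D a (0, 1) (x', 0) = t x' a.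
    move=> bx' ax'; rewrite (D_leaf (z := (x', 0))) //; last exact: atlas_gchart.
    by have [_ F0' ->] := hF bx' => //; rewrite -F0'.
  have [b' a'] : ball0 (x + rC s *: u) /\ dom a (F (x + rC s *: u, 0)).
    apply: (rP (x + rC s *: u, 0)); rewrite pair_dist subrr nrm0 (max_idPl (nrm_ge0 _)) nrmZ nrm_rC.
    move: s2; rewrite ltr_pdivlMr // => K; apply: le_lt_trans K.
    by rewrite ler_wpM2l // lerDr.
  by rewrite !tE.
have [d hd] := main 0 a i _ _ aa ay i0 (rt v) (rt ('i *: v)).
rewrite diffZv mxE mulrA -expr2 sqrCi mulN1r subrr b0 mul0r subr0 => /eqP.
rewrite mulf_eq0 (negPf i0) orbF => /eqP d0; by rewrite (dv_uniq hd).
Qed.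

End ConstructedMaps.

(** * Maps with values in row vectors *)

Section RowValued.
Context {R : realType}.
Local Notation C := (Cplx R).

Lemma common_radius (k : nat) (P : 'I_k -> R -> Prop) :
  (forall i d d', 0 < d' -> d' <= d -> P i d -> P i d') ->
  (forall i, exists2 d, 0 < d & P i d) -> exists2 d, 0 < d & forall i, P i d.
Proof.
move=> mono H; have [f fP] := choice (fun i => (let: ex_intro2 d d0 dP := H i in
  ex_intro (fun d => 0 < d /\ P i d) d (conj d0 dP))).
pose m := \big[Num.min/1]_(i < k) f i.
have m0 : 0 < m by apply: lt_bigmin => // i _; case: (fP i).
exists m => // i; have [_ Pi] := fP i; apply: mono Pi => //; exact: bigmin_le.
Qed.

Lemma differentiable_rV (V : normedModType C) (k : nat) (f : V -> 'rV[C]_k) z :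
  (forall i, differentiable (fun w => f w 0 i : C) z) -> differentiable f z.
Proof.
move=> df; pose L v := \row_i ('d (fun w => f w 0 i : C) z v : C).
have [K KP] := choice (fun i => (let: ex_intro2 d d0 dP := diff_bounded (df i) in
  ex_intro (fun d => 0 <= d /\ forall h, nrm ('d (fun w => f w 0 i : C) z h) <= d * nrm h) d (conj d0 dP))).
have [| | |h _] := @diff_intro R V _ f z L (\sum_i K i); last exact: h.
- by move=> a u v; apply/rowP => i; rewrite !mxE diffDv diffZv.
- move=> v; have S0 : 0 <= \sum_i K i by apply: sumr_ge0 => i _; case: (KP i).
  apply: nrm_rV_le => [|i]; first by rewrite mulr_ge0 ?nrm_ge0.
  rewrite mxE; have [_ h] := KP i; apply: le_trans (h v) _; rewrite ler_wpM2r ?nrm_ge0 //.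
  by rewrite (bigD1 i) //= lerDl; apply: sumr_ge0 => j _; case: (KP j).
move=> e e0.
have [|i|dl dl0 dP] := @common_radius k (fun i d => forall h, nrm h < d ->
   nrm (f (z + h) 0 i - f z 0 i - 'd (fun w => f w 0 i : C) z h) <= e * nrm h).
- by move=> i d d' _ dd H h hd; apply: H; apply: lt_le_trans dd.
- by have [d d0 dP] := diff_eps (df i) e0; exists d.
exists dl => // h hd; apply: nrm_rV_le => [|i]; first by rewrite mulr_ge0 ?nrm_ge0 // ltW.
by rewrite !mxE; exact: dP.
Qed.

(** The algebra of the period relation: A and B stand for derivatives of F at y and y + w, and l1,
    l2 for the rates of the period along v and i v. *)
Lemma dbar_combination (V : lmodType C) (A1 A2 B1 B2 E : V) (b b' l1 l2 : C) :
  A1 + 'i *: A2 = b *: E -> B1 + 'i *: B2 = b' *: E ->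
  A1 = B1 + l1 *: E -> A2 = B2 + l2 *: E -> b *: E = (b' + (l1 + 'i * l2)) *: E.
Proof.
by move=> <- h -> ->; rewrite !scalerDl -h scalerDr scalerA addrACA.
Qed.

End RowValued.

(** * Periods of compact leaves *)

Section Periods.
Context {R : realType} {n : nat} {M : complex_manifold R n}.
Local Notation C := (Cplx R).
Local Notation T := 'rV[C]_n.-1.
Local Notation ball0 := (euclidean_ball R n.-1).
Variables (Fol : foliation M) (p : T -> M) (t : T -> chart M 'rV[C]_n -> 'rV[C]_n).
Variable F : T * C -> M.
Hypotheses (hp : transverse_disk Fol p) (ht : trivialization Fol p t).
Hypotheses (hF : constructed_with Fol p t F) (hs : smooth_map (ball0 `*` setT) F).
Local Notation D := (coord_derive F).
Local Notation dbar := (dbar F).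

Lemma period_shift x w : ball0 x -> F (x, w) = p x -> forall y, F (x, y + w) = F (x, y).
Proof.
move=> bx Fw y; have := @luc_deck _ _ _ _ _ _ 0 w (constructed_covering hF bx).
by rewrite subr0; apply; rewrite (constructed_at0 hF bx).
Qed.

(** Nearby points are only asked to have some period close to w; the first order behaviour of these
    periods comes from [period_rate]. *)
Definition stable_period x w := forall e : R, 0 < e -> exists2 d : R, 0 < d &
  forall x', nrm (x' - x) < d -> exists2 w', nrm (w' - w) < e & F (x', w') = p x'.

Lemma coord_increment a x y v i d E P' : atlas a -> ball0 x -> dom a (F (x, y)) ->
  D a (v, 0) (x, y) 0 i = d -> D a (0, 1) (x, y) 0 i = E -> crd a (F (x, y)) 0 i = P' ->
  forall e : R, 0 < e -> exists2 dl : R, 0 < dl & forall (s : R) (h : C) P,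
    `|s| < dl -> nrm h < dl -> crd a (F (x + rC s *: v, y + h)) 0 i = P ->
    nrm (P - P' - (rC s * d + E * h)) <= e * (`|s| + nrm h).
Proof.
move=> aa bx ay dE EE PE e e0.
suff [dl dl0 dP] : exists2 dl : R, 0 < dl & forall (s : R) (h : C), `|s| < dl -> nrm h < dl ->
    nrm (crd a (F (x + rC s *: v, y + h)) 0 i - crd a (F (x, y)) 0 i -
      (rC s * D a (v, 0) (x, y) 0 i + D a (0, 1) (x, y) 0 i * h)) <= e * (`|s| + nrm h).
  by exists dl => // s h P sl hl <-; rewrite -dE -EE -PE; exact: dP.
have ga := atlas_gchart aa.
have [r r0 rP] := F_near hs (z := (x, y)) bx ay.
have [H _ _] := smooth_coord hs (z := (x, y)) aa bx ay (v, 0).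
have [_ cE _] := smooth_coord hs (z := (x, y)) aa bx ay (0, 1).
apply: (@partial_increment _ _ (fun z => crd a (F z) 0 i) (fun z => D a (0, 1) z 0 i) x y v
  (D a (v, 0) (x, y) 0 i) r r0) e0.
- by move=> z /rP[bz az]; exact: (leaf_cderiv hF hs i ga bz az).
- exact: continuous_coord.
exact: rder_coord H.
Qed.

Lemma D_leaf_shift a x w y : atlas a -> ball0 x -> F (x, w) = p x -> dom a (F (x, y)) ->
  D a (0, 1) (x, y + w) = D a (0, 1) (x, y).
Proof.
move=> aa bx Fw ay; have ga := atlas_gchart aa; have per := period_shift bx Fw.
apply/rowP => i.
have h1 := leaf_cderiv hF hs (z := (x, y)) i ga bx ay.
have h2 := leaf_cderiv hF hs (z := (x, y + w)) i ga bx ltac:(by rewrite per).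
rewrite /= addrC in h2.
have S := proj2 (cderiv_shift (fun y => crd a (F (x, y)) 0 i) w y _) h2.
rewrite [w + y]addrC in S.
apply: cderiv_uniq S _; apply: cderiv_ext h1 => z /=.
by rewrite [w + z]addrC per.
Qed.

(** The equation F (x', w') = p x' is expanded in a coordinate where D_(0,1) F is nonzero: whatever
    period w' close to w exists at x + s v, it equals w + s l + o(s). *)
Lemma period_rate x w v : ball0 x -> F (x, w) = p x -> exists l : C,
  forall e : R, 0 < e -> exists2 dl : R, 0 < dl & forall (s : R) w', `|s| < dl ->
    nrm (w' - w) < dl -> ball0 (x + rC s *: v) -> F (x + rC s *: v, w') = p (x + rC s *: v) ->
    nrm (w' - w - rC s * l) <= e * `|s|.
Proof.
move=> bx Fw; have [a aa ax] := atlas_cover (p x).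
have ay : dom a (F (x, 0)) by rewrite (constructed_at0 hF bx).
have aw : dom a (F (x, w)) by rewrite Fw.
have /eqP En := D_leaf_neq0 hF hs (z := (x, w)) aa bx aw.
have [i i0] : exists i, D a (0, 1) (x, w) 0 i != 0.
  apply/not_existsP => H; apply: En; apply/rowP => i; rewrite mxE.
  by apply/eqP/negPn/negP => h; apply: (H i).
have [E EE] : exists E, D a (0, 1) (x, w) 0 i = E by eexists.
have [d1 d1E] : exists d, D a (v, 0) (x, w) 0 i = d by eexists.
have [d0 d0E] : exists d, D a (v, 0) (x, 0) 0 i = d by eexists.
have [P' PE] : exists P, crd a (p x) 0 i = P by eexists.
rewrite EE in i0.
(* Expanding F (x + s v, w') at (x, w), and p (x + s v) = F (x + s v, 0) at (x, 0), gives s d1 + E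
   (w' - w) = s d0 to first order. *)
exists ((d0 - d1) / E) => e e0; set l := (d0 - d1) / E.
have l0 := nrm_ge0 l; have E0 : 0 < nrm E by rewrite nrm_gt0.
(* The error contains k nrm (w' - w), itself bounded through the quantity being estimated; 2 k <=
   nrm E lets it be absorbed on the left. *)
have [k [k0 kE ke]] : exists k : R, [/\ 0 < k, 2 * k <= nrm E & k * (2 * (2 + nrm l)) <= e * nrm E].
  have L : 0 < 2 * (2 + nrm l) by rewrite mulr_gt0 // ltr_wpDr.
  exists (Num.min (nrm E / 2) (e * nrm E / (2 * (2 + nrm l)))).
  split; first by rewrite lt_min !divr_gt0 // mulr_gt0.
    by rewrite mulrC -ler_pdivlMr // ge_min lexx.
  by rewrite -ler_pdivlMr // ge_min lexx orbT.
have [dl1 dl10 P1] := coord_increment aa bx aw d1E EE (etrans (congr1 (fun q => crd a q 0 i) Fw) PE) k0.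
have [dl2 dl20 P2] := coord_increment aa bx ay d0E (erefl _)
  (etrans (congr1 (fun q => crd a q 0 i) (constructed_at0 hF bx)) PE) k0.
exists (Num.min dl1 dl2); first by rewrite lt_min dl10.
move=> s w'; rewrite !lt_min => /andP[s1 s2] /andP[w1 _] bs Fw'.
have [P QE] : exists P, crd a (p (x + rC s *: v)) 0 i = P by eexists.
have Ew : w + (w' - w) = w' by rewrite addrC subrK.
have A := P1 s (w' - w) P s1 w1 ltac:(by rewrite Ew Fw').
have B := P2 s 0 P s2 ltac:(by rewrite nrm0) ltac:(by rewrite addr0 (constructed_at0 hF bs)).
rewrite mulr0 addr0 nrm0 addr0 in B.
set h := w' - w in A *.
have K : nrm (E * (h - rC s * l)) <= k * (2 * `|s| + nrm h).
  have -> : E * (h - rC s * l) = (P - P' - rC s * d0) - (P - P' - (rC s * d1 + E * h)).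
    by rewrite /l; field.
  apply: le_trans (nrmB _ _) _; apply: le_trans (lerD B A) _.
  by rewrite le_eqVlt; apply/orP; left; apply/eqP; ring.
rewrite nrmM in K.
have N : nrm h <= nrm (h - rC s * l) + `|s| * nrm l.
  by apply: le_trans (nrm_sub _ (rC s * l)) _; rewrite addrC nrmM nrm_rC.
have s0 := normr_ge0 s; have X0 := nrm_ge0 (h - rC s * l).
rewrite -(ler_pM2l E0).
apply: (@le_trans _ _ (k * (2 * (2 + nrm l)) * `|s|)); last first.
  by apply: le_trans (ler_wpM2r s0 ke) _; rewrite mulrA [nrm E * e]mulrC.
move: K N kE k0 s0 X0 l0.
set X := nrm (h - _); set u := nrm h; set S := `|s|; set L := nrm l; set N := nrm E.
clear => K H kE k0 s0 X0 l0.
have : k * u <= k * (X + S * L) by rewrite ler_wpM2l // ltW.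
have : 2 * k * X <= N * X by rewrite ler_wpM2r.
lra.
Qed.

(** The identity does not involve s, so for each e it suffices to compare the increments of F (x', y
    + w') and F (x', y) for one small s and one period w' supplied by stability. *)
Lemma stable_period_D x w v l : ball0 x -> F (x, w) = p x -> stable_period x w ->
  (forall e : R, 0 < e -> exists2 dl : R, 0 < dl & forall (s : R) w', `|s| < dl ->
    nrm (w' - w) < dl -> ball0 (x + rC s *: v) -> F (x + rC s *: v, w') = p (x + rC s *: v) ->
    nrm (w' - w - rC s * l) <= e * `|s|) ->
  forall y a, atlas a -> dom a (F (x, y)) ->
    D a (v, 0) (x, y) = D a (v, 0) (x, y + w) + l *: D a (0, 1) (x, y).
Proof.
move=> bx Fw st rate y a aa ay; have per := period_shift bx Fw.
apply/rowP => i; rewrite !mxE.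
have ayw : dom a (F (x, y + w)) by rewrite per.
have [E EE] : exists E, D a (0, 1) (x, y) 0 i = E by eexists.
have EE' : D a (0, 1) (x, y + w) 0 i = E by rewrite (D_leaf_shift aa bx Fw ay).
have [d0 d0E] : exists d, D a (v, 0) (x, y) 0 i = d by eexists.
have [d1 d1E] : exists d, D a (v, 0) (x, y + w) 0 i = d by eexists.
have [P' PE] : exists P, crd a (F (x, y)) 0 i = P by eexists.
suff : d0 = d1 + l * E.
  by move=> H; exact: etrans d0E (etrans H (esym (congr2 (fun u u' => u + l * u') d1E EE))).
apply/eqP; rewrite -subr_eq0 -nrm_eq0 eq_le nrm_ge0 andbT; apply/ler_addgt0Pr => e e0.
rewrite add0r; have l0 := nrm_ge0 l; have E0 := nrm_ge0 E.
have L : 0 < 3 + nrm l + nrm E by rewrite -addrA ltr_wpDr ?addr_ge0.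
have [k [k0 k1 ke]] : exists k : R, [/\ 0 < k, k <= 1 & k * (3 + nrm l + nrm E) <= e].
  exists (Num.min 1 (e / (3 + nrm l + nrm E))).
  split; first by rewrite lt_min ltr01 divr_gt0.
    by rewrite ge_min lexx.
  by rewrite -ler_pdivlMr // ge_min lexx orbT.
have [dl1 dl10 P1] := coord_increment aa bx ayw d1E EE'
  (etrans (congr1 (fun q => crd a q 0 i) (per y)) PE) k0.
have [dl2 dl20 P2] := coord_increment aa bx ay d0E EE PE k0.
have [dl3 dl30 P3] := rate k k0.
have /openP_nrm ob := @open_euclidean_ball R n.-1; have [r r0 rP] := ob _ bx.
have [eta [eta0 eta1 eta3]] : exists eta : R, [/\ 0 < eta, eta <= dl1 & eta <= dl3].
  by exists (Num.min dl1 dl3); rewrite lt_min dl10 !ge_min !lexx orbT.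
have [d dd0 dP] := st eta eta0.
have v0 := nrm_ge0 v; have v1 : 0 < 1 + nrm v by rewrite ltr_wpDr.
have [s [s0 s1 s2 [s3 sr sd]]] : exists s : R, [/\ 0 < s, s < dl1, s < dl2 &
   [/\ s < dl3, s * (1 + nrm v) < r & s * (1 + nrm v) < d]].
  have [m [m0 m1 m2 [m3 m4 m5]]] : exists m : R, [/\ 0 < m, m <= dl1, m <= dl2 &
    [/\ m <= dl3, m <= r / (1 + nrm v) & m <= d / (1 + nrm v)]].
    exists (Num.min dl1 (Num.min dl2 (Num.min dl3 (Num.min (r / (1 + nrm v)) (d / (1 + nrm v)))))).
    by rewrite !lt_min dl10 dl20 dl30 !divr_gt0 // !ge_min !lexx !orbT.
  have hm : m / 2 < m by rewrite ltr_pdivrMr // ltr_pMr // ltr1n.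
  exists (m / 2); split; first by rewrite divr_gt0.
  - exact: lt_le_trans hm m1.
  - exact: lt_le_trans hm m2.
  split; first exact: lt_le_trans hm m3.
    by rewrite -ltr_pdivlMr //; exact: lt_le_trans hm m4.
  by rewrite -ltr_pdivlMr //; exact: lt_le_trans hm m5.
have sn : `|s| = s by rewrite gtr0_norm.
have sv q : s * (1 + nrm v) < q -> nrm (x + rC s *: v - x) < q.
  move=> sq; rewrite [_ - x]addrC addKr nrmZ nrm_rC sn; apply: le_lt_trans sq.
  by rewrite ler_wpM2l ?(ltW s0) // lerDr.
have bs : ball0 (x + rC s *: v) by apply: rP; exact: sv.
have [w' w'e Fw'] := dP _ (sv _ sd).
have per' := period_shift bs Fw'.
have H3 := P3 s w' ltac:(by rewrite sn) (lt_le_trans w'e eta3) bs Fw'.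
have Ey : y + w + (w' - w) = y + w' by rewrite addrA [y + w + w']addrAC addrK.
have [P QE] : exists P, crd a (F (x + rC s *: v, y)) 0 i = P by eexists.
have H1 := P1 s (w' - w) P ltac:(by rewrite sn) (lt_le_trans w'e eta1) ltac:(by rewrite Ey per').
have H2 := P2 s 0 P ltac:(by rewrite sn) ltac:(by rewrite nrm0) ltac:(by rewrite addr0).
rewrite mulr0 addr0 nrm0 addr0 in H2.
rewrite sn in H1 H2 H3.
set h := w' - w in H1 H3.
set X := d0 - _.
have K : nrm (rC s * X) <= k * s + k * (s + nrm h) + nrm E * (k * s).
  have -> : rC s * X = - (P - P' - rC s * d0) + (P - P' - (rC s * d1 + E * h)) + E * (h - rC s * l).
    by rewrite /X; ring.
  apply: le_trans (nrmD _ _) _; apply: lerD; last by rewrite nrmM ler_wpM2l.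
  by apply: le_trans (nrmD _ _) _; apply: lerD; rewrite ?nrmN.
have N : nrm h <= k * s + s * nrm l.
  apply: le_trans (nrm_sub _ (rC s * l)) _; rewrite addrC; apply: lerD => //.
  by rewrite nrmM nrm_rC sn.
rewrite nrmM nrm_rC sn in K; rewrite -(ler_pM2l s0); apply: le_trans K _.
move: N k1 ke k0 s0 l0 E0; set u := nrm h; set A := nrm l; set B := nrm E; clear.
move=> N k1 ke k0 s0 l0 E0.
have h1 : k * u <= k * (k * s + s * A) by rewrite ler_wpM2l // ltW.
have h2 : k * (k * s) <= k * s.
  by rewrite ler_wpM2l ?(ltW k0) // ler_piMl // ltW.
have h3 : s * (k * (3 + A + B)) <= s * e by rewrite ler_wpM2l // ltW.
apply: le_trans h3; move: h1 h2; clear; lra.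
Qed.

Lemma stable_dbar_zero x v : ball0 x -> compact_leaf Fol (p x) ->
  (forall w, F (x, w) = p x -> stable_period x w) ->
  forall y a, atlas a -> dom a (F (x, y)) -> dbar a v (x, y) = 0.
Proof.
move=> bx cL st.
have [b bE] := dbar_multiple hp hF hs v bx.
have [hb b0 db0] := multiple_entire hp ht hF hs bx bE.
suff bz y : b y = 0 by move=> y a aa ay; rewrite bE // bz scale0r.
have shift w : F (x, w) = p x -> exists c, forall y, b y = b (y + w) + c.
  move=> Fw; have [l1 l1P] := period_rate v bx Fw; have [l2 l2P] := period_rate ('i *: v) bx Fw.
  exists (l1 + 'i * l2) => {}y; have [a aa ay] := atlas_cover (F (x, y)).
  have ayw : dom a (F (x, y + w)) by rewrite (period_shift bx Fw).
  have En := D_leaf_neq0 hF hs (z := (x, y)) aa bx ay.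
  have B1 := bE y a aa ay; have B2 := bE (y + w) a aa ayw.
  rewrite (D_leaf_shift aa bx Fw ay) in B2.
  have H1 := stable_period_D bx Fw (st w Fw) l1P aa ay.
  have H2 := stable_period_D bx Fw (st w Fw) l2P aa ay.
  have := dbar_combination B1 B2 H1 H2.
  by move=> /eqP; rewrite -subr_eq0 -scalerBl scaler_eq0 (negPf En) orbF subr_eq0 => /eqP.
have hdb z : holo (dv b) z by apply: dv_holo; exists 1.
have dper w z : F (x, w) = p x -> dv b z = dv b (z + w).
  move=> /shift[c cE]; apply: dv_uniq.
  have H := dvP (hb (w + z)).
  have S := proj2 (cderiv_shift b w z _) H.
  rewrite [z + w]addrC; have := cderivD S (cderiv_cst c z); rewrite addr0.
  by apply: cderiv_ext => u; rewrite [w + u]addrC -cE.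
have [N NP] := luc_cocompact (constructed_covering hF bx) cL.
have [K K0 KP] := bounded_on_ball N hdb.
have cst := @liouville R (dv b) K hdb.
apply: etrans (dv0_cst hb _ y) b0 => z; apply: etrans (cst _ z) db0 => {}z.
have [u uN Fu] := NP z; rewrite -[z](addrK u) [X in dv b X]addrC.
have Fw : F (x, z + u) = p x by rewrite -(constructed_at0 hF bx).
rewrite -[X in nrm X](dper _ (- u) Fw); apply: KP; by rewrite nrmN.
Qed.

End Periods.

(** * Grid squares and auxiliary estimates *)

Section Grid.
Context {R : realType}.
Local Notation C := (Cplx R).
Local Notation Re := (@complex.Re R).
Local Notation Im := (@complex.Im R).

Lemma insq_dist x y s (w w' : C) : insq x y s w -> insq x y s w' -> nrm (w' - w) <= 2 * s.
Proof.
move=> [w1 w2] [w1' w2']; apply: le_trans (nrm_le_ReIm _) _; rewrite ReB ImB.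
have h1 : `|Re w' - Re w| <= s by rewrite ler_norml; move: w1 w1'; clear; lra.
have h2 : `|Im w' - Im w| <= s by rewrite ler_norml; move: w2 w2'; clear; lra.
by rewrite mulr2n mulrDl mul1r lerD.
Qed.

(** A countable family of closed squares, with every point in arbitrarily small ones; the integer
    triple can be coded by a natural number. *)
Definition grid_square (k l : int) (j : nat) : set C :=
  [set w | insq (k%:~R / j.+1%:R) (l%:~R / j.+1%:R) (j.+1%:R^-1) w].

Lemma grid_square_near (w : C) (e : R) : 0 < e -> exists k l j, grid_square k l j w /\
  forall w', grid_square k l j w' -> nrm (w' - w) < e.
Proof.
move=> e0; pose j := Num.bound (2 / e).
have j0 : 0 < (j.+1%:R : R) by rewrite ltr0n.
have itv u : exists k : int, k%:~R / j.+1%:R <= u <= k%:~R / j.+1%:R + (j.+1%:R : R)^-1.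
  exists (Num.floor (u * j.+1%:R)).
  have /andP[h1 h2] := floor_itv (u * j.+1%:R).
  rewrite ler_pdivrMr // h1 /= -[X in _ + X]mul1r -mulrDl ler_pdivlMr //.
  by apply: ltW; rewrite -[1]/(1%:~R) -intrD.
have [k kP] := itv (Re w); have [l lP] := itv (Im w).
exists k, l, j; split; first by split.
move=> w' w'P; apply: le_lt_trans (insq_dist (conj kP lP) w'P) _.
rewrite -/(2 / _) ltr_pdivrMr // mulrC -ltr_pdivrMr //.
apply: lt_trans (archi_boundP _) _; first by rewrite divr_ge0 // ltW.
by rewrite ltr_nat.
Qed.

Lemma close_zero (A0 A1 B0 B1 : C) (e : R) : A1 + 'i * B1 = 0 ->
  nrm (A1 - A0) < e -> nrm (B1 - B0) < e -> nrm (A0 + 'i * B0) < e + e.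
Proof.
move=> h hA hB; rewrite -nrmN.
have -> : - (A0 + 'i * B0) = (A1 - A0) + 'i * (B1 - B0).
  by rewrite -[LHS]add0r -h; ring.
by apply: le_lt_trans (nrmD _ _) _; rewrite nrmM nrmi mul1r; exact: ltrD.
Qed.

(** The Cauchy-Riemann relation in direction (v, h): A and A' come from (i v, 0) and (v, 0), related
    by dbar F = 0, while B and B' come from the leaf direction. *)
Lemma cr_combination (L K A B A' B' h e : C) : L = A + B -> K = A' + B' ->
  B = 'i * h * e -> B' = h * e -> A' + 'i * A = 0 -> L = 'i * K.
Proof.
move=> -> -> -> -> /eqP; rewrite addr_eq0 => /eqP ->.
by rewrite mulrDr mulrN !mulrA -expr2 sqrCi mulN1r opprK.
Qed.

End Grid.

(** * Holomorphy along disks with compact leaves *)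

Section CompactLeaves.
Context {R : realType} {n : nat} {M : complex_manifold R n}.
Local Notation C := (Cplx R).
Local Notation Re := (@complex.Re R).
Local Notation Im := (@complex.Im R).
Local Notation T := 'rV[C]_n.-1.
Local Notation ball0 := (euclidean_ball R n.-1).
Variables (Fol : foliation M) (p : T -> M) (t : T -> chart M 'rV[C]_n -> 'rV[C]_n).
Variable F : T * C -> M.
Hypotheses (hp : transverse_disk Fol p) (ht : trivialization Fol p t).
Hypotheses (hF : constructed_with Fol p t F) (hs : smooth_map (ball0 `*` setT) F).
Local Notation D := (coord_derive F).
Local Notation dbar := (dbar F).

(** X is Hausdorff, so F (x, w) and p x stay apart near each w; compactness of the square, by
    bisection, makes the radius uniform. *)
Lemma no_period_near x x0 y0 (s0 : R) : ball0 x -> 0 < s0 ->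
  (forall w, insq x0 y0 s0 w -> F (x, w) <> p x) ->
  exists2 d : R, 0 < d & forall x', nrm (x' - x) < d ->
    forall w, insq x0 y0 s0 w -> F (x', w) <> p x'.
Proof.
move=> bx s00 H; pose Q a b s := exists2 d : R, 0 < d & forall x', nrm (x' - x) < d ->
    forall w, insq a b s w -> F (x', w) <> p x'.
apply: (@square_induction R Q) => // [a b s s_gt0 [d1 d10 P1] [d2 d20 P2] [d3 d30 P3] [d4 d40 P4]|c d cx dy].
  exists (Num.min (Num.min d1 d2) (Num.min d3 d4)); first by rewrite !lt_min d10 d20 d30 d40.
  move=> x'; rewrite !lt_min => /andP[/andP[l1 l2] /andP[l3 l4]] w [/andP[w1 w2] /andP[w3 w4]].
  have E u : u + s / 2 + s / 2 = u + s by rewrite -addrA -splitr.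
  have [h|h] := lerP (Re w) (a + s / 2); have [k|k] := lerP (Im w) (b + s / 2).
  - by apply: (P1 x' l1); split; rewrite ?w1 ?w3.
  - by apply: (P3 x' l3); split; rewrite ?w1 ?(ltW k) ?E.
  - by apply: (P2 x' l2); split; rewrite ?w3 ?(ltW h) ?E.
  - by apply: (P4 x' l4); split; rewrite ?(ltW h) ?(ltW k) ?E.
have w0 : insq x0 y0 s0 (pt c d) by split; rewrite ?pt_Re ?pt_Im.
have /eqP ne := H _ w0.
have := @manifold_hausdorff R n M; rewrite open_hausdorff => hd.
have [[A B] /= [/set_mem hA /set_mem hB] [oA oB /eqP AB]] := hd _ _ ne.
have [e1 e10 h1] := map_near (constructed_continuous hs (z := (x, pt c d)) bx) oA hA.
have [hol _ _ _] := hp; have [cp _] := hol x bx.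
have [e2 e20 h2] := map_near cp oB hB.
exists (e1 / 2); first by rewrite divr_gt0.
move=> a b s s_gt0; rewrite ltr_pdivlMr // mulrC => sl ca db _ _ _ _.
exists (Num.min e1 e2); first by rewrite lt_min e10.
move=> x'; rewrite lt_min => /andP[l1 l2] w ws E.
have w0' : insq a b s (pt c d) by split; rewrite ?pt_Re ?pt_Im.
have : (A `&` B) (p x').
  split; last exact: h2.
  rewrite -E; apply: h1; rewrite -[_ - _]/(x' - x, w - pt c d) nrm_pair_lt l1 /=.
  exact: le_lt_trans (insq_dist w0' ws) sl.
by rewrite AB.
Qed.

(* The points x where some period lies in a given closed grid square form a closed
   set; by Baire a dense set of x avoids the boundaries of all these sets. *)
Lemma stable_dense (O : set T) x0 : open O -> O `<=` ball0 -> O x0 ->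
  exists2 x, O x & forall w, F (x, w) = p x -> stable_period p F x w.
Proof.
move=> oO Ob Ox0.
(* Numbers that code no triple get the false property, whose negation holds everywhere. *)
pose P m (x : T) := if unpickle m is Some (k, l, j) then
  exists2 w, grid_square k l j w & F (x, w) = p x else False.
have [|x Ox xP] := @baire_boundary R T O P x0 (@nest_rV R n.-1) oO Ox0.
  move=> m x Ox; rewrite /P; case: (unpickle m) => [[[k l] j]|]; last by exists 1.
  move=> H; have [||d d0 dP] := @no_period_near x (k%:~R / j.+1%:R) (l%:~R / j.+1%:R) (j.+1%:R^-1) (Ob _ Ox).
  - by rewrite invr_gt0.
  - by move=> w ws E; apply: H; exists w.
  by exists d => // x' /dP h [w ws /h]; apply.
exists x => // w Fw e e0; have [k [l [j [ws small]]]] := grid_square_near w e0.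
have PE x' : P (pickle (k, l, j)) x' = exists2 w, grid_square k l j w & F (x', w) = p x'.
  by rewrite /P pickleK.
have [|d d0 dP] := xP (pickle (k, l, j)); first by rewrite PE; exists w.
exists d; first exact: d0.
move=> x' x'd; have := dP x' x'd; rewrite PE => -[w' w's E].
by exists w'; [exact: small|exact: E].
Qed.

Lemma dbar_coord (a : chart M 'rV[C]_n) v z (i : 'I_n) :
  dbar a v z 0 i = D a (v, 0) z 0 i + 'i * D a ('i *: v, 0) z 0 i.
Proof. by rewrite mxE [X in _ + X]mxE. Qed.

Lemma compact_dbar_zero (O : set T) : open O -> O `<=` ball0 ->
  (forall x, O x -> compact_leaf Fol (p x)) ->
  forall x v y a, O x -> atlas a -> dom a (F (x, y)) -> dbar a v (x, y) = 0.
Proof.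
move=> oO Ob cO x v y a Ox aa ay; have bx := Ob _ Ox.
apply/rowP => i; rewrite [RHS]mxE; apply/eqP/negPn/negP => ne.
have [_ c1 _] := smooth_coord hs (z := (x, y)) aa bx ay (v, 0).
have [_ c2 _] := smooth_coord hs (z := (x, y)) aa bx ay ('i *: v, 0).
pose e := nrm (dbar a v (x, y) 0 i) / 2.
have e0 : 0 < e by rewrite divr_gt0 // nrm_gt0.
have [d1 d10 h1] := continuous_coord i c1 e0.
have [d2 d20 h2] := continuous_coord i c2 e0.
have [r r0 rP] := F_near hs (z := (x, y)) bx ay.
have [d [d_gt0 dd1 dd2 ddr]] : exists d : R, [/\ 0 < d, d <= d1, d <= d2 & d <= r].
  by exists (Num.min d1 (Num.min d2 r)); rewrite !lt_min d10 d20 r0 !ge_min !lexx !orbT.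
have [|||x' [Ox' x'd] st] := @stable_dense (O `&` [set x' | nrm (x' - x) < d]) x.
- by apply: openI => //; exact: open_nball.
- by move=> z [] /Ob.
- by split => //=; rewrite subrr nrm0.
have near : nrm ((x', y) - (x, y)) < d.
  by rewrite -[_ - _]/(x' - x, y - y) nrm_pair_lt subrr nrm0 d_gt0 andbT.
have [_ ay'] := rP _ (lt_le_trans near ddr).
have z0 := stable_dbar_zero hp ht hF hs v (Ob _ Ox') (cO _ Ox') st aa ay'.
have A := h1 _ (lt_le_trans near dd1); have B := h2 _ (lt_le_trans near dd2).
have H1 : D a (v, 0) (x', y) 0 i + 'i * D a ('i *: v, 0) (x', y) 0 i = 0.
  have r0E : (0 : 'rV[C]_n) 0 i = 0 by rewrite mxE.
  exact: etrans (esym (dbar_coord a v (x', y) i)) (etrans (congr1 (fun w : 'rV[C]_n => w 0 i) z0) r0E).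
have : nrm (dbar a v (x, y) 0 i) < e + e by rewrite dbar_coord; exact: close_zero H1 A B.
by rewrite /e -splitr ltxx.
Qed.

(** The Cauchy-Riemann relation splits into the x part, which is dbar F = 0, and the y part, which
    is holomorphy along the leaves; smoothness of F then yields complex differentiability. *)
Lemma compact_holomorphic (O : set T) : open O -> O `<=` ball0 ->
  (forall x, O x -> compact_leaf Fol (p x)) -> holomorphic_map (O `*` setT) F.
Proof.
move=> oO Ob cO [x y] [/= Ox _]; have bx := Ob _ Ox; split; first exact: constructed_continuous.
move=> a aa ay; have ga := atlas_gchart aa.
apply: differentiable_rV => i.
pose U := [set z : T * C | O z.1 /\ dom a (F z)].
have oU : open U.
  apply/openP_nrm => z [Oz az]; have [r r0 rP] := F_near hs (Ob _ Oz) az.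
  have /openP_nrm oO' := oO; have [d d0 dP] := oO' _ Oz.
  exists (Num.min r d); first by rewrite lt_min r0.
  move=> w; rewrite lt_min => /andP[w1 w2]; have [_ aw] := rP w w1; split => //.
  by apply: dP; apply: le_lt_trans w2; exact: fst_le (w - z).
have rd u z : U z -> rder (fun z => crd a (F z) 0 i : C) z u (D a u z 0 i).
  by move=> [Oz az]; exact: (rder_coord i (coord_rder hs u ga (Ob _ Oz) az)).
have cD u z : U z -> cont_at (fun z => D a u z 0 i) z.
  move=> [Oz az]; have [_ h _] := smooth_coord hs aa (Ob _ Oz) az u.
  exact: (continuous_coord i h).
have add z u u' : U z -> D a (u + u') z 0 i = D a u z 0 i + D a u' z 0 i.
  move=> Uz; have /openP_nrm oU' := oU; have [r r0 rP] := oU' _ Uz.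
  apply: rder_uniq (rd _ _ Uz) _.
  apply: (rder_additive r0 _ (cD u z Uz) (cD u' z Uz)) => w /rP Uw.
  by split; exact: rd.
have leafD z h : U z -> D a (0, h) z 0 i = h * D a (0, 1) z 0 i.
  move=> [Oz az]; rewrite !(D_leaf hF hs _ ga (Ob _ Oz) az).
  by rewrite -[h in LHS]mulr1 -[h * 1]/(h *: (1 : C)) diffZv mxE.
have Di z u : U z -> D a ('i *: u) z 0 i = 'i * D a u z 0 i.
  case: u => v h Uz; have Uz' := Uz; case: Uz' => Oz az.
  have E : ((v, h) : T * C) = (v, 0) + (0, h).
    by apply/eqP; rewrite xpair_eqE /= addr0 add0r !eqxx.
  have E' : 'i *: ((v, h) : T * C) = ('i *: v, 0) + (0, 'i * h).
    by apply/eqP; rewrite xpair_eqE /= addr0 add0r !eqxx.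
  have e1 := etrans (congr1 (fun u => D a u z 0 i) E') (add z _ _ Uz).
  have e2 := etrans (congr1 (fun u => D a u z 0 i) E) (add z _ _ Uz).
  apply: (cr_combination e1 e2 (leafD _ _ Uz) (leafD _ _ Uz)).
  case: z {E E' e1 e2} az Oz Uz => x' y' az Oz Uz.
  have z0 := compact_dbar_zero oO Ob cO v Oz aa az.
  have r0E : (0 : 'rV[C]_n) 0 i = 0 by rewrite mxE.
  exact: etrans (esym (dbar_coord a v (x', y') i)) (etrans (congr1 (fun w : 'rV[C]_n => w 0 i) z0) r0E).
have [| | |d _] := @cauchy_riemann R _ (fun z => crd a (F z) 0 i : C) (fun u z => D a u z 0 i) U oU _ _ (x, y).
- by move=> z v Uz; split; [exact: rd|exact: cD|exact: Di].
- move=> z [Oz az]; apply/continuous_nrm => e e0.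
  have cc : {for z, continuous (crd a \o F)}.
    by apply: continuous_comp; [exact: (constructed_continuous hs (Ob _ Oz))|exact: crd_continuous].
  have [d d0 dP] := continuous_coord i cc e0; by exists d.
- by split.
exact: d.
Qed.

End CompactLeaves.

(** * Transverse disks *)

Section Disks.
Context {R : realType} {n : nat} {M : complex_manifold R n}.
Local Notation C := (Cplx R).
Local Notation T := 'rV[C]_n.-1.
Local Notation ball0 := (euclidean_ball R n.-1).
Variable Fol : foliation M.

Lemma euclidean_ball_nrm_le (x : T) : ball0 x -> nrm x <= 1.
Proof.
move=> /euclidean_ball_nrm H; apply: nrm_rV_le => // i.
rewrite -(@ler_pXn2r _ 2) ?nnegrE ?nrm_ge0 // expr1n; apply: le_trans (ltW H).
by rewrite (bigD1 i) //= lerDl; apply: sumr_ge0 => j _; exact: sqr_ge0.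
Qed.

Lemma affine_diff (E : normedModType C) (b : E) (L : T -> E) (x : T) :
  (forall k u v, L (k *: u + v) = k *: L u + L v) -> (forall v, nrm (L v) <= nrm v) ->
  differentiable (fun x => b + L x) x /\ forall v, 'd (fun x => b + L x) x v = L v.
Proof.
move=> Ll Lb; apply: (@diff_intro R T E _ x L 1) => // [v|e e0]; first by rewrite mul1r.
exists 1 => // h _.
have -> : L (x + h) = L x + L h by rewrite -[x]scale1r Ll !scale1r.
by rewrite addrA [_ + L h]addrC addrK subrr nrm0 mulr_ge0 ?nrm_ge0 // ltW.
Qed.

Lemma scale_lin (E : normedModType C) (e : R) (k : C) (u v : E) :
  rC e *: (k *: u + v) = k *: (rC e *: u) + rC e *: v.
Proof. by rewrite scalerDr !scalerA mulrC. Qed.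

Lemma scale_le (E : normedModType C) (e : R) (v : E) : 0 <= e <= 1 -> nrm (rC e *: v) <= nrm v.
Proof.
by move=> /andP[e0 e1]; rewrite nrmZ nrm_rC ger0_norm // ler_piMl ?nrm_ge0.
Qed.

Lemma open_in_chart (E : normedModType C) (k : chart M E) (W : set E) : open W ->
  open (dom k `&` crd k @^-1` W).
Proof.
move=> oW; rewrite openE => q [kq Wq]; apply: filterI.
  by apply: open_nbhs_nbhs; split => //; exact: dom_open.
by apply: (crd_continuous kq); exact: open_nbhs_nbhs.
Qed.

Lemma leaf_open_open (O : set M) : open O -> leaf_open Fol O.
Proof.
move=> oO c x fc; apply/openP_nrm => y [[q cq qE] Oq].
have pq : par c (x, y) = q by rewrite -qE crdK.
rewrite pq in Oq; have [e e0 eP] := par_near cq oO Oq; rewrite qE in eP.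
exists e => // w we; have [|h1 h2 h3] := eP (x, w).
  by rewrite [_ - _]surjective_pairing nrm_pair_lt /= subrr nrm0 e0.
by split => //; exists (par c (x, w)).
Qed.

Lemma luc_continuous q (f : C -> M) (y : C) :
  leaf_universal_covering q (f : C -> leaf_space Fol) -> {for y, continuous f}.
Proof.
move=> [_ cf _ _] A; rewrite nbhsE => -[B [oB By] BA].
have nB : nbhs (f y : leaf_space Fol) B.
  by apply: open_nbhs_nbhs; split => //; exact: leaf_open_open.
have H : nbhs y (f @^-1` B) := cf y B nB.
by apply: (@filterS _ (nbhs y) _ (f @^-1` B)) => // z /BA.
Qed.

(** Places a piece of the disk inside one foliated chart, where [constructed_exists] provides a
    trivialization. *)
Lemma sub_disk p x1 : transverse_disk Fol p -> ball0 x1 ->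
  forall O, open O -> O (p x1) -> exists p', [/\ transverse_disk Fol p', p' 0 = p x1 &
    forall x, ball0 x -> O (p' x) /\ exists2 x', ball0 x' & p' x = p x'].
Proof.
move=> [hol inj emb tr] bx1 O oO Ox1; have [cp _] := hol x1 bx1.
have [e1 e10 h1] := map_near cp oO Ox1.
have /openP_nrm ob := @open_euclidean_ball R n.-1; have [e2 e20 h2] := ob _ bx1.
have [e [e0 le1 [le2 le3]]] : exists e : R, [/\ 0 < e, e <= 1 & e < e1 /\ e < e2].
  have m0 : 0 < Num.min 1 (Num.min e1 e2) by rewrite !lt_min ltr01 e10 e20.
  have hm : Num.min 1 (Num.min e1 e2) / 2 < Num.min 1 (Num.min e1 e2).
    by rewrite ltr_pdivrMr // ltr_pMr // ltr1n.
  exists (Num.min 1 (Num.min e1 e2) / 2); move: hm; rewrite !lt_min => /and3P[l1 l2 l3].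
  by rewrite divr_gt0 // ltW.
have e01 : 0 <= e <= 1 by rewrite le1 ltW.
pose l (x : T) : T := x1 + rC e *: x.
have lx x : ball0 x -> nrm (l x - x1) <= e.
  move=> /euclidean_ball_nrm_le xb; rewrite /l addrC addKr nrmZ nrm_rC gtr0_norm //.
  by rewrite ler_piMr // ltW.
have lb x : ball0 x -> ball0 (l x) by move=> /lx h; apply: h2; apply: le_lt_trans le3.
have ne : rC e != 0 :> C by rewrite rC_eq0 gt_eqF.
have linj x x' : l x = l x' -> x = x' by move=> /addrI /(scalerI ne).
have dl x := @affine_diff T x1 (fun x => rC e *: x) x (scale_lin e) (fun v => scale_le v e01).
exists (p \o l); split.
- split.
  + move=> x bx; have [cl dp] := hol _ (lb x bx); have [d1 d2] := dl x; split.
      apply: continuous_comp; last exact: cl.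
      exact: differentiable_continuous d1.
    by move=> a aa ax; exact: (@differentiable_comp _ _ _ _ l (crd a \o p) x d1 (dp a aa ax)).
  + by move=> x x' bx bx' /inj E; apply: linj; apply: E; exact: lb.
  + move=> O' oO' O'b.
    pose O'' := (fun z : T => (rC e)^-1 *: (z - x1)) @^-1` O'.
    have lK x : (rC e)^-1 *: (l x - x1) = x by rewrite /l addrC addKr scalerA mulVf // scale1r.
    have Kl z : l ((rC e)^-1 *: (z - x1)) = z by rewrite /l scalerA divff // scale1r addrC subrK.
    have im : l @` O' = O''.
      apply/seteqP; split => [_ [x O'x <-]|z O''z]; first by rewrite /O'' /= lK.
      by exists ((rC e)^-1 *: (z - x1)).
    have oO'' : open O''.
      apply/openP_nrm => z O''z; have /openP_nrm H := oO'; have [d d0 dP] := H _ O''z.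
      exists (e * d); first by rewrite mulr_gt0.
      move=> w wz; apply: dP; rewrite -scalerBr opprB addrA subrK nrmZ nrmV nrm_rC gtr0_norm //.
      by rewrite mulrC ltr_pdivrMr // mulrC.
    have [|V [oV VE]] := emb O'' oO''; first by rewrite -im => _ [x /O'b bx <-]; exact: lb.
    exists V; split => //.
    apply/seteqP; split => [_ [x O'x <-]|r [Vr [x bx rE]]].
      split; last by exists x => //; exact: O'b.
      have : (p @` O'') (p (l x)) by exists (l x) => //; rewrite -im; exists x.
      by rewrite VE => -[].
    have : (p @` O'') r by rewrite VE; split => //; exists (l x) => //; exact: lb.
    by rewrite -im => -[_ [x' O'x' <-] <-]; exists x'.
  + move=> x a bx aa ax v; have [cl dp] := hol _ (lb x bx); have [d1 d2] := dl x.
    have E : 'd (crd a \o (p \o l)) x v = 'd (crd a \o p) (l x) (rC e *: v).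
      by rewrite -(d2 v); exact: (@diff_comp_val _ _ _ _ l (crd a \o p) x v d1 (dp a aa ax)).
    rewrite E => /(tr _ _ (lb x bx) aa ax) /eqP.
    by rewrite scaler_eq0 (negPf ne) => /eqP.
- by rewrite /= /l scaler0 addr0.
move=> x bx; split; last by exists (l x) => //; exact: lb.
by apply: h1; apply: le_lt_trans (lx x bx) le2.
Qed.

(** The slice of the chart at fixed leaf coordinate. It gives a disk through any point, so that
    [Gamma_values] can be shown to be nonempty. *)
Lemma slice_disk c q : fcharts Fol c -> dom c q -> exists p,
  [/\ transverse_disk Fol p, p 0 = q & forall x, ball0 x -> dom c (p x)].
Proof.
move=> fc cq; have gc := fchart_gchart fc.
have [e1 e10 h1] := par_near cq (dom_open c) cq.
case: (crd c q) (crdK cq) h1 => x0 y0 pq h1.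
have [e [e0 le1 le2]] : exists e : R, [/\ 0 < e, e <= 1 & e < e1].
  have m0 : 0 < Num.min 1 e1 by rewrite lt_min ltr01.
  have hm : Num.min 1 e1 / 2 < Num.min 1 e1 by rewrite ltr_pdivrMr // ltr_pMr // ltr1n.
  exists (Num.min 1 e1 / 2); move: hm; rewrite !lt_min => /andP[l1 l2].
  by rewrite divr_gt0 // ltW.
have e01 : 0 <= e <= 1 by rewrite le1 ltW.
pose l (x : T) : T * C := (x0, y0) + (rC e *: x, 0).
have lE x : l x = (x0 + rC e *: x, y0) by apply/eqP; rewrite xpair_eqE /= addr0 !eqxx.
have lx x : ball0 x -> nrm (l x - (x0, y0)) <= e.
  move=> /euclidean_ball_nrm_le xb; rewrite /l addrC addKr nrm_pair_le nrm0 (ltW e0) andbT nrmZ nrm_rC gtr0_norm //.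
  by rewrite ler_piMr // ltW.
have lc x : ball0 x -> [/\ dom c (par c (l x)), True & crd c (par c (l x)) = l x].
  by move=> /lx h; have [|h2 _ h3] := h1 (l x); first exact: le_lt_trans h le2.
have ne : rC e != 0 :> C by rewrite rC_eq0 gt_eqF.
have [Ll Lb] : (forall (k : C) (u v : T), (rC e *: (k *: u + v), 0) =
     k *: ((rC e *: u, 0) : T * C) + (rC e *: v, 0)) /\
   (forall v : T, nrm ((rC e *: v, 0) : T * C) <= nrm v).
  split=> [k u v|v].
    by apply/eqP; rewrite xpair_eqE /= scale_lin scaler0 addr0 !eqxx.
  by rewrite nrm_pair_le nrm0 nrm_ge0 scale_le.
have dl x := @affine_diff (T * C)%type (x0, y0) (fun x => (rC e *: x, 0)) x Ll Lb.
have cim x : ball0 x -> (crd c @` dom c) (l x).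
  by move=> /lc[h2 _ h3]; exists (par c (l x)).
have dp x a : ball0 x -> atlas a -> dom a (par c (l x)) ->
    differentiable (crd a \o (par c \o l)) x /\
    forall v, 'd (crd a \o (par c \o l)) x v = 'd (change c a) (l x) (rC e *: v, 0).
  move=> bx aa ax; have [d1 d2] := dl x.
  have dc := change_par_diff gc (atlas_gchart aa) (cim x bx) ax.
  split; first exact: (@differentiable_comp _ _ _ _ l (change c a) x d1 dc).
  by move=> v; rewrite -d2 -(@diff_comp_val _ _ _ _ l (change c a) x v d1 dc).
exists (par c \o l); split.
- split.
  + move=> x bx; split; last by move=> a aa ax; have [] := dp x a bx aa ax.
    apply: continuous_comp; last by apply: par_continuous; exact: cim.
    by have [d1 _] := dl x; exact: differentiable_continuous d1.
  + move=> x x' bx bx' E; have [_ _ h2] := lc x bx; have [_ _ h3] := lc x' bx'.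
    have : l x = l x' by rewrite -h2 -h3 -[par c (l x)]/((par c \o l) x) E.
    by rewrite !lE => -[/addrI /(scalerI ne)].
  + move=> O oO Ob.
    pose W := [set z : T * C | O ((rC e)^-1 *: (z.1 - x0))].
    have oW : open W.
      apply/openP_nrm => z Wz; have /openP_nrm H := oO; have [d d0 dP] := H _ Wz.
      exists (e * d); first by rewrite mulr_gt0.
      move=> w wz; apply: dP; rewrite -scalerBr opprB addrA subrK nrmZ nrmV nrm_rC gtr0_norm //.
      rewrite mulrC ltr_pdivrMr // mulrC; apply: le_lt_trans wz; exact: fst_le (w - z).
    exists (dom c `&` crd c @^-1` W); split; first exact: open_in_chart.
    have lK x : (rC e)^-1 *: ((l x).1 - x0) = x by rewrite lE /= addrC addKr scalerA mulVf // scale1r.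
    apply/seteqP; split => [_ [x Ox <-]|r [[cx Wx] [x bx E]]].
      have bx := Ob _ Ox; have [h2 _ h3] := lc x bx; split; last by exists x.
      by split => //=; rewrite h3 /W /= lK.
    exists x => //; move: Wx; rewrite -E /= ; have [_ _ ->] := lc x bx.
    by rewrite /W /= lK.
  + move=> x a bx aa ax v /(_ c fc); have [h2 _ h3] := lc x bx => /(_ h2).
    have [d1 ->] := dp x a bx aa ax.
    have [_ hid] := change_near_id h2.
    have := gchart_chain (rC e *: v, 0) gc (atlas_gchart aa) gc h2 ax h2.
    rewrite hid h3 => <- /= /eqP; by rewrite scaler_eq0 (negPf ne) => /eqP.
- by rewrite /= lE scaler0 addr0.
by move=> x /lc[].
Qed.

(* Inside the domain of one foliated chart, the vector fields d/dy of the chart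
   give the trivialization. *)
Lemma constructed_exists (hpar : forall q, parabolic_leaf Fol q) p c :
  transverse_disk Fol p -> fcharts Fol c -> (forall x, ball0 x -> dom c (p x)) ->
  exists t F, trivialization Fol p t /\ constructed_with Fol p t F.
Proof.
move=> hp fc cp; have gc := fchart_gchart fc; have [hol _ _ _] := hp.
pose t (x : T) (a : chart M 'rV[C]_n) := 'd (change c a) (crd c (p x)) ((0 : T), (1 : C)).
have H x : exists g : C -> M, ball0 x -> [/\ leaf_universal_covering (p x) (g : C -> leaf_space Fol),
    g 0 = p x & 'd (fun y : C => (crd c (g y)).2 : C) (0 : C) (1 : C) = 1].
  have [bx|nb] := pselect (ball0 x); last by exists (fun=> p x).
  have [f luc] := hpar (p x); have [rf _ _ _] := luc.
  have [y1 _ y1E] : range f (p x) by rewrite rf; exact: leaf_refl.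
  have cy1 : dom c (f y1 : M) by rewrite y1E; exact: cp.
  have nz := luc_derivative_neq0 luc fc cy1; have cd := luc_cderiv luc fc cy1.
  set d := 'd _ _ _ in nz cd; have nz' : d^-1 != 0 by rewrite invr_eq0.
  exists (fun y => f (y1 + y * d^-1)) => _; split; first exact: luc_affine nz' luc.
    by rewrite mul0r addr0.
  have E : y1 = y1 + 0 * d^-1 by rewrite mul0r addr0.
  rewrite E in cd.
  have h := cderiv_comp (f := fun y => y1 + y * d^-1) (cderiv_affine y1 d^-1 0) cd.
  have [_ ->] := cderiv_differentiable h; by rewrite mul1r mulVf.
have [g gP] := choice H.
exists t, (fun z => g z.1 z.2); split; last first.
  move=> x bx; have [luc g0 gd] := gP x bx; split => // a aa ax.
  have c0 : dom c (g x 0) by rewrite g0; exact: cp.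
  have [d1 d2] := leaf_map_diff luc fc c0; have [_ d3] := d2 1.
  have a0 : dom a (g x 0) by rewrite g0.
  have cg : {for (0 : C), continuous (fun y => g x y)}.
    exact: luc_continuous luc.
  have [_ ->] := map_diff gc (atlas_gchart aa) c0 a0 cg d1.
  by rewrite d3 gd g0.
move=> x bx; have cx := cp x bx; split.
  move=> a b aa ab ax bx'.
  exact: gchart_chain gc (atlas_gchart aa) (atlas_gchart ab) cx ax bx'.
move=> a aa ax; have ga := atlas_gchart aa; split.
- move=> c' fc' c'x; rewrite /t -(gchart_chain _ gc ga (fchart_gchart fc') cx ax c'x).
  exact: fcharts_transverse fc fc' cx c'x 1.
- apply/eqP => /(gchart_inj gc ga cx ax)/(congr1 snd) /= /eqP; by rewrite oner_eq0.
apply: differentiable_rV => i.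
have [e e0 eP] := par_near cx (dom_open a) ax.
have dn w : nrm (w - crd c (p x)) < e -> differentiable (change c a) w.
  move=> /eP[h1 h2 h3]; apply: (change_par_diff gc ga) => //; by exists (par c w).
have [cpx dpx] := hol x bx.
have [dcp _] := map_diff ga gc ax cx cpx (dpx a aa ax).
(* In the chart a, t is a derivative of the change of charts evaluated along p, and derivatives of
   holomorphic functions are holomorphic. *)
have dh : differentiable (fun z => 'd (fun w => change c a w 0 i : C) z ((0 : T), (1 : C)) : C) (crd c (p x)).
  apply: diff_holomorphic; exists e => // z /dn dz.
  by have [] := diff_post (@coord_lin R n i) (fun w => @nrm_coord R n w i) dz.
have [r r0 rP] := map_near cpx (dom_open a) ax.
have dcomp := @differentiable_comp _ _ _ _ (crd c \o p) _ x dcp dh.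
have /openP_nrm ob := @open_euclidean_ball R n.-1; have [r2 r20 h2] := ob _ bx.
have [| |h _] := diff_near (g := fun x' => t x' a 0 i : C) (e := Num.min r r2) _ _ dcomp.
- by rewrite lt_min r0.
- move=> x'; rewrite lt_min => /andP[l1 l2]; rewrite /= /t.
  have dz : differentiable (change c a) (crd c (p x')).
    by apply: (gchart_change gc ga); [exact/cp/h2|exact: rP].
  by have [_ ->] := diff_post (@coord_lin R n i) (fun w => @nrm_coord R n w i) dz.
exact: h.
Qed.

End Disks.

(** * Local inverses and Gamma *)

Section LocalInverses.
Context {R : realType}.
Local Notation C := (Cplx R).

Lemma immersion_newton (m : nat) (f : 'rV[C]_m * C -> 'rV[C]_m.+1) z0 (r0 : R) : 0 < r0 ->
  (forall z, nrm (z - z0) < r0 -> differentiable f z) ->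
  (forall v, 'd f z0 v = 0 -> v = 0) ->
  exists2 r : R, 0 < r &
    (forall z z', nrm (z - z0) < r -> nrm (z' - z0) < r -> f z = f z' -> z = z') /\
    (forall dl : R, 0 < dl -> exists2 eta : R, 0 < eta & forall w, nrm (w - f z0) < eta ->
      exists2 z, nrm (z - z0) < dl & f z = w).
Proof.
move=> r00 df inj.
have dlin a u v : 'd f z0 (a *: u + v) = a *: 'd f z0 u + 'd f z0 v by rewrite diffDv diffZv.
have [B [Bl AB BA]] := injective_linear_inverse dlin inj.
have [KB KB0 KBP] := rV_linear_bounded Bl.
have d0 : differentiable f z0 by apply: df; rewrite subrr nrm0.
have [KA KA0 KAP] := diff_bounded d0.
apply: (@newton R _ _ f (fun v => 'd f z0 v) B KA KB z0) => //.
- exact: nest_prod (@nest_rV R m) (@nest_C R).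
- by move=> u v; exact: linearB.
- by move=> u v; rewrite addrC -scaleN1r Bl scaleN1r addrC.
move=> e e0.
have [|i|dl dl0 dP] := @common_radius R m.+1 (fun i d => forall z z',
    nrm (z - z0) < d -> nrm (z' - z0) < d ->
    nrm (f z' 0 i - f z 0 i - 'd f z0 (z' - z) 0 i) <= e * nrm (z' - z)).
- by move=> i d d' _ dd H z z' h h'; apply: H; [apply: lt_le_trans h dd|apply: lt_le_trans h' dd].
- have dfi z : nrm (z - z0) < r0 -> differentiable (fun w => f w 0 i : C) z /\
      forall v, 'd (fun w => f w 0 i : C) z v = 'd f z v 0 i.
    by move=> /df; exact: diff_post (@coord_lin R m.+1 i) (fun w => @nrm_coord R m.+1 w i).
  have [|d dd0 dP] := @strict_diff R _ (fun w => f w 0 i : C) z0 r0 r00 _ e e0.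
    by move=> z /dfi[].
  have [|_ E] := dfi z0; first by rewrite subrr nrm0.
  by exists d => // z z' h h'; rewrite -E; exact: dP.
exists dl => // z z' h h'; apply: nrm_rV_le => [|i]; first by rewrite mulr_ge0 ?nrm_ge0 // ltW.
by rewrite !mxE; exact: dP.
Qed.

(** The increment h of g differs from B q by at most KB k nrm h <= nrm h / 2; hence nrm h <= 2 KB
    nrm q, and then the difference is o(q). *)
Lemma inverse_diff (m : nat) (f : 'rV[C]_m * C -> 'rV[C]_m.+1) (g : 'rV[C]_m.+1 -> 'rV[C]_m * C) z0 :
  differentiable f z0 -> (forall v, 'd f z0 v = 0 -> v = 0) -> g (f z0) = z0 ->
  {for f z0, continuous g} ->
  (exists2 e : R, 0 < e & forall w, nrm (w - f z0) < e -> f (g w) = w) ->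
  differentiable g (f z0) /\ forall u, 'd g (f z0) ('d f z0 u) = u.
Proof.
move=> df inj gz /continuous_nrm cg [e1 e10 e1P].
have dlin a u v : 'd f z0 (a *: u + v) = a *: 'd f z0 u + 'd f z0 v by rewrite diffDv diffZv.
have [B [Bl AB BA]] := injective_linear_inverse dlin inj.
have [KB KB0 KBP] := rV_linear_bounded Bl.
have BB u v : B (u - v) = B u - B v by rewrite addrC -scaleN1r Bl scaleN1r addrC.
suff [d1 d2] : differentiable g (f z0) /\ forall v, 'd g (f z0) v = B v.
  by split => [|u]; [exact: d1|rewrite d2 AB].
apply: (@diff_intro R _ _ g (f z0) B KB) => // e e0.
have [k [k0 k1 k2]] : exists k : R, [/\ 0 < k, KB * k <= 2^-1 & KB * k * (2 * KB) <= e].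
  have [k [k0 k1 k2]] : exists k : R, [/\ 0 < k, k <= 2^-1 / KB & k <= e / (2 * KB * KB)].
    exists (Num.min (2^-1 / KB) (e / (2 * KB * KB))); rewrite lt_min !ge_min !lexx orbT.
    by rewrite !divr_gt0 ?invr_gt0 ?mulr_gt0.
  exists k; split => //; first by rewrite mulrC -ler_pdivlMr.
  rewrite (_ : KB * k * (2 * KB) = k * (2 * KB * KB)); last by ring.
  by rewrite -ler_pdivlMr ?mulr_gt0.
have [d1 d10 D1] := diff_eps df k0; have [d2 d20 D2] := cg d1 d10.
exists (Num.min d2 e1); first by rewrite lt_min d20.
move=> q; rewrite lt_min => /andP[q2 q1]; rewrite gz.
set h := g (f z0 + q) - z0.
have qE : f z0 + q - f z0 = q by rewrite addrC addKr.
have fh : f (z0 + h) = f z0 + q.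
  by rewrite /h [z0 + _]addrC subrK; apply: e1P; rewrite qE.
have hd : nrm h < d1 by have := D2 (f z0 + q); rewrite qE gz; apply.
have H := D1 h hd; rewrite fh qE in H.
have K : nrm (h - B q) <= KB * k * nrm h.
  rewrite -{1}(AB h) -BB; apply: le_trans (KBP _) _; rewrite -mulrA ler_wpM2l ?(ltW KB0) //.
  by rewrite nrmC.
have N : nrm h <= KB * nrm q + nrm (h - B q).
  apply: le_trans (nrm_sub h (B q)) _; rewrite lerD2r; exact: KBP.
have h0 := nrm_ge0 h; have q0 := nrm_ge0 q.
have H2 : KB * k * nrm h <= 2^-1 * nrm h by rewrite ler_wpM2r.
have H3 : nrm h <= 2 * (KB * nrm q).
  move: K N H2; set u := KB * nrm q; set w := KB * k * nrm h; set y := nrm (h - _); set x := nrm h.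
  by clear; lra.
apply: le_trans K _; apply: (@le_trans _ _ (KB * k * (2 * (KB * nrm q)))).
  by rewrite ler_wpM2l // mulr_ge0 // ltW.
by rewrite [2 * _]mulrA mulrA ler_wpM2r.
Qed.

Lemma rderive_zero (V W : normedModType C) (phi : V -> W) z v (e : R) : 0 < e ->
  (forall w, nrm (w - z) < e -> phi w = 0) -> rderive phi v z = 0.
Proof.
move=> e0 H; apply: rder_rderive.
apply: (@rder_near _ _ _ (fun=> 0) phi z v 0 e e0); first by move=> w /H ->.
by move=> k k0; exists 1 => // s _; rewrite scaler0 !subrr nrm0 mulr_ge0 // ltW.
Qed.

End LocalInverses.

(** * Local inverses near compact leaves *)

Section Gamma.
Context {R : realType} {m : nat} {M : complex_manifold R m.+1}.
Local Notation C := (Cplx R).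
Local Notation T := 'rV[C]_m.+1.-1.
Local Notation ball0 := (euclidean_ball R m.+1.-1).
Variables (Fol : foliation M) (p : T -> M) (t : T -> chart M 'rV[C]_m.+1 -> 'rV[C]_m.+1).
Variable F : T * C -> M.
Hypotheses (hp : transverse_disk Fol p) (ht : trivialization Fol p t).
Hypotheses (hF : constructed_with Fol p t F) (hs : smooth_map (ball0 `*` setT) F).
Hypothesis himm : immersive (ball0 `*` setT) F.
Variable O : set T.
Hypotheses (oO : open O) (Ob : O `<=` ball0) (cO : forall x, O x -> compact_leaf Fol (p x)).
Local Notation D := (coord_derive F).

Lemma hol_near z a : O z.1 -> atlas a -> dom a (F z) -> exists2 r : R, 0 < r &
  forall w, nrm (w - z) < r -> [/\ O w.1, dom a (F w) & differentiable (crd a \o F) w].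
Proof.
move=> Oz aa az; have [r1 r10 P1] := F_near hs (Ob Oz) az.
have /openP_nrm oO' := oO; have [r2 r20 P2] := oO' _ Oz.
exists (Num.min r1 r2); first by rewrite lt_min r10.
move=> w; rewrite lt_min => /andP[w1 w2]; have [_ aw] := P1 w w1.
have Ow : O w.1 by apply: P2; apply: le_lt_trans w2; exact: fst_le (w - z).
split => //; have [_ h] := compact_holomorphic hp ht hF hs oO Ob cO (conj Ow I : (O `*` setT) w).
exact: h.
Qed.

Lemma hol_diff_inj z a : O z.1 -> atlas a -> dom a (F z) -> forall v,
  'd (crd a \o F) z v = 0 -> v = 0.
Proof.
move=> Oz aa az v; have [r r0 rP] := hol_near Oz aa az.
have [|_ _ d] := rP z; first by rewrite subrr nrm0.
rewrite -(rder_rderive (differentiable_rder v d)); apply: himm => //; split => //.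
exact: Ob.
Qed.

(** Where F is holomorphic, its complex differential is injective between spaces of equal dimension,
    so F is locally injective and open. *)
Lemma hol_newton z : O z.1 ->
  (exists2 r : R, 0 < r & forall w w', nrm (w - z) < r -> nrm (w' - z) < r -> F w = F w' -> w = w') /\
  (forall dl : R, 0 < dl -> exists V, [/\ open V, V (F z) &
    forall q, V q -> exists2 w, nrm (w - z) < dl & F w = q]).
Proof.
move=> Oz; have [a aa az] := atlas_cover (F z).
have [r r0 rP] := hol_near Oz aa az.
have [||s s0 [inj op]] := @immersion_newton R m (crd a \o F) z r r0.
- by move=> w /rP[].
- exact: hol_diff_inj.
split.
  by exists s => // w w' h h' E; apply: inj => //=; rewrite E.
move=> dl dl0; have m0 : 0 < Num.min dl r by rewrite lt_min dl0.
have [eta eta0 etaP] := op _ m0.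
exists (dom a `&` crd a @^-1` [set w | nrm (w - crd a (F z)) < eta]); split.
- by apply: open_in_chart; exact: open_nball.
- by split => //=; rewrite subrr nrm0.
move=> q [aq /= /etaP[w]]; rewrite lt_min => /andP[w1 w2] E; exists w => //.
by have [_ aw _] := rP w w2; rewrite -(crdK aq) -E /= crdK.
Qed.

Lemma hol_local_inverse : O 0 -> exists V U0 G,
  [/\ local_inverse F V U0 G, V (F (0, 0)) & U0 `<=` O `*` setT].
Proof.
move=> O0; have [[r r0 inj] op] := @hol_newton (0, 0) O0.
have /openP_nrm oO' := oO; have [s s0 sP] := oO' _ O0.
have m0 : 0 < Num.min r s by rewrite lt_min r0.
have [V [oV Vz VP]] := op _ m0.
pose U0 := [set z : T * C | nrm (z - (0, 0)) < Num.min r s /\ V (F z)].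
have UO z : U0 z -> O z.1.
  move=> [zr _]; apply: sP; apply: le_lt_trans (fst_le (z - (0, 0))) _.
  by apply: lt_le_trans zr _; rewrite ge_min lexx orbT.
have Uinj z z' : U0 z -> U0 z' -> F z = F z' -> z = z'.
  move=> [zr _] [z'r _]; apply: inj; [apply: lt_le_trans zr _|apply: lt_le_trans z'r _];
  by rewrite ge_min lexx.
(* Outside the image of U0 the value is the default (0, 0). *)
pose G q := xget (0, 0) [set z | U0 z /\ F z = q].
have oU : open U0.
  apply/openP_nrm => z Uz; have [zr Vz'] := Uz.
  have [e e0 eP] := map_near (constructed_continuous hs (Ob (UO z Uz))) oV Vz'.
  exists (Num.min e (Num.min r s - nrm (z - (0, 0)))); first by rewrite lt_min e0 subr_gt0.
  move=> w; rewrite lt_min => /andP[w1 w2]; split; last exact: eP.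
  by apply: le_lt_trans (nrm_dist w z (0, 0)) _; rewrite -ltrBrDr.
exists V, U0, G; split => //; last by move=> z /UO.
split => //.
- by split => //; rewrite subrr nrm0.
- by move=> z /UO Oz; split => //; exact: Ob.
split; last first.
  move=> z Uz; have [h1 h2] : U0 (G (F z)) /\ F (G (F z)) = F z.
    by apply: (@xgetPex _ (0, 0) [set z' | U0 z' /\ F z' = F z]); exists z.
  exact: Uinj.
split.
- by move=> z [].
- by move=> z z' /set_mem h /set_mem h'; exact: Uinj.
by move=> q Vq; have [z zr zE] := VP q Vq; exists z => //; split => //; rewrite zE.
Qed.

Variables (V : set M) (U0 : set (T * C)) (G : M -> T * C).
Hypothesis hG : local_inverse F V U0 G.

Lemma inverseK q : V q -> F (G q) = q /\ U0 (G q).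
Proof.
move=> Vq; have [_ _ _ _ [[_ _ sur] GF]] := hG.
by have [z Uz <-] := sur q Vq; rewrite GF.
Qed.

(** Continuity of G is not part of [local_inverse]; it follows from openness of F, since G inverts F
    on U0. *)
Lemma inverse_continuous q : V q -> O (G q).1 -> forall dl : R, 0 < dl -> exists W,
  [/\ open W, W q & forall q', W q' -> nrm (G q' - G q) < dl].
Proof.
move=> Vq Oq dl dl0; have [FG UG] := inverseK Vq; have [_ oU _ _ [_ GF]] := hG.
have [_ op] := hol_newton Oq; rewrite FG in op.
have /openP_nrm oU' := oU; have [s s0 sP] := oU' _ UG.
have m0 : 0 < Num.min dl s by rewrite lt_min dl0.
have [W [oW Wq WP]] := op _ m0; exists W; split => // q' /WP[w].
by rewrite lt_min => /andP[w1 /sP Uw] <-; rewrite GF.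
Qed.

Lemma inverse_near a q : V q -> O (G q).1 -> atlas a -> dom a q ->
  exists2 e : R, 0 < e & forall w, nrm (w - crd a q) < e ->
    [/\ V (par a w), O (G (par a w)).1, dom a (par a w) & crd a (par a w) = w].
Proof.
move=> Vq Oq aa aq; have [oV _ _ _ _] := hG.
have /openP_nrm oO' := oO; have [s s0 sP] := oO' _ Oq.
have [W [oW Wq WP]] := inverse_continuous Vq Oq s0.
have [e1 e10 P1] := par_near aq oV Vq; have [e2 e20 P2] := par_near aq oW Wq.
exists (Num.min e1 e2); first by rewrite lt_min e10.
move=> w; rewrite lt_min => /andP[/P1[h1 h2 h3] /P2[_ h4 _]]; split => //.
by apply: sP; apply: le_lt_trans (fst_le (G (par a w) - G q)) _; exact: WP.
Qed.

Lemma inverse_holomorphic a q : V q -> O (G q).1 -> atlas a -> dom a q ->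
  let g := fun w => (G (par a w)).2 : C in
  differentiable g (crd a q) /\ 'd g (crd a q) (D a (0, 1) (G q)) = 1.
Proof.
move=> Vq Oq aa aq g; have [FG UG] := inverseK Vq.
have aG : dom a (F (G q)) by rewrite FG.
have [r r0 rP] := hol_near Oq aa aG.
have [|_ _ dF] := rP (G q); first by rewrite subrr nrm0.
have E : (crd a \o F) (G q) = crd a q by rewrite /= FG.
have [|||d1 d2] := @inverse_diff R m (crd a \o F) (fun w => G (par a w)) (G q) dF (hol_diff_inj Oq aa aG).
- by rewrite E crdK.
- rewrite E; apply/continuous_nrm => e e0; rewrite crdK //.
  have [W [oW Wq WP]] := inverse_continuous Vq Oq e0.
  have [e1 e10 P1] := par_near aq oW Wq.
  by exists e1 => // w /P1[_ h _]; exact: WP.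
- rewrite E; have [e e0 eP] := inverse_near Vq Oq aa aq.
  by exists e => // w /eP[h1 h2 h3 h4] /=; have [-> _] := inverseK h1.
rewrite E in d1 d2.
have [h1 h2] := diff_post (pi := snd) (fun k (u v : T * C) => erefl) (@snd_le R T C) d1.
split; first exact: h1.
have -> : D a (0, 1) (G q) = 'd (crd a \o F) (G q) (0, 1).
  exact: rder_rderive (differentiable_rder _ dF).
by rewrite h2 d2.
Qed.

(** For holomorphic g one has dg (J Z) = i dg (Z), so [lambda] is zero on a whole neighbourhood. *)
Lemma inverse_lambda a q : V q -> O (G q).1 -> atlas a -> dom a q ->
  forall Z Y, ext_d (lambda (fun w => (G (par a w)).2 : C)) (crd a q) Z Y = 0.
Proof.
move=> Vq Oq aa aq Z Y; set g := fun w => _.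
have [e e0 eP] := inverse_near Vq Oq aa aq.
have L Z' w : nrm (w - crd a q) < e -> lambda g w Z' = 0.
  move=> /eP[h1 h2 h3 h4]; have [d _] := inverse_holomorphic h1 h2 aa h3; rewrite h4 in d.
  rewrite /lambda !(rder_rderive (differentiable_rder _ d)) diffZv.
  exact: subrr.
exact: etrans (congr2 (fun u v : C => u - v) (rderive_zero Z e0 (L Y)) (rderive_zero Y e0 (L Z))) (subrr 0).
Qed.

(** The condition [is_A] is tested on Y = D_(0,1) F, which is tangent to the leaves and satisfies dg
    (Y) = 1: it gives A = 0 near q. *)
Lemma form_zero a q A : V q -> O (G q).1 -> atlas a -> dom a q -> is_A Fol a V G A ->
  forall Z Y, ext_d A (crd a q) Z Y = 0.
Proof.
move=> Vq Oq aa aq hA Z Y; have [e e0 eP] := inverse_near Vq Oq aa aq.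
have L Z' w : nrm (w - crd a q) < e -> A w Z' = 0.
  move=> /eP[h1 h2 h3 h4]; have [FG UG] := inverseK h1.
  have aG : dom a (F (G (par a w))) by rewrite FG.
  have bG := Ob h2.
  have [d d1] := inverse_holomorphic h1 h2 aa h3; rewrite h4 in d d1.
  have tg : leaf_tangent Fol a (par a w) (D a (0, 1) (G (par a w))).
    move=> c fc cw; have cG : dom c (F (G (par a w))) by rewrite FG.
    have [H _] := D_leaf_fchart hF hs fc bG cG; rewrite -{}[RHS]H.
    by rewrite (D_change hs (0, 1) (atlas_gchart aa) (fchart_gchart fc) bG aG cG) FG.
  have := hA _ Z' _ h1 h3 tg.
  rewrite inverse_lambda // h4 (rder_rderive (differentiable_rder _ d)) d1.
  by rewrite mulr1.
exact: etrans (congr2 (fun u v : C => u - v) (rderive_zero Z e0 (L Y)) (rderive_zero Y e0 (L Z))) (subrr 0).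
Qed.

End Gamma.

(** * Vanishing of Gamma *)

Section Vanishing.
Context {R : realType} {m : nat} {M : complex_manifold R m.+1}.
Local Notation C := (Cplx R).
Local Notation T := 'rV[C]_m.+1.-1.
Local Notation ball0 := (euclidean_ball R m.+1.-1).
Variable Fol : foliation M.
Hypotheses (hpar : forall q : M, parabolic_leaf Fol q) (hstand : standing_assumption Fol).

Lemma compact_leaf_eq q r : @leaf _ _ _ Fol q r -> compact_leaf Fol q -> compact_leaf Fol r.
Proof. by move=> /leaf_eq E; rewrite /compact_leaf E. Qed.

Lemma standing_constructed p t F : transverse_disk Fol p -> trivialization Fol p t ->
  constructed_with Fol p t F ->
  smooth_map (ball0 `*` setT) F /\ immersive (ball0 `*` setT) F.
Proof. by move=> hp ht hF; have [|h1 h2 _] := hstand hp (F := F); first by exists t. Qed.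

Lemma constructed_in_leaf p t F x y : constructed_with Fol p t F -> ball0 x -> @leaf _ _ _ Fol (p x) (F (x, y)).
Proof. by move=> hF bx; have [rf _ _ _] := constructed_covering hF bx; rewrite -rf; exists y. Qed.

(** The leaf of p x is compact as soon as one of its points, here F (x, y), lies in N. Holomorphy is
    thus obtained over an open part of the ball, even if other leaves through the disk are not
    compact. *)
Lemma compact_base p t F (N : set M) y : constructed_with Fol p t F ->
  smooth_map (ball0 `*` setT) F -> open N -> (forall r, N r -> compact_leaf Fol r) ->
  let O := [set x | ball0 x /\ N (F (x, y))] in
  [/\ open O, O `<=` ball0 & forall x, O x -> compact_leaf Fol (p x)].
Proof.
move=> hF hs oN cN O; split; last 2 first.
- by move=> x [].
- move=> x [bx Nx]; apply: compact_leaf_eq (cN _ Nx); apply: leaf_sym; exact: constructed_in_leaf hF bx.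
apply/openP_nrm => x [bx Nx]; have [r r0 rP] := map_near (constructed_continuous hs (z := (x, y)) bx) oN Nx.
have /openP_nrm ob := @open_euclidean_ball R m.+1.-1; have [s s0 sP] := ob _ bx.
exists (Num.min r s); first by rewrite lt_min r0.
move=> w; rewrite lt_min => /andP[w1 w2]; split; first exact: sP.
by apply: rP; rewrite -[_ - _]/(w - x, y - y) nrm_pair_lt w1 subrr nrm0.
Qed.

(** [Gamma_is] asks for a singleton: every value is 0 by [form_zero], and 0 is attained by a map
    constructed along a slice through q. *)
Lemma Gamma_vanishes q (N : set M) : open N -> N q -> (forall r, N r -> compact_leaf Fol r) ->
  Gamma_vanishes_at Fol q.
Proof.
move=> oN Nq cN a Z Y aa aq tY; apply/seteqP; split => [g [F [V [U0 [G [A []]]]]]|_ ->].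
  move=> [p [hp [t [ht hF]]]] hG Vq hA ->.
  have [hs himm] := standing_constructed hp ht hF.
  have [oO Ob cO] := compact_base (G q).2 hF hs oN cN.
  have [FG UG] := inverseK hG Vq; have [_ _ _ Ub _] := hG.
  apply: (form_zero hp ht hF hs himm oO Ob cO hG Vq _ aa aq hA).
  split; first by have [] := Ub _ UG.
  by rewrite -surjective_pairing FG.
have [c fc cq] := fcharts_cover Fol q.
have [p [hp p0 cp]] := slice_disk fc cq.
have [t [F [ht hF]]] := constructed_exists hpar hp fc cp.
have [hs himm] := standing_constructed hp ht hF.
have [oO Ob cO] := compact_base 0 hF hs oN cN.
have b0 := @euclidean_ball0 R m.+1.-1.
have F00 : F (0, 0) = q by rewrite (constructed_at0 hF b0).
have O0 : [set x | ball0 x /\ N (F (x, 0))] 0 by split => //=; rewrite F00.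
have [V [U0 [G [hG V0 UO]]]] := hol_local_inverse hp ht hF hs himm oO Ob cO O0.
(* The zero form satisfies [is_A], because the exterior derivative of [lambda] vanishes. *)
exists F, V, U0, G, (fun _ _ => 0); split => //.
- by exists p; split => //; exists t.
- by rewrite -F00.
- move=> q' Z' Y' Vq' aq' _; rewrite mul0r.
  have [_ UG'] := inverseK hG Vq'.
  by rewrite (inverse_lambda hp ht hF hs himm oO Ob cO hG Vq' _ aa aq') //; have [] := UO _ UG'.
by rewrite /ext_d !(rderive_zero _ ltr01) // subrr.
Qed.

(** A map constructed along a small piece of the disk reaches q at some (0, y). It is holomorphic,
    hence open there, and all its values lie on leaves that meet the disk. *)
Lemma saturation_nbhs p q : transverse_disk Fol p ->
  (forall r, saturation Fol (p @` ball0) r -> compact_leaf Fol r) ->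
  saturation Fol (p @` ball0) q ->
  exists N, [/\ open N, N q & forall r, N r -> compact_leaf Fol r].
Proof.
move=> hp cs [_ [x1 bx1 <-] lq].
have [c fc cx] := fcharts_cover Fol (p x1).
have [p' [hp' p'0 p'P]] := sub_disk hp bx1 (dom_open c) cx.
have cp' x : ball0 x -> dom c (p' x) by move=> /p'P[].
have [t [F [ht hF]]] := constructed_exists hpar hp' fc cp'.
have [hs himm] := standing_constructed hp' ht hF.
have cl x : ball0 x -> compact_leaf Fol (p' x).
  move=> /p'P[_ [x' bx' ->]]; apply: cs; exists (p x'); [by exists x'|exact: leaf_refl].
have b0 := @euclidean_ball0 R m.+1.-1.
have [rf _ _ _] := constructed_covering hF b0.
have [y _ yE] : range (fun y => F (0, y) : leaf_space Fol) q by rewrite rf p'0.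
have oB := @open_euclidean_ball R m.+1.-1.
have [_ op] := hol_newton hp' ht hF hs himm oB (fun _ h => h) cl (z := (0, y)) b0.
have /openP_nrm ob := oB; have [s s0 sP] := ob _ b0.
have [N [oN Nq NP]] := op s s0; exists N; split => //; first by rewrite -yE.
move=> r /NP[[x y'] wz <-].
have bx : ball0 x by apply: sP; apply: le_lt_trans wz; exact: fst_le ((x, y') - (0, y)).
exact: compact_leaf_eq (constructed_in_leaf y' hF bx) (cl x bx).
Qed.

End Vanishing.

Theorem proposition3p3 (R : realType) (n : nat) (hn : (2 <= n)%N)
    (X : complex_manifold R n) (Fol : foliation X)
    (hpar : forall q : X, parabolic_leaf Fol q)
    (hstand : standing_assumption Fol)
    (hX : kaehler X \/ n = 2%N) :
  (forall p : 'rV[Cplx R]_n.-1 -> X, transverse_disk Fol p ->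
     (forall q, saturation Fol (p @` euclidean_ball R n.-1) q ->
        compact_leaf Fol q) ->
     (forall F, constructed_along Fol p F ->
        holomorphic_map (euclidean_ball R n.-1 `*` [set: Cplx R]) F) /\
     (forall q, saturation Fol (p @` euclidean_ball R n.-1) q ->
        Gamma_vanishes_at Fol q)) /\
  ((forall q : X, compact_leaf Fol q) ->
     forall q : X, Gamma_vanishes_at Fol q).
Proof.
(* Writing n as a successor lets n.-1 compute, as the identification of row vectors of length m + 1
   with pairs requires. *)
case: n hn X Fol hpar hstand hX => [//|m] _ X Fol hpar hstand _.
(* If all leaves are compact, X itself serves as the neighbourhood of q. *)
split=> [p hp cs|cX q]; last by apply: (Gamma_vanishes hpar hstand openT).
split=> [F [t [ht hF]]|q sq].
  have [hs _ _] : [/\ smooth_map (euclidean_ball R m.+1.-1 `*` setT) F, _ & _] := hstand p F hp (ex_intro _ t (conj ht hF)).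
  apply: (compact_holomorphic hp ht hF hs (@open_euclidean_ball R m.+1.-1)) => // x bx.
  by apply: cs; exists (p x); [exists x|exact: leaf_refl].
have [N [oN Nq cN]] := saturation_nbhs hpar hstand hp cs sq.
exact: (Gamma_vanishes hpar hstand oN Nq cN).
Qed.
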